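(* Let $\mathfrak g=\widehat{\mathfrak{sl}}_2$. Then the $\mathcal E$-algebra isomorphism $\mathcal A(\Gamma)\hat\otimes_{\mathbb Z}\mathcal E\simeq K_0(\mathcal O^+_{2\mathbb Z})$ defined by $z_r\otimes[\tfrac r2\omega_1]\mapsto[L^+_{q^r}]$ ($r\in V$) defines a monoidal categorification: under this isomorphism the cluster monomials of $\mathcal A(\Gamma)$ are identified, up to invertible representations, with the classes of all the real simple objects of $\mathcal O^+_{2\mathbb Z}$.
   Context: Setting. $q\in\mathbb C^*$ is not a root of unity; fix $h$ with $q=e^h$ and put $q^s=e^{sh}$ for $s\in\mathbb Q$. $U_q(\widehat{\mathfrak{sl}}_2)$ is the quantum loop algebra (Drinfeld--Jimbo generators $e_i,f_i,k_i^{\pm1}$, $i=0,1$, with $k_0k_1=1$; $\Delta(e_i)=e_i\otimes1+k_i\otimes e_i$, $\Delta(f_i)=f_i\otimes k_i^{-1}+1\otimes f_i$, $\Delta(k_i)=k_i\otimes k_i$). The Borel algebra $U_q(\mathfrak b)$ is the Hopf subalgebra generated by $e_0,e_1,k_0^{\pm1},k_1^{\pm1}$; it contains the Drinfeld generators $\phi^+_{1,m}$ ($m\ge0$), $\phi^+_{1,0}=k_1$. $P_{\mathbb Q}=\mathbb Q\omega_1$ with $\omega_1(\alpha_1^\vee)=1$, $\alpha_1=2\omega_1$, and $\omega\le\omega'$ iff $\omega'-\omega\in\mathbb Z_{\ge0}\alpha_1$. An $\ell$-weight is a power series $\Psi(z)=\sum_{m\ge0}\Psi_mz^m$ with $\Psi_0\in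 q^{\mathbb Q}$; $L(\Psi)$ is the simple $U_q(\mathfrak b)$-module generated by $v$ with $e_1v=0$, $\phi^+_{1,m}v=\Psi_mv$. Category $\mathcal O$: the $U_q(\mathfrak b)$-modules that are direct sums of finite-dimensional weight spaces $V_\omega=\{v\mid k_1v=q^{\omega(\alpha_1^\vee)}v\}$, $\omega\in P_{\mathbb Q}$, with weights in a finite union of cones $\{\omega\le\lambda\}$. $\boldsymbol\Psi_a=1-za$ ($a\in\mathbb C^*$), $L^+_a=L(\boldsymbol\Psi_a)$. $[\omega]=L(q^{\omega(\alpha_1^\vee)})$ is one-dimensional; these are the invertible objects. $Y_a=q(1-zaq^{-1})/(1-zaq)$. An $\ell$-weight is positive if it is a monomial (finite product, nonnegative exponents) in the $Y_a$, the $\boldsymbol\Psi_a$ and the constants $q^{\omega(\alpha_1^\vee)}$; $\mathcal O^+$ is the category of objects of $\mathcal O$ all of whose simple constituents have positive highest $\ell$-weight. Let $\widetilde\Gamma$ be the quiver with vertex set $\mathbb Z$ and arrows $r\to r+2$; fix one of its two connected components $\Gamma$, with vertex set $V$ (the even or the odd integers). $\mathcal O^+_{2\mathbb Z}$ is the subcategory of objects of $\mathcal O^+$ whose simple constituents have highest $\ell$-weight with all roots and poles of the form $q^r$, $r\in V$; it is monoidal. $\mathcal A(\Gamma)\subset\mathbb Z[z_r^{\pm1}]_{r\in V}$ is the cluster algebra with initial seed $(\{z_r\}_{r\in V},\Gamma)$ (finite sequences of mutations, no frozen variables). A cluster monomial is a (finite) monomial in the cluster variables of a single cluster. $\mathcal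 E$ is the ring of maps $c:P_{\mathbb Q}\to\mathbb Z$ with support in a finite union of cones $\{\omega\le\mu\}$, written $\sum c(\omega)[\omega]$, $[\omega][\omega']=[\omega+\omega']$; a countable sum in $\mathcal E$ is one with finitely many nonzero contributions at each $\omega$ and total in $\mathcal E$. $K_0(\mathcal O^+_{2\mathbb Z})$ is the ring of formal sums $\sum\lambda_\Psi[L(\Psi)]$ of classes of simple objects of $\mathcal O^+_{2\mathbb Z}$, $\lambda_\Psi\in\mathbb Z$, with $\sum|\lambda_\Psi|\dim(L(\Psi)_\omega)[\omega]\in\mathcal E$. Let $\chi:\mathbb Z[z_r^{\pm1}]\otimes\mathcal E\to\mathcal E$ be the $\mathcal E$-algebra map with $\chi(z_r^{\pm1})=[\mp\frac r2\omega_1]$, and $|\chi|(A)=\sum|A_\omega|[\omega]$ if $\chi(A)=\sum A_\omega[\omega]$. $\mathcal A(\Gamma)\hat\otimes\mathcal E$ is the algebra of countable sums $\sum A_i$, $A_i\in\mathcal A(\Gamma)\otimes\mathcal E$, such that $\sum|\chi|(A_i)$ is a countable sum in $\mathcal E$. The displayed assignment is known to define an isomorphism of $\mathcal E$-algebras compatible with countable sums. A simple object $S$ of a monoidal category is real if $S\otimes S$ is simple. A monoidal categorification of a cluster algebra is an identification with a Grothendieck ring of a monoidal category under which the cluster monomials are the classes of all the real simple objects (up to invertibles, here up to multiplication by classes $[\omega]$).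
   Formalization: In the completion, |χ|(A) sums the absolute values of the coefficients of the separate terms z^m⊗[ω], before terms with equal image under χ are collected; read literally, D=z_0⊗[0]−z_2⊗[ω_1] has χ(D)=0 and D+D+… would be admissible. *)

(* Defs.v *)
From HB Require Import structures.
From mathcomp Require Import all_boot all_order all_algebra.
From mathcomp Require Import all_classical all_reals all_analysis.
From mathcomp Require Import complex.
Set Implicit Arguments.
Unset Strict Implicit.
Unset Printing Implicit Defensive.
Import Order.TTheory GRing.Theory Num.Theory.
Local Open Scope classical_set_scope.
Local Open Scope complex_scope.
Local Open Scope ring_scope.

Definition cexp (R : realType) (w : R[i]) : R[i] :=
  let: x +i* y := w in (expR x * cos y) +i* (expR x * sin y).

(** The weight [s *: omega_1] of P_QQ is encoded by [s : rat]; thus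
    [omega(alpha_1^vee) = s] and [alpha_1] is [2]. *)
Definition qpow (R : realType) (h : R[i]) (s : rat) : R[i] := cexp (ratr s * h).

Definition qpar (R : realType) (h : R[i]) : R[i] := cexp h.

Definition wle (w w' : rat) : Prop := exists n : nat, w' - w = n%:R * 2%:R.

Definition in_finite_cones (A : set rat) : Prop :=
  exists mus : seq rat, forall w, A w -> exists2 mu, mu \in mus & wle w mu.

Inductive DJgen := GE of 'I_2 | GF of 'I_2 | GK of 'I_2 | GKinv of 'I_2.

Inductive Bgen := BE of 'I_2 | BK of 'I_2 | BKinv of 'I_2.

Definition Bincl (g : Bgen) : DJgen :=
  match g with BE i => GE i | BK i => GK i | BKinv i => GKinv i end.

(** Noncommutative polynomial expressions with coefficients in [C] in the
    generators [G]; the scalar [c] is [c] times the unit. *)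
Inductive ncterm (C G : Type) :=
| TGen of G
| TCst of C
| TAdd of ncterm C G & ncterm C G
| TMul of ncterm C G & ncterm C G.
Arguments TGen {C G}.
Arguments TCst {C G}.

Declare Scope ncterm_scope.
Delimit Scope ncterm_scope with T.
Bind Scope ncterm_scope with ncterm.
Notation "s + t" := (TAdd s t) : ncterm_scope.
Notation "s * t" := (TMul s t) : ncterm_scope.
Notation "s - t" := (TAdd s (TMul (TCst (-1)%R) t)) : ncterm_scope.
Notation "[ 'comm' s , t ]" := (s * t - t * s)%T : ncterm_scope.

Fixpoint tmap (C G H : Type) (f : G -> H) (t : ncterm C G) : ncterm C H :=
  match t with
  | TGen g => TGen (f g)
  | TCst c => TCst c
  | TAdd s t => (tmap f s + tmap f t)%T
  | TMul s t => (tmap f s * tmap f t)%T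
  end.

Fixpoint tact (C : pzRingType) (G : Type) (V : lmodType C) (rho : G -> V -> V)
    (t : ncterm C G) (v : V) : V :=
  match t with
  | TGen g => rho g v
  | TCst c => c *: v
  | TAdd s t => tact rho s v + tact rho t v
  | TMul s t => tact rho s (tact rho t v)
  end.

(** Equality in the unital associative [C]-algebra presented by the
    generators [G] and the relations [rel]. *)
Inductive presented_eq (C : pzRingType) (G : Type)
    (rel : ncterm C G -> ncterm C G -> Prop) :
    ncterm C G -> ncterm C G -> Prop :=
| PErel s t : rel s t -> presented_eq rel s t
| PErefl s : presented_eq rel s s
| PEsym s t : presented_eq rel s t -> presented_eq rel t s
| PEtrans s t u :
    presented_eq rel s t -> presented_eq rel t u -> presented_eq rel s u
| PEadd s s' t t' : presented_eq rel s s' -> presented_eq rel t t' ->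
    presented_eq rel (s + t) (s' + t')
| PEmul s s' t t' : presented_eq rel s s' -> presented_eq rel t t' ->
    presented_eq rel (s * t) (s' * t')
| PEaddA s t u : presented_eq rel (s + (t + u)) (s + t + u)
| PEaddC s t : presented_eq rel (s + t) (t + s)
| PEadd0 s : presented_eq rel (TCst 0 + s) s
| PEsub s : presented_eq rel (s - s) (TCst 0)
| PEmulA s t u : presented_eq rel (s * (t * u)) (s * t * u)
| PEmul1 s : presented_eq rel (TCst 1 * s) s
| PEmulDl s t u : presented_eq rel ((s + t) * u) (s * u + t * u)
| PEmulDr s t u : presented_eq rel (s * (t + u)) (s * t + s * u)
| PEcstD a b : presented_eq rel (TCst (a + b)) (TCst a + TCst b)
| PEcstM a b : presented_eq rel (TCst (a * b)) (TCst a * TCst b)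
| PEcst_central a s : presented_eq rel (TCst a * s) (s * TCst a).

Section QuantumAlgebra.
Variables (R : realType) (h : R[i]).
Local Notation C := R[i].
Local Notation q := (qpar h).

Definition cartan (i j : 'I_2) : int := if i == j then 2 else - 2.

Local Notation tE i := (TGen (GE i)).
Local Notation tF i := (TGen (GF i)).
Local Notation tK i := (TGen (GK i)).
Local Notation tKinv i := (TGen (GKinv i)).

Definition qint3 : C := q ^+ 2 + 1 + q ^- 2.

Definition serre (x y : ncterm C DJgen) : ncterm C DJgen :=
  (x * x * x * y - TCst qint3 * (x * x * y * x)
   + TCst qint3 * (x * y * x * x) - y * x * x * x)%T.

Inductive DJrel : ncterm C DJgen -> ncterm C DJgen -> Prop :=
| DJ_KKinv i : DJrel (tK i * tKinv i) (TCst 1)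
| DJ_KinvK i : DJrel (tKinv i * tK i) (TCst 1)
| DJ_K0K1 : DJrel (tK ord0 * tK ord_max) (TCst 1)
| DJ_KK i j : DJrel (tK i * tK j) (tK j * tK i)
| DJ_KE i j :
    DJrel (tK i * tE j * tKinv i) (TCst (q ^ cartan i j) * tE j)
| DJ_KF i j :
    DJrel (tK i * tF j * tKinv i) (TCst (q ^ (- cartan i j)) * tF j)
| DJ_EF i j :
    DJrel [comm tE i, tF j]
      (if i == j then TCst (q - q^-1)^-1 * (tK i - tKinv i) else TCst 0)%T
| DJ_serreE i j : i != j -> DJrel (serre (tE i) (tE j)) (TCst 0)
| DJ_serreF i j : i != j -> DJrel (serre (tF i) (tF j)) (TCst 0).

Definition Uq_eq := presented_eq DJrel.

(** Modules over the subalgebra U_q(b) of U_q(sl_2^) generated by the [e_i]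
    and [k_i^{+-1}]: two expressions in these generators that are equal in the
    whole algebra U_q(sl_2^) must act in the same way. *)
Record bmod := BMod {
  bcar :> lmodType C;
  bact : Bgen -> {linear bcar -> bcar};
  bact_rel : forall s t : ncterm C Bgen,
    Uq_eq (tmap Bincl s) (tmap Bincl t) -> tact bact s =1 tact bact t
}.

(** The Drinfeld generators contained in U_q(b).  The identification with the
    Drinfeld presentation is [e_1 = x^+_0], [k_1 = phi^+_0] and
    [e_0 = x^-_1 k_1^{-1}]; then
    [phi^+_m = (q - q^-1) [x^+_0, x^-_m]] for [m > 0],
    [phi^+_1 = (q - q^-1) k_1 h_1] and [[h_1, x^-_m] = - [2]_q x^-_{m+1}]. *)
Definition drin_xm1 : ncterm C Bgen := (TGen (BE ord0) * TGen (BK ord_max))%T.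

Definition drin_h1 : ncterm C Bgen :=
  (TGen (BKinv ord_max) * [comm TGen (BE ord_max), drin_xm1])%T.

(** [drin_xm m] is [x^-_{m+1}]. *)
Fixpoint drin_xm (m : nat) : ncterm C Bgen :=
  match m with
  | 0%N => drin_xm1
  | m'.+1 => (TCst (- (q + q^-1)^-1)%R * [comm drin_h1, drin_xm m'])%T
  end.

Definition drin_phi (m : nat) : ncterm C Bgen :=
  match m with
  | 0%N => TGen (BK ord_max)
  | m'.+1 => (TCst (q - q^-1)%R * [comm TGen (BE ord_max), drin_xm m'])%T
  end.

Definition submodule (V : bmod) (N : set V) : Prop :=
  [/\ N 0,
      forall (a : C) x y, N x -> N y -> N (a *: x + y) &
      forall g x, N x -> N (bact V g x)].

Definition simple_mod (V : bmod) : Prop :=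
  (exists v : V, v != 0) /\
  forall N : set V, submodule N -> N = [set 0] \/ N = setT.

(** The subquotient [N / N'] of [V] is isomorphic to [S]: there is a
    surjective homomorphism from [N] to [S] with kernel [N'] (the values of
    [f] outside [N] are irrelevant). *)
Definition subquotient_iso (V : bmod) (N' N : set V) (S : bmod) : Prop :=
  [/\ submodule N', submodule N, N' `<=` N &
    exists f : V -> S,
      [/\ forall (a : C) x y, N x -> N y -> f (a *: x + y) = a *: f x + f y,
          forall g x, N x -> f (bact V g x) = bact S g (f x),
          forall s, exists2 x, N x & f x = s &
          forall x, N x -> (f x = 0 <-> N' x)]].

Definition constituent (V S : bmod) : Prop :=
  exists N' N : set V, subquotient_iso N' N S.

(** There are submodules [N'_0 <= N_0 <= N'_1 <= N_1 <= ...] of [V] with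
    [N_i / N'_i] isomorphic to [S] for [i < n]. *)
Definition occurs_times (V S : bmod) (n : nat) : Prop :=
  exists N' N : nat -> set V,
    (forall i, (i < n)%N -> subquotient_iso (N' i) (N i) S) /\
    (forall i, (i.+1 < n)%N -> N i `<=` N' i.+1).

(** Jordan-Hoelder multiplicity of the simple module [S] in [V], which may
    have infinite length. *)
Definition has_mult (V S : bmod) (n : nat) : Prop :=
  occurs_times V S n /\ ~ occurs_times V S n.+1.

Definition bilinear_map (V W U : lmodType C) (b : V -> W -> U) : Prop :=
  (forall (a : C) x x' y, b (a *: x + x') y = a *: b x y + b x' y) /\
  (forall (a : C) x y y', b x (a *: y + y') = a *: b x y + b x y').

(** [T], with the universal bilinear map [t], is the tensor product of [V] and
    [W], on which U_q(b) acts through the coproduct; the action of [k_i^-1] is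
    determined by that of [k_i]. *)
Definition is_tensor (V W T : bmod) (t : V -> W -> T) : Prop :=
  [/\ bilinear_map t,
      forall (U : lmodType C) (b : V -> W -> U), bilinear_map b ->
        exists! f : {linear T -> U}, forall x y, f (t x y) = b x y,
      forall i x y, bact T (BE i) (t x y) =
        t (bact V (BE i) x) y + t (bact V (BK i) x) (bact W (BE i) y) &
      forall i x y, bact T (BK i) (t x y) =
        t (bact V (BK i) x) (bact W (BK i) y)].

Definition real_simple (S : bmod) : Prop :=
  simple_mod S /\
  exists (T : bmod) (t : S -> S -> T), is_tensor t /\ simple_mod T.

Definition weight_space (V : bmod) (w : rat) : set V :=
  [set v | bact V (BK ord_max) v = qpow h w *: v].

Definition has_dim (V : lmodType C) (W : set V) (n : nat) : Prop :=
  exists b : 'I_n -> V, (forall i, W (b i)) /\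
    forall v, W v -> exists! c : 'rV[C]_n, v = \sum_(i < n) c 0 i *: b i.

(** The sum of the weight spaces is automatically direct: they are eigenspaces
    of [k_1] for distinct eigenvalues, as [q] is not a root of unity. *)
Definition in_O (V : bmod) : Prop :=
  [/\ forall v : V, exists s : seq V,
        v = \sum_(x <- s) x /\
        forall x, x \in s -> exists w, weight_space w x,
      forall w, exists n, has_dim (@weight_space V w) n &
      in_finite_cones [set w | exists2 v : V, v != 0 & weight_space w v]].

(** The power series [\sum_m Psi m z^m]. *)
Definition lweight := nat -> C.

Definition lw_mul (f g : lweight) : lweight :=
  fun n => \sum_(i < n.+1) f i * g (n - i)%N.

Definition lw_cst (c : C) : lweight := fun n => if n is 0%N then c else 0.

Definition lw_lin (a : C) : lweight :=
  fun n => match n with 0%N => 1 | 1%N => - a | _ => 0 end.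

(** The power series [(1 - z a)^-1]. *)
Definition lw_geom (a : C) : lweight := fun n => a ^+ n.

Definition lw_weight (w : rat) : lweight := lw_cst (qpow h w).

Definition lw_Psi (a : C) : lweight := lw_lin a.

Definition lw_Y (a : C) : lweight :=
  lw_mul (lw_cst q) (lw_mul (lw_lin (a * q^-1)) (lw_geom (a * q))).

Definition positive_lw (Psi : lweight) : Prop :=
  exists (ys ps : seq C) (w : rat),
    [/\ all (fun a => a != 0) ys, all (fun a => a != 0) ps &
      Psi = lw_mul (lw_weight w)
              (lw_mul (\big[lw_mul/lw_cst 1]_(a <- ys) lw_Y a)
                      (\big[lw_mul/lw_cst 1]_(a <- ps) lw_Psi a))].

(** [Psi] is the expansion at [0] of the reduced fraction [P / Q], whose roots
    and poles satisfy [A]. *)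
Definition roots_poles_in (A : set C) (Psi : lweight) : Prop :=
  exists P Q : {poly C},
    [/\ coprimep P Q, Q`_0 != 0,
        lw_mul (fun n => Q`_n) Psi = (fun n => P`_n) &
        forall x, root P x \/ root Q x -> A x].

(** [S] is isomorphic to [L(Psi)]; a simple module is generated by any of its
    nonzero vectors. *)
Definition is_L (Psi : lweight) (S : bmod) : Prop :=
  simple_mod S /\
  exists v : S, [/\ v != 0, bact S (BE ord_max) v = 0 &
    forall m, tact (bact S) (drin_phi m) v = Psi m *: v].

Definition in_Oplus (V : bmod) : Prop :=
  in_O V /\ forall S, simple_mod S -> constituent V S ->
    exists2 Psi, is_L Psi S & positive_lw Psi.

End QuantumAlgebra.

Arguments bact {R h} _ _.
Arguments weight_space {R h} V w _ /.

(** The even integers for [e = false], the odd ones for [e = true]. *)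
Definition vtx (e : bool) : Type := {r : int | odd `|r|%N == e}.
HB.instance Definition _ (e : bool) :=
  Choice.copy (vtx e) {r : int | odd `|r|%N == e}.

Definition in_Oplus2Z (R : realType) (h : R[i]) (e : bool) (V : bmod h) : Prop :=
  in_Oplus V /\ forall S, simple_mod S -> constituent V S ->
    exists2 Psi, is_L Psi S &
      roots_poles_in [set x | exists r : vtx e, x = qpar h ^ (val r)] Psi.

(** A quiver without loops and 2-cycles is encoded by the skew-symmetric matrix
    [b], where [b r s] is the number of arrows from [r] to [s] minus the number
    of arrows from [s] to [r]. *)
Definition quiver (e : bool) := vtx e -> vtx e -> int.

Definition Gamma (e : bool) : quiver e :=
  fun r s => (val s == val r + 2)%:Z - (val r == val s + 2)%:Z.

Definition posp (n : int) : nat := `|Num.max n 0|%N.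

Definition mutate_quiver (e : bool) (k : vtx e) (b : quiver e) : quiver e :=
  fun r s => if (r == k) || (s == k) then - b r s
    else b r s + (posp (b r k) * posp (b k s))%N%:Z
               - (posp (b s k) * posp (b k r))%N%:Z.

(** The function [f : G -> int] stands for the formal sum [\sum_x f x [x]].
    The sum defining [conv] is finite in all the rings below. *)
Definition conv (G : zmodType) (f g : G -> int) : G -> int :=
  fun x => \sum_(y \in setT) f y * g (x - y).

Definition delta (T : Type) (x : T) : T -> int := fun y => (`[< y = x >])%:Z.

Definition in_E (c : rat -> int) : Prop :=
  in_finite_cones [set w | c w != 0].

Definition summable_in_E (I : choiceType) (c : I -> rat -> int) : Prop :=
  (forall w, finite_set [set i | c i w != 0]) /\
  in_E (fun w => \sum_(i \in setT) c i w).

Section ClusterAlgebra.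
Variable e : bool.
Local Notation V := (vtx e).

(** The Laurent monomial [\prod_r z_r^(m r)] is encoded by its exponent [m] and
    a Laurent polynomial by its coefficients. *)
Definition laurent (f : (V -> int) -> int) : Prop :=
  finite_set [set m | f m != 0] /\
  forall m, f m != 0 -> finite_set [set r | m r != 0].

Definition expo (r : V) : V -> int := delta r.

Definition zvar (r : V) : (V -> int) -> int := delta (expo r).

Definition lone : (V -> int) -> int := delta 0.

Definition lpow (f : (V -> int) -> int) (n : nat) := iter n (conv f) lone.

Definition seed := ((V -> (V -> int) -> int) * quiver e)%type.

(** The new cluster variable is computed inside the ring of Laurent
    polynomials, in which the division is always possible (Laurent phenomenon)
    and has a unique result.  The products have finitely many factors other
    than [1]. *)
Definition seed_mutation (k : V) (S S' : seed) : Prop :=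
  let: (x, b) := S in let: (x', b') := S' in
  [/\ b' = mutate_quiver k b,
      forall r, r != k -> x' r = x r,
      laurent (x' k) &
      conv (x k) (x' k) =
        (\big[@conv _/lone]_(r \in setT) lpow (x r) (posp (b r k))) +
        (\big[@conv _/lone]_(r \in setT) lpow (x r) (posp (b k r)))].

Inductive reachable : seed -> Prop :=
| reach_init : reachable (zvar, @Gamma e)
| reach_mut k S S' : reachable S -> seed_mutation k S S' -> reachable S'.

Definition cluster_variable (f : (V -> int) -> int) : Prop :=
  exists2 S : seed, reachable S & exists r, f = S.1 r.

Definition cluster_monomial (f : (V -> int) -> int) : Prop :=
  exists2 S : seed, reachable S &
    exists rs : seq V, f = \big[@conv _/lone]_(r <- rs) S.1 r.

Inductive cluster_algebra : ((V -> int) -> int) -> Prop :=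
| CAvar f : cluster_variable f -> cluster_algebra f
| CAone : cluster_algebra lone
| CAsub f g :
    cluster_algebra f -> cluster_algebra g -> cluster_algebra (f - g)
| CAmul f g :
    cluster_algebra f -> cluster_algebra g -> cluster_algebra (conv f g).

(** [D (m, w)] is the coefficient of [z^m (x) [w]]. *)
Definition tens (f : (V -> int) -> int) (c : rat -> int) :
  (V -> int) * rat -> int := fun p => f p.1 * c p.2.

Inductive cluster_tensor_E : ((V -> int) * rat -> int) -> Prop :=
| CTE0 : cluster_tensor_E 0
| CTEadd f c D : cluster_algebra f -> in_E c -> cluster_tensor_E D ->
    cluster_tensor_E (tens f c + D).

(** [chi(z^m) = [chi_wt m]]. *)
Definition chi_wt (m : V -> int) : rat :=
  \sum_(r \in setT) ((m r)%:~R * (- ((val r)%:~R / 2%:R)) : rat).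

(** [|chi|(D)], where the absolute values are taken of the coefficients of the
    separate terms [z^m (x) [w]], that is before the terms having the same
    image by [chi] are collected: otherwise [D = z_0 (x) [0] - z_2 (x) [omega_1]],
    say, would satisfy [|chi|(D) = 0], and the infinite sum [D + D + ...] would
    have to belong to the completion. *)
Definition abs_chi (D : (V -> int) * rat -> int) : rat -> int :=
  fun w => \sum_(m \in setT) `|D (m, w - chi_wt m)|.

Definition completed_cluster_algebra (D : (V -> int) * rat -> int) : Prop :=
  exists A : nat -> (V -> int) * rat -> int,
    [/\ forall i, cluster_tensor_E (A i),
        summable_in_E (fun i => abs_chi (A i)) &
        D = (fun p => \sum_(i \in setT) A i p)].

End ClusterAlgebra.

Section GrothendieckRing.
Variables (R : realType) (h : R[i]) (e : bool).
Local Notation lw := (lweight R).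

Definition dim_L (Psi : lw) (w : rat) : nat :=
  xget 0%N [set n | exists2 S : bmod h, is_L Psi S &
                      has_dim (weight_space S w) n].

(** Multiplicity of [L(Psi'')] in the tensor product of [L(Psi)] and
    [L(Psi')]. *)
Definition tensor_mult (Psi Psi' Psi'' : lw) : nat :=
  xget 0%N [set n | exists (S S' S'' T : bmod h) (t : S -> S' -> T),
    [/\ is_L Psi S, is_L Psi' S', is_L Psi'' S'', is_tensor t &
        has_mult T S'' n]].

(** [lam] stands for [\sum_Psi lam Psi [L(Psi)]]. *)
Definition in_K0 (lam : lw -> int) : Prop :=
  (forall Psi, lam Psi != 0 ->
     exists2 S : bmod h, is_L Psi S & in_Oplus2Z e S) /\
  summable_in_E (fun Psi w => `|lam Psi| * (dim_L Psi w)%:Z).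

Definition K0_abs (lam : lw -> int) : rat -> int :=
  fun w => \sum_(Psi \in setT) `|lam Psi| * (dim_L Psi w)%:Z.

Definition K0_mul (lam mu : lw -> int) : lw -> int :=
  fun Psi => \sum_(p \in setT)
    lam p.1 * mu p.2 * (tensor_mult p.1 p.2 Psi)%:Z.

Definition K0_class (Psi : lw) : lw -> int := delta Psi.

(** The structure map [E -> K_0], [[w] |-> [L(q^w)]]. *)
Definition E_to_K0 (c : rat -> int) : lw -> int :=
  fun Psi => \sum_(w \in setT) c w * delta (lw_weight h w) Psi.

Local Notation V := (vtx e).

Definition E_algebra_iso (Phi : ((V -> int) * rat -> int) -> (lw -> int)) :
    Prop :=
  [/\ set_bij (@completed_cluster_algebra e) in_K0 Phi,
      forall D D', completed_cluster_algebra D -> completed_cluster_algebra D' ->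
        Phi (D + D') = Phi D + Phi D',
      forall D D', completed_cluster_algebra D -> completed_cluster_algebra D' ->
        Phi (conv D D') = K0_mul (Phi D) (Phi D') &
      forall c, in_E c -> Phi (tens (@lone e) c) = E_to_K0 c].

Definition countable_sum_compatible
    (Phi : ((V -> int) * rat -> int) -> (lw -> int)) : Prop :=
  forall A : nat -> (V -> int) * rat -> int,
    (forall i, completed_cluster_algebra (A i)) ->
    summable_in_E (fun i => abs_chi (A i)) ->
    summable_in_E (fun i => K0_abs (Phi (A i))) /\
    Phi (fun p => \sum_(i \in setT) A i p) =
      (fun Psi => \sum_(i \in setT) Phi (A i) Psi).

(** Up to multiplication by the invertible classes [[w]], the images of the
    cluster monomials are exactly the classes of the real simple objects. *)
Definition monoidal_categorification
    (Phi : ((V -> int) * rat -> int) -> (lw -> int)) : Prop :=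
  (forall f, cluster_monomial f ->
     exists (S : bmod h) (Psi : lw) (w : rat),
       [/\ in_Oplus2Z e S, real_simple S, is_L Psi S &
           Phi (tens f (delta 0)) =
             K0_mul (E_to_K0 (delta w)) (K0_class Psi)]) /\
  (forall (S : bmod h), in_Oplus2Z e S -> real_simple S ->
     exists (f : (V -> int) -> int) (Psi : lw) (w : rat),
       [/\ cluster_monomial f, is_L Psi S &
           Phi (tens f (delta 0)) =
             K0_mul (E_to_K0 (delta w)) (K0_class Psi)]).

End GrothendieckRing.

(* Main.v *)
(** The seeds of [A(Gamma)] correspond to the triangulations of an infinite
    polygon with vertex set [ZZ] and one more vertex at infinity that are
    obtained from the fan at infinity by finitely many flips: the cluster
    variable of the arc from [a] to infinity is [z_a], that of the arc from [a]
    to [b] is [\sum_(a <= k < b) z_a z_b / (z_k z_(k+1))], and the exchange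
    relations are Ptolemy relations.  Any finite noncrossing family of arcs
    extends to such a triangulation, so cluster monomials are the products over
    noncrossing families.  On the other side the arcs correspond to simple
    modules with highest l-weight [kap (1 - be z) / (1 - a z)] or
    [kap (1 - be z)], whose tensor products can be computed with the Drinfeld
    currents.  The product over a noncrossing family is the class of a simple
    module: its constituents have highest l-weights among the monomials of the
    product, and comparing these monomials with those of other noncrossing
    families leaves only the leading one.  Doubling a noncrossing family gives a
    noncrossing family, so these simple modules are real.  Finally a positive
    l-weight with roots and poles in [q^V] satisfies the ballot condition that
    makes parenthesis matching possible, so that it is the leading monomial of a
    noncrossing family; hence every simple object arises. *)

Require Import Defs.
From HB Require Import structures.
From mathcomp Require Import all_boot all_order all_algebra.
From mathcomp Require Import all_classical all_reals all_analysis.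
From mathcomp Require Import complex.
From mathcomp Require Import ring zify.
Set Implicit Arguments. Unset Strict Implicit. Unset Printing Implicit Defensive.
Import Order.TTheory GRing.Theory Num.Theory.
Local Open Scope classical_set_scope.
Local Open Scope complex_scope.
Local Open Scope ring_scope.

(** * Drinfeld generators *)

(** Two obstacles shape the proof. Modules are given by Drinfeld--Jimbo generators, so the current
    relations have to be derived. The Cartan element $h_1$ is shown to commute with the other Cartan
    currents only on modules generated by a vector on which they act by scalars: there an operator
    vanishes once it q-commutes with the generators and kills that vector. A tensor product need not
    be of this kind; it is studied in coordinates along a rank-one factor, where leading terms of
    the currents suffice. Secondly, tensor products are nowhere constructed: as [tensor_mult] is 0
    when there is none, they are read off from nonzero products in $K_0$, available because [Phi] is
    injective. The finite arcs are reached through a module of length two, the product of an $L^+$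
    and a Kirillov--Reshetikhin module, which turns an exchange relation into a recursion for
    preimages under [Phi]. The constituents of a product of arcs are found by multiplying with
    classes $[L^+]$ until no denominator is left; this preserves inequalities between classes.
    Height, a linear function of exponents that the leading monomial maximizes, drives the
    induction. *)

Section LinearReflection.
Variables (C : pzRingType) (V : lmodType C).

(** Formal linear combinations of words in linear operators [op i] applied to
    vectors [at j]; two of them are equal as soon as the coefficients of each
    word agree. *)
Inductive lexp :=
| LAtom of nat | LZero | LAdd of lexp & lexp | LOpp of lexp
| LScale of C & lexp | LApp of nat & lexp.

Variables (op : nat -> {linear V -> V}) (env : seq V).

Fixpoint leval (t : lexp) : V :=
  match t with
  | LAtom i => nth 0 env i | LZero => 0 | LAdd s t => leval s + leval t
  | LOpp t => - leval t | LScale c t => c *: leval t | LApp i t => op i (leval t)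
  end.

Fixpoint lwords (t : lexp) : seq (seq nat * nat) :=
  match t with
  | LAtom i => [:: ([::], i)] | LZero => [::] | LAdd s t => lwords s ++ lwords t
  | LOpp t => lwords t | LScale _ t => lwords t
  | LApp i t => [seq (i :: w.1, w.2) | w <- lwords t]
  end.

Fixpoint lcoef (w : seq nat) (j : nat) (t : lexp) : C :=
  match t with
  | LAtom i => if w is [::] then if eqn i j then 1 else 0 else 0
  | LZero => 0 | LAdd s t => lcoef w j s + lcoef w j t
  | LOpp t => - lcoef w j t | LScale c t => c * lcoef w j t
  | LApp i t => if w is i' :: w' then if eqn i i' then lcoef w' j t else 0 else 0
  end.

Definition lmono (w : seq nat * nat) : V := foldr (fun i => op i) (nth 0 env w.2) w.1.

Lemma leval_words t (r : seq (seq nat * nat)) :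
  uniq r -> {subset lwords t <= r} ->
  leval t = \sum_(w <- r) lcoef w.1 w.2 t *: lmono w.
Proof.
elim: t r => [i||s IHs t IHt|t IH|c t IH|i t IH] r ur /= sub; rewrite ?eqnE.
- have ir : ([::], i) \in r by apply: sub; rewrite inE.
  rewrite (bigD1_seq _ ir ur) /= eqxx scale1r big1 ?addr0 // => -[w j] /=.
  by case: w => [|? ?] /=; rewrite ?eqnE ?scale0r // xpair_eqE eqxx /= eq_sym => /negbTE ->; rewrite scale0r.
- by rewrite big1 // => w _; rewrite scale0r.
- rewrite (IHs r) ?(IHt r) // => [|w Hw|w Hw]; last 2 first.
  + by apply: sub; rewrite mem_cat Hw orbT.
  + by apply: sub; rewrite mem_cat Hw.
  by rewrite -big_split; apply: eq_bigr => w _; rewrite scalerDl.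
- by rewrite (IH r) // -sumrN; apply: eq_bigr => w _; rewrite scaleNr.
- by rewrite (IH r) // scaler_sumr; apply: eq_bigr => w _; rewrite scalerA.
pose r' := undup (lwords t).
rewrite (IH r' (undup_uniq _)); last by move=> w; rewrite mem_undup.
rewrite linear_sum /=.
have inj : injective (fun w : seq nat * nat => (i :: w.1, w.2)) by move=> [? ?] [? ?] [-> ->].
rewrite [RHS](bigID (mem [seq (i :: w.1, w.2) | w <- r'])) /= [X in _ + X]big1_seq ?addr0.
  rewrite /= -[RHS]big_filter [RHS](perm_big [seq (i :: w.1, w.2) | w <- r']) /=.
    rewrite big_map. apply: eq_bigr => w _ /=.
    by rewrite ?eqnE eqxx linearZ_LR.
  apply: uniq_perm; rewrite ?filter_uniq ?map_inj_uniq ?undup_uniq // => w.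
  rewrite mem_filter; apply/andP/idP => [[]//|H]; split=> //.
  apply: sub; case/mapP: H => u Hu ->; apply/mapP; exists u => //.
  by rewrite -mem_undup.
move=> [[|i' w] j] /= /andP[Hn _]; rewrite ?scale0r // ?eqnE.
case: eqP => [ii|]; rewrite ?scale0r // -ii in Hn *.
have -> : lcoef w j t = 0; last by rewrite scale0r.
have : (w, j) \notin lwords t.
  by apply: contra Hn => H; apply/mapP; exists (w, j); rewrite ?mem_undup.
elim: t w {IH sub r' Hn} => //= [k|s IHs t IHt|t IH|c t IH|k t IH] w.
- by case: w => //=; rewrite ?eqnE inE xpair_eqE eqxx /= eq_sym => /negbTE ->.
- by rewrite mem_cat negb_or => /andP[/IHs -> /IHt ->]; rewrite addr0.
- by move=> /IH ->; rewrite oppr0.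
- by move=> /IH ->; rewrite mulr0.
case: w => // k' w; rewrite ?eqnE; case: eqP => // <- H; apply: IH.
by apply: contra H => H; apply/mapP; exists (w, j).
Qed.

Fixpoint lall (r : seq (seq nat * nat)) (s t : lexp) : Prop :=
  if r is w :: r' then lcoef w.1 w.2 s = lcoef w.1 w.2 t /\ lall r' s t else True.

Lemma lreflect s t : lall (undup (lwords s ++ lwords t)) s t -> leval s = leval t.
Proof.
move=> H.
rewrite !(@leval_words _ (undup (lwords s ++ lwords t))) ?undup_uniq //; last 2 first.
- by move=> w Hw; rewrite mem_undup mem_cat Hw orbT.
- by move=> w Hw; rewrite mem_undup mem_cat Hw.
elim: (undup _) H => [|w r IH] /=; first by rewrite !big_nil.
by case=> E /IH {}IH; rewrite !big_cons E IH.
Qed.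

(** Certificate step: [c] times a known equation is added to the goal. After all the needed
    equations have been added, the goal holds coefficient by coefficient and [lreflect] applies. *)
Lemma lin_comb (c : C) (l r a b : V) : l = r -> a + c *: r = b + c *: l -> a = b.
Proof. by move=> -> /addIr. Qed.

End LinearReflection.

Ltac mem_idx x l :=
  match l with
  | x :: _ => constr:(O)
  | _ :: ?l' => let n := mem_idx x l' in constr:(S n)
  end.
Ltac add_atom x l :=
  match l with
  | @nil _ => constr:(x :: l)
  | x :: _ => l
  | ?y :: ?l' => let l2 := add_atom x l' in constr:(y :: l2)
  end.
(* env is a pair (ops, atoms) *)
Ltac lenv t e :=
  match t with
  | 0 => e
  | ?a + ?b => let e1 := lenv a e in lenv b e1
  | - ?a => lenv a e
  | _ *: ?a => lenv a e
  | GRing.Linear.sort ?f ?x =>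
      let e1 := lenv x e in
      match e1 with (?o, ?l) => let o' := add_atom f o in constr:((o', l)) end
  | _ => match e with (?o, ?l) => let l' := add_atom t l in constr:((o, l')) end
  end.
Ltac lreify C t o l :=
  match t with
  | 0 => constr:(@LZero C)
  | ?a + ?b => let x := lreify C a o l in let y := lreify C b o l in constr:(LAdd x y)
  | - ?a => let x := lreify C a o l in constr:(LOpp x)
  | ?c *: ?a => let x := lreify C a o l in constr:(@LScale C c x)
  | GRing.Linear.sort ?f ?u =>
      let x := lreify C u o l in let i := mem_idx f o in constr:(@LApp C i x)
  | _ => let i := mem_idx t l in constr:(@LAtom C i)
  end.
(** Reifies both sides over common lists of operators and vectors; one scalar identity per word
    remains. *)
Ltac lin_with C V :=
  match goal with
  | |- @eq _ ?a ?b =>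
    let e0 := constr:((@nil ({linear V -> V}), @nil V)) in
    let e1 := lenv a e0 in let e2 := lenv b e1 in
    match e2 with
    | (?o, ?l) =>
      let x := lreify C a o l in let y := lreify C b o l in
      refine (@lreflect C V (nth (idfun : {linear V -> V}) o) l x y _);
      let r := eval vm_compute in (undup (lwords x ++ lwords y)) in
      change (lall r x y); cbn [lall lcoef fst snd eqn]
    end
  end.

(** Closes a scalar identity that holds modulo [d = 1]; it is applied with [d = s * s]. *)
Lemma eq_mod1 (C : pzRingType) (x y c d : C) : d = 1 -> x - y = c * (d - 1) -> x = y.
Proof. by move=> ->; rewrite subrr mulr0 => /subr0_eq. Qed.

(** * Relations between the Drinfeld currents *)

Section Drinfeld.
Variables (C : fieldType) (V : lmodType C).
Implicit Types (q s : C) (k ki h : {linear V -> V}) (X Y : nat -> {linear V -> V}).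

(** [X m = x^+_m], [Y m = x^-_{m+1}] and [h = h_1]; the sign [s] makes the
    relations invariant under [(X, Y, q, s) |-> (Y, X, q^-1, - s)]. *)
Record drin q s k ki h X Y : Prop := Drin {
  dr_kki v : k (ki v) = v;
  dr_kik v : ki (k v) = v;
  dr_kX0 v : k (X 0%N v) = q ^+ 2 *: X 0%N (k v);
  dr_kY0 v : k (Y 0%N v) = q ^- 2 *: Y 0%N (k v);
  dr_p0 v : X 0%N (Y 0%N v) - Y 0%N (X 0%N v) = s *: k (h v);
  dr_X m v : h (X m v) = X m (h v) + (s * (q + q^-1)) *: X m.+1 v;
  dr_Y m v : h (Y m v) = Y m (h v) - (s * (q + q^-1)) *: Y m.+1 v;
  dr_XX v : X 1%N (X 0%N v) = q ^+ 2 *: X 0%N (X 1%N v);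
  dr_YY v : Y 1%N (Y 0%N v) = q ^- 2 *: Y 0%N (Y 1%N v) }.

Lemma drinC q s k ki h X Y : drin q s k ki h X Y -> drin q^-1 (- s) k ki h Y X.
Proof.
case=> a1 a2 a3 a4 a5 a6 a7 a8 a9; split=> // [v|v|v|m v|m v|v|v].
- by rewrite a4 exprVn.
- by rewrite a3 exprVn invrK.
- by rewrite -opprB a5 scaleNr.
- by rewrite a7 invrK mulNr scaleNr addrC [q^-1 + q]addrC addrC.
- by rewrite a6 invrK mulNr scaleNr opprK [q^-1 + q]addrC.
- by rewrite a9 exprVn.
- by rewrite a8 exprVn invrK.
Qed.

Section Basic.
Variables (q s : C) (k ki h : {linear V -> V}) (X Y : nat -> {linear V -> V}).
Hypotheses (q0 : q != 0) (s1 : s * s = 1) (q2n : q + q^-1 != 0) (D : drin q s k ki h X Y).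
Tactic Notation "lc" uconstr(c) constr(H) := refine (@lin_comb C V c _ _ _ _ H _).
Ltac lin := lin_with C V; repeat split; first [ring | solve [field; rewrite ?q0 //] | idtac].

Lemma k_inj u v : k u = k v -> u = v.
Proof. by move=> e; rewrite -(dr_kik D u) e (dr_kik D). Qed.

Lemma s_neq0 : s != 0.
Proof. by apply: contra_eq_neq s1 => ->; rewrite mul0r eq_sym oner_eq0. Qed.

Lemma sq_neq0 : s * (q + q^-1) != 0.
Proof. by rewrite mulf_neq0 // s_neq0. Qed.

Definition Pb m n v := X m (Y n v) - Y n (X m v).

(** [k h] is a multiple of the bracket of [X 0] and [Y 0], whose weights [q ^+ 2] and [q ^- 2]
    cancel. *)
Lemma kh v : k (h v) = h (k v).
Proof.
apply: k_inj; apply: (scalerI s_neq0); rewrite -(dr_p0 D (k v)).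
lc (-1) (congr1 k (dr_p0 D v)).
lc 1 (dr_kX0 D (Y 0%N v)). lc (-1) (dr_kY0 D (X 0%N v)).
lc (- q^-2) (congr1 (Y 0%N) (dr_kX0 D v)). lc (q^+2) (congr1 (X 0%N) (dr_kY0 D v)).
by lin.
Qed.

Lemma kX m v : k (X m v) = q ^+ 2 *: X m (k v).
Proof.
elim: m v => [|m IH] v; first exact: (dr_kX0 D).
apply: (scalerI sq_neq0).
lc (-1) (congr1 k (dr_X D m v)). lc (q^+2) (dr_X D m (k v)).
lc (1) (kh (X m v)). lc 1 (congr1 h (IH v)). lc (-1) (IH (h v)).
lc (- q^+2) (congr1 (X m) (kh v)).
by lin.
Qed.

(** [h] acts on brackets as a derivation, raising the index of [X] and that of [Y] with opposite
    signs. *)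
Lemma PbD m n v : h (Pb m n v) - Pb m n (h v) =
  (s * (q + q^-1)) *: (Pb m.+1 n v - Pb m n.+1 v).
Proof.
rewrite /Pb. lc 1 (dr_X D m (Y n v)). lc 1 (congr1 (X m) (dr_Y D n v)).
lc (-1) (dr_Y D n (X m v)). lc (-1) (congr1 (Y n) (dr_X D m v)).
by lin.
Qed.

Lemma Pb00 v : Pb 0%N 0%N v = s *: k (h v).
Proof. exact: (dr_p0 D). Qed.

(** [Pb 0 0] is a multiple of [k h], hence commutes with [h], so the right-hand side of [PbD]
    vanishes. *)
Lemma Pb10 v : Pb 1%N 0%N v = Pb 0%N 1%N v.
Proof.
apply: (scalerI sq_neq0). lc (-1) (PbD 0%N 0%N v). 
lc 1 (congr1 h (Pb00 v)). lc (-1) (Pb00 (h v)). lc (-s) (kh (h v)).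
rewrite /Pb. by lin.
Qed.

(** This is [dr_XX] bracketed with [Y 0]. *)
Lemma Pb10X v : Pb 1%N 0%N (X 0%N v) - q ^+ 2 *: X 0%N (Pb 1%N 0%N v) =
  q ^+ 2 *: Pb 0%N 0%N (X 1%N v) - X 1%N (Pb 0%N 0%N v).
Proof.
rewrite /Pb. lc 1 (dr_XX D (Y 0%N v)). lc (-1) (congr1 (Y 0%N) (dr_XX D v)).
by lin.
Qed.

(** [Hb = 2 k h_2] up to normalization. *)
Definition Hb v := 2%:R *: Pb 1%N 0%N v - (q - q^-1) *: k (h (h v)).
(** The quantum integer [[4]]: the relation [[h_2, x^+_m] = ([4] / 2) x^+_{m+2}] is doubled, as [Hb]
    is. *)
Definition cb := (q ^+ 2 + q ^- 2) * (q + q^-1).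

Lemma HbX0 v : Hb (X 0%N v) = q ^+ 2 *: X 0%N (Hb v) + cb *: k (X 2%N v).
Proof.
have s1' : s ^+ 2 = 1 by rewrite expr2.
have eX m u : X m (k u) = q^-2 *: k (X m u).
  by rewrite kX scalerA mulVf ?scale1r // expf_neq0.
rewrite /Hb /cb. lc 2%:R (Pb10X v). lc (2%:R * q^+2) (Pb00 (X 1%N v)).
lc (-2%:R) (congr1 (X 1%N) (Pb00 v)).
lc (- 2%:R * s) (eX 1%N (h v)).
lc (q^+2*(q - q^-1)) (eX 0%N (h (h v))).
lc (- (q - q^-1)) (congr1 (k \o h) (dr_X D 0%N v)).
lc (- (q - q^-1)) (congr1 k (dr_X D 0%N (h v))).
rewrite /=.
lc (- (q - q^-1)*(s * (q + q^-1)) + 2%:R*s*q^+2) (congr1 k (dr_X D 1%N v)).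
rewrite /Pb; lin.
transitivity (s * s * cb); last by rewrite s1 /cb; field; rewrite ?q0.
by rewrite /cb; field; rewrite ?q0.
Qed.
End Basic.

Section Commutation.
Variables (q s : C) (k ki h : {linear V -> V}) (X Y : nat -> {linear V -> V}).
Hypotheses (q0 : q != 0) (s1 : s * s = 1) (q2n : q + q^-1 != 0) (D : drin q s k ki h X Y).
Hypotheses (q3n : q ^+ 2 + 1 + q ^- 2 != 0) (two0 : 2%:R != 0 :> C).
Tactic Notation "lc" uconstr(c) constr(H) := refine (@lin_comb C V c _ _ _ _ H _).
Ltac lin := lin_with C V; repeat split; first [ring | solve [field; rewrite ?q0 //] | idtac].

Let D' := drinC D.
Let q0' : q^-1 != 0. Proof. by rewrite invr_eq0. Qed.
Let s1' : - s * - s = 1. Proof. by rewrite mulrNN. Qed.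
Let q2n' : q^-1 + q^-1^-1 != 0. Proof. by rewrite invrK addrC. Qed.

Lemma kY m v : k (Y m v) = q ^- 2 *: Y m (k v).
Proof. by rewrite (kX q0' s1' q2n' D') exprVn. Qed.

Lemma PbC m n v : Pb Y X m n v = - Pb X Y n m v.
Proof. by rewrite /Pb opprB. Qed.

Lemma HbC v : Hb q^-1 k h Y X v = - Hb q k h X Y v.
Proof.
rewrite /Hb PbC -(Pb10 q0 s1 q2n D) invrK. by rewrite /Pb; lin.
Qed.

Lemma HbY0 v : Hb q k h X Y (Y 0%N v) =
  q ^- 2 *: Y 0%N (Hb q k h X Y v) - cb q *: k (Y 2%N v).
Proof.
have := HbX0 q0' s1' q2n' D' v; rewrite !HbC => e.
have -> : cb q = cb q^-1 by rewrite /cb !exprVn !invrK [q^-1 + q]addrC [q ^- 2 + _]addrC.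
rewrite -exprVn. lc (-1) e.
rewrite /Hb /Pb; lin.
Qed.

Let p10k v : Pb X Y 1%N 0%N (k v) = k (Pb X Y 1%N 0%N v).
Proof.
rewrite /Pb.
lc (-1) (kX q0 s1 q2n D 1%N (Y 0%N v)). lc 1 (kY 0%N (X 1%N v)).
lc (-q^+2) (congr1 (X 1%N) (kY 0%N v)). lc (q^-2) (congr1 (Y 0%N) (kX q0 s1 q2n D 1%N v)).
by lin.
Qed.

(** This amounts to [[h_1, h_2] = 0]. Put [D = Pb 2 0 - Pb 0 2] and [[2] = q + q^-1]. The derivation
    property of [h] gives [2 [h, Pb 1 0] = s [2] D]; commuting [Hb] with [Pb 0 0 = s k h] gives [2 s
    [Pb 1 0, h] = [4] D]. Eliminating [D] leaves [2 [2] (q^2 + 1 + q^-2)] times the commutator equal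
    to 0. *)
Lemma hPb10 v : h (Pb X Y 1%N 0%N v) = Pb X Y 1%N 0%N (h v).
Proof.
have kk u := kh q0 s1 D u.
have e1 : Hb q k h X Y (Pb X Y 0%N 0%N v) - Pb X Y 0%N 0%N (Hb q k h X Y v) =
    cb q *: k (Pb X Y 2%N 0%N v - Pb X Y 0%N 2%N v).
  have HX u := HbX0 q0 s1 q2n D u.
  have HB : forall u w, Hb q k h X Y (u - w) = Hb q k h X Y u - Hb q k h X Y w.
    by move=> u w; rewrite /Hb /Pb; lin.
  rewrite {1}/Pb HB (HX (Y 0%N v)) (HbY0 (X 0%N v)).
  lc (q^+2) (congr1 (X 0%N) (HbY0 v)). lc (-q^-2) (congr1 (Y 0%N) (HX v)).
  lc (cb q) (kX q0 s1 q2n D 0%N (Y 2%N v)).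
  lc (cb q) (kY 0%N (X 2%N v)).
  by rewrite /Pb; lin.
have d20 : (2%:R : C) *: (h (Pb X Y 1%N 0%N v) - Pb X Y 1%N 0%N (h v)) =
    (s * (q + q^-1)) *: (Pb X Y 2%N 0%N v - Pb X Y 0%N 2%N v).
  have P01 u := Pb10 q0 s1 q2n D u.
  have e2 := PbD D 1%N 0%N v; have e3 := PbD D 0%N 1%N v.
  rewrite -!P01 in e3. lc 1 e2. lc 1 e3. by lin.
have e4 : k ((2%:R * s : C) *: (Pb X Y 1%N 0%N (h v) - h (Pb X Y 1%N 0%N v))) =
    cb q *: k (Pb X Y 2%N 0%N v - Pb X Y 0%N 2%N v).
  have HBs u : Hb q k h X Y (s *: u) = s *: Hb q k h X Y u by rewrite /Hb /Pb; lin.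
  rewrite -e1 !(Pb00 D) HBs /Hb p10k.
  lc (- (s * (q - q^-1))) (congr1 (k \o h) (kk (h v))).
  by rewrite /=; lin.
have {}e4 : (2%:R * s : C) *: (Pb X Y 1%N 0%N (h v) - h (Pb X Y 1%N 0%N v)) =
    cb q *: (Pb X Y 2%N 0%N v - Pb X Y 0%N 2%N v).
  by apply: (k_inj D); rewrite e4 linearZ.
apply/eqP; rewrite -subr_eq0; apply/eqP.
apply: (scalerI q3n); apply: (scalerI q2n); apply: (scalerI two0).
rewrite !scaler0; lc (- (s * (q + q^-1))) e4; lc (cb q) d20; rewrite /cb.
lin.
  by refine (@eq_mod1 C _ _ (- (2%:R * (q + q^-1))) _ s1 _); ring.
by refine (@eq_mod1 C _ _ (2%:R * (q + q^-1)) _ s1 _); ring.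
Qed.

(** [Hb] commutes with [h] by [hPb10], and the [X m] arise from [X 0] by brackets with [h]. *)
Lemma HbXm m v : Hb q k h X Y (X m v) =
  q ^+ 2 *: X m (Hb q k h X Y v) + cb q *: k (X m.+2 v).
Proof.
elim: m v => [|m IH] v; first exact: HbX0 q0 s1 q2n D v.
have hH u : h (Hb q k h X Y u) = Hb q k h X Y (h u).
  rewrite /Hb -hPb10. lc (q - q^-1) (kh q0 s1 D (h (h u))).
  by lin.
have HB : forall u w, Hb q k h X Y (u - w) = Hb q k h X Y u - Hb q k h X Y w.
  by move=> u w; rewrite /Hb /Pb; lin.
have HBs c u : Hb q k h X Y (c *: u) = c *: Hb q k h X Y u by rewrite /Hb /Pb; lin.
apply: (scalerI (sq_neq0 s1 q2n)).
have e : (s * (q + q^-1)) *: X m.+1 v = h (X m v) - X m (h v).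
  by rewrite (dr_X D) addrAC subrr add0r.
rewrite -HBs e HB -hH !IH -hH.
lc (q^+2) (dr_X D m (Hb q k h X Y v)).
lc (cb q) (congr1 k (dr_X D m.+2 v)).
lc (- cb q) (kh q0 s1 D (X m.+2 v)).
by lin.
Qed.

(** The defect of Drinfeld's quadratic relation between the currents [x^+]. *)
Definition Rb m n v := X m.+1 (X n v) - q ^+ 2 *: X n (X m.+1 v)
  - q ^+ 2 *: X m (X n.+1 v) + X n.+1 (X m v).

Lemma RbC m n v : Rb m n v = Rb n m v.
Proof. by rewrite /Rb; lin. Qed.

Lemma RbD m n v : h (Rb m n v) - Rb m n (h v) =
  (s * (q + q^-1)) *: (Rb m.+1 n v + Rb m n.+1 v).
Proof.
rewrite /Rb.
lc 1 (dr_X D m.+1 (X n v)). lc 1 (congr1 (X m.+1) (dr_X D n v)).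
lc (-q^+2) (dr_X D n (X m.+1 v)). lc (-q^+2) (congr1 (X n) (dr_X D m.+1 v)).
lc (-q^+2) (dr_X D m (X n.+1 v)). lc (-q^+2) (congr1 (X m) (dr_X D n.+1 v)).
lc 1 (dr_X D n.+1 (X m v)). lc 1 (congr1 (X n.+1) (dr_X D m v)).
by lin.
Qed.

Lemma RbH m n v : Hb q k h X Y (Rb m n v) - q ^+ 4 *: Rb m n (Hb q k h X Y v) =
  cb q *: k (Rb m.+2 n v + Rb m n.+2 v).
Proof.
have HB u w : Hb q k h X Y (u - w) = Hb q k h X Y u - Hb q k h X Y w.
  by rewrite /Hb /Pb; lin.
have HA u w : Hb q k h X Y (u + w) = Hb q k h X Y u + Hb q k h X Y w.
  by rewrite /Hb /Pb; lin.
have HBs c u : Hb q k h X Y (c *: u) = c *: Hb q k h X Y u by rewrite /Hb /Pb; lin.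
have H2 a b u : Hb q k h X Y (X a (X b u)) = q ^+ 4 *: X a (X b (Hb q k h X Y u))
    + cb q *: k (X a (X b.+2 u) + X a.+2 (X b u)).
  rewrite HbXm; lc (q^+2) (congr1 (X a) (HbXm b u)).
  lc (- cb q) (kX q0 s1 q2n D a (X b.+2 u)); by lin.
by rewrite /Rb !(HB, HA, HBs) !H2; lin.
Qed.

Hypothesis cb0 : q ^+ 2 + q ^- 2 != 0.

(** Induction on [m + n]. From a settled degree, brackets with [h_1] give
    [Rb (m+1) n = - Rb m (n+1)] and brackets with [h_2] give [Rb (m+2) n = - Rb m (n+2)]. The first
    relation used twice has the opposite sign of the second, so twice the defect vanishes. In total
    degree 1 the symmetry [RbC] plays the part of [h_2]. *)
Lemma Rb0 m n v : Rb m n v = 0.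
Proof.
have RN (m' n' : nat) : (forall u, Rb m' n' u = 0) -> forall u, Rb m'.+1 n' u = - Rb m' n'.+1 u.
  move=> H u; apply/eqP; rewrite -addr_eq0; apply/eqP.
  by apply: (scalerI (sq_neq0 s1 q2n)); rewrite -RbD !H linear0 subrr scaler0.
have RN2 (m' n' : nat) : (forall u, Rb m' n' u = 0) -> forall u, Rb m'.+2 n' u = - Rb m' n'.+2 u.
  move=> H u; apply/eqP; rewrite -addr_eq0; apply/eqP.
  have cbn : cb q != 0 by rewrite /cb mulf_neq0.
  apply: (k_inj D); apply: (scalerI cbn); rewrite -RbH !H.
  by rewrite /Hb /Pb; lin.
have half u : u = - u -> u = 0 :> V.
  move/eqP; rewrite -addr_eq0 -mulr2n -scaler_nat scaler_eq0 (negbTE two0) /=.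
  by move/eqP.
have [N] := ubnP (m + n); elim: N m n v => // N IH m n v; rewrite ltnS => le_mn.
have small (m' n' : nat) u : (m' + n' < m + n)%N -> Rb m' n' u = 0.
  by move=> H; apply: IH; apply: leq_trans H le_mn.
have alt j u : (j <= m + n)%N -> Rb j (m + n - j) u = (-1) ^+ j *: Rb 0%N (m + n)%N u.
  elim: j => [|j IHj] lj; first by rewrite subn0 scale1r.
  rewrite RN => [|w]; last by apply: small; lia.
  by rewrite subnSK // IHj ?exprS ?mulN1r ?scaleNr // ltnW.
suff R0 u : Rb 0%N (m + n)%N u = 0.
  by have := alt m v (leq_addr _ _); rewrite addKn R0 scaler0.
case E : (m + n)%N => [|[|N']].
- by rewrite /Rb (dr_XX D); lin.
- apply: half; rewrite -RN; first exact: RbC.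
  by move=> w; apply: small; rewrite E.
have := alt 2%N u; rewrite E => /(_ isT).
rewrite sqrrN expr1n scale1r subSS subSS subn0 => e.
by apply: half; rewrite -{1}e RN2 // => w; apply: small; rewrite E.
Qed.

(** Bracketing [Rb m n] with [Y 0] yields [Xr m n + Xr n m = 0]. *)
Definition Xr m n v := Pb X Y m.+1 0%N (X n v) - q ^+ 2 *: X n (Pb X Y m.+1 0%N v)
  - q ^+ 2 *: Pb X Y m 0%N (X n.+1 v) + X n.+1 (Pb X Y m 0%N v).

Definition del m v := h (Pb X Y m 0%N v) - Pb X Y m 0%N (h v).

Lemma XrC m n v : Xr m n v = - Xr n m v.
Proof.
lc 1 (Rb0 m n (Y 0%N v)); lc (-1) (congr1 (Y 0%N) (Rb0 m n v)).
by rewrite /Xr /Rb /Pb linear0; lin.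
Qed.

(** Only [n] is raised, since [h] commutes with [Pb m 0] up to the error [del m]. *)
Lemma XrD m n v : h (Xr m n v) - Xr m n (h v) = (s * (q + q^-1)) *: Xr m n.+1 v
  + (del m.+1 (X n v) - q ^+ 2 *: X n (del m.+1 v)
     - q ^+ 2 *: del m (X n.+1 v) + X n.+1 (del m v)).
Proof.
rewrite /Xr /del /Pb.
lc 1 (congr1 (Pb X Y m.+1 0%N) (dr_X D n v)).
lc (- q ^+ 2) (dr_X D n (Pb X Y m.+1 0%N v)).
lc (- q ^+ 2) (congr1 (Pb X Y m 0%N) (dr_X D n.+1 v)).
lc 1 (dr_X D n.+1 (Pb X Y m 0%N v)).
by rewrite /Pb; lin.
Qed.

Lemma del0 v : del 0 v = 0.
Proof.
rewrite /del !(Pb00 D); lc (-s) (kh q0 s1 D (h v)).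
by lin.
Qed.

Lemma del1 v : del 1 v = 0.
Proof. by rewrite /del hPb10 subrr. Qed.

Let half u : u = - u -> u = 0 :> V.
Proof.
move/eqP; rewrite -addr_eq0 -mulr2n -scaler_nat scaler_eq0 (negbTE two0) /=.
by move/eqP.
Qed.

Lemma Xr_step m : (forall v, del m v = 0) -> (forall v, del m.+1 v = 0) ->
  (forall v, Xr m 0 v = 0) -> forall n v, Xr m n v = 0.
Proof.
move=> d0 d1 H0; elim=> [|n IH] v; first exact: H0.
apply: (scalerI (sq_neq0 s1 q2n)); rewrite scaler0.
by lc (-1) (XrD m n v); rewrite !IH !d0 !d1; lin.
Qed.

Lemma Xr0 n v : Xr 0 n v = 0.
Proof.
apply: Xr_step => [u|u|u]; [exact: del0|exact: del1|].
by apply: half; exact: XrC.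
Qed.

(** Consider [XrD] at [(N + 1, 0)]: all the [Xr] vanish, and of the four error terms only the two
    with [del N.+2] remain. *)
Lemma delX N v : (forall j u, (j < N.+2)%N -> del j u = 0) ->
  del N.+2 (X 0%N v) = q ^+ 2 *: X 0%N (del N.+2 v).
Proof.
move=> H.
have X1 u : Xr N.+1 1 u = 0.
  rewrite XrC; case: N H => [|N] H.
    by have := half (XrC 1%N 1%N u) => ->; rewrite oppr0.
  rewrite (@Xr_step 1%N) ?oppr0 // => [w|w|w]; [exact: del1|exact: H|].
  by rewrite XrC Xr0 oppr0.
have X0 u : Xr N.+1 0 u = 0 by rewrite XrC Xr0 oppr0.
by lc (-1) (XrD N.+1 0 v); rewrite X1 !X0 !(H N.+1) //; lin.
Qed.
End Commutation.

End Drinfeld.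

Section Drinfeld2.
Variables (C : fieldType) (V : lmodType C).
Definition generates (k ki : {linear V -> V}) (X Y : nat -> {linear V -> V}) (v0 : V) :=
  forall P : V -> Prop, (forall a u w, P u -> P w -> P (a *: u + w)) ->
  (forall u, P u -> P (X 0%N u)) -> (forall u, P u -> P (Y 0%N u)) ->
  (forall u, P u -> P (k u)) -> (forall u, P u -> P (ki u)) -> P v0 -> forall u, P u.

Section Cyclic.
Variables (q s : C) (k ki h : {linear V -> V}) (X Y : nat -> {linear V -> V}).
Hypotheses (q0 : q != 0) (s1 : s * s = 1) (D : drin q s k ki h X Y).
Hypotheses (q2n : q + q^-1 != 0) (q3n : q ^+ 2 + 1 + q ^- 2 != 0).
Hypotheses (q4n : q ^+ 2 + q ^- 2 != 0) (two0 : 2%:R != 0 :> C).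

Let D' := drinC D.
Let q0' : q^-1 != 0. Proof. by rewrite invr_eq0. Qed.
Let s1' : - s * - s = 1. Proof. by rewrite mulrNN. Qed.
Let q2n' : q^-1 + q^-1^-1 != 0. Proof. by rewrite invrK addrC. Qed.
Let q3n' : q^-1 ^+ 2 + 1 + q^-1 ^- 2 != 0.
Proof. by rewrite !exprVn invrK addrC [_ + 1]addrC addrA. Qed.
Let q4n' : q^-1 ^+ 2 + q^-1 ^- 2 != 0. Proof. by rewrite !exprVn invrK addrC. Qed.

Variables (v0 : V) (eta : C) (psi : nat -> C).
Hypothesis gen : generates k ki X Y v0.
Hypothesis hv0 : h v0 = eta *: v0.
Hypothesis pv0 : forall m, Pb X Y 0 m v0 = psi m *: v0.

(** When [del] vanishes, [PbD] says that an index may be moved from [Y] to [X]. *)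
Lemma Pb_shift N : (forall j u, (j < N)%N -> del h X Y j u = 0) ->
  forall m n u, (m + n <= N)%N -> Pb X Y m n u = Pb X Y (m + n) 0 u.
Proof.
move=> H m n; elim: n m => [|n IH] m u le; first by rewrite addn0.
have lt : (m + n < N)%N by rewrite -addnS.
have e : h (Pb X Y (m + n)%N 0%N u) - Pb X Y (m + n)%N 0%N (h u) = 0.
  exact: (H (m + n)%N u lt).
have := PbD D m n u; rewrite (IH m _ (ltnW lt)) (IH m _ (ltnW lt)) e => /esym/eqP.
rewrite scaler_eq0 (negbTE (sq_neq0 s1 q2n)) /= subr_eq0 => /eqP <-.
by rewrite (IH m.+1 u lt) addSn addnS.
Qed.

(** [del N.+2] q-commutes with [X 0], with [Y 0] by the symmetry [drinC], and commutes with [k]; it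
    kills the cyclic vector because the Cartan operators act there by scalars. Hence its kernel is
    everything. *)
Lemma del_all N u : del h X Y N u = 0.
Proof.
have [M] := ubnP N; elim: M N u => // M IHM [|[|N]] u; rewrite ltnS => leM.
- exact: (del0 q0 s1 D).
- exact: (del1 q0 s1 q2n D q3n two0).
have H j w : (j < N.+2)%N -> del h X Y j w = 0.
  by move=> lt; exact: (IHM j w (leq_trans lt leM)).
have sh := Pb_shift H.
(* Exchanging [X] and [Y] replaces [Pb n 0] by [- Pb 0 n], which is [- Pb n 0] up to degree
   [N.+2]. *)
have dY n w : (n <= N.+2)%N -> del h Y X n w = - del h X Y n w.
  by move=> le; rewrite /del !(PbC X Y) !(sh 0%N n _ le) add0n; lin_with C V; repeat split; ring.
have kP w : Pb X Y N.+2 0%N (k w) = k (Pb X Y N.+2 0%N w).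
  have kXn m x := kX q0 s1 q2n D m x.
  have kYn m x := kY q0 s1 q2n D m x.
  rewrite /Pb.
  refine (@lin_comb C V (-1) _ _ _ _ (kXn N.+2 (Y 0%N w)) _).
  refine (@lin_comb C V 1 _ _ _ _ (kYn 0%N (X N.+2 w)) _).
  refine (@lin_comb C V (- q ^+ 2) _ _ _ _ (congr1 (X N.+2) (kYn 0%N w)) _).
  refine (@lin_comb C V (q ^- 2) _ _ _ _ (congr1 (Y 0%N) (kXn N.+2 w)) _).
  lin_with C V; repeat split; first [ring | by field; rewrite ?q0].
have kdel w : del h X Y N.+2 (k w) = k (del h X Y N.+2 w).
  by rewrite /del kP -(kh q0 s1 D (Pb _ _ _ _ _)) -(kh q0 s1 D w) kP; lin_with C V; repeat split; ring.
apply: (gen (P := fun u => del h X Y N.+2 u = 0)) => {u} [a u w Hu Hw|u Hu|u Hu|u Hu|u Hu|].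
- have -> : del h X Y N.+2 (a *: u + w) = a *: del h X Y N.+2 u + del h X Y N.+2 w.
    by rewrite /del /Pb; lin_with C V; repeat split; ring.
  by rewrite Hu Hw scaler0 addr0.
- by rewrite (delX q0 s1 q2n D q3n two0 q4n u H) Hu linear0 scaler0.
- apply: oppr_inj; rewrite -(dY _ _ (leqnn _)).
  rewrite (delX q0' s1' q2n' D' q3n' two0 q4n') => [|j w lt].
    by rewrite (dY _ _ (leqnn _)) Hu oppr0 linear0 scaler0.
  by rewrite (dY _ _ (ltnW lt)) (H j w lt) oppr0.
- by rewrite kdel Hu linear0.
- by apply: (k_inj D); rewrite -kdel (dr_kki D) Hu linear0.
have e : Pb X Y N.+2 0%N v0 = psi N.+2 *: v0.
  by rewrite -(pv0 N.+2) (sh 0%N N.+2 v0 (leqnn _)).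
have e2 : Pb X Y N.+2 0%N (eta *: v0) = eta *: Pb X Y N.+2 0%N v0.
  by rewrite /Pb; lin_with C V; repeat split; ring.
rewrite /del hv0 e2 e; refine (@lin_comb C V (psi N.+2) _ _ _ _ hv0 _).
lin_with C V; repeat split; ring.
Qed.

Lemma Pb_sum m n u : Pb X Y m n u = Pb X Y (m + n) 0 u.
Proof. exact: (Pb_shift (N := (m + n)%N) (fun j w _ => del_all j w) u (leqnn _)). Qed.

Lemma hPb m n u : h (Pb X Y m n u) = Pb X Y m n (h u).
Proof.
apply/eqP; rewrite -subr_eq0; apply/eqP; rewrite !(Pb_sum m n).
exact: del_all.
Qed.

Lemma Xr_all m n u : Xr q X Y m n u = 0.
Proof.
apply: (Xr_step s1 q2n D) => [w|w|w]; [exact: del_all|exact: del_all|].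
by rewrite (XrC q0 s1 q2n D q3n two0 q4n) (Xr0 q0 s1 q2n D q3n two0 q4n) oppr0.
Qed.
End Cyclic.
End Drinfeld2.

Lemma tact_is_linear (C : comPzRingType) (G : Type) (V : lmodType C)
  (rho : G -> {linear V -> V}) t : linear (tact (fun g => rho g) t).
Proof.
elim: t => [g|c|s IHs t IHt|s IHs t IHt] a u w /=.
- by rewrite linearP.
- by rewrite scalerDr !scalerA mulrC.
- by rewrite IHs IHt scalerDr addrACA.
- by rewrite IHt IHs.
Qed.

HB.instance Definition _ (C : comPzRingType) (G : Type) (V : lmodType C)
  (rho : G -> {linear V -> V}) t :=
  GRing.isLinear.Build C V V _ (tact (fun g => rho g) t) (tact_is_linear rho t).

(** * Modules with a highest l-weight *)

Section SubLmodule.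
Variables (C : pzRingType) (V : lmodType C) (N : V -> Prop).

Definition lin_closed := N 0 /\ forall a u w, N u -> N w -> N (a *: u + w).

Definition in_sub (_ : lin_closed) : {pred V} := fun x => `[< N x >].

Hypothesis HN : lin_closed.

Lemma in_sub_closed : submod_closed (in_sub HN).
Proof.
have [N0 Nl] := HN; split; first exact/asboolP.
by move=> a u w /asboolP Nu /asboolP Nw; apply/asboolP; exact: Nl.
Qed.

HB.instance Definition _ := GRing.isSubmodClosed.Build C V (in_sub HN) in_sub_closed.

Record sub_car := SubCar { sub_val :> V; _ : sub_val \in in_sub HN }.
HB.instance Definition _ := [isSub for sub_val].
HB.instance Definition _ := [Choice of sub_car by <:].
HB.instance Definition _ := [SubChoice_isSubLmodule of sub_car by <:].

Lemma sub_memP (x : sub_car) : N (val x).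
Proof. by case: x => x /= /asboolP. Qed.

Definition sub_of (x : V) (Nx : N x) : sub_car := SubCar (introT (asboolP _) Nx).
End SubLmodule.

Section SubModule.
Variables (R : realType) (h : R[i]) (V : bmod h) (N : set V).
Hypothesis HN : submodule N.

Lemma submodule_lin : lin_closed N.
Proof. by case: HN. Qed.
Local Notation sub_car := (sub_car submodule_lin).

Lemma submodule_act g x : N x -> N (bact V g x).
Proof. by case: HN => _ _; apply. Qed.

Definition sub_act_fun g (x : sub_car) : sub_car :=
  sub_of submodule_lin (submodule_act g (sub_memP x)).

Lemma sub_act_linear g : linear (sub_act_fun g).
Proof. by move=> a u w; apply: val_inj; rewrite /= linearP. Qed.
HB.instance Definition _ g := GRing.isLinear.Build _ _ _ _ (sub_act_fun g) (sub_act_linear g).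

Lemma val_sub_tact t x : val (tact (fun g => sub_act_fun g) t x) = tact (bact V) t (val x).
Proof.
elim: t x => //= [s IHs t IHt x|s IHs t IHt x]; first by rewrite -IHs -IHt.
by rewrite IHs IHt.
Qed.

Definition sub_bmod : bmod h.
Proof.
refine (@BMod R h sub_car (fun g => sub_act_fun g) _).
move=> s t st x; apply: val_inj; rewrite !val_sub_tact; exact: bact_rel.
Defined.

Lemma sub_actE g (x : sub_bmod) : val (bact sub_bmod g x) = bact V g (val x).
Proof. by []. Qed.
Lemma sub_tactE t (x : sub_bmod) : val (tact (bact sub_bmod) t x) = tact (bact V) t (val x).
Proof. exact: val_sub_tact. Qed.
End SubModule.

Section ProdModule.
Variables (R : realType) (h : R[i]) (V W : bmod h).

Definition prod_act_fun g (x : V * W) : V * W := (bact V g x.1, bact W g x.2).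
Lemma prod_act_linear g : linear (prod_act_fun g).
Proof. by move=> a u w; congr pair; rewrite /= linearP. Qed.
HB.instance Definition _ g := GRing.isLinear.Build _ _ _ _ (prod_act_fun g) (prod_act_linear g).

Lemma prod_tact t x : tact (fun g => prod_act_fun g) t x = (tact (bact V) t x.1, tact (bact W) t x.2).
Proof.
elim: t x => //= [s IHs t IHt x|s IHs t IHt x]; first by rewrite IHs IHt.
by rewrite IHt IHs.
Qed.

Definition prod_bmod : bmod h.
Proof.
refine (@BMod R h (V * W)%type (fun g => prod_act_fun g) _).
by move=> s t st x; rewrite !prod_tact; congr pair; exact: bact_rel.
Defined.
End ProdModule.

Delimit Scope ncterm_scope with T.

(** * From the Serre relations to the first current relations *)

Section Operators.
Variables (R : realType) (h : R[i]).
Local Notation C := R[i].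
Local Notation q := (qpar h).
Implicit Types (V : bmod h).

(** [drin_xp m] is [x^+_m], by [[h_1, x^+_m] = [2]_q x^+_{m+1}]. *)
Fixpoint drin_xp (m : nat) : ncterm C Bgen :=
  match m with
  | 0%N => TGen (BE ord_max)
  | m'.+1 => (TCst (q + q^-1)^-1%R * [comm drin_h1 R, drin_xp m'])%T
  end.

Definition opk V : {linear V -> V} := bact V (BK ord_max).
Definition opki V : {linear V -> V} := bact V (BKinv ord_max).
Definition ope V : {linear V -> V} := bact V (BE ord0).
Definition oph V : {linear V -> V} := tact (fun g => bact V g) (drin_h1 R).
Definition opX V m : {linear V -> V} := tact (fun g => bact V g) (drin_xp m).
Definition opY V m : {linear V -> V} := tact (fun g => bact V g) (drin_xm h m).
Definition opP V m : {linear V -> V} := tact (fun g => bact V g) (drin_phi h m).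

Arguments opk : simpl never.
Arguments opki : simpl never.
Arguments ope : simpl never.
Arguments oph : simpl never.
Arguments opX : simpl never.
Arguments opY : simpl never.
Arguments opP : simpl never.

Hypothesis qnr : forall n : nat, (0 < n)%N -> q ^+ n != 1.

Lemma q_neq0 : q != 0.
Proof.
rewrite /qpar /cexp; case: h => x y; rewrite eq_complex /= !mulf_eq0.
rewrite gt_eqF ?expR_gt0 //=; apply/negP => /andP[/eqP c0 /eqP s0].
by have := cos2Dsin2 y; rewrite c0 s0 !expr0n addr0 => /eqP; rewrite eq_sym oner_eq0.
Qed.

Lemma q2_neq : q ^+ 2 != 1. Proof. exact: qnr. Qed.

Lemma qqV_neq0 : q - q^-1 != 0.
Proof.
apply: contraNneq (qnr (isT : (0 < 2)%N)) => e.
by rewrite expr2 -(subr0 (q * q)) -(mulr0 q) -e mulrBr mulfV ?q_neq0 // subKr.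
Qed.

Lemma qDqV_neq0 : q + q^-1 != 0.
Proof.
apply: contraNneq (qnr (isT : (0 < 4)%N)) => e.
have : q * (q + q^-1) = 0 by rewrite e mulr0.
rewrite mulrDr mulfV ?q_neq0 // -expr2 => /eqP; rewrite addr_eq0 => /eqP e2.
by rewrite (exprM _ 2 2) e2 sqrrN expr1n.
Qed.

Lemma q3_neq0 : q ^+ 2 + 1 + q ^- 2 != 0.
Proof.
apply: contraNneq (qnr (isT : (0 < 6)%N)) => e.
have : (q ^+ 2 - 1) * q ^+ 2 * (q ^+ 2 + 1 + q ^- 2) = 0 by rewrite e mulr0.
move=> e2; rewrite -subr_eq0 -e2; apply/eqP; field; exact: q_neq0.
Qed.

Lemma q4_neq0 : q ^+ 2 + q ^- 2 != 0.
Proof.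
apply: contraNneq (qnr (isT : (0 < 8)%N)) => e.
have : (q ^+ 4 - 1) * q ^+ 2 * (q ^+ 2 + q ^- 2) = 0 by rewrite e mulr0.
move=> e2; rewrite -subr_eq0 -e2; apply/eqP; field; exact: q_neq0.
Qed.

Lemma two_neq0 : 2%:R != 0 :> C. Proof. by rewrite pnatr_eq0. Qed.

Section Mod.
Variable V : bmod h.
Local Notation k := (opk V).
Local Notation ki := (opki V).
Local Notation X := (opX V).
Local Notation Y := (opY V).

Lemma opkK v : ki (k v) = v.
Proof.
have := @bact_rel _ _ V (TGen (BKinv ord_max) * TGen (BK ord_max)) (TCst 1)
  (PErel (DJ_KinvK _ _)) v.
by rewrite /= scale1r.
Qed.
Lemma opkiK v : k (ki v) = v.
Proof.
have := @bact_rel _ _ V (TGen (BK ord_max) * TGen (BKinv ord_max)) (TCst 1)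
  (PErel (DJ_KKinv _ _)) v.
by rewrite /= scale1r.
Qed.
Lemma opk0 v : bact V (BK ord0) v = ki v.
Proof.
rewrite -{1}(opkiK v).
have := @bact_rel _ _ V (TGen (BK ord0) * TGen (BK ord_max)) (TCst 1)
  (PErel (DJ_K0K1 _)) (ki v).
by rewrite /= scale1r => ->.
Qed.
Lemma opki0 v : bact V (BKinv ord0) v = k v.
Proof.
have := @bact_rel _ _ V (TGen (BK ord0) * TGen (BKinv ord0)) (TCst 1)
  (PErel (DJ_KKinv _ _)) v.
by rewrite /= scale1r opk0 => e; rewrite -{2}e opkiK.
Qed.

Lemma opY0 v : Y 0%N v = ope V (k v). Proof. by []. Qed.
Lemma opYS m v : Y m.+1 v = (- (q + q^-1)^-1) *: (oph V (Y m v) - Y m (oph V v)).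
Proof. by rewrite -[- opY V m (oph V v)]scaleN1r. Qed.
Lemma opXS m v : X m.+1 v = ((q + q^-1)^-1) *: (oph V (X m v) - X m (oph V v)).
Proof. by rewrite -[- opX V m (oph V v)]scaleN1r. Qed.
Lemma opP0 v : opP V 0 v = k v. Proof. by []. Qed.
Lemma opPS m v : opP V m.+1 v = (q - q^-1) *: Pb X Y 0 m v.
Proof. by rewrite /opP /= scaleN1r. Qed.
Lemma ophE v : oph V v = ki (X 0%N (Y 0%N v) - Y 0%N (X 0%N v)).
Proof. by rewrite /oph /= scaleN1r. Qed.

Lemma ke1 v : k (X 0%N v) = q ^+ 2 *: X 0%N (k v).
Proof.
have := @bact_rel _ _ V (TGen (BK ord_max) * TGen (BE ord_max) * TGen (BKinv ord_max))
  (TCst (q ^ cartan ord_max ord_max) * TGen (BE ord_max)) (PErel (DJ_KE _ _ _)) (k v).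
by rewrite /= -/(opk V) -/(opki V) opkK.
Qed.
Lemma ke0 v : k (ope V v) = q ^- 2 *: ope V (k v).
Proof.
have := @bact_rel _ _ V (TGen (BK ord_max) * TGen (BE ord0) * TGen (BKinv ord_max))
  (TCst (q ^ cartan ord_max ord0) * TGen (BE ord0)) (PErel (DJ_KE _ _ _)) (k v).
by rewrite /= -/(opk V) -/(opki V) opkK.
Qed.

Let q0 := q_neq0.
Let VV : lmodType R[i] := V.
Local Notation E := (X 0%N).
Local Notation e0 := (ope V).
Tactic Notation "lc" uconstr(c) constr(H) := refine (@lin_comb _ VV c _ _ _ _ H _).
Ltac lin := match type of VV with GRing.Lmodule.type ?C => lin_with C VV end; repeat split; first [ring | solve [field; rewrite ?q0 //] | idtac].

Lemma serre1 v : E (E (E (e0 v))) = qint3 h *: E (E (e0 (E v)))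
   - qint3 h *: E (e0 (E (E v))) + e0 (E (E (E v))).
Proof.
have := @bact_rel _ _ V
  (TGen (BE ord_max) * TGen (BE ord_max) * TGen (BE ord_max) * TGen (BE ord0)
   - TCst (qint3 h) * (TGen (BE ord_max) * TGen (BE ord_max) * TGen (BE ord0) * TGen (BE ord_max))
   + TCst (qint3 h) * (TGen (BE ord_max) * TGen (BE ord0) * TGen (BE ord_max) * TGen (BE ord_max))
   - TGen (BE ord0) * TGen (BE ord_max) * TGen (BE ord_max) * TGen (BE ord_max))%T
  (TCst 0) (PErel (DJ_serreE h (isT : ord_max != ord0 :> 'I_2))) v.
rewrite /= !scale0r => e; apply/eqP; rewrite -subr_eq0; apply/eqP; rewrite -[RHS]e /= /ope.
by lin.
Qed.
Lemma serre0 v : e0 (e0 (e0 (E v))) = qint3 h *: e0 (e0 (E (e0 v)))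
   - qint3 h *: e0 (E (e0 (e0 v))) + E (e0 (e0 (e0 v))).
Proof.
have := @bact_rel _ _ V
  (TGen (BE ord0) * TGen (BE ord0) * TGen (BE ord0) * TGen (BE ord_max)
   - TCst (qint3 h) * (TGen (BE ord0) * TGen (BE ord0) * TGen (BE ord_max) * TGen (BE ord0))
   + TCst (qint3 h) * (TGen (BE ord0) * TGen (BE ord_max) * TGen (BE ord0) * TGen (BE ord0))
   - TGen (BE ord_max) * TGen (BE ord0) * TGen (BE ord0) * TGen (BE ord0))%T
  (TCst 0) (PErel (DJ_serreE h (isT : ord0 != ord_max :> 'I_2))) v.
rewrite /= !scale0r => e; apply/eqP; rewrite -subr_eq0; apply/eqP; rewrite -[RHS]e /= /ope.
by lin.
Qed.

Lemma kY0 v : k (Y 0%N v) = q ^- 2 *: Y 0%N (k v).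
Proof. by rewrite !opY0 ke0. Qed.

Lemma ophP v : k (oph V v) = E (Y 0%N v) - Y 0%N (E v).
Proof. by rewrite ophE opkiK. Qed.

Lemma kk_inj u w : k u = k w -> u = w.
Proof. by move=> e; rewrite -(opkK u) e opkK. Qed.

Lemma e0Y v : e0 v = Y 0%N (ki v). Proof. by rewrite opY0 opkiK. Qed.
Lemma kiE v : E (ki v) = q ^+ 2 *: ki (E v).
Proof. by apply: kk_inj; rewrite ke1 linearZ /= !opkiK. Qed.
Lemma kiY v : Y 0%N (ki v) = q ^- 2 *: ki (Y 0%N v).
Proof. by apply: kk_inj; rewrite kY0 linearZ /= !opkiK. Qed.

Let ki0 w : ki (k w) = 1 *: w. Proof. by rewrite opkK scale1r. Qed.
Let kiE' c u w : ki u = c *: w -> ki (E u) = (q ^- 2 * c) *: E w.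
Proof.
move=> e; have -> : ki (E u) = q ^- 2 *: E (ki u).
  by rewrite kiE scalerA mulVf ?expf_neq0 // scale1r.
by rewrite e linearZ /= scalerA.
Qed.
Let kiY' c u w : ki u = c *: w -> ki (Y 0%N u) = (q ^+ 2 * c) *: Y 0%N w.
Proof.
move=> e; have -> : ki (Y 0%N u) = q ^+ 2 *: Y 0%N (ki u).
  by rewrite kiY scalerA mulfV ?expf_neq0 // scale1r.
by rewrite e linearZ /= scalerA.
Qed.
Let stE c t w : t = c *: w -> E t = c *: E w. Proof. by move=> ->; rewrite linearZ. Qed.
Let ste0 c d t z w : t = c *: z -> ki z = d *: w -> e0 t = (c * d) *: Y 0%N w.
Proof. by move=> -> e; rewrite linearZ /= e0Y e linearZ /= scalerA. Qed.

(** Evaluating the Serre relation at [k v] makes the factor [k_1^{-1}] of [e_0 = x^-_1 k_1^{-1}]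
    cancel, at the price of powers of [q]. *)
Lemma serreX v : E (E (E (Y 0%N v))) = (qint3 h * q ^- 2) *: E (E (Y 0%N (E v)))
   - (qint3 h * q ^- 4) *: E (Y 0%N (E (E v))) + q ^- 6 *: Y 0%N (E (E (E v))).
Proof.
have u1 : k v = 1 *: k v by rewrite scale1r.
have := serre1 (k v).
rewrite (stE (stE (stE (ste0 u1 (ki0 _))))).
rewrite (stE (stE (ste0 (stE u1) (kiE' (ki0 _))))).
rewrite (stE (ste0 (stE (stE u1)) (kiE' (kiE' (ki0 _))))).
rewrite (ste0 (stE (stE (stE u1))) (kiE' (kiE' (kiE' (ki0 _))))).
move=> e; lc 1 e.
by lin.
Qed.

Lemma serreY v : Y 0%N (Y 0%N (Y 0%N (E v))) = q ^+ 6 *: E (Y 0%N (Y 0%N (Y 0%N v)))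
   - (qint3 h * q ^+ 4) *: Y 0%N (E (Y 0%N (Y 0%N v)))
   + (qint3 h * q ^+ 2) *: Y 0%N (Y 0%N (E (Y 0%N v))).
Proof.
pose u := k (k (k v)); have u1 : u = 1 *: u by rewrite scale1r.
have := serre0 u.
rewrite (ste0 (ste0 (ste0 (stE u1) (kiE' (ki0 _))) (kiY' (kiE' (ki0 _)))) (kiY' (kiY' (kiE' (ki0 _))))).
rewrite (ste0 (ste0 (stE (ste0 u1 (ki0 _))) (kiE' (kiY' (ki0 _)))) (kiY' (kiE' (kiY' (ki0 _))))).
rewrite (ste0 (stE (ste0 (ste0 u1 (ki0 _)) (kiY' (ki0 _)))) (kiE' (kiY' (kiY' (ki0 _))))).
rewrite (stE (ste0 (ste0 (ste0 u1 (ki0 _)) (kiY' (ki0 _))) (kiY' (kiY' (ki0 _))))).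
by move=> e; lc 1 e; lin.
Qed.

Lemma kX1 u : k (X 1%N u) = (q + q^-1)^-1 *: (k (oph V (E u)) - q ^+ 2 *: E (k (oph V u))).
Proof. by rewrite opXS linearZ linearB -(ke1 (oph V u)). Qed.
Lemma kY1 u : k (Y 1%N u) =
  - (q + q^-1)^-1 *: (k (oph V (Y 0%N u)) - q ^- 2 *: Y 0%N (k (oph V u))).
Proof. by rewrite opYS linearZ linearB -(kY0 (oph V u)). Qed.

(** After multiplication by [k] both sides are words in [e_1] and [x^-_1], and their difference is a
    multiple of the Serre relation. *)
Lemma opXX v : X 1%N (E v) = q ^+ 2 *: E (X 1%N v).
Proof.
apply: kk_inj; lc 1 (kX1 (E v)); lc (- q ^+ 4) (congr1 E (kX1 v)).
lc (- q ^+ 2) (ke1 (X 1%N v)).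
rewrite !ophP; lc ((q + q^-1)^-1 * q ^+ 6) (serreX v).
by rewrite /qint3; move: (q + q^-1)^-1 => a; lin.
Qed.

Lemma opYY v : Y 1%N (Y 0%N v) = q ^- 2 *: Y 0%N (Y 1%N v).
Proof.
apply: kk_inj; lc 1 (kY1 (Y 0%N v)); lc (- q ^- 4) (congr1 (Y 0%N) (kY1 v)).
lc (- q ^- 2) (kY0 (Y 1%N v)).
rewrite !ophP; lc ((q + q^-1)^-1 * q ^- 6) (serreY v).
by rewrite /qint3; move: (q + q^-1)^-1 => a; lin.
Qed.

Lemma bmod_drin : drin q 1 k ki (oph V) X Y.
Proof.
have nz := qDqV_neq0.
split=> [v|v|v|v|v|m v|m v|v|v].
- exact: opkiK.
- exact: opkK.
- exact: ke1.
- exact: kY0.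
- by rewrite scale1r ophP.
- by rewrite opXS scalerA mul1r mulfV // scale1r addrC subrK.
- by rewrite opYS scalerA mul1r mulrN mulfV // scaleN1r opprK addrC subrK.
- exact: opXX.
- exact: opYY.
Qed.

Lemma opXE m v : X m v = tact (fun g => bact V g) (drin_xp m) v. Proof. by []. Qed.
Lemma opX0E v : X 0%N v = bact V (BE ord_max) v. Proof. by []. Qed.
Lemma opYE m v : Y m v = tact (fun g => bact V g) (drin_xm h m) v. Proof. by []. Qed.
Lemma opPE m v : opP V m v = tact (fun g => bact V g) (drin_phi h m) v. Proof. by []. Qed.
Lemma opkE v : k v = bact V (BK ord_max) v. Proof. by []. Qed.
Lemma opkiE v : ki v = bact V (BKinv ord_max) v. Proof. by []. Qed.
Lemma opeE v : ope V v = bact V (BE ord0) v. Proof. by []. Qed.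
End Mod.
End Operators.
Global Opaque opk opki ope oph opX opY opP.

Section Eigen.
Variables (C : fieldType) (V : lmodType C) (k : {linear V -> V}) (lam : nat -> C).
Hypothesis lam_inj : injective lam.
Variable N : V -> Prop.
Hypotheses (N0 : N 0) (Nlin : forall a u w, N u -> N w -> N (a *: u + w))
  (Nk : forall u, N u -> N (k u)).

(** Applying [k - lam D] removes the last component and multiplies the others by nonzero scalars. *)
Lemma eig_sub D (f : nat -> V) :
  (forall e, (e < D)%N -> k (f e) = lam e *: f e) -> N (\sum_(e < D) f e) ->
  forall e, (e < D)%N -> N (f e).
Proof.
have NZ a u : N u -> N (a *: u) by move=> Nu; rewrite -[_ *: _]addr0; exact: Nlin.
elim: D f => [//|D IH] f kf; rewrite big_ord_recr /= => Ns.
have Nf e : (e < D)%N -> N (f e).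
  move=> lt; have ne : lam e - lam D != 0.
    by rewrite subr_eq0; apply/eqP => /lam_inj E; rewrite E ltnn in lt.
  rewrite -[f e]scale1r -(mulVf ne) -scalerA; apply: NZ.
  apply: (IH (fun e => (lam e - lam D) *: f e)) => // [e' lt'|].
    by rewrite linearZ /= kf 1?ltnW // !scalerA mulrC.
  have := Nlin (- lam D) Ns (Nk Ns).
  rewrite [k (_ + _)]linearD [k (\sum_(_ < _) _)]linear_sum kf //.
  set A := (X in N X); set B := (X in _ -> N X); suff -> : A = B by [].
  rewrite /A /B scalerDr addrACA -scalerDl addNr scale0r addr0 scaler_sumr -big_split /=.
  apply: eq_bigr => i _; rewrite (kf _ (ltnW (ltn_ord i : (i < D)%N))).
  by rewrite -scalerDl addrC.
move=> e; rewrite ltnS leq_eqVlt => /orP[/eqP ->|]; last exact: Nf.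
have : N (\sum_(i < D) f i).
  elim: {+}D Nf => [|D' IHD] Nf; first by rewrite big_ord0.
  rewrite big_ord_recr /= -[\sum_(i < _) _]scale1r; apply: Nlin; last exact: Nf.
  by apply: IHD => i lt; apply: Nf; exact: ltnW.
by move=> Nt; have := Nlin (-1) Nt Ns; rewrite scaleN1r addKr.
Qed.
End Eigen.

Lemma sum_widen (V : zmodType) D D' (f : nat -> V) : (forall e, (D <= e)%N -> f e = 0) ->
  (D <= D')%N -> \sum_(e < D') f e = \sum_(e < D) f e.
Proof.
move=> f0 le; rewrite -!(big_mkord xpredT) (big_cat_nat (n := D)) //=.
rewrite [X in _ + X]big1_seq ?addr0 // => e; rewrite mem_index_iota => /andP[_ /andP[H _]]; exact: f0.
Qed.

(** * Singular vectors and simplicity *)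

Section HighestWeight.
Variables (R : realType) (h : R[i]).
Local Notation C := R[i].
Local Notation q := (qpar h).
Hypothesis qnr : forall n : nat, (0 < n)%N -> q ^+ n != 1.
Implicit Types (V : bmod h) (Psi : lweight R).

Let q0 : q != 0 := q_neq0 h.
Let qq0 := qqV_neq0 qnr.
Let q2n := qDqV_neq0 qnr.
Let q3n := q3_neq0 qnr.
Let q4n := q4_neq0 qnr.
Let one1 : 1 * 1 = 1 :> C. Proof. by rewrite mulr1. Qed.

Definition genby V (v : V) := forall N : set V, submodule N -> N v -> forall u, N u.

Record hwm V Psi (v : V) : Prop := Hwm {
  hwm_neq0 : v != 0;
  hwm_e : bact V (BE ord_max) v = 0;
  hwm_P : forall m, opP V m v = Psi m *: v;
  hwm_gen : genby v }.

Lemma simple_genby V (v : V) : simple_mod V -> v != 0 -> genby v.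
Proof.
move=> [_ sV] v0 N sN Nv u; case: (sV N sN) => E; last by rewrite E.
by move: Nv; rewrite E => /= e; rewrite e eqxx in v0.
Qed.

Lemma is_L_hwm V Psi : is_L Psi V -> exists v : V, hwm Psi v.
Proof.
by case=> sV [v [v0 ev pv]]; exists v; split=> //; exact: simple_genby.
Qed.

Lemma submod_tact V (N : set V) t u : submodule N -> N u -> N (tact (fun g => bact V g) t u).
Proof.
move=> [N0 Nl Ng]; elim: t u => [g|c|s IHs t IHt|s IHs t IHt] u Nu /=.
- exact: Ng.
- by rewrite -[_ *: _]addr0; exact: Nl.
- by rewrite -[tact _ s u]scale1r; apply: Nl; [exact: IHs|exact: IHt].
- by apply: IHs; exact: IHt.
Qed.

Lemma ord2 (i : 'I_2) : i = ord0 \/ i = ord_max.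
Proof. by case: i => [[|[|]]] // H; [left|right]; exact: val_inj. Qed.

(** The remaining generators are [e_0 = Y_0 k_1^{-1}], [k_0 = k_1^{-1}] and [k_0^{-1} = k_1]. *)
Lemma gen_submod V (N : V -> Prop) : N 0 -> (forall a u w, N u -> N w -> N (a *: u + w)) ->
  (forall u, N u -> N (opX V 0 u)) -> (forall u, N u -> N (opY V 0 u)) ->
  (forall u, N u -> N (opk V u)) -> (forall u, N u -> N (opki V u)) -> submodule N.
Proof.
move=> N0 Nl NX NY Nk Nki; split=> // -[] i u Nu; case: (ord2 i) => ->.
- rewrite -[bact V _ u]/(ope V u) e0Y; exact/NY/Nki.
- exact: NX.
- rewrite opk0; exact: Nki.
- exact: Nk.
- rewrite opki0; exact: Nk.
- exact: Nki.
Qed.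

Section General.
Variable V : bmod h.
Local Notation k := (opk V).
Local Notation ki := (opki V).
Local Notation X := (opX V).
Local Notation Y := (opY V).
Local Notation P := (opP V).
Let D : drin q 1 k ki (oph V) X Y := bmod_drin qnr V.

Let VV : lmodType R[i] := V.
Tactic Notation "lc" uconstr(c) constr(H) := refine (@lin_comb _ VV c _ _ _ _ H _).
Ltac lin := match type of VV with GRing.Lmodule.type ?C => lin_with C VV end;
  repeat split; first [ring | solve [field; rewrite ?q0 //] | idtac].

Lemma kXm m v : k (X m v) = q ^+ 2 *: X m (k v).
Proof. exact: (kX q0 one1 q2n D). Qed.
Lemma kYm m v : k (Y m v) = q ^- 2 *: Y m (k v).
Proof. exact: (kY q0 one1 q2n D). Qed.
Lemma khm v : k (oph V v) = oph V (k v).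
Proof. exact: (kh q0 one1 D). Qed.
Lemma kPm m v : k (P m v) = P m (k v).
Proof.
case: m => [//|m]; rewrite !opPS /Pb.
lc (q - q^-1) (kXm 0 (Y m v)). lc ((q - q^-1) * q ^+ 2) (congr1 (X 0%N) (kYm m v)).
lc (- (q - q^-1)) (kYm m (X 0%N v)). lc (- (q - q^-1) * q ^- 2) (congr1 (Y m) (kXm 0 v)).
by lin.
Qed.
End General.

Section Hwm.
Variables (V : bmod h) (Psi : lweight R) (v : V).
Hypothesis HV : hwm Psi v.
Local Notation k := (opk V).
Local Notation ki := (opki V).
Local Notation X := (opX V).
Local Notation Y := (opY V).
Local Notation P := (opP V).
Let D : drin q 1 k ki (oph V) X Y := bmod_drin qnr V.
Let VV : lmodType R[i] := V.
Tactic Notation "lc" uconstr(c) constr(H) := refine (@lin_comb _ VV c _ _ _ _ H _).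
Ltac lin := match type of VV with GRing.Lmodule.type ?C => lin_with C VV end;
  repeat split; first [ring | solve [field; rewrite ?q0 //] | idtac].

Lemma hwm_generates : generates k ki X Y v.
Proof.
move=> N Nl NX NY Nk Nki Nv; apply: (hwm_gen HV) => //.
have N0 : N 0 by have := Nl (-1) _ _ Nv Nv; rewrite scaleN1r addNr.
exact: gen_submod.
Qed.

Lemma hwm_Psi0 : Psi 0%N != 0.
Proof.
apply: contraNneq (hwm_neq0 HV) => e.
have := hwm_P HV 0; rewrite e scale0r opP0 => kv.
by rewrite -(opkK v) kv linear0.
Qed.

(** The eigenvalue is read off from [phi^+_1 = (q - q^-1) k_1 h_1]. *)
Lemma hwm_h : oph V v = (Psi 1%N / ((q - q^-1) * Psi 0%N)) *: v.
Proof.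
apply: (@kk_inj _ h V); rewrite linearZ /= -(opP0 v) (hwm_P HV) scalerA.
apply: (scalerI qq0); have := hwm_P HV 1; rewrite opPS /Pb -ophP => ->.
rewrite scalerA; congr (_ *: _); field.
by rewrite q0 hwm_Psi0 /= -expr2 subr_eq0 (q2_neq qnr).
Qed.

Lemma hwm_p m : Pb X Y 0 m v = (Psi m.+1 / (q - q^-1)) *: v.
Proof.
apply: (scalerI qq0); rewrite -opPS (hwm_P HV) scalerA mulrC divfK //.
Qed.

Let psum m n u := Pb_sum q0 one1 D q2n q3n q4n (two_neq0 R) hwm_generates hwm_h hwm_p m n u.
Let gen' : generates k ki Y X v.
Proof. by move=> N Nl NX NY Nk Nki Nv; apply: hwm_generates. Qed.
Let q0' : q^-1 != 0. Proof. by rewrite invr_eq0. Qed.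
Let s1' : - 1 * - 1 = 1 :> C. Proof. by rewrite mulrNN mulr1. Qed.
Let q2n' : q^-1 + q^-1^-1 != 0. Proof. by rewrite invrK addrC. Qed.
Let q3n' : q^-1 ^+ 2 + 1 + q^-1 ^- 2 != 0.
Proof. by rewrite !exprVn invrK addrC [_ + 1]addrC addrA. Qed.
Let q4n' : q^-1 ^+ 2 + q^-1 ^- 2 != 0. Proof. by rewrite !exprVn invrK addrC. Qed.

Lemma P0sum m n u : Pb X Y m n u = Pb X Y 0 (m + n) u.
Proof. by rewrite psum [RHS]psum. Qed.

Lemma hwm_XY m n u : X m (Y n u) = Y n (X m u) + (q - q^-1)^-1 *: P (m + n).+1 u.
Proof.
rewrite opPS -P0sum scalerA mulVf // scale1r /Pb addrC subrK //.
Qed.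

(** This is [Xr = 0], where by [P0sum] the index of the bracket may stand on either side. The case
    [N = 0] is apart because [phi^+_0 = k_1] is not a bracket. *)
Lemma hwm_PX N n u : P N.+1 (X n u) =
  q ^+ 2 *: X n (P N.+1 u) + q ^+ 2 *: P N (X n.+1 u) - X n.+1 (P N u).
Proof.
case: N => [|N].
  rewrite !opPS !opP0 /Pb -!ophP.
  lc (q - q^-1) (congr1 k (dr_X D n u)).
  lc (q - q^-1) (kXm n (oph V u)). lc (- q ^- 2) (kXm n.+1 u).
  by lin.
have P0C m w : Pb X Y 0 m w = Pb X Y m 0 w by rewrite psum add0n.
rewrite !opPS !(P0C N.+1) !(P0C N).
have := Xr_all q0 one1 D q2n q3n q4n (two_neq0 R) hwm_generates hwm_h hwm_p N n u.
rewrite /Xr => e.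
by lc (q - q^-1) e; rewrite /Pb; lin.
Qed.

Let pv' m : Pb Y X 0 m v = (- (Psi m.+1 / (q - q^-1))) *: v.
Proof. by rewrite (PbC X Y) psum addn0 -[m]add0n -psum add0n hwm_p scaleNr. Qed.

Lemma hwm_PY N n u : P N.+1 (Y n u) =
  q ^- 2 *: Y n (P N.+1 u) + q ^- 2 *: P N (Y n.+1 u) - Y n.+1 (P N u).
Proof.
case: N => [|N].
  rewrite !opPS !opP0 /Pb -!ophP.
  lc (q - q^-1) (congr1 k (dr_Y D n u)).
  lc (q - q^-1) (kYm n (oph V u)). lc (- q ^+ 2) (kYm n.+1 u).
  by lin.
rewrite !opPS.
have := Xr_all q0' s1' (drinC D) q2n' q3n' q4n' (two_neq0 R) gen' hwm_h pv' N n u.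
rewrite /Xr !exprVn !(PbC X Y) => e.
by lc (- (q - q^-1)) e; rewrite /Pb; lin.
Qed.

Lemma hwm_hP m u : oph V (P m u) = P m (oph V u).
Proof.
case: m => [|m]; first by rewrite !opP0 khm.
rewrite !opPS linearZ /=; congr (_ *: _).
exact: (hPb q0 one1 D q2n q3n q4n (two_neq0 R) hwm_generates hwm_h hwm_p).
Qed.

Definition lam d := Psi 0%N * q ^- (2 * d).

Lemma lam_inj : injective lam.
Proof.
move=> d e /(mulfI hwm_Psi0)/invr_inj; wlog le : d e / (d <= e)%N.
  by move=> H E; case: (leqP d e) => [/H ->//|/ltnW /H ->].
have -> : (2 * e = 2 * d + 2 * (e - d))%N by lia.
rewrite exprD -{1}[q ^+ (2 * d)]mulr1 => /(mulfI (expf_neq0 _ q0)) /eqP.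
rewrite eq_sym => E; apply/eqP; rewrite eqn_leq le /= leqNgt; apply/negP => lt.
by move: E; apply/negP; apply: qnr; rewrite muln_gt0 subn_gt0.
Qed.

Lemma lamS d : lam d.+1 = lam d * q ^- 2.
Proof. by rewrite /lam -mulrA -invfM -exprD; congr (_ * _^-1); congr (_ ^+ _); lia. Qed.

Definition dg d u := k u = lam d *: u.

Lemma dg_lin d a u w : dg d u -> dg d w -> dg d (a *: u + w).
Proof. by rewrite /dg => eu ew; rewrite linearP eu ew scalerDr !scalerA mulrC. Qed.
Lemma dg0 d : dg d 0. Proof. by rewrite /dg linear0 scaler0. Qed.
Lemma dgZ d a u : dg d u -> dg d (a *: u).
Proof. by move=> H; rewrite -[_ *: _]addr0; apply: dg_lin => //; exact: dg0. Qed.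
Lemma dg_v : dg 0 v. Proof. by rewrite /dg -opP0 (hwm_P HV) /lam muln0 expr0 invr1 mulr1. Qed.
Lemma dgY d m u : dg d u -> dg d.+1 (Y m u).
Proof. by rewrite /dg kYm => ->; rewrite linearZ scalerA lamS mulrC. Qed.
Lemma dgX d m u : dg d.+1 u -> dg d (X m u).
Proof.
rewrite /dg kXm => ->; rewrite linearZ scalerA lamS mulrCA mulfV ?mulr1 ?expf_neq0 //.
Qed.
Lemma dgP d m u : dg d u -> dg d (P m u).
Proof. by rewrite /dg kPm => ->; rewrite linearZ. Qed.

(** The submodule generated by a space [U0] of singular vectors of weight
    [mu], stable under the Cartan currents. *)
Section Levels.
Variables (U0 : V -> Prop) (n0 : nat) (u0 : V).
Hypotheses (U0u : U0 u0) (U0lin : forall a u w, U0 u -> U0 w -> U0 (a *: u + w))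
  (U0P : forall m u, U0 u -> U0 (P m u)) (U0X : forall m u, U0 u -> X m u = 0)
  (U0k : forall u, U0 u -> dg n0 u).

(** Words in the [Y m] are enough: [lvlP] and [lvlX] show that the Cartan currents and the [X m]
    preserve their span. *)
Inductive lvl : nat -> V -> Prop :=
| lvl0 u : U0 u -> lvl 0 u
| lvlY d m u : lvl d u -> lvl d.+1 (Y m u)
| lvl_lin d a u w : lvl d u -> lvl d w -> lvl d (a *: u + w).

Lemma lvlz d : lvl d 0.
Proof.
have [w lw] : exists w, lvl d w.
  by elim: d => [|d [w lw]]; [exists u0; exact: lvl0|exists (Y 0%N w); exact: lvlY].
by have := lvl_lin (-1) lw lw; rewrite scaleN1r addNr.
Qed.
Lemma lvlZ d a u : lvl d u -> lvl d (a *: u).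
Proof. by move=> l; rewrite -[_ *: _]addr0; apply: lvl_lin => //; exact: lvlz. Qed.
Lemma lvlD d u w : lvl d u -> lvl d w -> lvl d (u + w).
Proof. by move=> l l'; rewrite -[u]scale1r; exact: lvl_lin. Qed.

Lemma lvl_dg d u : lvl d u -> dg (n0 + d) u.
Proof.
elim=> [w /U0k|d' m w _ H|d' a w w' _ H _ H']; first by rewrite addn0.
  by rewrite addnS; exact: dgY.
exact: dg_lin.
Qed.

Lemma lvlP d m u : lvl d u -> lvl d (P m u).
Proof.
move=> l; elim: l m => {d u} [u Uu m|d n u l IH m|d a u w _ IHu _ IHw m].
- exact/lvl0/U0P.
- elim: m n => [|m IHm] n; first by rewrite opP0 kYm; exact/lvlZ/lvlY/(IH 0%N).
  rewrite hwm_PY -scaleN1r; apply: lvlD; last exact/lvlZ/lvlY/IH.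
  by apply: lvlD; apply: lvlZ; [apply: lvlY; exact: IH|exact: IHm].
- by rewrite linearP; exact: lvl_lin.
Qed.

Lemma lvlX d m u : lvl d u -> if d is d'.+1 then lvl d' (X m u) else X m u = 0.
Proof.
elim=> {d u} [u Uu|d n u l IH|d a u w _ IHu _ IHw]; first exact: U0X.
  rewrite hwm_XY; apply: lvlD; last by apply: lvlZ; exact: lvlP.
  by case: d l IH => [|d] l IH; [rewrite IH linear0; exact: lvlz|exact: lvlY].
case: d IHu IHw => [|d] IHu IHw; rewrite linearP; last exact: lvl_lin.
by rewrite IHu IHw scaler0 addr0.
Qed.

Definition levels u := exists D (f : nat -> V), [/\ forall e, lvl e (f e),
  forall e, (D <= e)%N -> f e = 0 & u = \sum_(e < D) f e].

Lemma levels_submod : submodule levels.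
Proof.
have wid D1 D2 f : (forall e, (D1 <= e)%N -> f e = 0) -> (D1 <= D2)%N ->
  \sum_(e < D2) f e = \sum_(e < D1) f e :> V by exact: sum_widen.
apply: gen_submod.
- by exists 0%N, (fun=> 0); split=> [e|//|]; [exact: lvlz|rewrite big_ord0].
- move=> a u w [D1 [f [lf f0 ->]]] [D2 [g [lg g0 ->]]].
  exists (maxn D1 D2), (fun e => a *: f e + g e); split=> [e|e|].
  + exact: lvl_lin.
  + by rewrite geq_max => /andP[/f0 -> /g0 ->]; rewrite scaler0 addr0.
  + rewrite big_split /= -scaler_sumr (wid _ _ _ f0 (leq_maxl D1 D2)) (wid _ _ _ g0 (leq_maxr D1 D2)) //.
- move=> u [D1 [f [lf f0 ->]]]; exists D1, (fun e => X 0 (f e.+1)); split=> [e|e le|].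
  + exact: (lvlX 0 (lf e.+1)).
  + by rewrite f0 ?linear0 // ltnW.
  + rewrite -(wid D1 D1.+1) // linear_sum big_ord_recl /= (lvlX 0 (lf 0%N)) add0r.
    by apply: eq_bigr => i _.
- move=> u [D1 [f [lf f0 ->]]].
  exists D1.+1, (fun e => if e is e'.+1 then Y 0 (f e') else 0); split=> [[|e]|[|e] le|] //.
  + exact: lvlz.
  + exact: lvlY.
  + by rewrite f0 ?linear0.
  + by rewrite linear_sum big_ord_recl add0r.
- move=> u [D1 [f [lf f0 ->]]]; exists D1, (fun e => k (f e)); split=> [e|e le|].
  + by rewrite (lvl_dg (lf e)); exact: lvlZ.
  + by rewrite f0 ?linear0.
  + by rewrite linear_sum.
- move=> u [D1 [f [lf f0 ->]]]; exists D1, (fun e => ki (f e)); split=> [e|e le|].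
  + have -> : ki (f e) = (lam (n0 + e))^-1 *: f e; last exact: lvlZ.
    apply: kk_inj; rewrite opkiK linearZ /= (lvl_dg (lf e)) scalerA mulVf ?scale1r //.
    by rewrite mulf_neq0 ?hwm_Psi0 // invr_neq0 // expf_neq0.
  + by rewrite f0 ?linear0.
  + by rewrite linear_sum.
Qed.
Lemma levels_u0 : levels u0.
Proof.
exists 1%N, (fun e => if e is 0%N then u0 else 0); split=> [[|e]|[|e]|] //.
- exact: lvl0.
- exact: lvlz.
- by rewrite big_ord1.
Qed.
End Levels.

Definition top_line u := exists c, u = c *: v.
Let tl_v : top_line v. Proof. by exists 1; rewrite scale1r. Qed.
Let tl_lin a u w : top_line u -> top_line w -> top_line (a *: u + w).
Proof. by case=> c -> [d ->]; exists (a * c + d); rewrite scalerA scalerDl. Qed.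
Let tl_P m u : top_line u -> top_line (P m u).
Proof. by case=> c ->; exists (c * Psi m); rewrite linearZ /= (hwm_P HV) scalerA. Qed.
Lemma hwm_Xv m : X m v = 0.
Proof.
elim: m => [|m IH]; first by rewrite opX0E (hwm_e HV).
by rewrite opXS IH hwm_h !linear0 linearZ /= IH scaler0 subr0 scaler0.
Qed.
Let tl_X m u : top_line u -> X m u = 0.
Proof. by case=> c ->; rewrite linearZ /= hwm_Xv scaler0. Qed.
Let tl_k u : top_line u -> dg 0 u.
Proof. by case=> c ->; exact/dgZ/dg_v. Qed.

Let top_levels u : levels top_line u.
Proof.
apply: (hwm_gen HV); first exact: (levels_submod tl_v tl_P tl_X tl_k).
exact: (levels_u0 tl_v).
Qed.

Lemma hwm_dec u : exists D (f : nat -> V), [/\ forall e, dg e (f e),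
  forall e, (D <= e)%N -> f e = 0 & u = \sum_(e < D) f e].
Proof.
have [D' [f [lf f0 ->]]] := top_levels u; exists D', f; split=> // e.
exact: (lvl_dg tl_k (lf e)).
Qed.

Lemma dg_sum0 D' (f : nat -> V) : (forall e, (e < D')%N -> dg e (f e)) ->
  \sum_(e < D') f e = 0 -> forall e, (e < D')%N -> f e = 0.
Proof.
move=> df s0; apply: (eig_sub lam_inj (N := fun u => u = 0) _ _ _ df) => //.
- by move=> a u w -> ->; rewrite scaler0 addr0.
- by move=> u ->; rewrite linear0.
Qed.

Lemma dg_submod (N : set V) D' (f : nat -> V) : submodule N ->
  (forall e, (e < D')%N -> dg e (f e)) ->
  N (\sum_(e < D') f e) -> forall e, (e < D')%N -> N (f e).
Proof.
move=> [N0 Nl Ng] df Ns; apply: (eig_sub lam_inj (N := N) _ _ _ df) => //.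
by move=> u; rewrite opkE; exact: Ng.
Qed.

(** Different degrees are independent, so the component of degree [d] in the expansion of [u] is [u]
    itself. *)
Lemma dg_lvl d u : dg d u -> lvl top_line d u.
Proof.
move=> du; have [D' [f [lf f0 eu]]] := top_levels u.
pose D'' := maxn D' d.+1; pose g e := f e - (if e == d then u else 0).
have ltd : (d < D'')%N by rewrite leq_max ltnSn orbT.
have := @dg_sum0 D'' g; have -> : \sum_(e < D'') g e = 0.
  rewrite sumrB (sum_widen f0) ?leq_maxl // -eu.
  rewrite (bigD1 (Ordinal ltd)) //= eqxx big1 ?addr0 ?subrr // => i ne.
  by case: eqP => // E; case/eqP: ne; exact: val_inj.
move=> /(_ _ erefl _ ltd); rewrite /g eqxx => H; suff -> : u = f d by exact: lf.
apply/esym/eqP; rewrite -subr_eq0; apply/eqP; apply: H => e lt.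
rewrite -scaleN1r addrC; apply: dg_lin; last exact: (lvl_dg tl_k (lf e)).
by case: eqP => [->|_] //; exact: dg0.
Qed.

Lemma hwm_deg0 u : dg 0 u -> exists c, u = c *: v.
Proof.
move=> /dg_lvl; move E : 0%N => n l.
by elim: l E => [{}u|//|d a {}u w _ IHu _ IHw E]; last exact: tl_lin (IHu E) (IHw E).
Qed.

Lemma hwm_degS d u (N : V -> Prop) : dg d.+1 u -> N 0 ->
  (forall a u w, N u -> N w -> N (a *: u + w)) ->
  (forall m w, dg d w -> N (Y m w)) -> N u.
Proof.
move=> /dg_lvl du N0 Nl NY; move E : d.+1 du => n l.
elim: l E => [//|d' m w lw _ [e]|d' a w w' _ IH _ IH' E].
  by apply: NY; rewrite e; exact: (lvl_dg tl_k lw).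
by apply: Nl; [exact: IH|exact: IH'].
Qed.

Lemma hwm_X0 m u : dg 0 u -> X m u = 0.
Proof. by move=> /hwm_deg0[c ->]; rewrite linearZ /= hwm_Xv scaler0. Qed.

Definition sing u := forall m, X m u = 0.

(** By induction on the degree, a homogeneous vector of a submodule avoiding [v] is singular,
    because [X m] sends it into the lower degree part of the submodule, which is 0. In degree 0 such
    a vector is a multiple of [v]. *)
Lemma sing_simple : (forall d u, dg d.+1 u -> sing u -> u = 0) -> simple_mod V.
Proof.
move=> H; split=> [|N sN]; first by exists v; exact: hwm_neq0 HV.
have [Nv|nNv] := pselect (N v).
  by right; apply/seteqP; split=> // u _; exact: (hwm_gen HV).
left; have Nd d u : dg d u -> N u -> u = 0.
  elim: d u => [|d IH] u du Nu.
    have [c E] := hwm_deg0 du; case: (eqVneq c 0) => [c0|c0]; first by rewrite E c0 scale0r.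
    case: nNv; have -> : v = c^-1 *: u by rewrite E scalerA mulVf // scale1r.
    by rewrite -[_ *: _]addr0; case: sN => N0 Nl _; exact: Nl.
  apply: (H _ _ du) => m; apply: IH; first exact: dgX.
  by rewrite opXE; exact: submod_tact.
apply/seteqP; split=> u /=; last by move=> ->; case: sN.
have [D' [f [df f0 ->]]] := hwm_dec u => Nu.
apply: big1 => e _; apply: (Nd e) => //.
exact: (dg_submod sN (fun e _ => df e) Nu).
Qed.

(** The singular vectors of degree [d.+1] form a space stable under the Cartan currents by [hwm_PX];
    the submodule they generate lives in degrees at least [d.+1] and misses [v]. *)
Lemma simple_sing : simple_mod V -> forall d u, dg d.+1 u -> sing u -> u = 0.
Proof.
move=> sV d u du su; pose U0 w := dg d.+1 w /\ sing w.
have U0lin a w w' : U0 w -> U0 w' -> U0 (a *: w + w').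
  move=> [dw sw] [dw' sw']; split; first exact: dg_lin.
  by move=> m; rewrite linearP sw sw' scaler0 addr0.
have U0P m w : U0 w -> U0 (P m w).
  move=> [dw sw]; split; first exact: dgP.
  elim: m w dw sw => [|m IH] w dw sw n.
    apply: (scalerI (expf_neq0 2 q0)).
    by rewrite opP0 -kXm sw linear0 scaler0.
  apply: (scalerI (expf_neq0 2 q0)); rewrite scaler0.
  by have := hwm_PX m n w; rewrite !sw (IH w dw sw) !linear0 ?scaler0 ?oppr0 ?addr0 => <-.
have U0X m w : U0 w -> X m w = 0 by case.
have U0k w : U0 w -> dg d.+1 w by case.
have U0u : U0 u by [].
have sN := levels_submod U0u U0P U0X U0k.
have [_ /(_ _ sN) [E|E]] := sV.
  by have := levels_u0 U0u; rewrite E.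
have : levels U0 v by rewrite E.
case=> D' [f [lf f0 ev]]; exfalso; move/eqP: (hwm_neq0 HV); apply.
(* Arranges [v], of degree 0, minus its supposed expansion in degrees from [d.+1] on into one family
   with sum 0. *)
pose g e := if (e < d.+1)%N then (if e == 0%N then v else 0) else - f (e - d.+1)%N.
have := @dg_sum0 (d.+1 + D') g; have -> : \sum_(e < d.+1 + D') g e = 0.
  rewrite big_split_ord /= big_ord_recl /= big1 ?addr0 => [|i _]; last first.
    by rewrite /g /= ltnS ifT.
  rewrite [X in _ + X](_ : _ = - v) ?subrr // [in RHS]ev -sumrN.
  by apply: eq_bigr => i _; rewrite /g /= ifN -?leqNgt ?leq_addr // addKn.
move=> /(_ _ erefl 0%N isT); rewrite /g /=; apply=> e _.
case: ifP => [_|/negbT]; first by case: eqP => [->|_]; [exact: dg_v|exact: dg0].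
rewrite -leqNgt => le; rewrite -scaleN1r; apply: dgZ.
by have := lvl_dg U0k (lf (e - d.+1)%N); rewrite subnKC.
Qed.
End Hwm.

Section Morphisms.
Implicit Types (W L : bmod h).

Definition bhom V W (f : V -> W) := linear f /\ forall g x, f (bact V g x) = bact W g (f x).

Lemma bhom_tact V W (f : V -> W) t x : bhom f ->
  f (tact (fun g => bact V g) t x) = tact (fun g => bact W g) t (f x).
Proof.
case=> fl fg; pose F : {linear V -> W} := HB.pack f (GRing.isLinear.Build _ _ _ _ f fl).
have FE u : f u = F u by [].
elim: t x => [g|c|s IHs t IHt|s IHs t IHt] x /=.
- exact: fg.
- by rewrite !FE linearZ.
- by rewrite FE linearD -!FE IHs IHt.
- by rewrite IHs IHt.
Qed.

Lemma bhom0 V W (f : V -> W) : bhom f -> f 0 = 0.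
Proof.
case=> fl _; have := fl (-1) 0 0; rewrite scaler0 addr0 scaleN1r => E.
by rewrite E addNr.
Qed.

Lemma bhom_ker V W (f : V -> W) : bhom f -> submodule [set x | f x = 0].
Proof.
move=> bf; have [fl fg] := bf; split=> /= [|a u w fu fw|g u fu]; first exact: bhom0.
  by rewrite fl fu fw scaler0 addr0.
by rewrite fg fu linear0.
Qed.

Lemma bhom_inj V W (f : V -> W) : bhom f -> (forall x, f x = 0 -> x = 0) -> injective f.
Proof.
move=> [fl _] H x y E; apply/eqP; rewrite -subr_eq0; apply/eqP/H.
by rewrite addrC -scaleN1r fl E scaleN1r addNr.
Qed.

Definition biso V W := exists f : V -> W, bhom f /\ bijective f.

Lemma biso_sym V W : biso V W -> biso W V.
Proof.
move=> [f [bf [g fK gK]]]; exists g; split; last by exists f.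
have [fl fg] := bf; split=> [a u w|x y]; apply: (can_inj fK); rewrite gK.
  by rewrite fl !gK.
by rewrite fg gK.
Qed.

(** The submodule of [V x L] generated by the pair [(v, v')] is the graph of the map. It projects
    onto [V]. Its intersection with [L] is a submodule of [L]; were this all of [L], it would
    contain [(0, v')], whereas the degree 0 part is the line of [(v, v')]. *)
Lemma hw_onto V L Psi (v : V) : hwm Psi v -> is_L Psi L ->
  exists f : V -> L, [/\ bhom f, forall y, exists x, f x = y & f v != 0].
Proof.
move=> HV HL; have [v' HL'] := is_L_hwm HL; have [sL _] := HL.
pose W := prod_bmod V L.
have pT t (x : W) : tact (fun g => bact W g) t x =
   (tact (fun g => bact V g) t x.1, tact (fun g => bact L g) t x.2) by exact: prod_tact.
pose Gs : set W := fun x => forall N : set W, submodule N -> N (v, v') -> N x.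
have sG : submodule Gs.
  split=> [N [N0 _ _] //|a u w Hu Hw N sN Nv|g u Hu N sN Nv].
    by have [_ Nl _] := sN; apply: Nl; [exact: Hu|exact: Hw].
  by have [_ _ Ng] := sN; apply: Ng; exact: Hu.
pose G := sub_bmod sG.
have Gv : Gs (v, v') by [].
pose vG : G := sub_of (submodule_lin sG) Gv.
have HG : hwm Psi vG.
  split.
  - apply/eqP => /(congr1 (fun x : G => (val x).1)) /= e.
    by have := hwm_neq0 HV; rewrite e eqxx.
  - apply: val_inj; rewrite sub_actE; congr pair; [exact: hwm_e HV|exact: hwm_e HL'].
  - move=> m; apply: val_inj; rewrite opPE sub_tactE pT /= -!opPE.
    by rewrite (hwm_P HV) (hwm_P HL').
  - move=> N sN Nv x.
    have sN' : submodule [set y : W | exists2 z : G, N z & val z = y].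
      have [N0 Nl Ng] := sN; split=> /=.
      + by exists 0.
      + by move=> a _ _ [z Nz <-] [z' Nz' <-]; exists (a *: z + z') => //; exact: Nl.
      + by move=> g _ [z Nz <-]; exists (bact G g z) => //; exact: Ng.
    have [|z Nz zx] := (sub_memP x : Gs _) _ sN'; first by exists vG.
    by have <- : z = x by exact: val_inj.
have onto1 y : exists x : G, (val x).1 = y.
  apply: (hwm_gen HV (N := [set y | exists x : G, (val x).1 = y])); last by exists vG.
  split=> /= [|a _ _ [x <-] [x' <-]|g _ [x <-]]; first by exists 0.
    by exists (a *: x + x').
  by exists (bact G g x).
have onto2 y : exists x : G, (val x).2 = y.
  apply: (hwm_gen HL' (N := [set y | exists x : G, (val x).2 = y])); last by exists vG.
  split=> /= [|a _ _ [x <-] [x' <-]|g _ [x <-]]; first by exists 0.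
    by exists (a *: x + x').
  by exists (bact G g x).
have fun12 (x : G) : (val x).1 = 0 -> (val x).2 = 0.
  pose K : set L := [set y | exists2 x : G, (val x).1 = 0 & (val x).2 = y].
  have sK : submodule K.
    split=> /= [|a _ _ [z z1 <-] [z' z1' <-]|g _ [z z1 <-]]; first by exists 0.
      by exists (a *: z + z') => //=; rewrite z1 z1' scaler0 addr0.
    by exists (bact G g z) => //=; rewrite z1 linear0.
  have [_ /(_ K sK) [E|E]] := sL.
    by move=> x1; have : K (val x).2; [exists x|rewrite E].
  have [z z1 z2] : K v' by rewrite E.
  have dz : dg Psi 0 z.
    apply: val_inj; rewrite opkE sub_actE /dg /= [lam Psi 0 *: _]surjective_pairing /= z1 z2.
    rewrite /prod_act_fun z1 z2 linear0 scaler0; congr pair; exact: (dg_v HL').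
  have [c cz] := hwm_deg0 HG dz; exfalso.
  have := z1; rewrite cz /= => /eqP; rewrite scaler_eq0 (negbTE (hwm_neq0 HV)) orbF => /eqP c0.
  by have := hwm_neq0 HL'; rewrite -z2 cz c0 /= scale0r eqxx.
have [s sE] := choice onto1.
pose f y := (val (s y)).2.
have fE (x : G) : f (val x).1 = (val x).2.
  apply/eqP; rewrite -subr_eq0; apply/eqP.
  by apply: (fun12 (s (val x).1 - x)); rewrite /= sE subrr.
exists f; split.
- split=> [a u w|g u].
    by rewrite -{1}(sE u) -{1}(sE w); exact: (fE (a *: s u + s w)).
  by rewrite -{1}(sE u); exact: (fE (bact G g (s u))).
- by move=> y; have [x <-] := onto2 y; exists (val x).1.
- by rewrite (fE vG) /= (hwm_neq0 HL').
Qed.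

Lemma is_L_iso V W Psi : is_L Psi V -> is_L Psi W -> biso V W.
Proof.
move=> HV HW; have [v Hv] := is_L_hwm HV; have [f [bf fo fv]] := hw_onto Hv HW.
exists f; split=> //.
have injf : injective f.
  apply: (bhom_inj bf) => x fx; have [[_ sV] _] := HV.
  have [E|E] := sV _ (bhom_ker bf).
    by have : [set x | f x = 0] x by []; rewrite E.
  have Ev : [set x | f x = 0] v by rewrite E.
  by move: fv; rewrite (Ev : f v = 0) eqxx.
have [g gE] := choice fo.
by exists g => x; rewrite ?gE //; apply: injf; rewrite gE.
Qed.

Lemma simple_iso V W : biso V W -> simple_mod V -> simple_mod W.
Proof.
move=> [f [bf [g fK gK]]] [[v v0] sV]; have [fl fg] := bf; split.
  exists (f v); apply: contra v0 => /eqP e; apply/eqP.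
  by apply: (can_inj fK); rewrite e (bhom0 bf).
move=> N [N0 Nl Ng]; have sN : submodule [set x | N (f x)].
  split=> /= [|a u w Nu Nw|x u Nu]; first by rewrite (bhom0 bf).
    by rewrite fl; exact: Nl.
  by rewrite fg; exact: Ng.
have [E|E] := sV _ sN; [left|right]; apply/seteqP; split=> //= y.
- move=> Ny; rewrite -(gK y); have : [set x | N (f x)] (g y) by rewrite /= gK.
  by rewrite E => /= ->; exact: bhom0.
- by move=> ->.
- by move=> _; rewrite -(gK y); have : [set x | N (f x)] (g y) by rewrite E.
Qed.

Lemma is_L_transport V W Psi : biso V W -> is_L Psi V -> is_L Psi W.
Proof.
move=> VW [sV [v [v0 ev pv]]]; split; first exact: simple_iso sV.
have [f [bf [g fK gK]]] := VW; have [fl fg] := bf.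
exists (f v); split.
- apply: contra v0 => /eqP e; apply/eqP.
  by apply: (can_inj fK); rewrite e (bhom0 bf).
- by rewrite -fg ev (bhom0 bf).
- move=> m; rewrite -(bhom_tact _ _ bf) pv.
  by have := fl (Psi m) v 0; rewrite !addr0 (bhom0 bf) addr0.
Qed.

(** Every component of a second highest l-weight vector is singular, so only that of degree 0
    survives. *)
Lemma is_L_uniq V Psi Psi' : is_L Psi V -> is_L Psi' V -> Psi = Psi'.
Proof.
move=> HV HV'; have [v Hv] := is_L_hwm HV; have [w Hw] := is_L_hwm HV'; have [sV _] := HV.
have kw : opk V w = Psi' 0%N *: w by rewrite -opP0 (hwm_P Hw).
have sw : sing w := hwm_Xv Hw.
suff [c cw] : exists c, w = c *: v.
  have c0 : c != 0 by apply: contraNneq (hwm_neq0 Hw) => e; rewrite cw e scale0r.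
  apply/funext => m; have := hwm_P Hw m; rewrite cw linearZ /= (hwm_P Hv) !scalerA.
  move/eqP; rewrite -subr_eq0 -scalerBl scaler_eq0 (negbTE (hwm_neq0 Hv)) orbF.
  by rewrite subr_eq0 mulrC => /eqP/(mulIf c0).
have [D [f [df f0 ew]]] := hwm_dec Hv w.
have fs e : (e < D)%N -> sing (f e).
  move=> lt m.
  case: e lt => [|e] lt; first exact: (hwm_X0 Hv _ (df 0%N)).
  have := @dg_sum0 _ _ _ Hv D (fun e => opX V m (f e.+1)).
  move=> /(_ (fun e _ => dgX _ (df e.+1))); apply; last exact: ltnW.
  have E : \sum_(i < D.+1) opX V m (f i) = 0.
    rewrite (@sum_widen _ D D.+1 (fun i => opX V m (f i))) ?leqnSn // => [|i le]; last by rewrite f0 ?linear0.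
    by rewrite -linear_sum -ew.
  by move: E; rewrite big_ord_recl (hwm_X0 Hv _ (df 0%N)) add0r.
have fz e : (e.+1 < D)%N -> f e.+1 = 0.
  by move=> lt; apply: (simple_sing Hv sV (df e.+1)); exact: fs.
case: D f0 ew fs fz => [|D] f0 ew fs fz.
  by rewrite ew big_ord0; exists 0; rewrite scale0r.
rewrite ew big_ord_recl big1 ?addr0 => [|i _]; first exact: (hwm_deg0 Hv (df 0%N)).
by apply: fz; rewrite ltnS.
Qed.
End Morphisms.
End HighestWeight.

(** * Modules of rank one and their tensor products *)

Section RankOne.
Variables (R : realType) (h : R[i]).
Local Notation C := R[i].
Local Notation q := (qpar h).
Hypothesis qnr : forall n : nat, (0 < n)%N -> q ^+ n != 1.
Let q0 : q != 0 := q_neq0 h.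
Let qq0 := qqV_neq0 qnr.
Let q2n := qDqV_neq0 qnr.
Let q21 : q * q - 1 != 0. Proof. by rewrite subr_eq0 -expr2 (q2_neq qnr). Qed.
Let q22 : q * q + 1 != 0.
Proof.
apply: contraNneq q2n => e; have : (q * q + 1) / q = 0 by rewrite e mul0r.
by rewrite mulrDl mulfK // mul1r => ->.
Qed.

Variables (kap a be : C).
Hypothesis kap0 : kap != 0.

(** The power series [kap (1 - be z) / (1 - a z)]. *)
Definition rk_lw : lweight R := fun m => if m is m'.+1 then kap * (a - be) * a ^+ m' else kap.
(** Structure constants for the vectors [s_l = Y_0^l v]: [k_1] and [h_1] act on [s_l] by [rk_kap l]
    and [rk_eta l], [Y_m] sends [s_l] to [(rk_b l)^m s_{l+1}], and [X_m] sends [s_{l+1}] to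
    [(rk_b l)^m (rk_c (l+1)) s_l]. *)
Definition rk_kap l := kap * q ^- (2 * l).
Definition rk_b l := a * q ^- (2 * l).
Definition rk_eta l := (- (q ^+ 2 * a) - be + (q ^+ 2 + 1) * a * q ^- (2 * l)) / (q - q^-1).
Definition rk_c l := kap * (1 - q ^- (2 * l)) * (a * q ^+ 2 * q ^- (2 * l) - be)
  / ((q - q^-1) * (1 - q ^- 2)).
(** The l-weight of the basis vector [F^l v]. *)
Definition rk_th l : lweight R := fun m => if m is m'.+1 then
  (q - q^-1) * (rk_b l ^+ m' * rk_c l.+1 - (rk_b l * q ^+ 2) ^+ m' * rk_c l) else rk_kap l.

Let qS l : q ^- (2 * l.+1) = q ^- 2 * q ^- (2 * l).
Proof. by rewrite mulnS exprD invfM. Qed.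

Lemma rk_c0 : rk_c 0 = 0.
Proof. by rewrite /rk_c muln0 expr0 invr1 subrr mulr0 !mul0r. Qed.
Lemma rk_bS l : rk_b l.+1 = q ^- 2 * rk_b l. Proof. by rewrite /rk_b qS mulrCA. Qed.
Lemma rk_etaS l : rk_eta l.+1 = rk_eta l - (q + q^-1) * rk_b l.
Proof. by rewrite /rk_eta /rk_b qS; move: (q ^- (2 * l)) => u; field; rewrite q0 q21. Qed.
Lemma rk_cS l : rk_c l.+1 = rk_c l + rk_kap l * rk_eta l.
Proof.
rewrite /rk_c /rk_kap /rk_eta qS; move: (q ^- (2 * l)) => u; field.
by rewrite q0 q21.
Qed.
Lemma rk_kap_neq0 l : rk_kap l != 0.
Proof. by rewrite mulf_neq0 // invr_neq0 // expf_neq0. Qed.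
Lemma rk_th0 : rk_th 0 =1 rk_lw.
Proof.
case=> [|m] /=; first by rewrite /rk_kap muln0 expr0 invr1 mulr1.
rewrite rk_c0 mulr0 subr0 /rk_b /rk_c muln0 expr0 invr1 mulr1 muln1.
by move: (a ^+ m) => am; field; rewrite q0 q21.
Qed.

Variable S : bmod h.
Hypothesis HS : is_L rk_lw S.
Local Notation k := (opk S).
Local Notation X := (opX S).
Local Notation Y := (opY S).

Let VV : lmodType R[i] := S.
Tactic Notation "lc" uconstr(c) constr(H) := refine (@lin_comb _ VV c _ _ _ _ H _).
Ltac lin := match type of VV with GRing.Lmodule.type ?C => lin_with C VV end;
  repeat split; first [ring | solve [field; rewrite ?q0 //] | idtac].

Lemma rk_ex : exists v : S, hwm rk_lw v. Proof. exact: is_L_hwm HS. Qed.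
Definition rk_v : S := projT1 (cid rk_ex).
Lemma rk_hwm : hwm rk_lw rk_v. Proof. exact: projT2 (cid rk_ex). Qed.
Definition rk_s l : S := iter l (Y 0%N) rk_v.
Lemma rk_sS l : rk_s l.+1 = Y 0%N (rk_s l). Proof. by []. Qed.

Lemma rk_dg l : dg rk_lw l (rk_s l).
Proof. by elim: l => [|l IH]; [exact: (dg_v rk_hwm)|exact: (dgY qnr)]. Qed.

Lemma rk_ks l : k (rk_s l) = rk_kap l *: rk_s l. Proof. exact: rk_dg. Qed.

(** From index 1 on, the coefficients of the l-weight form a geometric progression of ratio [a];
    hence [Y m.+1 v - a Y m v] is singular of degree 1, and so zero. *)
Lemma rk_Yv m : Y m rk_v = a ^+ m *: rk_s 1.
Proof.
elim: m => [|m IH]; first by rewrite scale1r.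
apply/eqP; rewrite exprS -scalerA -IH -subr_eq0; apply/eqP.
have [sS _] := HS.
apply: (simple_sing qnr rk_hwm sS (d := 0)) => [|n].
  rewrite -scaleNr addrC; apply: dg_lin; apply: (dgY qnr); exact: (dg_v rk_hwm).
lc 1 (hwm_XY qnr rk_hwm n m.+1 rk_v); lc (- a) (hwm_XY qnr rk_hwm n m rk_v).
lc 1 (congr1 (Y m.+1) (hwm_Xv qnr rk_hwm n)); lc (- a) (congr1 (Y m) (hwm_Xv qnr rk_hwm n)).
lc ((q - q^-1)^-1) (hwm_P rk_hwm (n + m.+1).+1); lc (- a * (q - q^-1)^-1) (hwm_P rk_hwm (n + m).+1).
rewrite addnS /= exprS; by lin.
Qed.

Let stp l : oph S (rk_s l) = rk_eta l *: rk_s l -> Y 1 (rk_s l) = rk_b l *: rk_s l.+1 ->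
  oph S (rk_s l.+1) = rk_eta l.+1 *: rk_s l.+1.
Proof.
move=> hs Y1; rewrite rk_etaS; lc 1 (dr_Y (bmod_drin qnr S) 0 (rk_s l)).
lc 1 (congr1 (Y 0%N) hs). lc (- (q + q^-1)) Y1.
by rewrite !rk_sS; lin.
Qed.

(** [h] and the [Y m] are treated together: [dr_YY] gives [Y 1] on the next vector, this yields the
    eigenvalue of [h] one step further, and brackets with [h] then give all the [Y m]. *)
Lemma rk_hY l : oph S (rk_s l) = rk_eta l *: rk_s l /\
  forall m, Y m (rk_s l) = rk_b l ^+ m *: rk_s l.+1.
Proof.
elim: l => [|l [hs Ys]].
  split=> [|m]; last by rewrite rk_Yv /rk_b muln0 expr0 invr1 mulr1.
  rewrite (hwm_h qnr rk_hwm); congr (_ *: _); rewrite /rk_eta /= muln0 expr0.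
  by field; rewrite q0 kap0 q21.
have hs' := stp hs (Ys 1%N); split=> //.
have Y1 : Y 1 (rk_s l.+1) = rk_b l.+1 *: rk_s l.+2.
  have := Ys 1%N; rewrite expr1 => Y1; rewrite rk_bS.
  lc 1 (dr_YY (bmod_drin qnr S) (rk_s l)); lc (q ^- 2) (congr1 (Y 0%N) Y1).
  by rewrite !rk_sS; lin.
have hs2 := stp hs' Y1.
elim=> [|m IH]; first by rewrite scale1r.
rewrite opYS hs' IH; lc (- (q + q^-1)^-1 * rk_b l.+1 ^+ m) hs2.
lc ((q + q^-1)^-1 * rk_eta l.+1) IH; rewrite (rk_etaS l.+1) exprS; lin.
Qed.

Lemma rk_hs l : oph S (rk_s l) = rk_eta l *: rk_s l. Proof. by case: (rk_hY l). Qed.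
Lemma rk_Ys l m : Y m (rk_s l) = rk_b l ^+ m *: rk_s l.+1. Proof. by case: (rk_hY l). Qed.

Lemma rk_Xs0 m : X m (rk_s 0) = 0. Proof. exact: (hwm_Xv qnr rk_hwm). Qed.

Lemma rk_X0 l : X 0%N (rk_s l.+1) = rk_c l.+1 *: rk_s l.
Proof.
elim: l => [|l IH]; rewrite rk_cS.
  lc 1 (dr_p0 (bmod_drin qnr S) (rk_s 0)).
  lc 1 (congr1 k (rk_hs 0)); lc (rk_eta 0) (rk_ks 0).
  by lc 1 (congr1 (Y 0%N) (rk_Xs0 0)); rewrite rk_c0 rk_sS; lin.
lc 1 (dr_p0 (bmod_drin qnr S) (rk_s l.+1)).
lc 1 (congr1 k (rk_hs l.+1)); lc (rk_eta l.+1) (rk_ks l.+1).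
by lc 1 (congr1 (Y 0%N) IH); rewrite !rk_sS; lin.
Qed.

Lemma rk_Xs l m : X m (rk_s l.+1) = (rk_b l ^+ m * rk_c l.+1) *: rk_s l.
Proof.
elim: m => [|m IH]; first by rewrite expr0 mul1r rk_X0.
rewrite opXS; lc ((q + q^-1)^-1) (congr1 (oph S) IH); lc (- (q + q^-1)^-1) (congr1 (X m) (rk_hs l.+1)).
lc (- (q + q^-1)^-1 * rk_eta l.+1) IH; lc ((q + q^-1)^-1 * (rk_b l ^+ m * rk_c l.+1)) (rk_hs l).
by rewrite rk_etaS exprS; lin.
Qed.

Lemma rk_Ps l m : opP S m (rk_s l) = rk_th l m *: rk_s l.
Proof.
case: m => [|m]; first exact: rk_ks.
rewrite opPS /Pb; lc (q - q^-1) (congr1 (X 0%N) (rk_Ys l m)).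
lc ((q - q^-1) * rk_b l ^+ m) (rk_X0 l).
case: l => [|l]; first by lc (- (q - q^-1)) (congr1 (Y m) (rk_Xs0 0)); rewrite /rk_th rk_c0; lin.
lc (- (q - q^-1)) (congr1 (Y m) (rk_X0 l)); lc (- (q - q^-1) * rk_c l.+1) (rk_Ys l m).
rewrite /rk_th rk_bS mulrAC mulVf ?expf_neq0 // mul1r; by lin.
Qed.

(** Otherwise [rk_s l.+1] would be singular. *)
Lemma rk_c_neq0 l : rk_s l.+1 != 0 -> rk_c l.+1 != 0.
Proof.
apply: contraNneq => c0; have [sS _] := HS.
apply/eqP; apply: (simple_sing qnr rk_hwm sS (rk_dg l.+1)) => m.
by rewrite rk_Xs c0 mulr0 scale0r.
Qed.

Lemma rk_s_neq0 l : (forall i, (0 < i <= l)%N -> rk_c i != 0) -> rk_s l != 0.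
Proof.
elim: l => [|l IH] H; first exact: (hwm_neq0 rk_hwm).
have sl : rk_s l != 0 by apply: IH => i /andP[i0 il]; rewrite H // i0 ltnW.
apply: contraNneq sl => e; have := rk_X0 l; rewrite e linear0 => /esym/eqP.
by rewrite scaler_eq0 (negbTE (H l.+1 _)) ?ltnS ?leqnn // => ->.
Qed.

Lemma rk_s_le l l' : (l <= l')%N -> rk_s l' != 0 -> rk_s l != 0.
Proof.
move=> le; apply: contraNneq; rewrite -(subnK le).
by move=> e; elim: (_ - _)%N => [|n IH]; rewrite ?add0n ?e // addSn rk_sS (eqP IH) linear0.
Qed.

Lemma rk_line l u : dg rk_lw l u -> exists c, u = c *: rk_s l.
Proof.
elim: l u => [|l IH] u du; first exact: (hwm_deg0 qnr rk_hwm du).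
apply: (hwm_degS qnr rk_hwm (N := fun u => exists c, u = c *: rk_s l.+1) du) => [|x u' w' [c ->] [d ->]|m w /IH[c ->]].
- by exists 0; rewrite scale0r.
- by exists (x * c + d); rewrite scalerA scalerDl.
- by exists (c * rk_b l ^+ m); rewrite linearZ /= rk_Ys scalerA.
Qed.

Lemma rk_span (u : S) : exists D (c : nat -> C), u = \sum_(l < D) c l *: rk_s l.
Proof.
have [D [f [df f0 ->]]] := hwm_dec qnr rk_hwm u.
have [c cf] := choice (fun l => rk_line (df l)).
by exists D, c; apply: eq_bigr => l _; rewrite cf.
Qed.

Lemma rk_free D (c : nat -> C) : \sum_(l < D) c l *: rk_s l = 0 ->
  forall l, (l < D)%N -> rk_s l != 0 -> c l = 0.
Proof.
move=> s0 l lt nz; have := dg_sum0 qnr rk_hwm (f := fun l => c l *: rk_s l).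
move=> /(_ D (fun e _ => dgZ _ (rk_dg e)) s0 l lt) /eqP.
by rewrite scaler_eq0 (negbTE nz) orbF => /eqP.
Qed.

(** Coordinates in the basis of the nonzero [rk_s l]. Where [rk_s l = 0] the coordinate is set to 0,
    so that finite and infinite dimensional modules are treated alike. *)
Lemma rk_co_ex : exists co : S -> nat -> C,
  [/\ forall a u w l, co (a *: u + w) l = a * co u l + co w l,
      forall l l', co (rk_s l) l' = ((l == l') && (rk_s l != 0))%:R,
      forall u l, rk_s l = 0 -> co u l = 0 &
      forall u, exists D, (forall l, (D <= l)%N -> co u l = 0) /\
         u = \sum_(l < D) co u l *: rk_s l].
Proof.
have ex u : exists c : nat -> C, (forall l, rk_s l = 0 -> c l = 0) /\ exists D,
     (forall l, (D <= l)%N -> c l = 0) /\ u = \sum_(l < D) c l *: rk_s l.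
  have [D [c ->]] := rk_span u.
  exists (fun l => if (l < D)%N && (rk_s l != 0) then c l else 0); split.
    by move=> l ->; rewrite eqxx andbF.
  exists D; split=> [l le|]; first by rewrite ltnNge le.
  apply: eq_bigr => l _; rewrite ltn_ord /=; case: eqVneq => [->|] //=.
  by rewrite !scaler0.
have [co Hco] := choice ex.
have uniq u (c : nat -> C) D : (forall l, rk_s l = 0 -> c l = 0) -> (forall l, (D <= l)%N -> c l = 0) ->
    u = \sum_(l < D) c l *: rk_s l -> co u = c.
  move=> c0 cD eu; have [z0 [D' [zD eu']]] := Hco u.
  apply/funext => l; have [sl|sl] := eqVneq (rk_s l) 0; first by rewrite z0 // c0.
  pose M := maxn l.+1 (maxn D D'); apply/eqP; rewrite -subr_eq0; apply/eqP.
  have lM : (l < M)%N by rewrite leq_max ltnSn.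
  apply: (rk_free (D := M) (c := fun l => co u l - c l)) => //.
  rewrite (eq_bigr (fun l : 'I_M => co u l *: rk_s l - c l *: rk_s l)) => [|i _]; last by rewrite scalerBl.
  rewrite sumrB (@sum_widen _ D' M (fun l => co u l *: rk_s l)) => [|i /zD ->|]; rewrite ?scale0r //; last first.
    by rewrite !leq_max leqnn !orbT.
  rewrite (@sum_widen _ D M (fun l => c l *: rk_s l)) => [|i /cD ->|]; rewrite ?scale0r //; last first.
    by rewrite !leq_max leqnn !orbT.
  by rewrite -eu -eu' subrr.
exists co; split=> [a' u w l|l l'|u l|u].
- have [z0 [D1 [zD eu]]] := Hco u; have [w0 [D2 [wD ew]]] := Hco w.
  rewrite (uniq (a' *: u + w) (fun l => a' * co u l + co w l) (maxn D1 D2)) //.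
  + by move=> i si; rewrite z0 // w0 // mulr0 addr0.
  + by move=> i; rewrite geq_max => /andP[/zD -> /wD ->]; rewrite mulr0 addr0.
  rewrite {1}eu {1}ew scaler_sumr.
  rewrite -(@sum_widen _ D1 (maxn D1 D2) (fun l => a' *: (co u l *: rk_s l))) => [|i /zD ->|]; rewrite ?leq_maxl ?scale0r ?scaler0 //.
  rewrite -(@sum_widen _ D2 (maxn D1 D2) (fun l => (co w l *: rk_s l))) => [|i /wD ->|]; rewrite ?leq_maxr ?scale0r ?scaler0 //.
  by rewrite -big_split; apply: eq_bigr => i _; rewrite scalerDl scalerA.
- rewrite (uniq (rk_s l) (fun l' => ((l == l') && (rk_s l != 0))%:R) l.+1) //.
  + by move=> i si; case: eqP => //= ->; rewrite si eqxx.
  + by move=> i lt; case: eqP lt => [->|//]; rewrite ltnn.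
  rewrite big_ord_recr /= eqxx /= big1 ?add0r => [|i _].
    by case: eqP => [->|]; rewrite ?scaler0 ?scale1r.
  by rewrite gtn_eqF // scale0r.
- by move=> sl; have [z0 _] := Hco u; exact: z0.
- by have [_ ?] := Hco u.
Qed.
End RankOne.

(** * Action on a tensor product *)

Section TensorGeneral.
Variables (R : realType) (h : R[i]).
Local Notation C := R[i].
Local Notation q := (qpar h).
Hypothesis qnr : forall n : nat, (0 < n)%N -> q ^+ n != 1.
Variables (S W T : bmod h) (t : S -> W -> T).
Hypothesis Ht : is_tensor t.

Let q0 : q != 0 := q_neq0 h.

Lemma ten_linl y : linear (t^~ y). Proof. by case: Ht => -[H _] _ _ _ a x x'; exact: H. Qed.
Lemma ten_linr x : linear (t x). Proof. by case: Ht => -[_ H] _ _ _ a y y'; exact: H. Qed.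
Definition tenr (_ : is_tensor t) x : W -> T := t x.
Definition tenl (_ : is_tensor t) y : S -> T := t^~ y.
HB.instance Definition _ x := GRing.isLinear.Build _ _ _ _ (tenr Ht x) (ten_linr x).
HB.instance Definition _ y := GRing.isLinear.Build _ _ _ _ (tenl Ht y) (ten_linl y).
Lemma tl0 y : t 0 y = 0. Proof. exact: (linear0 (tenl Ht y)). Qed.
Lemma tr0 x : t x 0 = 0. Proof. exact: (linear0 (tenr Ht x)). Qed.
Lemma tlZ a x y : t (a *: x) y = a *: t x y. Proof. by rewrite -[LHS]/(tenl Ht y _) linearZ. Qed.
Lemma trZ a x y : t x (a *: y) = a *: t x y. Proof. by rewrite -[LHS]/(tenr Ht x _) linearZ. Qed.
Lemma tlB x x' y : t (x - x') y = t x y - t x' y. Proof. exact: (linearB (tenl Ht y)). Qed.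
Lemma trB x y y' : t x (y - y') = t x y - t x y'. Proof. exact: (linearB (tenr Ht x)). Qed.
Lemma trP a x y y' : t x (a *: y + y') = a *: t x y + t x y'. Proof. exact: ten_linr. Qed.
Lemma tlP a x x' y : t (a *: x + x') y = a *: t x y + t x' y. Proof. exact: ten_linl. Qed.
Lemma tlsum I (r : seq I) (P : pred I) F y :
  t (\sum_(i <- r | P i) F i) y = \sum_(i <- r | P i) t (F i) y.
Proof. exact: (linear_sum (tenl Ht y)). Qed.
Lemma trsum I (r : seq I) (P : pred I) F x :
  t x (\sum_(i <- r | P i) F i) = \sum_(i <- r | P i) t x (F i).
Proof. exact: (linear_sum (tenr Ht x)). Qed.

Lemma ten_uniq (U : lmodType C) (f g : {linear T -> U}) :
  (forall x y, f (t x y) = g (t x y)) -> f =1 g.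
Proof.
move=> E; have [|f0 [_ u0]] := (let: And4 _ H _ _ := Ht in H) U (fun x y => f (t x y)).
  by split=> a x y z; rewrite ?tlP ?trP linearP.
have Ef := u0 f (fun x y => erefl); have Eg := u0 g (fun x y => esym (E x y)).
by move=> x; rewrite -Ef -Eg.
Qed.

(** The universal property gives a map from [T] to the subspace [N], and its composite with the
    inclusion is the identity. *)
Lemma ten_span (N : T -> Prop) : lin_closed N -> (forall x y, N (t x y)) -> forall u, N u.
Proof.
move=> HN Nt u; pose b x y : sub_car HN := sub_of HN (Nt x y).
have [|f [fb _]] := (let: And4 _ H _ _ := Ht in H) (sub_car HN : lmodType C) b.
  split=> a x y z; apply: val_inj; rewrite /=.
    by rewrite tlP.
  by rewrite trP.
have vl : linear (fun z : T => val (f z) : T) by move=> a x y; rewrite linearP.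
pose F : {linear T -> T} := HB.pack (fun z : T => val (f z) : T) (GRing.isLinear.Build _ _ _ _ _ vl).
have E : F =1 (idfun : {linear T -> T}) by apply: ten_uniq => x y; rewrite /F /= fb.
by rewrite -[u]/((idfun : {linear T -> T}) u) -E; exact: sub_memP.
Qed.

Lemma ten_E x y : opX T 0 (t x y) = t (opX S 0 x) y + t (opk S x) (opX W 0 y).
Proof. by rewrite !opX0E; case: Ht => _ _ -> _. Qed.
Lemma ten_k x y : opk T (t x y) = t (opk S x) (opk W y).
Proof. by rewrite !opkE; case: Ht => _ _ _ ->. Qed.
Lemma ten_F x y : opY T 0 (t x y) = t (opY S 0 x) (opk W y) + t x (opY W 0 y).
Proof.
rewrite !opY0 ten_k !opeE; case: Ht => _ _ -> _.
by rewrite opk0 opkK.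
Qed.

(** The cross term is what remains of the bracket of [e_1] and [x^-_1] on the tensor product. It
    lowers the weight in the first factor, which makes the action of [h_1] triangular. *)
Lemma ten_h x y : oph T (t x y) =
  t (oph S x) y + t x (oph W y) - (q ^+ 2 - q ^- 2) *: t (opY S 0 x) (opX W 0 y).
Proof.
apply: (@kk_inj _ h T); rewrite ophP ten_F ten_E !linearD !ten_E !ten_F linearN linearZ /= !ten_k.
have D1 := dr_kY0 (bmod_drin qnr S) x.
have D2 : opX W 0 (opk W y) = q ^- 2 *: opk W (opX W 0 y).
  by rewrite ke1 // scalerA mulVf ?scale1r // expf_neq0.
rewrite !ophP D2 D1 !(tlB, trB, tlZ, trZ); have q0' := q0.
pose VV : lmodType R[i] := T.
set Z := t (opY S 0 (opk S x)) (opk W (opX W 0 y)).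
lin_with (R[i]) VV; repeat split; first [ring | by field].
Qed.

End TensorGeneral.

(** * Leading terms of the currents along a rank-one factor *)

Section TensorRankOne.
Variables (R : realType) (h : R[i]).
Local Notation C := R[i].
Local Notation q := (qpar h).
Hypothesis qnr : forall n : nat, (0 < n)%N -> q ^+ n != 1.
Let q0 : q != 0 := q_neq0 h.
Let qq0 := qqV_neq0 qnr.
Let q2n := qDqV_neq0 qnr.
Variables (kap a be : C).
Hypothesis kap0 : kap != 0.
Variables (S W T : bmod h) (t : S -> W -> T).
Hypothesis HS : is_L (rk_lw kap a be) S.
Variables (Psi : lweight R) (w0 : W).
Hypothesis HW : hwm Psi w0.
Hypothesis Ht : is_tensor t.

Local Notation s := (rk_s HS).
Local Notation c := (rk_c h kap a be).
Local Notation b := (rk_b h a).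
Local Notation kp := (rk_kap h kap).
Local Notation eta := (rk_eta h a be).
Local Notation th := (rk_th h kap a be).

Definition rk_co := projT1 (cid (rk_co_ex qnr kap0 HS)).
Lemma rk_coP : [/\ forall a u w l, rk_co (a *: u + w) l = a * rk_co u l + rk_co w l,
      forall l l', rk_co (s l) l' = ((l == l') && (s l != 0))%:R,
      forall u l, s l = 0 -> rk_co u l = 0 &
      forall u, exists D, (forall l, (D <= l)%N -> rk_co u l = 0) /\
         u = \sum_(l < D) rk_co u l *: s l].
Proof. exact: projT2 (cid (rk_co_ex qnr kap0 HS)). Qed.

Lemma cw_ex l : exists f : {linear T -> W}, forall x y, f (t x y) = rk_co x l *: y.
Proof.
have [lin _ _ _] := rk_coP.
have [|f [fE _]] := (let: And4 _ H _ _ := Ht in H) W (fun x y => rk_co x l *: y).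
  split=> z x y y'; first by rewrite lin scalerDl scalerA.
  by rewrite scalerDr !scalerA mulrC.
by exists f.
Qed.
(** [cw l u] is the coefficient, a vector of [W], of [rk_s l] in the expansion of [u] along the
    first factor. *)
Definition cw l : {linear T -> W} := projT1 (cid (cw_ex l)).
Lemma cwE l x y : cw l (t x y) = rk_co x l *: y.
Proof. by rewrite /cw; case: cid => f /= ->. Qed.
Lemma cw_s l l' y : s l' != 0 -> cw l (t (s l') y) = (l' == l)%:R *: y.
Proof. by move=> nz; have [_ E _ _] := rk_coP; rewrite cwE E nz andbT. Qed.
Lemma cw_z l u : s l = 0 -> cw l u = 0.
Proof.
move=> sl; have [_ _ E _] := rk_coP.
apply: (ten_span Ht (N := fun u => cw l u = 0)) => [|x y]; last by rewrite cwE E // scale0r.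
by split=> [|z x y xe ye]; rewrite ?linear0 // linearP xe ye scaler0 addr0.
Qed.

Lemma cw_span (N : T -> Prop) : lin_closed N -> (forall l y, s l != 0 -> N (t (s l) y)) ->
  forall u, N u.
Proof.
move=> HN Ns; apply: (ten_span Ht) => // x y; have [_ _ _ /(_ x)[D [_ ->]]] := rk_coP.
have [N0 Nl] := HN; rewrite (tlsum Ht).
apply: (@big_ind _ N) => // [u w Nu Nw|l _]; first by rewrite -[u]scale1r; exact: Nl.
rewrite (tlZ Ht) -[X in N X]addr0; apply: Nl => //.
have [e|] := eqVneq (s l) 0; last exact: Ns.
by rewrite e (tl0 Ht).
Qed.

Lemma cw_ext2 (U : lmodType C) (f g : {linear T -> U}) :
  (forall l y, s l != 0 -> f (t (s l) y) = g (t (s l) y)) -> f =1 g.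
Proof.
move=> E; apply: cw_span => [|l y]; last exact: E.
by split=> [|z x y xe ye]; rewrite ?linear0 // !linearP xe ye.
Qed.

Lemma cw_dec u : exists D, (forall l, (D <= l)%N -> cw l u = 0) /\
  u = \sum_(l < D) t (s l) (cw l u).
Proof.
move: u; apply: cw_span => [|l y nz].
  split=> [|z x y [D1 [x0 ex]] [D2 [y0 ey]]].
    by exists 0%N; split=> [l _|]; rewrite ?linear0 ?big_ord0.
  exists (maxn D1 D2); split=> [l|].
    by rewrite geq_max => /andP[/x0 ex' /y0 ey']; rewrite linearP ex' ey' scaler0 addr0.
  rewrite [in LHS]ex [in LHS]ey.
  rewrite -(@sum_widen _ D1 (maxn D1 D2) (fun l => t (s l) (cw l x))) => [|i /x0 ->|]; rewrite ?leq_maxl ?(tr0 Ht) //.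
  rewrite -(@sum_widen _ D2 (maxn D1 D2) (fun l => t (s l) (cw l y))) => [|i /y0 ->|]; rewrite ?leq_maxr ?(tr0 Ht) //.
  by rewrite scaler_sumr -big_split; apply: eq_bigr => i _; rewrite linearP (trP Ht).
exists l.+1; split=> [l' lt|]; first by rewrite cw_s // ltn_eqF // scale0r.
rewrite big_ord_recr /= cw_s // eqxx scale1r big1 ?add0r // => i _.
by rewrite cw_s // gtn_eqF ?ltn_ord // scale0r (tr0 Ht).
Qed.

Lemma cw_ext u w : (forall l, cw l u = cw l w) -> u = w.
Proof.
move=> E; have [D [D0 ->]] := cw_dec u; have [D' [D0' ->]] := cw_dec w.
rewrite -(@sum_widen _ D (maxn D D') (fun l => t (s l) (cw l u))) => [|i /D0 ->|]; rewrite ?leq_maxl ?(tr0 Ht) //.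
rewrite -(@sum_widen _ D' (maxn D D') (fun l => t (s l) (cw l w))) => [|i /D0' ->|]; rewrite ?leq_maxr ?(tr0 Ht) //.
by apply: eq_bigr => i _; rewrite E.
Qed.

Lemma cw0 u : (forall l, cw l u = 0) -> u = 0.
Proof. by move=> H; apply: cw_ext => l; rewrite H linear0. Qed.

Let tz := tl0 Ht.
Let tZ := tlZ Ht.

Let delZ (i l : nat) (x y : C) (w : W) : (i = l -> x = y) ->
  x *: ((i == l)%:R *: w) = y *: ((i == l)%:R *: w).
Proof. by case: eqP => [E /(_ E) ->//|_ _]; rewrite scale0r !scaler0. Qed.

Lemma cw_k l u : cw l (opk T u) = kp l *: opk W (cw l u).
Proof.
move: u; apply: (@cw_ext2 W (cw l \o opk T) (kp l \*: (opk W \o cw l))) => i y nz /=.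
rewrite ten_k // (rk_ks qnr) tZ [LHS]linearZ /= !(cw_s _ _ nz) [opk W (_ *: y)]linearZ /=.
by apply: delZ => ->.
Qed.

Lemma cw_X0 l u : cw l (opX T 0 u) = c l.+1 *: cw l.+1 u + kp l *: opX W 0 (cw l u).
Proof.
move: u; apply: (@cw_ext2 W (cw l \o opX T 0%N)
   ((c l.+1 \*: cw l.+1) \+ (kp l \*: (opX W 0%N \o cw l)))) => i y nz /=.
rewrite ten_E // (rk_ks qnr) tZ [LHS]linearD /= [X in _ + X]linearZ /= !(cw_s _ _ nz) [X in _ = _ + _ *: X]linearZ /=.
congr (_ + _); last by apply: delZ => ->.
case: i nz => [|i] nz; first by rewrite rk_Xs0 // tz linear0 scale0r scaler0.
rewrite (rk_X0 qnr) // tZ linearZ /= (cw_s _ _ (rk_s_le (leqnSn i) nz)) eqSS.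
by apply: delZ => ->.
Qed.

Lemma cw_Y0 u : cw 0 (opY T 0 u) = opY W 0 (cw 0 u).
Proof.
move: u; apply: (@cw_ext2 W (cw 0%N \o opY T 0%N) (opY W 0%N \o cw 0%N)) => i y nz /=.
rewrite ten_F // linearD /= -rk_sS.
have -> : cw 0 (t (s i.+1) (opk W y)) = 0.
  by have [e|ne] := eqVneq (s i.+1) 0; rewrite ?e ?tz ?linear0 // (cw_s _ _ ne) scale0r.
by rewrite add0r !(cw_s _ _ nz) linearZ.
Qed.

Let cw_sS l i y : s l.+1 != 0 -> cw l.+1 (t (s i.+1) y) = (i == l)%:R *: y.
Proof.
move=> nzl; have [e|ne] := eqVneq (s i.+1) 0; last by rewrite (cw_s _ _ ne) eqSS.
rewrite e tz linear0; case: eqP => [E|_]; last by rewrite scale0r.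
by move: nzl; rewrite -E e eqxx.
Qed.

Lemma cw_YS l u : s l.+1 != 0 ->
  cw l.+1 (opY T 0 u) = opk W (cw l u) + opY W 0 (cw l.+1 u).
Proof.
move=> nzl; move: u; apply: (@cw_ext2 W (cw l.+1 \o opY T 0%N)
  ((opk W \o cw l) \+ (opY W 0%N \o cw l.+1))) => i y nz /=.
by rewrite ten_F // [LHS]linearD /= -rk_sS cw_sS // !(cw_s _ _ nz) !linearZ.
Qed.

Lemma cw_h0 u : cw 0 (oph T u) = eta 0 *: cw 0 u + oph W (cw 0 u).
Proof.
move: u; apply: (@cw_ext2 W (cw 0%N \o oph T)
  ((eta 0 \*: cw 0%N) \+ (oph W \o cw 0%N))) => i y nz /=.
rewrite ten_h // -rk_sS (rk_hs qnr) // tZ; have cD := linearD (cw 0%N); have cZ := linearZ_LR (cw 0%N).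
rewrite linearB cD !cZ /= !(cw_s _ _ nz).
have -> : cw 0 (t (s i.+1) (opX W 0 y)) = 0.
  by have [e|ne] := eqVneq (s i.+1) 0; rewrite ?e ?tz ?linear0 // (cw_s _ _ ne) scale0r.
rewrite scaler0 subr0 [X in _ = _ + X]linearZ /=; congr (_ + _).
by apply: delZ => ->.
Qed.

Lemma cw_hS l u : s l.+1 != 0 -> cw l.+1 (oph T u) =
  eta l.+1 *: cw l.+1 u + oph W (cw l.+1 u) - (q ^+ 2 - q ^- 2) *: opX W 0 (cw l u).
Proof.
move=> nzl; move: u; apply: (@cw_ext2 W (cw l.+1 \o oph T)
  (((eta l.+1 \*: cw l.+1) \+ (oph W \o cw l.+1)) \- ((q ^+ 2 - q ^- 2) \*: (opX W 0%N \o cw l)))) => i y nz /=.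
rewrite ten_h // -rk_sS (rk_hs qnr) // tZ; have cD := linearD (cw l.+1); have cZ := linearZ_LR (cw l.+1).
rewrite [LHS]linearB cD !cZ /= !(cw_s _ _ nz) cw_sS //.
by rewrite (linearZ_LR (oph W)) (linearZ_LR (opX W 0%N)) (@delZ i l.+1 (eta i) (eta l.+1)) // => ->.
Qed.

Let q21 : q * q - 1 != 0. Proof. by rewrite subr_eq0 -expr2 (q2_neq qnr). Qed.
Let q22 : q * q + 1 != 0.
Proof.
apply: contraNneq q2n => e; have : (q * q + 1) / q = 0 by rewrite e mul0r.
by rewrite mulrDl mulfK // mul1r => ->.
Qed.
Let VV : lmodType R[i] := W.
Tactic Notation "lc" uconstr(c) constr(H) := refine (@lin_comb _ VV c _ _ _ _ H _).
Ltac lin := match type of VV with GRing.Lmodule.type ?C => lin_with C VV end;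
  repeat split; first [ring | solve [field; rewrite ?q0 ?q21 ?q22 //] | idtac].

(** A filtration on which each current has a computable leading term, although no closed formula for
    its coproduct is available. *)
Definition ge l u := forall l', (l' < l)%N -> cw l' u = 0.

Lemma ge_k l u : ge l u -> ge l (opk T u).
Proof. by move=> g l' lt; rewrite cw_k g // linear0 scaler0. Qed.

Lemma ge_h l u : ge l u -> ge l (oph T u) /\ cw l (oph T u) = eta l *: cw l u + oph W (cw l u).
Proof.
move=> g; split=> [l' lt|].
  have [e|ne] := eqVneq (s l') 0; first exact: cw_z.
  case: l' lt ne => [|l'] lt ne; first by rewrite cw_h0 g // !(linear0, scaler0, addr0, subr0).
  by rewrite cw_hS // !g // ?(ltnW lt) // !(linear0, scaler0, addr0, subr0).
have [e|ne] := eqVneq (s l) 0; first by rewrite !cw_z // !(linear0, scaler0, addr0, subr0).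
case: l g ne => [|l] g ne; first exact: cw_h0.
by rewrite cw_hS // [cw l u]g // !(linear0, scaler0, addr0, subr0).
Qed.

(** Induction on [m] by brackets with [h]. The component at [l.+1] is needed for [ge_P], where a
    subsequent [X 0] lowers the index by one again. *)
Lemma ge_Y m l u : ge l u -> [/\ ge l (opY T m u), cw l (opY T m u) = opY W m (cw l u) &
  s l.+1 != 0 -> cw l.+1 (opY T m u) =
     opY W m (cw l.+1 u) + \sum_(i < m.+1) b l ^+ i *: opP W (m - i) (cw l u)].
Proof.
elim: m u => [|m IH] u g.
  split=> [l' lt||nz].
  - have [e|ne] := eqVneq (s l') 0; first exact: cw_z.
    case: l' lt ne => [|l'] lt ne; first by rewrite cw_Y0 g // linear0.
    by rewrite cw_YS // !g // ?(ltnW lt) // !linear0 addr0.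
  - have [e|ne] := eqVneq (s l) 0; first by rewrite !cw_z // linear0.
    case: l g ne => [|l] g ne; first exact: cw_Y0.
    by rewrite cw_YS // [cw l u]g // linear0 add0r.
  - by rewrite cw_YS // big_ord1 /= expr0 scale1r opP0 addrC.
have [gh hl] := ge_h g.
have [g1 E1 F1] := IH u g; have [g2 E2 F2] := IH _ gh.
have [gh1 hl1] := ge_h g1.
split=> [l' lt||nz].
- by rewrite opYS linearZ linearB /= gh1 // g2 // subrr scaler0.
- rewrite !opYS linearZ linearB /= hl1 E1 E2 hl.
  by lc 0 (erefl (0 : W)); lin.
rewrite !opYS linearZ linearB /= cw_hS // F1 // E1 F2 // hl cw_hS //.
rewrite [in RHS]big_ord_recl /= expr0 subn0 opPS /Pb.
have -> : \sum_(i < m.+1) b l ^+ bump 0 i *: opP W (m.+1 - bump 0 i) (cw l u) =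
   b l *: \sum_(i < m.+1) b l ^+ i *: opP W (m - i) (cw l u).
  rewrite scaler_sumr; apply: eq_bigr => i _.
  by rewrite /bump /= add1n subSS exprS scalerA.
have -> : \sum_(i < m.+1) b l ^+ i *: opP W (m - i) (eta l *: cw l u + oph W (cw l u)) =
   eta l *: (\sum_(i < m.+1) b l ^+ i *: opP W (m - i) (cw l u)) +
   oph W (\sum_(i < m.+1) b l ^+ i *: opP W (m - i) (cw l u)).
  rewrite (linear_sum (oph W)) scaler_sumr -big_split /=; apply: eq_bigr => i _.
  by rewrite linearP (linearZ_LR (oph W)) /= scalerDr !scalerA mulrC (hwm_hP qnr HW).
rewrite rk_etaS //; set Z := \sum_(i < _) _; lin.
Qed.

Lemma rk_cz l : s l != 0 -> s l.+1 = 0 -> c l.+1 = 0.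
Proof.
move=> nz e; have := rk_X0 qnr kap0 HS l; rewrite e linear0 => /esym/eqP.
by rewrite scaler_eq0 (negbTE nz) orbF => /eqP.
Qed.

(** [X m] can lower the filtration by one, through the first factor; at index [l] the Cartan
    currents of the first factor are convolved with the [X] of the second. *)
Lemma ge_X m l u : ge l u -> [/\ forall l', (l'.+1 < l)%N -> cw l' (opX T m u) = 0,
  forall l0, l = l0.+1 -> cw l0 (opX T m u) = (b l0 ^+ m * c l) *: cw l u &
  cw l (opX T m u) = (b l ^+ m * c l.+1) *: cw l.+1 u +
     \sum_(i < m.+1) th l i *: opX W (m - i) (cw l u)].
Proof.
elim: m u => [|m IH] u g.
  split=> [l' lt|l0 E|].
  - by rewrite cw_X0 !g // ?linear0 ?scaler0 ?addr0 // ltnW.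
  - by rewrite cw_X0 [cw l0 u]g ?E // linear0 scaler0 addr0 expr0 mul1r.
  - by rewrite cw_X0 expr0 mul1r big_ord1.
have [gh hl] := ge_h g.
have [A1 B1 C1] := IH u g; have [A2 B2 C2] := IH _ gh.
split=> [l' lt|l0 E|].
- rewrite opXS linearZ linearB /= A2 // subr0.
  have [e|ne] := eqVneq (s l') 0; first by rewrite cw_z ?scaler0.
  case: l' lt ne => [|l'] lt ne; first by rewrite cw_h0 A1 // !(linear0, scaler0, addr0, subr0).
  by rewrite cw_hS // !A1 ?(ltnW lt) // !(linear0, scaler0, addr0, subr0).
- rewrite opXS linearZ linearB /= (B2 _ E) hl.
  have [e|ne] := eqVneq (s l0) 0.
    have el : s l = 0 by rewrite E rk_sS e linear0.
    by rewrite !cw_z // !(linear0, scaler0, addr0, subr0).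
  have -> : cw l0 (oph T (opX T m u)) = eta l0 *: cw l0 (opX T m u) + oph W (cw l0 (opX T m u)).
    case: l0 E ne => [|l0] E ne; first exact: cw_h0.
    by rewrite cw_hS // [cw l0 (opX T m u)]A1 ?E // !(linear0, scaler0, addr0, subr0).
  by rewrite (B1 _ E) E rk_etaS // exprS; lin.
have [e|ne] := eqVneq (s l) 0.
  rewrite !cw_z // ?rk_sS ?e ?linear0 // !(linear0, scaler0, add0r) big1 // => i _.
  by rewrite !(linear0, scaler0).
rewrite opXS linearZ linearB /= C2 hl.
have -> : cw l (oph T (opX T m u)) = eta l *: cw l (opX T m u) + oph W (cw l (opX T m u))
   - (q ^+ 2 - q ^- 2) *: ((if l is l0.+1 then b l0 ^+ m * c l else 0) *: opX W 0 (cw l u)).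
  clear IH; case: l g hl A1 B1 C1 A2 B2 C2 gh ne => [|l0] g hl A1 B1 C1 A2 B2 C2 gh ne.
    by rewrite cw_h0 scale0r scaler0 subr0.
  by rewrite cw_hS // (B1 l0 erefl) [opX W 0 (_ *: _)]linearZ.
have -> : (b l ^+ m * c l.+1) *: cw l.+1 (oph T u) = (b l ^+ m * c l.+1) *:
   (eta l.+1 *: cw l.+1 u + oph W (cw l.+1 u) - (q ^+ 2 - q ^- 2) *: opX W 0 (cw l u)).
  have [e1|ne1] := eqVneq (s l.+1) 0; last by rewrite cw_hS.
  by rewrite rk_cz // mulr0 !scale0r.
rewrite C1 [in RHS]big_ord_recr /= subnn.
have -> : \sum_(i < m.+1) th l i *: opX W (m.+1 - i) (cw l u) = (q + q^-1)^-1 *: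
   (oph W (\sum_(i < m.+1) th l i *: opX W (m - i) (cw l u)) -
    \sum_(i < m.+1) th l i *: opX W (m - i) (oph W (cw l u))).
  rewrite linear_sum -sumrB scaler_sumr; apply: eq_bigr => i _.
  rewrite subSn -1?ltnS // opXS; lin.
have -> : \sum_(i < m.+1) th l i *: opX W (m - i) (eta l *: cw l u + oph W (cw l u)) =
   eta l *: (\sum_(i < m.+1) th l i *: opX W (m - i) (cw l u)) +
   \sum_(i < m.+1) th l i *: opX W (m - i) (oph W (cw l u)).
  rewrite scaler_sumr -big_split /=; apply: eq_bigr => i _.
  by rewrite linearP scalerDr !scalerA mulrC.
rewrite rk_etaS // (exprS (b l)); set Z := \sum_(i < _) _; set Z' := \sum_(i < _) _.
case: l {IH g hl A1 B1 C1 A2 B2 C2 gh ne} Z Z' => [|l0] Z Z' /=.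
  by rewrite rk_c0; move: (b 0 ^+ m) => bm; lin.
have -> : b l0.+1 * q ^+ 2 = b l0 by rewrite rk_bS mulrAC mulVf ?expf_neq0 // mul1r.
lin.
Qed.

(** To leading order the series [phi^+(z)] is group-like: on the component at [l] it acts by the
    product of the series [th l] and [phi^+(z)] on [W]. *)
Lemma ge_P m l u : ge l u -> ge l (opP T m u) /\
  cw l (opP T m u) = \sum_(i < m.+1) th l i *: opP W (m - i) (cw l u).
Proof.
move=> g; case: m => [|m].
  by split; [exact: ge_k|rewrite big_ord1 opP0 cw_k].
have [gY Yl YlS] := ge_Y m g; have [A B C1] := ge_X 0 g.
split=> [l' lt|].
  rewrite opPS /Pb linearZ linearB /= cw_X0 [cw l' (opY T m u)]gY // linear0 scaler0 addr0.
  have [A' B' _] := ge_X 0 gY.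
  have [lt1|] := ltnP l'.+1 l.
    have g' : ge l'.+1 (opX T 0 u) by move=> j lj; apply: A; apply: leq_trans lt1; rewrite ltnS.
    have [gg _ _] := ge_Y m g'; rewrite gg // subr0.
    by rewrite gY // !scaler0.
  move=> le; have E : l = l'.+1 by apply/eqP; rewrite eqn_leq le lt.
  have g' : ge l' (opX T 0 u) by move=> j lj; apply: A; rewrite E ltnS.
  have [_ -> _] := ge_Y m g'; rewrite (B _ E) -E Yl linearZ /= expr0 mul1r subrr scaler0 //.
rewrite opPS /Pb linearZ linearB /= cw_X0 Yl.
have [e|ne] := eqVneq (s l) 0.
  rewrite !cw_z // ?rk_sS ?e ?linear0 // !(linear0, scaler0, addr0, subr0) big1 // => i _.
  by rewrite !(linear0, scaler0).
have -> : c l.+1 *: cw l.+1 (opY T m u) = c l.+1 *: (opY W m (cw l.+1 u) +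
    \sum_(i < m.+1) b l ^+ i *: opP W (m - i) (cw l u)).
  have [e1|ne1] := eqVneq (s l.+1) 0; last by rewrite YlS.
  by rewrite rk_cz // !scale0r.
have -> : cw l (opY T m (opX T 0 u)) = opY W m (c l.+1 *: cw l.+1 u + kp l *: opX W 0 (cw l u)) +
   (if l is l0.+1 then c l *: \sum_(i < m.+1) b l0 ^+ i *: opP W (m - i) (cw l u) else 0).
  case: l g gY Yl YlS A B C1 ne => [|l0] g gY Yl YlS A B C1 ne.
    by have [_ -> _] := @ge_Y m 0%N (opX T 0 u) (fun _ => ltac:(by [])); rewrite cw_X0 addr0.
  have g' : ge l0 (opX T 0 u) by move=> j lj; apply: A; rewrite ltnS.
  have [_ _ ->//] := ge_Y m g'; rewrite cw_X0 (B l0 erefl) expr0 mul1r; congr (_ + _).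
  rewrite scaler_sumr; apply: eq_bigr => i _.
  by rewrite linearZ /= !scalerA mulrC.
rewrite [in RHS]big_ord_recl /= subn0 opPS /Pb.
have -> : \sum_(i < m.+1) th l (bump 0 i) *: opP W (m.+1 - bump 0 i) (cw l u) =
   (q - q^-1) *: (c l.+1 *: (\sum_(i < m.+1) b l ^+ i *: opP W (m - i) (cw l u)) -
     (if l is l0.+1 then c l *: \sum_(i < m.+1) b l0 ^+ i *: opP W (m - i) (cw l u) else 0)).
  case: l {g gY Yl YlS A B C1 ne} => [|l0].
    rewrite subr0 !scaler_sumr; apply: eq_bigr => i _.
    rewrite /bump /= add1n subSS rk_c0 mulr0 subr0 !scalerA; congr (_ *: _).
    by rewrite mulrA mulrAC.
  rewrite !scaler_sumr -sumrB scaler_sumr; apply: eq_bigr => i _.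
  rewrite /bump add1n subSS; set P := opP _ _ _; rewrite /= rk_bS // mulrAC mulVf ?expf_neq0 // mul1r.
  by move: (_ ^+ i) (_ ^+ i) => bm bm'; lin.
set Z := \sum_(i < _) _; set Z' := (if l is l0.+1 then _ else _).
by lin.
Qed.
End TensorRankOne.

Section DegreeSums.
Variables (R : realType) (h : R[i]).
Local Notation q := (qpar h).
Hypothesis qnr : forall n : nat, (0 < n)%N -> q ^+ n != 1.
Let q0 : q != 0 := q_neq0 h.
Variables (V : bmod h) (Psi : lweight R).
Hypothesis Psi0 : Psi 0%N != 0.

(** Only a nonzero constant term is assumed, since this serves for tensor products that are not yet
    known to have a highest l-weight. *)
Lemma lam_injective : injective (lam h Psi).
Proof.
move=> d e /(mulfI Psi0)/invr_inj; wlog le : d e / (d <= e)%N.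
  by move=> H E; case: (leqP d e) => [/H ->//|/ltnW /H ->].
have -> : (2 * e = 2 * d + 2 * (e - d))%N by lia.
rewrite exprD -{1}[q ^+ (2 * d)]mulr1 => /(mulfI (expf_neq0 _ q0)) /eqP.
rewrite eq_sym => E; apply/eqP; rewrite eqn_leq le /= leqNgt; apply/negP => lt.
by move: E; apply/negP; apply: qnr; rewrite muln_gt0 subn_gt0.
Qed.

Lemma lam_neq0 d : lam h Psi d != 0.
Proof. by rewrite mulf_neq0 // invr_neq0 // expf_neq0. Qed.

Lemma deg_sub (N : V -> Prop) D (f : nat -> V) : lin_closed N ->
  (forall u, N u -> N (opk V u)) -> (forall e, (e < D)%N -> dg Psi e (f e)) ->
  N (\sum_(e < D) f e) -> forall e, (e < D)%N -> N (f e).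
Proof. by move=> [N0 Nl] Nk df; apply: (eig_sub lam_injective N0 Nl Nk). Qed.

Lemma deg_sum0 D (f : nat -> V) : (forall e, (e < D)%N -> dg Psi e (f e)) ->
  \sum_(e < D) f e = 0 -> forall e, (e < D)%N -> f e = 0.
Proof.
move=> df; apply: (deg_sub (N := fun u => u = 0)) => //; last by move=> u ->; rewrite linear0.
by split=> // x u w -> ->; rewrite scaler0 addr0.
Qed.
End DegreeSums.

(** In every stage of a flag of a weight space the Cartan currents have an
    eigenvector, whose l-weight lies in [Sg]. *)
Definition flagw (R : realType) (h : R[i]) (V : bmod h) (Psi : lweight R)
    (Sg : lweight R -> Prop) :=
  forall d (Z Z' : V -> Prop), lin_closed Z -> lin_closed Z' ->
  (forall m u, Z u -> Z (opP V m u)) -> (forall m u, Z' u -> Z' (opP V m u)) ->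
  (forall u, Z u -> dg Psi d u) -> (exists2 z, Z z & ~ Z' z) ->
  exists z Th, [/\ Z z, ~ Z' z, Sg Th & forall m, Z' (opP V m z - Th m *: z)].

(** * Generators, singular vectors and l-weights of a tensor product *)

Section TensorRankOne2.
Variables (R : realType) (h : R[i]).
Local Notation C := R[i].
Local Notation q := (qpar h).
Hypothesis qnr : forall n : nat, (0 < n)%N -> q ^+ n != 1.
Let q0 : q != 0 := q_neq0 h.
Variables (kap a be : C).
Hypothesis kap0 : kap != 0.
Variables (S W T : bmod h) (t : S -> W -> T).
Hypothesis HS : is_L (rk_lw kap a be) S.
Variables (Psi : lweight R) (w0 : W).
Hypothesis HW : hwm Psi w0.
Hypothesis Ht : is_tensor t.

Local Notation s := (rk_s HS).
Local Notation c := (rk_c h kap a be).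
Local Notation b := (rk_b h a).
Local Notation kp := (rk_kap h kap).
Local Notation th := (rk_th h kap a be).
Local Notation cw := (cw qnr kap0 HS Ht).
Local Notation ge := (ge qnr kap0 HS Ht).
Local Notation PsT := (lw_mul (rk_lw kap a be) Psi).

Lemma PsT0 : PsT 0%N = kap * Psi 0%N. Proof. by rewrite /lw_mul big_ord1. Qed.
Lemma PsT_neq0 : PsT 0%N != 0. Proof. by rewrite PsT0 mulf_neq0 // (hwm_Psi0 HW). Qed.

Lemma dg_neg n u : (0 < n)%N -> opk W u = (Psi 0%N * q ^+ (2 * n)) *: u -> u = 0.
Proof.
move=> n0 ku; have [D [f [df f0 eu]]] := hwm_dec qnr HW u.
have := @deg_sum0 _ _ qnr W _ (hwm_Psi0 HW) D (fun e => (lam h Psi e - Psi 0%N * q ^+ (2 * n)) *: f e).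
have -> : \sum_(e < D) (lam h Psi e - Psi 0%N * q ^+ (2 * n)) *: f e = 0.
  rewrite (eq_bigr (fun e : 'I_D => opk W (f e) - (Psi 0%N * q ^+ (2 * n)) *: f e)) => [|e _].
    by rewrite sumrB -linear_sum -scaler_sumr -eu ku subrr.
  by rewrite scalerBl (df e).
move=> /(_ (fun e _ => dgZ _ (df e)) erefl) z; rewrite eu; apply: big1 => e _.
have /eqP := z e (ltn_ord e); rewrite scaler_eq0 => /orP[|/eqP//].
rewrite subr_eq0 /lam => /eqP/(mulfI (hwm_Psi0 HW)) E; exfalso.
have := @qnr (2 * e + 2 * n)%N; rewrite exprD -E mulfV ?expf_neq0 // eqxx => H.
by have : false by apply: H; lia.
Qed.

Lemma cw_dg D u : dg PsT D u -> forall l, ((l <= D)%N -> dg Psi (D - l) (cw l u)) /\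
  ((D < l)%N -> cw l u = 0).
Proof.
move=> du l; have e : opk W (cw l u) = (Psi 0%N * q ^- (2 * D) * q ^+ (2 * l)) *: cw l u.
  apply: (scalerI (rk_kap_neq0 h kap0 l)); rewrite -cw_k // du linearZ /= scalerA.
  by congr (_ *: _); rewrite /lam PsT0 /rk_kap; field; rewrite !expf_neq0.
split=> le.
  rewrite /dg e; congr (_ *: _); rewrite /lam -mulrA; congr (_ * _).
  rewrite -{1}(subnK le) mulnDr exprD invfM -mulrA mulVf ?mulr1 // expf_neq0 //.
apply: (@dg_neg (l - D)); rewrite ?subn_gt0 // e; congr (_ *: _); rewrite -mulrA; congr (_ * _).
rewrite -{1}(subnKC (ltnW le)) mulnDr exprD mulrA mulVf ?mul1r // expf_neq0 //.
Qed.

Lemma dgP' V Ps d m (u : bcar V) : dg Ps d u -> @dg _ h V Ps d (opP V m u).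
Proof. exact: (dgP qnr). Qed.

Lemma ten_dec u : exists D (f : nat -> T), [/\ forall e, dg PsT e (f e),
  forall e, (D <= e)%N -> f e = 0 & u = \sum_(e < D) f e].
Proof.
move: u; apply: (cw_span qnr kap0 (HS := HS) Ht) => [|l y nz].
  split=> [|z x y [D1 [f [df f0 ex]]] [D2 [g [dg' g0 ey]]]].
    by exists 0%N, (fun=> 0); split=> // [e|]; [exact: dg0|rewrite big_ord0].
  exists (maxn D1 D2), (fun e => z *: f e + g e); split=> [e|e|].
  - exact: dg_lin.
  - by rewrite geq_max => /andP[/f0 -> /g0 ->]; rewrite scaler0 addr0.
  - rewrite big_split /= -scaler_sumr (sum_widen f0 (leq_maxl D1 D2)) (sum_widen g0 (leq_maxr D1 D2)).
    by rewrite -ex -ey.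
have [D [f [df f0 ->]]] := hwm_dec qnr HW y.
exists (l + D)%N, (fun e => if (l <= e)%N then t (s l) (f (e - l)%N) else 0); split=> [e|e le|].
- case: ifP => le; last exact: dg0.
  rewrite /dg ten_k // (rk_ks qnr) // (df (e - l)%N) (tlZ Ht) (trZ Ht) scalerA; congr (_ *: _).
  rewrite /lam /rk_kap PsT0 -!mulrA; congr (_ * _); rewrite mulrCA; congr (_ * _).
  by rewrite -invfM -exprD -mulnDr addnC subnK.
- by case: ifP => // _; rewrite f0 ?(tr0 Ht) // leq_subRL ?(leq_trans (leq_addr D l)).
rewrite big_split_ord /= [X in _ = X + _]big1 ?add0r => [|i _]; last by rewrite leqNgt ltn_ord.
by rewrite (trsum Ht); apply: eq_bigr => i _; rewrite leq_addr addKn.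
Qed.

Definition ten_top := t (s 0) w0.
Let s00 : s 0 != 0 := hwm_neq0 (rk_hwm HS).

Lemma cw_top l : cw l ten_top = (0%N == l)%:R *: w0. Proof. exact: cw_s. Qed.

Lemma ten_top_neq0 : ten_top != 0.
Proof.
apply: contraNneq (hwm_neq0 HW) => e.
by have := cw_top 0; rewrite e linear0 scale1r => <-.
Qed.

Lemma dg_top : dg PsT 0 ten_top.
Proof.
rewrite /dg ten_k // (rk_ks qnr) // -opP0 (hwm_P HW) (tlZ Ht) (trZ Ht) scalerA; congr (_ *: _).
by rewrite /lam /rk_kap PsT0 muln0 expr0 invr1 !mulr1.
Qed.

Lemma ge_top : ge 0 ten_top. Proof. by []. Qed.

Lemma ten_top_E : bact T (BE ord_max) ten_top = 0.
Proof.
rewrite -opX0E; apply: (@cw0 _ _ qnr _ _ _ kap0 _ _ _ _ HS Ht) => l.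
rewrite cw_X0 // !cw_top /= scale0r scaler0 add0r.
by rewrite (linearZ_LR (opX W 0%N)) (hwm_Xv qnr HW) !scaler0.
Qed.

Lemma ten_top_P m : opP T m ten_top = PsT m *: ten_top.
Proof.
apply: (cw_ext (HS := HS) (qnr := qnr) (kap0 := kap0) (Ht := Ht)) => l; rewrite linearZ /= cw_top.
case: l => [|l]; last first.
  by have [_ ->] := cw_dg (dgP' m dg_top) l.+1; rewrite // scale0r scaler0.
have [_ ->] := ge_P HW m ge_top; rewrite cw_top !scale1r /lw_mul scaler_suml.
by apply: eq_bigr => i _; rewrite (hwm_P HW) scalerA rk_th0.
Qed.

Section Generation.
(** A linear relation between the [Y m w0] that, applied with the same coefficients to [rk_s l]
    tensored with [w0], leaves a nonzero multiple of [rk_s l.+1] tensored with [w0]. *)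
Hypothesis G : forall l, s l.+1 != 0 -> exists n (al : nat -> C),
  \sum_(m < n) al m *: opY W m w0 = 0 /\
  \sum_(m < n) al m * (\sum_(i < m.+1) b l ^+ i * Psi (m - i)%N) != 0.

Let dg_s l : dg PsT l (t (s l) w0).
Proof.
rewrite /dg ten_k // (rk_ks qnr) // -opP0 (hwm_P HW) (tlZ Ht) (trZ Ht) scalerA; congr (_ *: _).
by rewrite /lam /rk_kap PsT0 mulrAC.
Qed.

(** [A] climbs along the first factor above [w0] by means of [G]; [B] then spreads over [W], the
    action of a generator on the second factor being the action on [T] corrected by vectors already
    reached. *)
Lemma ten_gen : genby ten_top.
Proof.
move=> N sN Nt; have [N0 Nl Ng] := sN.
have NZ (z : C) u : N u -> N (z *: u) by move=> Nu; rewrite -[_ *: _]addr0; exact: Nl.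
have ND u w : N u -> N w -> N (u + w) by move=> Nu Nw; rewrite -[u]scale1r; exact: Nl.
have Nop tm u : N u -> N (tact (fun g => bact T g) tm u) by exact: submod_tact.
have A l : s l != 0 -> N (t (s l) w0).
  elim: l => [//|l IH] nzS; have nz := rk_s_le (leqnSn l) nzS; have Nl' := IH nz.
  have [n [al [z0 z1]]] := G nzS; set z := \sum_(m < n) _ in z1.
  suff -> : t (s l.+1) w0 = z^-1 *: \sum_(m < n) al m *: opY T m (t (s l) w0).
    apply: (NZ); apply: big_ind => [//|u w|m _]; first exact: ND.
    by apply: (NZ); rewrite opYE; exact: Nop.
  apply: (scalerI z1); rewrite scalerA mulfV // scale1r.
  apply: (cw_ext (HS := HS) (qnr := qnr) (kap0 := kap0) (Ht := Ht)) => j.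
  have gl : ge l (t (s l) w0) by move=> j' lj; rewrite cw_s // gtn_eqF // scale0r.
  have clm m := ge_Y HW m gl.
  rewrite [LHS]linearZ [RHS]linear_sum [LHS]/= (cw_s qnr kap0 Ht j w0 nzS).
  have [lj|lj|->] := ltngtP j l.+1.
  - rewrite scale0r scaler0.
    have [lj'|] := ltnP j l.
      by rewrite big1 // => m _; rewrite linearZ /=; have [g' _ _] := clm m; rewrite g' // scaler0.
    move=> le; have -> : j = l by apply/eqP; rewrite eqn_leq le -ltnS lj.
    rewrite -[LHS]z0; apply: eq_bigr => m _; rewrite linearZ /=; have [_ -> _] := clm m.
    by rewrite cw_s // eqxx scale1r.
  - rewrite scale0r scaler0 big1 // => m _; rewrite linearZ /=.
    by have [_ ->] := cw_dg (dgY qnr m (dg_s l)) j; rewrite ?scaler0.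
  rewrite scale1r scaler_suml; apply: eq_bigr => m _; rewrite linearZ /=.
  have [_ _ -> //] := clm m; rewrite !cw_s // eqxx ltn_eqF // scale0r linear0 add0r scale1r.
  rewrite -scalerA; congr (_ *: _); rewrite scaler_suml; apply: eq_bigr => i _.
  by rewrite (hwm_P HW) scalerA.
have B y l : N (t (s l) y).
  apply: (hwm_generates HW (P := fun y => forall l, N (t (s l) y))) => {y l} [x u w Hu Hw l|u Hu l|u Hu l|u Hu l|u Hu l|l].
  - by rewrite (trP Ht); exact: Nl.
  - have -> : t (s l) (opX W 0 u) = (kp l)^-1 *: (opX T 0 (t (s l) u) - t (opX S 0 (s l)) u).
      apply: (scalerI (rk_kap_neq0 h kap0 l)); rewrite scalerA mulfV ?rk_kap_neq0 // scale1r.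
      by rewrite ten_E // (rk_ks qnr) // (tlZ Ht) addrC addKr.
    apply: (NZ); apply: (ND); first by rewrite opXE; apply: (Nop).
    rewrite -scaleN1r; apply: (NZ); case: l => [|l]; first by rewrite rk_Xs0 // (tl0 Ht).
    by rewrite rk_X0 // (tlZ Ht); apply: (NZ).
  - have -> : t (s l) (opY W 0 u) = opY T 0 (t (s l) u) - t (s l.+1) (opk W u).
      by rewrite ten_F // -rk_sS addrC addKr.
    apply: (ND); first by rewrite opYE; apply: (Nop).
    have -> : t (s l.+1) (opk W u) = (kp l.+1)^-1 *: opk T (t (s l.+1) u).
      by rewrite ten_k // (rk_ks qnr) // (tlZ Ht) scalerA mulVf ?rk_kap_neq0 // scale1r.
    by rewrite -scaleN1r; do 2 apply: (NZ); rewrite opkE; apply: (Ng).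
  - have -> : t (s l) (opk W u) = (kp l)^-1 *: opk T (t (s l) u).
      by rewrite ten_k // (rk_ks qnr) // (tlZ Ht) scalerA mulVf ?rk_kap_neq0 // scale1r.
    by apply: (NZ); rewrite opkE; apply: (Ng).
  - have -> : t (s l) (opki W u) = kp l *: opki T (t (s l) u).
      apply: (@kk_inj _ h T); rewrite [opk T (_ *: _)]linearZ /= opkiK ten_k // opkiK (rk_ks qnr) //.
      by rewrite (tlZ Ht).
    by apply: (NZ); rewrite opkiE; apply: (Ng).
  have [e|] := eqVneq (s l) 0; last exact: A.
  by rewrite e (tl0 Ht).
by apply: (cw_span qnr kap0 (HS := HS) Ht) => [|l y _]; [split|exact: B].
Qed.

Lemma ten_hwm : hwm PsT ten_top.
Proof.
split; [exact: ten_top_neq0|exact: ten_top_E|exact: ten_top_P|exact: ten_gen].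
Qed.
End Generation.

(** If the components up to [l] vanish, the component of [X 0 u] at [l] is [c l.+1] times the next
    component of [u], and [c l.+1] is nonzero as long as [rk_s l.+1] is. *)
Lemma sing_cw0 u : sing u -> cw 0 u = 0 -> u = 0.
Proof.
move=> su u0; apply: (@cw0 _ _ qnr _ _ _ kap0 _ _ _ _ HS Ht) => l.
have [n] := ubnP l; elim: n l => // n IH [//|l]; rewrite ltnS => lt.
have g : ge l.+1 u by move=> j lj; apply: IH; exact: leq_trans lt.
have [e|nz] := eqVneq (s l.+1) 0; first exact: cw_z.
have [_ /(_ l erefl) E _] := ge_X 0 g; move: E.
rewrite su linear0 expr0 mul1r => /esym/eqP.
by rewrite scaler_eq0 (negbTE (rk_c_neq0 qnr kap0 nz)) => /eqP.
Qed.

(** Take the largest [l] for which some vector of [Z] outside [Z'] starts at [l]. Leading components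
    give spaces [A] and [A'] in [W], to which the flag property of [W] applies. An eigenvector of
    [A] modulo [A'] lifts, because by maximality everything in [Z] that starts later lies in
    [Z']. *)
Lemma flagw_ten Sg : flagw W Psi Sg ->
  flagw T PsT (fun Th => exists l Th', Sg Th' /\ Th = lw_mul (th l) Th').
Proof.
move=> FW D Z Z' lZ lZ' ZP ZP' Zd [z0 Zz0 nZz0].
have [[Z0 Zl] [Z0' Zl']] := (lZ, lZ').
have ZB x y : Z x -> Z y -> Z (x - y) by move=> Zx Zy; rewrite addrC -scaleN1r; exact: Zl.
have ZZ x c' : Z x -> Z (c' *: x) by move=> Zx; rewrite -[_ *: _]addr0; exact: Zl.
have ZD' x y : Z' x -> Z' y -> Z' (x + y) by move=> Zx Zy; rewrite -[x]scale1r; exact: Zl'.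
pose Q l := exists z, [/\ Z z, ~ Z' z & ge l z].
have [l [Ql mx]] : exists l, Q l /\ forall l', (l < l')%N -> ~ Q l'.
  have bd l : Q l -> (l <= D)%N.
    move=> [z [Zz nZz gz]]; rewrite leqNgt; apply/negP => lt; apply: nZz.
    suff -> : z = 0 by [].
    apply: (@cw0 _ _ qnr _ _ _ kap0 _ _ _ _ HS Ht) => j; have [lj|lj] := leqP j D.
      by apply: gz; exact: leq_ltn_trans lt.
    by have [_ ->] := cw_dg (Zd _ Zz) j.
  have [|l /asboolP Ql ml] := @ex_maxnP (fun l => `[< Q l >]) D _ (fun i Hi => bd i (elimT (asboolP _) Hi)).
    by exists 0%N; apply/asboolP; exists z0.
  exists l; split=> // l' lt Ql'; have := ml l' (introT (asboolP _) Ql').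
  by rewrite leqNgt lt.
have small z : Z z -> ge l.+1 z -> Z' z.
  by move=> Zz gz; apply: contrapT => nZ; apply: (mx l.+1 (ltnSn l)); exists z.
have geS z z' : ge l z -> ge l z' -> cw l z = cw l z' -> ge l.+1 (z - z').
  move=> g g' E j; rewrite ltnS leq_eqVlt linearB => /orP[/eqP -> /=|lt]; first by rewrite E subrr.
  by rewrite /= g // g' // subrr.
have gel x z z' : ge l z -> ge l z' -> ge l (x *: z + z').
  by move=> g g' j lj; rewrite linearP /= g // g' // scaler0 addr0.
have ge0 : ge l 0 by move=> j _; rewrite linear0.
pose A y := exists z, [/\ Z z, ge l z & cw l z = y].
pose A' y := exists z, [/\ Z z /\ Z' z, ge l z & cw l z = y].
have lin_A : lin_closed A.
  split; first by exists 0; rewrite linear0.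
  move=> x u w [z [Zz g <-]] [z' [Zz' g' <-]]; exists (x *: z + z').
  by split; [exact: Zl|exact: gel|rewrite linearP].
have lin_A' : lin_closed A'.
  split; first by exists 0; rewrite linear0.
  move=> x u w [z [[Zz Zz1] g <-]] [z' [[Zz' Zz1'] g' <-]]; exists (x *: z + z').
  by split; [split; [exact: Zl|exact: Zl']|exact: gel|rewrite linearP].
(* Stability under the convolved currents gives stability under the [opP W m]: the triangular system
   is inverted, its diagonal entry [kp l] being nonzero. *)
have inv (B : W -> Prop) : lin_closed B ->
   (forall m y, B y -> B (\sum_(i < m.+1) th l i *: opP W (m - i) y)) ->
   forall m y, B y -> B (opP W m y).
  move=> [B0 Bl] HB m y By; have [n] := ubnP m; elim: n m => // n IH m; rewrite ltnS => le.
  have k0 := rk_kap_neq0 h kap0 l.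
  have := HB m _ By; rewrite big_ord_recl /= subn0 => HH.
  have -> : opP W m y = (kp l)^-1 *: (kp l *: opP W m y +
      \sum_(i < m) th l (bump 0 i) *: opP W (m - bump 0 i) y) +
     (- (kp l)^-1) *: (\sum_(i < m) th l (bump 0 i) *: opP W (m - bump 0 i) y).
    by rewrite scalerDr scalerA mulVf // scale1r scaleNr addrK.
  have BZ x u : B u -> B (x *: u) by move=> Bu; rewrite -[_ *: _]addr0; exact: Bl.
  apply: (Bl) => //; apply: (BZ); apply: big_ind => // [u w Bu Bw|i _].
    by rewrite -[u]scale1r; exact: Bl.
  apply: (BZ); apply: IH; rewrite /bump /= add1n; have := ltn_ord i; lia.
have [||||y0 [Th' [[y [Zy gy <-]] nA ST HT]]] := FW (D - l)%N A A' lin_A lin_A'.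
- apply: inv => // m y [z [Zz g <-]]; exists (opP T m z).
  have [g' ->] := ge_P HW m g; split=> //; exact: ZP.
- apply: inv => // m y [z [[Zz Zz1] g <-]]; exists (opP T m z).
  by have [g' ->] := ge_P HW m g; split=> //; split; [exact: ZP|exact: ZP'].
- move=> y [z [Zz g <-]]; have [le|lt] := leqP l D.
    by have [H _] := cw_dg (Zd _ Zz) l; exact: H.
  by have [_ ->] := cw_dg (Zd _ Zz) l; rewrite // ; exact: dg0.
- have [z [Zz nZz g]] := Ql; exists (cw l z); first by exists z.
  move=> [z' [[Zz' Zz1'] g' E]]; apply: nZz; rewrite -[z](subrK z') addrC.
  by apply: (ZD') => //; apply: (small); [exact: ZB|exact: geS].
exists y, (lw_mul (th l) Th'); split=> //; first by move=> Zy'; apply: nA; exists y.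
  by exists l, Th'.
move=> m; have [gP clP] := ge_P HW m gy.
have [z [[Zz Zz1] gz ez]] : A' (cw l (opP T m y - lw_mul (th l) Th' m *: y)).
  rewrite linearB linearZ /= clP /lw_mul scaler_suml -sumrB.
  have [A0 Al] := lin_A'.
  apply: big_ind => // [u w Au Aw|i _]; first by rewrite -[u]scale1r; exact: Al.
  rewrite -scalerA -scalerBr -[_ *: _]addr0; exact: Al.
rewrite -[_ - _](subrK z) addrC; apply: (ZD') => //; apply: (small).
  by apply: (ZB) => //; apply: (ZB); [exact: ZP|exact: ZZ].
apply: (geS) => //.
by rewrite addrC -scaleN1r scalerA; apply: gel.
Qed.

Lemma sing_P V Ps v (HV : @hwm _ h V Ps v) d m (u : V) : dg Ps d u -> sing u -> sing (opP V m u).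
Proof.
move=> du su; elim: m u du su => [|m IH] u du su n; apply: (scalerI (expf_neq0 2 q0)).
  by rewrite opP0 -(kXm qnr) su linear0 scaler0.
rewrite scaler0; have := hwm_PX qnr HV m n u.
by rewrite !su (IH u du su) !linear0 ?scaler0 ?oppr0 ?addr0 => <-.
Qed.

Lemma flagw_rk : flagw S (rk_lw kap a be) (fun Th => exists l, Th = th l).
Proof.
move=> d Z Z' lZ lZ' ZP ZP' Zd [z Zz nZz]; exists z, (th d); split=> //; first by exists d.
move=> m; have [x ->] := rk_line qnr kap0 HS (Zd _ Zz).
by rewrite linearZ /= (rk_Ps qnr kap0) scalerA mulrC -scalerA subrr; case: lZ'.
Qed.

Section Prefundamental.
Hypothesis a0 : a = 0.

Lemma rk_th_a0 l : th l = (fun m => q ^- (2 * l) * rk_lw kap a be m).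
Proof.
apply/funext => -[|m]; first by rewrite /= /rk_kap mulrC.
rewrite /= (rk_cS qnr) /rk_b /rk_kap /rk_eta a0 !mul0r; case: m => [|m]; last first.
  by rewrite !exprS !(mul0r, mulr0, subrr).
rewrite !expr0; field; rewrite !expf_neq0 //=.
by rewrite q0 subr_eq0 -expr2 (q2_neq qnr).
Qed.

Let b0 l : b l = 0. Proof. by rewrite /rk_b a0 mul0r. Qed.
Let lw1 : rk_lw kap a be 1 = - (kap * be).
Proof. by rewrite /= a0 sub0r mulrN expr0 mulr1. Qed.
Let lw2 m : rk_lw kap a be m.+2 = 0. Proof. by rewrite /= a0 exprS mul0r mulr0. Qed.

(** The highest l-weight of the first factor is [kap (1 - be z)], and [b 0 = 0], so the component at
    0 of [X m.+1 u = 0] says that [X m.+1] and [be] times [X m] agree on [cw 0 u]. *)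
Lemma sing_cw u m : sing u -> opX W m (cw 0 u) = be ^+ m *: opX W 0 (cw 0 u).
Proof.
move=> su; elim: m => [|m IH]; first by rewrite scale1r.
have g : ge 0 u by [].
have [_ _ E] := ge_X m.+1 g; move: E; rewrite su linear0 b0 exprS !mul0r scale0r add0r.
rewrite big_ord_recl big_ord_recl big1 ?addr0 => [|i _]; last by rewrite rk_th0 // lw2 scale0r.
rewrite !rk_th0 // lw1 subn0 subSS subn0 IH => /esym/eqP.
rewrite addr_eq0 -scaleNr opprK => /eqP E; apply: (scalerI kap0); rewrite E !scalerA.
by rewrite exprS mulrA.
Qed.

(** Reduces simplicity to properties of [W]: a singular vector is determined by its component at 0,
    on which the [X m] form a geometric progression of ratio [be]. *)
Lemma ten_is_L :
  (forall l, s l.+1 != 0 -> exists n (al : nat -> C),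
  \sum_(m < n) al m *: opY W m w0 = 0 /\ \sum_(m < n) al m * Psi m != 0) ->
  (forall d u, dg Psi d.+1 u -> (forall m, opX W m u = be ^+ m *: opX W 0 u) -> u = 0) ->
  is_L PsT T.
Proof.
move=> G NZ; have HT : hwm PsT ten_top.
  apply: ten_hwm => l nz; have [n [al [z0 z1]]] := G l nz; exists n, al; split=> //.
  rewrite (eq_bigr (fun m : 'I_n => al m * Psi m)) // => m _; congr (_ * _).
  rewrite big_ord_recl big1 /= ?addr0 => [|i _]; first by rewrite expr0 mul1r subn0.
  by rewrite b0 exprS !mul0r.
split; last by exists ten_top; case: HT.
apply: (sing_simple qnr HT) => d u du su.
apply: sing_cw0 => //; apply: (NZ d) => [|m]; last exact: sing_cw.
by have [H _] := cw_dg du 0; rewrite -[d.+1]subn0; exact: H.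
Qed.
End Prefundamental.
End TensorRankOne2.

(** * Products of positive prefundamental modules *)

Section TensorPolynomial.
Variables (R : realType) (h : R[i]).
Local Notation C := R[i].
Local Notation q := (qpar h).
Hypothesis qnr : forall n : nat, (0 < n)%N -> q ^+ n != 1.
Let q0 : q != 0 := q_neq0 h.

Definition multiple (Ps : lweight R) : lweight R -> Prop :=
  fun Th => exists x, Th = (fun m => x * Ps m).

Variables (kap be : C) (kap0 : kap != 0).
Variables (S W T : bmod h) (t : S -> W -> T).
Hypothesis HS : is_L (rk_lw kap 0 be) S.
Variables (Psi : lweight R).
Hypothesis HW : is_L Psi W.
Hypothesis Ht : is_tensor t.
Local Notation PsT := (lw_mul (rk_lw kap 0 be) Psi).

Lemma lw_mulZl x f g : lw_mul (fun m => x * f m) g = (fun m : nat => x * lw_mul f g m) :> lweight R.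
Proof. by apply/funext => m; rewrite /lw_mul mulr_sumr; apply: eq_bigr => i _; rewrite mulrA. Qed.
Lemma lw_mulZr x f g : lw_mul f (fun m => x * g m) = (fun m : nat => x * lw_mul f g m) :> lweight R.
Proof. by apply/funext => m; rewrite /lw_mul mulr_sumr; apply: eq_bigr => i _; rewrite mulrCA. Qed.

(** Makes the flag property applicable to the vectors on which the [X m] form a geometric
    progression. *)
Lemma Z_stable w0 (HW0 : @hwm _ h W Psi w0) (be' : C) u N n :
  (forall m, opX W m u = be' ^+ m *: opX W 0 u) ->
  opX W n (opP W N u) = be' ^+ n *: opX W 0 (opP W N u).
Proof.
move=> Xu; elim: N n => [|N IH] n; apply: (scalerI (expf_neq0 2 q0)).
  by rewrite !opP0 -(kXm qnr) Xu linearZ /= (kXm qnr) !scalerA mulrC.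
pose VV : lmodType R[i] := W.
refine (@lin_comb _ VV (-1) _ _ _ _ (hwm_PX qnr HW0 N n u) _).
refine (@lin_comb _ VV (be' ^+ n) _ _ _ _ (hwm_PX qnr HW0 N 0 u) _).
refine (@lin_comb _ VV 1 _ _ _ _ (congr1 (opP W N.+1) (Xu n)) _).
refine (@lin_comb _ VV (- q ^+ 2) _ _ _ _ (congr1 (opP W N) (Xu n.+1)) _).
refine (@lin_comb _ VV (q ^+ 2 * be' ^+ n) _ _ _ _ (congr1 (opP W N) (Xu 1%N)) _).
refine (@lin_comb _ VV 1 _ _ _ _ (IH n.+1) _).
refine (@lin_comb _ VV (- be' ^+ n) _ _ _ _ (IH 1%N) _).
rewrite expr1 (exprS be'); lin_with (R[i]) VV; repeat split; ring.
Qed.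

Hypothesis be0 : be != 0.
Hypothesis FW : flagw W Psi (multiple Psi).
Variable d : nat.
Hypothesis Psid : Psi d != 0.
Hypothesis Psigt : forall m, (d < m)%N -> Psi m = 0.

(** Generation: [Y d w0] is singular because [Psi] has degree [d], hence it is zero, while [Psi d]
    is not. Singular vectors: they would provide an eigenvector [y] with [X m y = be^m X 0 y]; then
    [X 0 y] is an eigenvector too, and both eigenvalue series are multiples of [Psi]. The
    coefficients 0 and 1 of [hwm_PX] force [be (q^4 - 1) = 0]. *)
Lemma ten_poly : is_L PsT T /\ flagw T PsT (multiple PsT).
Proof.
have [w0 HW0] := is_L_hwm HW; have [sW _] := HW.
split; last first.
  have F := flagw_ten qnr kap0 HS HW0 Ht FW.
  move=> D Z Z' lZ lZ' ZP ZP' Zd ex; have [z [Th [Zz nZ [l [Th' [[x ->] eTh]]] H]]] := F D Z Z' lZ lZ' ZP ZP' Zd ex.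
  exists z, Th; split=> //; rewrite eTh (rk_th_a0 qnr) // lw_mulZl lw_mulZr.
  by exists (q ^- (2 * l) * x); apply/funext => m; rewrite mulrA.
apply: (ten_is_L qnr kap0 (HS := HS) HW0 Ht) => // [l _|e u du Xu].
  exists d.+1, (fun m => (m == d)%:R); split; last first.
    by rewrite big_ord_recr big1 /= ?add0r ?eqxx ?mul1r // => i _; rewrite ltn_eqF // mul0r.
  rewrite big_ord_recr big1 /= ?add0r ?eqxx ?scale1r => [|i _]; last by rewrite ltn_eqF // scale0r.
  apply: (simple_sing qnr HW0 sW (d := 0)) => [|n]; first exact/(dgY qnr)/(dg_v HW0).
  rewrite (hwm_XY qnr HW0) (hwm_Xv qnr HW0) linear0 add0r (hwm_P HW0) Psigt ?scale0r ?scaler0 //.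
  by rewrite ltnS leq_addl.
apply: contrapT => u0.
pose Z x := dg Psi e.+1 x /\ forall m, opX W m x = be ^+ m *: opX W 0 x.
have zero (D : nat) : [/\ lin_closed (fun x : W => x = 0) & forall m (x : W), x = 0 -> opP W m x = 0].
  by split=> [|m x ->]; [split=> // y x w -> ->; rewrite scaler0 addr0|rewrite linear0].
have [lz Pz] := zero 0%N.
have [||||y [Th [[dy Xy] y0 [x eTh] Hy]]] := FW (Z := Z) (Z' := fun x => x = 0) (d := e.+1) _ lz _ Pz.
- split; first by split; [exact: dg0|move=> m; rewrite !(linear0, scaler0)].
  move=> y v w [dv Xv] [dw Xw]; split; first exact: dg_lin.
  by move=> m; rewrite !linearP Xv Xw.
- by move=> m v [dv Xv]; split; [exact: (dgP qnr)|move=> n; exact: (Z_stable HW0)].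
- by move=> v [].
- by exists u.
have Py m : opP W m y = Th m *: y by apply/eqP; rewrite -subr_eq0 Hy.
have Xy0 : opX W 0 y != 0.
  apply/negP => /eqP E; apply: y0; apply: (simple_sing qnr HW0 sW dy) => m.
  by rewrite Xy E scaler0.
have PXy m : opP W m.+1 (opX W 0 y) = (q ^+ 2 * Th m.+1 - be * Th m) *: opX W 0 y
    + (q ^+ 2 * be) *: opP W m (opX W 0 y).
  pose VV : lmodType R[i] := W.
  refine (@lin_comb _ VV 1 _ _ _ _ (hwm_PX qnr HW0 m 0 y) _).
  refine (@lin_comb _ VV (q ^+ 2) _ _ _ _ (congr1 (opX W 0) (Py m.+1)) _).
  refine (@lin_comb _ VV (q ^+ 2) _ _ _ _ (congr1 (opP W m) (Xy 1%N)) _).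
  refine (@lin_comb _ VV (-1) _ _ _ _ (congr1 (opX W 1) (Py m)) _).
  refine (@lin_comb _ VV (- Th m) _ _ _ _ (Xy 1%N) _).
  by rewrite expr1; lin_with (R[i]) VV; repeat split; ring.
have PXy0 : opP W 0 (opX W 0 y) = (q ^+ 2 * Th 0%N) *: opX W 0 y.
  by rewrite opP0 (kXm qnr) -opP0 Py linearZ /= scalerA.
pose Z2 v := exists c, v = c *: opX W 0 y.
have Pline m : exists c, opP W m (opX W 0 y) = c *: opX W 0 y.
  elim: m => [|m [c E]]; first by exists (q ^+ 2 * Th 0%N).
  by rewrite PXy E; eexists; rewrite scalerA -scalerDl.
have [||||y' [Th' [[c ec] y0' [x' eTh'] Hy']]] := FW (Z := Z2) (Z' := fun x => x = 0) (d := e) _ lz _ Pz.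
- split; first by exists 0; rewrite scale0r.
  by move=> z v w [c1 ->] [c2 ->]; exists (z * c1 + c2); rewrite scalerA scalerDl.
- by move=> m v [c1 ->]; have [c2 E] := Pline m; exists (c1 * c2); rewrite linearZ /= E scalerA.
- by move=> v [c1 ->]; apply: dgZ; exact: (dgX qnr).
- by exists (opX W 0 y); [exists 1; rewrite scale1r|exact/eqP].
have c0 : c != 0 by apply: contra_notN y0' => /eqP E; rewrite ec E scale0r.
have Px m : opP W m (opX W 0 y) = Th' m *: opX W 0 y.
  apply: (scalerI c0); rewrite -linearZ -ec scalerA mulrC -scalerA -ec.
  by apply/eqP; rewrite -subr_eq0 Hy'.
have inj c1 c2 : c1 *: opX W 0 y = c2 *: opX W 0 y -> c1 = c2.
  by move/eqP; rewrite -subr_eq0 -scalerBl scaler_eq0 (negbTE Xy0) orbF subr_eq0 => /eqP.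
have e0 : Th' 0%N = q ^+ 2 * Th 0%N by apply: inj; rewrite -Px.
have e1 : Th' 1%N = q ^+ 2 * Th 1%N - be * Th 0%N + q ^+ 2 * be * Th' 0%N.
  by apply: inj; rewrite -Px PXy Px scalerA -scalerDl.
have P0 := hwm_Psi0 HW0.
rewrite eTh eTh' in e0 e1.
have x0 : x != 0.
  apply: contra_notN y0 => /eqP E; apply/eqP; have := Py 0%N; rewrite eTh E mul0r scale0r opP0.
  by move=> k0; rewrite -(opkK y) k0 linear0.
have ex' : x' = q ^+ 2 * x by apply: (mulIf P0); rewrite e0 mulrA.
have : be * (x * Psi 0%N) * (q ^+ 4 - 1) = 0.
  by move: e1; rewrite ex' => /eqP; rewrite -subr_eq0 => /eqP E; rewrite -[RHS]oppr0 -E; ring.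
move/eqP; rewrite !mulf_eq0 (negbTE be0) (negbTE x0) (negbTE P0) /= subr_eq0.
by apply/negP; apply: qnr.
Qed.
End TensorPolynomial.

(** * A prefundamental module times a module with one pole *)

Section TensorKR.
Variables (R : realType) (h : R[i]).
Local Notation C := R[i].
Local Notation q := (qpar h).
Hypothesis qnr : forall n : nat, (0 < n)%N -> q ^+ n != 1.
Let q0 : q != 0 := q_neq0 h.
Variables (kap be : C) (kap0 : kap != 0).
Variables (S W T : bmod h) (t : S -> W -> T).
Hypothesis HS : is_L (rk_lw kap 0 be) S.
Variables (kap' a' be' : C) (kap0' : kap' != 0) (be0' : be' != 0).
Local Notation Psi := (rk_lw kap' a' be').
Hypothesis HW : is_L Psi W.
Hypothesis Ht : is_tensor t.
Local Notation PsT := (lw_mul (rk_lw kap 0 be) Psi).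
Local Notation s := (rk_s HS).
Local Notation s' := (rk_s HW).
Let HW0 := rk_hwm HW.
Local Notation cw := (cw qnr kap0 HS Ht).

Let G (l : nat) : s l.+1 != 0 -> exists n (al : nat -> C),
  \sum_(m < n) al m *: opY W m (rk_v HW) = 0 /\ \sum_(m < n) al m * Psi m != 0.
Proof.
(* The relation is [Y 1 v = a' Y 0 v]; on the coefficients of [Psi] it takes the value
   [- kap' be']. *)
move=> _; exists 2%N, (fun m => if m is 0%N then - a' else 1).
rewrite !big_ord_recl !big_ord0 /= !addr0 mul1r scale1r !(rk_Yv qnr) expr0 expr1 scale1r.
split; first by rewrite scaleNr addNr.
have -> : - a' * kap' + kap' * (a' - be') * 1 = - (kap' * be') by ring.
by rewrite oppr_eq0 mulf_neq0.
Qed.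

Lemma ten_KR_hwm : hwm PsT (ten_top t HS (rk_v HW)).
Proof.
apply: (ten_hwm qnr kap0 (HS := HS) HW0 Ht) => l nz.
have [n [al [z0 z1]]] := G nz; exists n, al; split=> //.
rewrite (eq_bigr (fun m : 'I_n => al m * Psi m)) // => m _; congr (_ * _).
rewrite big_ord_recl big1 /= ?addr0 => [|i _]; first by rewrite expr0 mul1r subn0.
by rewrite /rk_b mul0r exprS !mul0r.
Qed.

(** Weight spaces of [W] are at most lines, and from degree [d.+1] to [d] the [X m] form a
    progression of ratio [rk_b h a' d], which would have to be [be]. *)
Lemma KR_Z_eq0 d (u : W) : dg Psi d.+1 u -> (forall m, opX W m u = be ^+ m *: opX W 0 u) ->
  (s' d.+1 != 0 -> rk_b h a' d != be) -> u = 0.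
Proof.
move=> du Xu H.
have [x eu] := rk_line qnr kap0' HW du.
have [e|nz] := eqVneq (s' d.+1) 0; first by rewrite eu e scaler0.
have := Xu 1%N; rewrite eu !linearZ /= !(rk_Xs qnr kap0') expr1 expr0 mul1r !scalerA => /eqP.
rewrite -subr_eq0 -scalerBl scaler_eq0 (negbTE (rk_s_le (leqnSn d) nz)) orbF.
rewrite expr1; have -> : x * (rk_b h a' d * rk_c h kap' a' be' d.+1) - x * be * rk_c h kap' a' be' d.+1 =
   x * (rk_b h a' d - be) * rk_c h kap' a' be' d.+1 by ring.
rewrite mulf_eq0 (negbTE (rk_c_neq0 qnr kap0' nz)) orbF mulf_eq0 subr_eq0 (negbTE (H nz)) orbF.
by move/eqP ->; rewrite scale0r.
Qed.

Lemma ten_KR : (forall d, s' d.+1 != 0 -> rk_b h a' d != be) -> is_L PsT T.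
Proof.
move=> H; apply: (ten_is_L qnr kap0 (HS := HS) HW0 Ht) => // d u du Xu.
exact: (KR_Z_eq0 du Xu (H d)).
Qed.

Lemma ten_KR_nosing d (u : T) : dg PsT d.+1 u -> sing u ->
  (s' d.+1 != 0 -> rk_b h a' d != be) -> u = 0.
Proof.
move=> du su H; apply: (sing_cw0 (qnr := qnr) (HS := HS) (Ht := Ht) (kap0 := kap0)) => //.
apply: (KR_Z_eq0 _ _ H) => [|m].
  by have [E _] := cw_dg qnr kap0 HS HW0 Ht du 0; rewrite -[d.+1]subn0; exact: E.
by apply: sing_cw.
Qed.

(** [ga] is chosen so that [X 0] kills [w]. The [X m] with [m > 0] do not see the second summand,
    the first factor having no pole, and they kill the first because [be = a']. *)
Lemma ten_KR_sing : be = a' -> s 1 != 0 -> s' 1 != 0 ->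
  exists w : T, [/\ w != 0, dg PsT 1 w, sing w &
    forall m, opP T m w = lw_mul (rk_lw kap 0 be) (rk_th h kap' a' be' 1) m *: w].
Proof.
move=> ea nz nz'.
have c1 := rk_c_neq0 qnr kap0 nz.
pose ga := - (kap * rk_c h kap' a' be' 1) / rk_c h kap 0 be 1.
have s0 : s 0 != 0 := hwm_neq0 (rk_hwm HS).
pose w := t (s 0) (s' 1) + ga *: t (s 1) (s' 0).
have cwE l : cw l w = (0%N == l)%:R *: s' 1 + (ga * (1%N == l)%:R) *: s' 0.
  have clP x y : cw l (x + ga *: y) = cw l x + ga *: cw l y by rewrite linearD linearZ.
  by rewrite clP (cw_s qnr kap0 Ht l _ s0) (cw_s qnr kap0 Ht l _ nz) scalerA.
have cw0w : cw 0 w = s' 1 by rewrite cwE mulr0 scale0r addr0 scale1r.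
have cw1w : cw 1 w = ga *: s' 0 by rewrite cwE scale0r add0r mulr1.
have w0 : w != 0.
  apply: contraNneq nz' => e; have := cwE 0%N.
  by rewrite e linear0 mulr0 scale0r addr0 scale1r => <-.
have dw : dg PsT 1 w.
  have kP x y : opk T (x + ga *: y) = opk T x + ga *: opk T y by rewrite linearD linearZ.
  rewrite /dg /w kP !ten_k // !(rk_ks qnr) // !(tlZ Ht) !(trZ Ht) scalerDr !scalerA.
  rewrite /lam /rk_kap /lw_mul big_ord1 /= muln0 expr0 invr1 !mulr1.
  by congr (_ *: _ + _ *: _); ring.
have sw : sing w.
  move=> m; apply: (cw0 (HS := HS) (qnr := qnr) (kap0 := kap0) (Ht := Ht)) => l.
  have dX : dg PsT 0 (opX T m w) by exact: (dgX qnr).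
  case: l => [|l]; last by have [_ ->] := cw_dg qnr kap0 HS HW0 Ht dX l.+1.
  have [_ _ ->] := @ge_X _ _ qnr _ _ _ kap0 _ _ _ _ HS Ht m 0%N w (fun _ => ltac:(by [])).
  rewrite cw0w cw1w.
  have -> : rk_b h 0 0 = 0 by rewrite /rk_b mul0r.
  case: m {dX} => [|m].
    rewrite big_ord1 expr0 mul1r rk_th0 // (rk_X0 qnr kap0') !scalerA -scalerDl.
    by rewrite /ga mulrC -mulrA mulVf // mulr1 addNr scale0r.
  rewrite exprS !mul0r scale0r add0r.
  rewrite big_ord_recl big_ord_recl big1 ?addr0 => [|i _]; last first.
    by rewrite rk_th0 //= exprS mul0r mulr0 scale0r.
  rewrite !rk_th0 // subn0 subSS subn0 !(rk_Xs qnr kap0') !scalerA -scalerDl ea.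
  have -> : rk_b h a' 0 = a' by rewrite /rk_b muln0 expr0 invr1 mulr1.
  rewrite (exprS a') (_ : _ + _ = 0) ?scale0r //= expr0; ring.
exists w; split=> // m; apply/eqP; rewrite -subr_eq0; apply/eqP.
apply: (sing_cw0 (qnr := qnr) (HS := HS) (Ht := Ht) (kap0 := kap0)).
  move=> n; have := sing_P qnr ten_KR_hwm m dw sw n; rewrite linearB linearZ /= => ->.
  by rewrite sw scaler0 subr0.
have [_ E] := @ge_P _ _ qnr _ _ _ kap0 _ _ _ _ HS _ _ HW0 Ht m 0%N w (fun _ => ltac:(by [])).
rewrite linearB linearZ E [X in _ - X]/= cw0w /lw_mul scaler_suml -sumrB.
apply: big1 => i _; by rewrite (rk_Ps qnr kap0') rk_th0 // scalerA subrr.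
Qed.
End TensorKR.

Section FlagTransport.
Variables (R : realType) (h : R[i]).
Hypothesis qnr : forall n : nat, (0 < n)%N -> (qpar h) ^+ n != 1.

Lemma flagw_sub (V : bmod h) Psi (Sg Sg' : lweight R -> Prop) : (forall Th, Sg Th -> Sg' Th) ->
  flagw V Psi Sg -> flagw V Psi Sg'.
Proof.
move=> sub F d Z Z' lZ lZ' ZP ZP' Zd ex; have [z [Th [? ? ? ?]]] := F d Z Z' lZ lZ' ZP ZP' Zd ex.
by exists z, Th; split=> //; exact: sub.
Qed.

Lemma bhom_op (V W : bmod h) (f : V -> W) : bhom f ->
  [/\ forall m x, f (opP V m x) = opP W m (f x), forall m x, f (opX V m x) = opX W m (f x),
      forall m x, f (opY V m x) = opY W m (f x) & forall x, f (opk V x) = opk W (f x)].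
Proof.
move=> bf; split=> *; rewrite ?opPE ?opXE ?opYE ?opkE; try exact: bhom_tact.
by case: bf => _ ->.
Qed.

Lemma flagw_biso (V W : bmod h) Psi Sg : biso V W -> flagw V Psi Sg -> flagw W Psi Sg.
Proof.
move=> [f [bf [g fK gK]]] F d Z Z' [Z0 Zl] [Z0' Zl'] ZP ZP' Zd [z0 Zz0 nZz0].
have [fl _] := bf; have [fP _ _ fk] := bhom_op bf.
have f0 := bhom0 bf.
have fB x u w : f (u - x *: w) = f u - x *: f w.
  have -> : u - x *: w = - x *: w + u by rewrite scaleNr addrC.
  by rewrite fl scaleNr addrC.
have [||||||z [Th [Zz nZ ST H]]] := F d (fun x => Z (f x)) (fun x => Z' (f x)).
- by split=> [|x u w Zu Zw]; rewrite ?f0 // fl; exact: Zl.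
- by split=> [|x u w Zu Zw]; rewrite ?f0 // fl; exact: Zl'.
- by move=> m u Zu; rewrite fP; exact: ZP.
- by move=> m u Zu; rewrite fP; exact: ZP'.
- move=> u /Zd; rewrite /dg -fk => E; apply: (can_inj fK); rewrite E.
  by have := fl (lam h Psi d) u 0; rewrite !addr0 f0 addr0 => ->.
- by exists (g z0); rewrite gK.
by exists (f z), Th; split=> // m; rewrite -fP -fB.
Qed.
End FlagTransport.

Local Open Scope quotient_scope.

(** * Quotient modules *)

Section QuotientModule.
Variables (R : realType) (h : R[i]) (A : bmod h) (K : set A).
Hypothesis HK : submodule K.
Local Notation I := (in_sub (submodule_lin HK)).
Definition quo := Quotient.quot I.
HB.instance Definition _ := GRing.Zmodule.on quo.

Definition qpr (x : A) : quo := \pi_quo x.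
Definition qrp (x : quo) : A := repr x.

Lemma qrpK x : qpr (qrp x) = x. Proof. exact: reprK. Qed.
Lemma qprE x y : qpr x = qpr y <-> K (x - y).
Proof.
split=> [/eqP|H]; first by rewrite -Quotient.idealrBE => /asboolP.
by apply/eqP; rewrite -Quotient.idealrBE; apply/asboolP.
Qed.
Lemma qprD x y : qpr (x + y) = qpr x + qpr y.
Proof. exact: (Quotient.pi_add I). Qed.
Lemma qpr0 : qpr 0 = 0. Proof. by apply: (addIr (qpr 0)); rewrite -qprD !add0r. Qed.
Lemma qpr0E x : qpr x = 0 <-> K x.
Proof. by rewrite -qpr0 qprE subr0. Qed.

Let KZ a x : K x -> K (a *: x).
Proof. by case: HK => K0 Kl _ Kx; rewrite -[_ *: _]addr0; exact: Kl. Qed.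

Definition qscale a (x : quo) : quo := qpr (a *: qrp x).
Lemma qscaleE a x : qscale a (qpr x) = qpr (a *: x).
Proof. by apply/qprE; rewrite -scalerBr; apply/KZ/qprE; rewrite qrpK. Qed.

Lemma qscaleA a b v : qscale a (qscale b v) = qscale (a * b) v.
Proof. by rewrite -[v]qrpK !qscaleE scalerA. Qed.
Lemma qscale1 : left_id 1 qscale.
Proof. by move=> v; rewrite -[v]qrpK qscaleE scale1r. Qed.
Lemma qscaleDr : right_distributive qscale +%R.
Proof. by move=> a u v; rewrite -[u]qrpK -[v]qrpK -qprD !qscaleE -qprD scalerDr. Qed.
Lemma qscaleDl v : {morph qscale^~ v : a b / a + b}.
Proof. by move=> a b; rewrite -[v]qrpK !qscaleE -qprD scalerDl. Qed.
HB.instance Definition _ := GRing.Zmodule_isLmodule.Build R[i] quo qscaleA qscale1 qscaleDr qscaleDl.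

Lemma qprZ a x : qpr (a *: x) = a *: qpr x. Proof. by rewrite -qscaleE. Qed.
Lemma qpr_lin : linear qpr. Proof. by move=> a x y; rewrite qprD qprZ. Qed.
HB.instance Definition _ := GRing.isLinear.Build _ _ _ _ qpr qpr_lin.

Definition qact g (x : quo) : quo := qpr (bact A g (qrp x)).
Lemma qactE g x : qact g (qpr x) = qpr (bact A g x).
Proof.
apply/qprE; rewrite -linearB; case: HK => _ _; apply.
by apply/qprE; rewrite qrpK.
Qed.
Lemma qact_lin g : linear (qact g).
Proof. by move=> a x y; rewrite -[x]qrpK -[y]qrpK -qpr_lin !qactE linearP qpr_lin. Qed.
HB.instance Definition _ g := GRing.isLinear.Build _ _ _ _ (qact g) (qact_lin g).

Lemma qtact tm x : tact (fun g => qact g) tm (qpr x) = qpr (tact (bact A) tm x).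
Proof.
elim: tm x => //= [g x|a x|s IHs t IHt x|s IHs t IHt x]; rewrite ?IHt ?IHs //.
- exact: qactE.
- by rewrite qprZ.
- by rewrite qprD.
Qed.

Definition quo_bmod : bmod h.
Proof.
refine (@BMod R h quo (fun g => qact g) _).
by move=> s t st x; rewrite -[x]qrpK !qtact (bact_rel st).
Defined.

Lemma qpr_hom : bhom (V := A) (W := quo_bmod) qpr.
Proof. by split=> [|g x]; [exact: qpr_lin|rewrite -[RHS]/(qact g (qpr x)) qactE]. Qed.
End QuotientModule.

(** * Simple subquotients and their multiplicities *)

Section Subquotients.
Variables (R : realType) (h : R[i]).
Local Notation C := R[i].
Local Notation q := (qpar h).
Hypothesis qnr : forall n : nat, (0 < n)%N -> q ^+ n != 1.
Implicit Types (V W S T : bmod h).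

Lemma subm0 V (N : set V) : submodule N -> N 0. Proof. by case. Qed.
Lemma submZ V (N : set V) a u : submodule N -> N u -> N (a *: u).
Proof. by case=> N0 Nl _ Nu; rewrite -[_ *: _]addr0; exact: Nl. Qed.
Lemma submL V (N : set V) a u w : submodule N -> N u -> N w -> N (a *: u + w).
Proof. by case=> _ + _; apply. Qed.
Lemma submA V (N : set V) g u : submodule N -> N u -> N (bact V g u).
Proof. by case=> _ _; apply. Qed.
Lemma submD V (N : set V) u w : submodule N -> N u -> N w -> N (u + w).
Proof. by case=> N0 Nl _ Nu; rewrite -[u]scale1r; exact: Nl. Qed.
Lemma submB V (N : set V) u w : submodule N -> N u -> N w -> N (u - w).
Proof. by move=> sN Nu Nw; apply: submD => //; rewrite -scaleN1r; exact: submZ. Qed.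

(** Zorn's lemma, applied to sets [A] considered through their union with [N'], so that the empty
    chain, with empty union, needs no separate treatment. *)
Lemma max_submod V (N' N : set V) u : submodule N' -> submodule N -> N' `<=` N -> ~ N' u ->
  exists M, [/\ submodule M, N' `<=` M, M `<=` N, ~ M u &
    forall K, submodule K -> M `<=` K -> K `<=` N -> ~ K u -> K `<=` M].
Proof.
move=> sN' sN sub nu.
pose P (A : set V) := [/\ submodule (A `|` N'), A `<=` N & ~ (A `|` N') u].
have [F FP tot|A [[sA AN nAu] mx]] := @Zorn_bigcup V P.
  have tot2 x y : (\bigcup_(X in F) X `|` N') x -> (\bigcup_(X in F) X `|` N') y ->
      exists A, [/\ P A, (A `|` N') x, (A `|` N') y & A `<=` \bigcup_(X in F) X].
    have sb X : F X -> X `<=` \bigcup_(X in F) X by move=> FX z; exists X.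
    move=> [[X FX Xx]|N'x] [[Y FY Yy]|N'y].
    - have [XY|YX] := tot X Y FX FY.
        by exists Y; split; [exact: FP|left; exact: XY|left|exact: sb].
      by exists X; split; [exact: FP|left|left; exact: YX|exact: sb].
    - by exists X; split; [exact: FP|left|right|exact: sb].
    - by exists Y; split; [exact: FP|right|left|exact: sb].
    - by exists set0; split; [split; rewrite ?set0U //|right|right|].
  have lift (A : set V) : A `<=` \bigcup_(X in F) X -> A `|` N' `<=` \bigcup_(X in F) X `|` N'.
    by move=> H z [/H|]; [left|right].
  split; last by move=> [[X FX Xu]|//]; have [_ _] := FP _ FX; apply; left.
    split; first by right; exact: subm0.
      by move=> a x y Hx Hy; have [A [[[_ Al _] _ _] Ax Ay /lift]] := tot2 x y Hx Hy; apply; exact: Al.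
    by move=> g x Hx; have [A [[[_ _ Ag] _ _] Ax _ /lift]] := tot2 x x Hx Hx; apply; exact: Ag.
  by move=> x [X FX Xx]; have [_ XN _] := FP _ FX; exact: XN.
have N'A : N' `<=` A `|` N' by move=> x; right.
have ANN : A `|` N' `<=` N by move=> x [/AN|/sub].
exists (A `|` N'); split=> //.
move=> K sK MK KN nK x Kx.
apply: contrapT => nMx; apply: (mx K); first by split=> [z Az|H]; [apply: MK; left|apply: nMx; left; exact: H].
have E : K `|` N' = K by apply/seteqP; split=> z; [case=> // Nz; apply: MK; right|left].
by split; rewrite ?E.
Qed.

(** [M'] is maximal between [N'] and [N] among the submodules without [u], and [M] is [M'] plus the
    module generated by [u]. A submodule between [M'] and [M] either contains [u] and is [M], or is
    [M'] by maximality. *)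
Lemma simple_subquo V (N' N : set V) u Th : submodule N' -> submodule N -> N' `<=` N ->
  N u -> ~ N' u -> N' (opX V 0 u) -> (forall m, N' (opP V m u - Th m *: u)) ->
  exists M' M S, [/\ N' `<=` M', M `<=` N, is_L Th S & subquotient_iso M' M S].
Proof.
move=> sN' sN sub Nu nu Xu Pu.
have [M' [sM' NM' M'N nM'u mx]] := max_submod sN' sN sub nu.
pose M : set V := fun x => exists2 z, M' z & exists tm, x = z + tact (fun g => bact V g) tm u.
have sM : submodule M.
  split.
  - by exists 0; [exact: subm0|exists (TCst 0); rewrite /= scale0r addr0].
  - move=> a _ _ [z Mz [tm ->]] [z' Mz' [tm' ->]]; exists (a *: z + z').
      by case: sM' => _ + _; apply.
    by exists (TAdd (TMul (TCst a) tm) tm'); rewrite /= scalerDr addrACA.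
  - move=> g _ [z Mz [tm ->]]; exists (bact V g z); first by case: sM' => _ _; apply.
    by exists (TMul (TGen g) tm); rewrite linearD.
have Mu : M u by exists 0; [exact: subm0|exists (TCst 1); rewrite /= scale1r add0r].
have M'M : M' `<=` M by move=> z Mz; exists z => //; exists (TCst 0); rewrite /= scale0r addr0.
have MN : M `<=` N.
  by move=> _ [z Mz [tm ->]]; apply: submD => //; [exact: M'N|exact: submod_tact].
pose A := sub_bmod sM.
pose K : set A := fun x => M' (val x).
have sK : submodule K.
  have [M0 Ml Mg] := sM'; split=> [|a x y Kx Ky|g x Kx]; rewrite /K; first exact: M0.
    by rewrite -[val _]/(a *: val x + val y); exact: Ml.
  by rewrite sub_actE; exact: Mg.
pose S := quo_bmod sK; pose pr : A -> S := qpr sK.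
pose uA : A := sub_of (submodule_lin sM) Mu.
have pr0 x : pr x = 0 <-> M' (val x) by exact: qpr0E.
have prop := bhom_op (qpr_hom sK).
have simS : simple_mod S.
  split; first by exists (pr uA); apply/eqP => /pr0.
  move=> L sL; pose L' : set V := fun x => exists2 y : A, val y = x & L (pr y).
  have [plin pg] := qpr_hom sK.
  have sL' : submodule L'.
    have [L0 Ll Lg] := sL; split.
    - by exists 0 => //; rewrite /pr linear0.
    - move=> a _ _ [x <- Lx] [y <- Ly]; exists (a *: x + y); first by rewrite linearP.
      by rewrite /pr plin; exact: Ll.
    - by move=> g _ [x <- Lx]; exists (bact A g x); rewrite // /pr pg; exact: Lg.
  have ML' : M' `<=` L'.
    move=> x Mx; exists (sub_of (submodule_lin sM) (M'M x Mx)) => //.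
    by have -> : pr (sub_of (submodule_lin sM) (M'M x Mx)) = 0 by [exact/pr0|]; exact: subm0.
  have L'M : L' `<=` M by move=> _ [y <- _]; exact: sub_memP.
  have [L'u|nL'u] := pselect (L' u).
    right; apply/seteqP; split=> // z _; have [z0 Mz0 [tm E]] := sub_memP (qrp z : A).
    have [y Ey Ly] : L' (val (qrp z)).
      rewrite E; apply: submD => //; first exact: ML'.
      exact: submod_tact.
    by have <- : pr y = z by [rewrite (val_inj Ey); exact: qrpK|].
  left; apply/seteqP; split=> z /=; last by move=> ->; exact: (subm0 sL).
  move=> Lz; rewrite -[z]qrpK; apply/pr0.
  apply: (mx L') => //; first by move=> x /L'M/MN.
  by exists (qrp z) => //; rewrite /pr qrpK.
exists M', M, S; split=> //.
  split=> //; exists (pr uA); have [pP pX _ _] := prop; split.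
  - by apply/eqP => /pr0.
  - rewrite -opX0E -pX; apply/pr0; rewrite opXE sub_tactE -opXE; exact: NM'.
  - move=> m; rewrite -opPE -pP; apply/eqP; rewrite -subr_eq0 -scaleNr addrC; apply/eqP.
    rewrite -[_ + _](qpr_lin sK); apply/pr0.
    rewrite /= opPE sub_tactE -opPE scaleNr addrC; exact/NM'/Pu.
split=> //; exists (fun x => if pselect (M x) is left Mx then pr (sub_of (submodule_lin sM) Mx) else 0).
have fE x (Mx : M x) : (if pselect (M x) is left Mx then pr (sub_of (submodule_lin sM) Mx) else 0) =
    pr (sub_of (submodule_lin sM) Mx).
  by case: pselect => // Mx'; congr pr; exact: val_inj.
split.
- move=> a x y Mx My; have Mxy : M (a *: x + y) by exact: submL.
  rewrite (fE _ Mx) (fE _ My) (fE _ Mxy) -[RHS](qpr_lin sK); congr (qpr _ _).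
  exact: val_inj.
- move=> g x Mx; have Mgx : M (bact V g x) by exact: submA.
  have [_ pg] := qpr_hom sK.
  by rewrite (fE _ Mx) (fE _ Mgx) -pg; congr (qpr _ _); apply: val_inj.
- move=> z; exists (val (qrp z : A)); first exact: sub_memP.
  by rewrite (fE _ (sub_memP (qrp z : A))) -[RHS]qrpK; congr (qpr _ _); apply: val_inj.
- by move=> x Mx; rewrite (fE _ Mx) pr0.
Qed.

Definition sq_hom V (N' N : set V) S (f : V -> S) :=
  [/\ forall (a : C) x y, N x -> N y -> f (a *: x + y) = a *: f x + f y,
      forall g x, N x -> f (bact V g x) = bact S g (f x),
      forall s, exists2 x, N x & f x = s &
      forall x, N x -> (f x = 0 <-> N' x)].

Lemma sq0 V (N' N : set V) S (f : V -> S) : submodule N -> sq_hom N' N f -> f 0 = 0.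
Proof.
by move=> [N0 _ _] [fl _ _ _]; have := fl (-1) 0 0 N0 N0; rewrite scaler0 addr0 scaleN1r addNr.
Qed.

Lemma sq_sum V (N' N : set V) S (f : V -> S) n (x : nat -> V) : submodule N -> sq_hom N' N f ->
  (forall i, (i < n)%N -> N (x i)) -> N (\sum_(i < n) x i) /\ f (\sum_(i < n) x i) = \sum_(i < n) f (x i).
Proof.
move=> sN [fl _ _ f0]; have [N0 Nl _] := sN.
have f00 : f 0 = 0 by have := fl (-1) 0 0 N0 N0; rewrite scaler0 addr0 scaleN1r addNr.
elim: n => [|n IH] H; first by rewrite !big_ord0.
have [Ns fs] := IH (fun i lt => H i (ltnW lt)); rewrite !big_ord_recr /=; split.
  by apply: submD => //; exact: H.
by rewrite -{1}[\sum_(i < n) _]scale1r fl ?fs ?scale1r //; exact: H.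
Qed.

Definition graded V (Psi : lweight R) := forall u : V, exists D (f : nat -> V),
  [/\ forall e, dg Psi e (f e), forall e, (D <= e)%N -> f e = 0 & u = \sum_(e < D) f e].

Definition findim V (Psi : lweight R) := forall d, exists m (b : 'I_m -> V), forall u,
  dg Psi d u -> exists c : 'I_m -> C, u = \sum_i c i *: b i.

Lemma eig_sum0 S (mu : nat -> C) (lam0 : C) D (y : nat -> S) : injective mu ->
  (forall e, (e < D)%N -> opk S (y e) = mu e *: y e) ->
  opk S (\sum_(e < D) y e) = lam0 *: (\sum_(e < D) y e) -> forall e, (e < D)%N -> y e != 0 -> mu e = lam0.
Proof.
move=> inj ky kS e lt nz.
have := @eig_sub _ _ (opk S) mu inj (fun x => x = 0) erefl _ _ D (fun e => (mu e - lam0) *: y e).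
case/(_ _ _ _ _ e lt)/Wrap.
- by move=> a u w -> ->; rewrite scaler0 addr0.
- by move=> u ->; rewrite linear0.
- by move=> i lti; rewrite linearZ /= ky // !scalerA mulrC.
- rewrite (eq_bigr (fun e : 'I_D => opk S (y e) - lam0 *: y e)) => [|i _].
    by rewrite sumrB -linear_sum -scaler_sumr kS subrr.
  by rewrite ky // scalerBl.
by move=> /eqP; rewrite scaler_eq0 (negbTE nz) orbF subr_eq0 => /eqP.
Qed.

(** Some homogeneous component of a preimage of the highest l-weight vector lies outside [N']; the
    eigenvalue of [k_1] determines its degree. *)
Lemma sq_lift V Psi (N' N : set V) S Th (v : S) (f : V -> S) : Psi 0%N != 0 -> graded V Psi ->
  hwm Th v -> submodule N -> sq_hom N' N f ->
  exists e x, [/\ N x, ~ N' x, dg Psi e x & Th 0%N = lam h Psi e].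
Proof.
move=> P0 gV HS sN hf; have [fl fg fs f0] := hf.
have [x Nx fx] := fs v; have [D [y [dy y0 ex]]] := gV x.
have Ny e : (e < D)%N -> N (y e).
  apply: (deg_sub qnr P0 (N := N) (D := D)) => // [|u Nu|]; last by rewrite -ex.
    by case: sN.
  by rewrite opkE; case: sN => _ _; apply.
have [_ fsum] := sq_sum sN hf Ny; rewrite -ex fx in fsum.
have [e lt nz] : exists2 e, (e < D)%N & f (y e) != 0.
  apply: contrapT => H; have := hwm_neq0 HS; rewrite fsum big1 ?eqxx // => e _.
  by apply/eqP; apply: contrapT => /negP nz; apply: H; exists (e : nat).
exists e, (y e); split=> //; first exact: Ny.
  by move=> /(f0 _ (Ny _ lt)) E; rewrite E eqxx in nz.
apply/esym; apply: (@eig_sum0 S (lam h Psi) _ D (fun e => f (y e))) lt nz => //.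
- exact: lam_injective.
- move=> i lti; rewrite opkE -fg; last exact: Ny.
  have := fl (lam h Psi i) (y i) 0 (Ny _ lti) (subm0 sN).
  have f00 := sq0 sN hf.
  by rewrite !addr0 f00 addr0 -(dy i) opkE.
- by rewrite -fsum -opP0 (hwm_P HS).
Qed.

Lemma indep_bound V n m (x : 'I_n -> V) (b : 'I_m -> V) :
  (forall c : 'I_n -> C, \sum_i c i *: x i = 0 -> forall i, c i = 0) ->
  (forall i, exists c : 'I_m -> C, x i = \sum_j c j *: b j) -> (n <= m)%N.
Proof.
move=> fr sp; have [A EA] := choice sp; rewrite leqNgt; apply/negP => lt.
pose M : 'M[C]_(n, m) := \matrix_(i, j) A i j.
have : kermx M != 0.
  by rewrite -mxrank_eq0 mxrank_ker -lt0n subn_gt0 (leq_ltn_trans (rank_leq_col M)).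
case/rowV0Pn => r /sub_kermxP rM /eqP; apply; apply/rowP => i; rewrite mxE.
apply: (fr (fun i => r 0 i)).
rewrite (eq_bigr (fun i => \sum_j (r 0 i * M i j) *: b j)) => [|j _]; last first.
  by rewrite EA scaler_sumr; apply: eq_bigr => k _; rewrite scalerA mxE.
rewrite exchange_big /= big1 // => j _; rewrite -scaler_suml.
by have /rowP/(_ j) := rM; rewrite !mxE => ->; rewrite scale0r.
Qed.

(** In a linear relation, the vector of largest index with a nonzero coefficient would lie in the
    [N'] of its own step. *)
Lemma chain_free V n (N' N : nat -> set V) (x : nat -> V) :
  (forall i, (i < n)%N -> [/\ submodule (N' i), submodule (N i), N' i `<=` N i, N i (x i) & ~ N' i (x i)]) ->
  (forall i, (i.+1 < n)%N -> N i `<=` N' i.+1) ->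
  forall c : 'I_n -> C, \sum_i c i *: x i = 0 -> forall i, c i = 0.
Proof.
move=> H sub c.
have [c' cc] : exists c' : nat -> C, forall i : 'I_n, c i = c' i.
  by exists (fun i => if insub i is Some j then c j else 0) => i; rewrite valK.
rewrite (eq_bigr (fun i : 'I_n => c' i *: x i)) => [|i _]; last by rewrite cc.
move=> s0 i; rewrite cc; move: (val i) (ltn_ord i) => {}i; move: s0; move: {c cc} c' i => c i s0; move: s0.
elim: n H sub c i => [//|n IH] H sub c i.
have NN j : (j < n)%N -> N j `<=` N' n.
  elim: n {IH i} H sub => [//|m IHm] H sub; rewrite ltnS leq_eqVlt => /orP[/eqP ->|lt]; first exact: sub.
  apply: subset_trans (sub m (ltnSn _)); apply: subset_trans (_ : N' m `<=` N m).
    by apply: IHm => // k lk; [apply: H; exact: ltnW|apply: sub; exact: ltnW].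
  by have [_ _ H' _ _] := H m (ltnW (ltnSn _)); exact: H'.
have [sN' sN _ Nx nx] := H n (ltnSn _).
rewrite big_ord_recr /= => s0.
have Ns : N' n (\sum_(j < n) c j *: x j).
  apply: (@big_ind _ (N' n)) => [|u w|j _]; [exact: subm0|exact: submD|].
  by apply: submZ => //; apply: (NN j) => //; have [] := H j (ltnW (ltn_ord j : (j < n)%N)).
have cn : c n = 0.
  apply/eqP; apply: contrapT => /negP cn; apply: nx.
  have -> : x n = - (c n)^-1 *: \sum_(j < n) c j *: x j.
    by move/eqP: s0; rewrite addr_eq0 => /eqP ->; rewrite scaleNr scalerN opprK scalerA mulVf // scale1r.
  exact: submZ.
rewrite ltnS leq_eqVlt => /orP[/eqP ->//|]; apply: IH.
- by move=> j lt; apply: H; exact: ltnW.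
- by move=> j lt; apply: sub; exact: ltnW.
- by move: s0; rewrite cn scale0r addr0.
Qed.

Lemma occurs_le V S n m : (m <= n)%N -> occurs_times V S n -> occurs_times V S m.
Proof.
move=> le [N' [N [H sub]]]; exists N', N; split=> i lt; [apply: H|apply: sub]; exact: leq_trans le.
Qed.

Lemma has_mult_uniq V S n m : has_mult V S n -> has_mult V S m -> n = m.
Proof.
move=> [On nOn] [Om nOm]; have [lt|lt|//] := ltngtP n m.
  by case: nOn; exact: occurs_le Om.
by case: nOm; exact: occurs_le On.
Qed.

(** Each occurrence of [S] contributes one vector to the space of its highest weight, and these are
    independent, so their number is bounded by the dimension. *)
Lemma mult_exists V Psi S Th : Psi 0%N != 0 -> graded V Psi -> findim V Psi -> is_L Th S ->
  exists n, has_mult V S n.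
Proof.
move=> P0 gV fV HS; have [v Hv] := is_L_hwm HS.
have O0 : occurs_times V S 0 by exists (fun=> set0), (fun=> set0).
have [B HB] : exists B, forall n, occurs_times V S n -> (n <= B)%N.
  have [[e Ee]|ne] := pselect (exists e, Th 0%N = lam h Psi e); last first.
    exists 0%N => -[//|n] [N' [N [H _]]]; exfalso; apply: ne.
    have [_ sN _ [f hf]] := H 0%N isT.
    by have [e [x [_ _ _ E]]] := sq_lift P0 gV Hv sN hf; exists e.
  have [m [b Hb]] := fV e; exists m => n [N' [N [H sub]]].
  have ex i : exists x, (i < n)%N -> [/\ N i x, ~ N' i x & dg Psi e x].
    have [lt|] := boolP (i < n)%N; last by exists 0.
    have [_ sN _ [f hf]] := H i lt.
    have [e' [x [Nx nx dx E]]] := sq_lift P0 gV Hv sN hf; exists x => _; split=> //.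
    by rewrite (lam_injective qnr P0 (etrans (esym Ee) E)).
  have [x Hx] := choice ex.
  apply: (@indep_bound V n m (fun i => x i) b) => [|i].
    apply: (chain_free (N' := N') (N := N)) => // i lt.
    have [sN' sN NN _] := H i lt; have [? ? ?] := Hx i lt; by split.
  by apply: Hb; have [] := Hx i (ltn_ord i).
have [|n /asboolP On mx] := @ex_maxnP (fun n => `[< occurs_times V S n >]) B _ (fun n H => HB n (elimT (asboolP _) H)).
  by exists 0%N; exact/asboolP.
by exists n; split=> // On1; have := mx _ (introT (asboolP _) On1); rewrite ltnn.
Qed.

Lemma submod_triv V : submodule [set 0 : V] /\ submodule (@setT V).
Proof.
split; split=> //= [a x y -> ->|g x ->]; last by rewrite linear0.
by rewrite scaler0 addr0.
Qed.

Lemma bhom_sub V W (f : V -> W) (K : set W) : bhom f -> submodule K -> submodule [set x | K (f x)].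
Proof.
move=> bf [K0 Kl Kg]; have [fl fg] := bf; split=> /= [|a x y|g x Kx].
- by rewrite (bhom0 bf).
- by rewrite fl; exact: Kl.
- by rewrite fg; exact: Kg.
Qed.

Lemma sq_full V S (f : V -> S) : bhom f -> (forall s, exists x, f x = s) ->
  subquotient_iso [set x | f x = 0] setT S.
Proof.
move=> bf fs; have [fl fg] := bf; have [_ sT] := submod_triv V.
split=> //; first exact: bhom_ker.
exists f; split=> //; first by move=> a x y _ _; exact: fl.
by move=> s; have [x] := fs s; exists x.
Qed.

Lemma simple_occurs V S n : simple_mod V -> (exists s : S, s != 0) ->
  occurs_times V S n.+1 -> n = 0%N /\ biso V S.
Proof.
move=> sV [s0 s0n].
move=> [N' [N [H sub]]].
have full i : (i < n.+1)%N -> N i = setT /\ N' i = [set 0].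
  move=> lt; have [sN' sN NN [f [fl fg fs f0]]] := H i lt.
  have [x Nx fx] := fs s0.
  have nN'x : ~ N' i x by move=> /(f0 _ Nx) E; rewrite -fx E eqxx in s0n.
  have f00 : f 0 = 0 by have := fl (-1) 0 0 (subm0 sN) (subm0 sN); rewrite scaler0 addr0 scaleN1r addNr.
  have [_ sV2] := sV; split.
    have [E|//] := sV2 _ sN; exfalso; move: Nx; rewrite E /= => x0.
    by apply: nN'x; rewrite x0; exact: subm0.
  have [//|E] := sV2 _ sN'; exfalso; apply: nN'x; by rewrite E.
split.
  case: n H sub full => [//|n] H sub full; have [N0 _] := full 0%N isT; have [_ N1] := full 1%N isT.
  have Z := sub 0%N isT; rewrite N0 N1 in Z.
  by have [[v v0] _] := sV; have /= E := Z v I; rewrite E eqxx in v0.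
have [N0 N1] := full 0%N isT; have [_ _ _ [f]] := H 0%N isT; rewrite N0 N1 => -[fl fg fs f0].
exists f; have bf : bhom f by split=> [a x y|g x]; [exact: fl|exact: fg].
split=> //; have injf : injective f by apply: (bhom_inj bf) => x /(f0 x I).
have [g gE] := choice (fun s => let: ex_intro2 x _ E := fs s in ex_intro _ x E).
by exists g => x //; apply: injf; rewrite gE.
Qed.

Lemma simple_mult V S Th Th' : is_L Th V -> is_L Th' S -> has_mult V S `[< Th' = Th >].
Proof.
move=> HV HS; have [sV _] := HV; have [[nS _] _] := HS.
have two n := @simple_occurs V S n sV nS.
split.
  case: asboolP => [E|_]; last by exists (fun=> set0), (fun=> set0).
  exists (fun=> [set 0]), (fun=> setT); split=> [i _|//].
  rewrite E in HS; have [f [bf [g fK gK]]] := is_L_iso qnr HV HS.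
  have := sq_full bf (fun s => ex_intro _ (g s) (gK s)).
  have -> // : [set x | f x = 0] = [set 0].
  apply/seteqP; split=> x /=; last by move=> ->; exact: bhom0.
  by move=> fx; apply: (can_inj fK); rewrite fx (bhom0 bf).
case: asboolP => [E /two[]//|nE /two[_ iso]]; apply: nE.
exact: (is_L_uniq qnr HS (is_L_transport iso HV)).
Qed.

(** [key] sorts the occurrences of [S]: if [M] has a vector of [N1] outside [M'], then [S] is [N1],
    otherwise it is [B]. Two occurrences in one chain would use the same factor twice or force
    [Th1 = Th2]. *)
Lemma length2_mult V (B S : bmod h) (N1 : set V) (sN1 : submodule N1) Th1 Th2 Th (g : V -> B) :
  is_L Th1 (sub_bmod sN1) -> is_L Th2 B -> bhom g -> (forall y, exists x, g x = y) ->
  (forall x, g x = 0 <-> N1 x) -> Th1 <> Th2 -> is_L Th S ->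
  has_mult V S (`[< Th = Th1 >] + `[< Th = Th2 >]).
Proof.
move=> H1 H2 bg gs gk ne HS; have [gl gg] := bg; have [z tT] := submod_triv V.
have [[_ si1] _] := H1; have [[_ si2] _] := H2.
have [[s0 s0n] siS] := (let: conj H _ := HS in H).
have simN1 K : submodule K -> K `<=` N1 -> K = [set 0] \/ K = N1.
  move=> sK KN; have sK' : submodule [set x : sub_bmod sN1 | K (val x)].
    have [K0 Kl Kg] := sK; split=> /= [|a x y Kx Ky|g' x Kx] //; first exact: Kl.
    exact: Kg.
  have [E|E] := si1 _ sK'; [left|right]; apply/seteqP; split=> x /=.
  - move=> Kx; have : [set x : sub_bmod sN1 | K (val x)] (sub_of (submodule_lin sN1) (KN x Kx)) by [].
    by rewrite E /= => /(congr1 val).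
  - by move=> ->; exact: subm0.
  - exact: KN.
  - move=> Nx; have : [set x : sub_bmod sN1 | K (val x)] (sub_of (submodule_lin sN1) Nx) by rewrite E.
    by [].
have imS (M : set V) : submodule M -> submodule [set y | exists2 x, M x & g x = y].
  move=> sM; have [M0 Ml Mg] := sM; split=> /= [|a _ _ [x Mx <-] [y My <-]|g' _ [x Mx <-]].
  - by exists 0; rewrite ?(bhom0 bg).
  - by exists (a *: x + y); [exact: Ml|exact: gl].
  - by exists (bact V g' x); [exact: Mg|exact: gg].
have N1n : exists2 x, N1 x & x != 0.
  have [[[x x0] _] _] := H1; exists (val x); first exact: sub_memP.
  by apply: contra x0 => /eqP E; apply/eqP; exact: val_inj.
have key (M' M : set V) : subquotient_iso M' M S ->
    [/\ Th = Th1, N1 `<=` M & forall x, M' x -> N1 x -> x = 0] \/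
    [/\ Th = Th2, forall y, exists2 x, M x & g x = y & forall x, M' x -> g x = 0].
  move=> [sM' sM MM [f [fl fg fs f0]]].
  have f00 : f 0 = 0 by have := fl (-1) 0 0 (subm0 sM) (subm0 sM); rewrite scaler0 addr0 scaleN1r addNr.
  have fB x y : M x -> M y -> f (x - y) = f x - f y.
    by move=> Mx My; rewrite addrC -scaleN1r fl // scaleN1r addrC.
  have sI (K : set V) : submodule K -> submodule (K `&` N1).
    move=> [K0 Kl Kg]; have [n0 nl ng] := sN1; split=> [//|a x y [Kx nx] [Ky ny]|g' x [Kx nx]].
      by split; [exact: Kl|exact: nl].
    by split; [exact: Kg|exact: ng].
  have [[x [Mx [Nx nM'x]]]|no] := pselect (exists x, M x /\ N1 x /\ ~ M' x).
    left; have sub : N1 `<=` M.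
      have [E|E] := simN1 _ (sI _ sM) (fun x => @proj2 _ _).
        have : (M `&` N1) x by []. 
        by rewrite E /= => x0; case: nM'x; rewrite x0; exact: subm0.
      by move=> y; rewrite -E => -[].
    have M'0 y : M' y -> N1 y -> y = 0.
      have [E|E] := simN1 _ (sI _ sM') (fun x => @proj2 _ _).
        by move=> My Ny; have : (M' `&` N1) y by []; rewrite E.
      by move: Nx; rewrite -E => -[].
    split=> //; pose F (y : sub_bmod sN1) := f (val y).
    have bF : bhom F.
      split=> [a y w|g' y]; rewrite /F.
        rewrite -[val _]/(a *: val y + val w); apply: fl; apply: sub; exact: sub_memP.
      by rewrite sub_actE fg //; apply: sub; exact: sub_memP.
    apply: (is_L_uniq qnr HS); apply: is_L_transport H1; exists F; split=> //.
    have injF : injective F.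
      apply: (bhom_inj bF) => y Fy; apply: val_inj; apply: M'0; last exact: sub_memP.
      by apply/(f0 (val y)) => //; apply: sub; exact: sub_memP.
    have sF : submodule [set s | exists y, F y = s].
      have [Fl Fg] := bF; split=> /= [|a _ _ [y <-] [w <-]|g' _ [y <-]].
      - by exists (0 : sub_bmod sN1); exact: (bhom0 bF).
      - by exists (a *: (y : sub_bmod sN1) + w); rewrite Fl.
      - by exists (bact (sub_bmod sN1) g' y); rewrite Fg.
    have Fs s : exists y, F y = s.
      have [E|E] := siS _ sF; last by have : [set s | exists y, F y = s] s by rewrite E.
      have : [set s | exists y, F y = s] (f x) by exists (sub_of (submodule_lin sN1) Nx).
      by rewrite E /= => /(f0 _ Mx).
    by have [G GE] := choice Fs; exists G => y //; apply: injF; rewrite GE.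
  have {}no x : M x -> N1 x -> M' x by move=> Mx Nx; apply: contrapT => H; apply: no; exists x.
  have [x0 Mx0 fx0] := fs s0; have nM'x0 : ~ M' x0 by move=> /(f0 _ Mx0) E; rewrite -fx0 E eqxx in s0n.
  right; have gM y : exists2 x, M x & g x = y.
    have [E|E] := si2 _ (imS _ sM); last by have : [set y | exists2 x, M x & g x = y] y by rewrite E.
    have : [set y | exists2 x, M x & g x = y] (g x0) by exists x0.
    by rewrite E /= => /gk N1x0; case: nM'x0; exact: no.
  have gM' x : M' x -> g x = 0.
    have [E|E] := si2 _ (imS _ sM').
      by move=> Mx; have : [set y | exists2 x, M' x & g x = y] (g x) by [exists x]; rewrite E.
    have [y My gy] : [set y | exists2 x, M' x & g x = y] (g x0) by rewrite E.
    exfalso; apply: nM'x0; rewrite -[x0](subrK y); apply: submD => //.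
    apply: no; first by apply: submB => //; exact: MM.
    by apply/gk; rewrite addrC -scaleN1r gl gy scaleN1r addNr.
  split=> //; have [x xE] := choice (fun y => let: ex_intro2 x Mx E := gM y in ex_intro _ x (conj Mx E)).
  have wd y w : M y -> M w -> g y = g w -> f y = f w.
    move=> My Mw E; apply/eqP; rewrite -subr_eq0 -fB //; apply/eqP/f0; first exact: submB.
    apply: no; first exact: submB.
    by apply/gk; rewrite addrC -scaleN1r gl E scaleN1r addNr.
  pose F y := f (x y).
  have bF : bhom F.
    split=> [a y w|g' y]; rewrite /F.
      have [My Ey] := xE y; have [Mw Ew] := xE w; have [Myw Eyw] := xE (a *: y + w).
      have Mc : M (a *: x y + x w) by exact: submL.
      by rewrite -fl //; apply: wd => //; rewrite gl Ey Ew.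
    have [My Ey] := xE y; have [Mw Ew] := xE (bact B g' y).
    rewrite -fg //; apply: wd => //; first by exact: submA.
    by rewrite gg Ey.
  apply: (is_L_uniq qnr HS); apply: is_L_transport H2; exists F; split=> //.
  have injF : injective F.
    apply: (bhom_inj bF) => y Fy; have [My <-] := xE y; apply: gM'; exact/(f0 _ My).
  have [u uE] := choice (fun s => let: ex_intro2 y My E := fs s in ex_intro _ y (conj My E)).
  have FgE w : M w -> F (g w) = f w by move=> Mw; rewrite /F; have [? ?] := xE (g w); exact: wd.
  exists (fun s => g (u s)) => [y|s]; last by have [Mu fu] := uE s; rewrite FgE.
  by apply: injF; have [Mu fu] := uE (F y); rewrite FgE.
split; last first.
  move=> [N' [N [H sub]]].
  have two i j : (i < j < `[< Th = Th1 >] + `[< Th = Th2 >] + 1)%N -> False.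
    move=> /andP[ij jn]; rewrite addn1 in jn.
    have Nij : N i `<=` N' j.
      elim: j ij jn => [//|j IH]; rewrite ltnS leq_eqVlt => /orP[/eqP ->|ij] jn; first exact: sub.
      apply: subset_trans (sub j jn); apply: subset_trans (IH ij (ltnW jn)) _.
      by have [_ _] := H j (ltnW jn).
    have [[E1 Ni Ni']|[E1 Ni Ni']] := key _ _ (H i (ltn_trans ij jn));
    have [[E2 Nj Nj']|[E2 Nj Nj']] := key _ _ (H j jn).
    - have [x Nx x0] := N1n; have Mx := Nij _ (Ni _ Nx); have xx := Nj' x Mx Nx.
      by rewrite xx eqxx in x0.
    - by case: ne; rewrite -E1.
    - by case: ne; rewrite -E1 E2.
    - have [[[y y0] _] _] := H2; have [x Nx gx] := Ni y.
      by rewrite -gx (Nj' x (Nij _ Nx)) eqxx in y0.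
  move: two; case: asboolP => [E1|n1]; case: asboolP => [E2|n2] /=.
  - by case: ne; rewrite -E1.
  - by move/(_ 0%N 1%N isT).
  - by move/(_ 0%N 1%N isT).
  - move=> _; have [[E _ _]|[E _ _]] := key _ _ (H 0%N isT); [exact: n1|exact: n2].
case: asboolP => [E1|n1]; case: asboolP => [E2|n2] /=.
- by case: ne; rewrite -E1.
- exists (fun=> [set 0]), (fun=> N1); split=> // i _; split=> //.
    by move=> x ->; exact: subm0.
  rewrite E1 in HS; have [f [bf [f' fK fK']]] := is_L_iso qnr H1 HS; have [fl fg] := bf.
  have f00 := bhom0 bf.
  exists (fun x => if pselect (N1 x) is left Nx then f (sub_of (submodule_lin sN1) Nx) else 0).
  have fE x (Mx : N1 x) : (if pselect (N1 x) is left Mx then f (sub_of (submodule_lin sN1) Mx) else 0) =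
    f (sub_of (submodule_lin sN1) Mx).
    by case: pselect => // Mx'; congr f; exact: val_inj.
  split.
  + move=> a x y Nx Ny; have Nxy : N1 (a *: x + y) by exact: submL.
    by rewrite !fE -fl; congr f; exact: val_inj.
  + move=> g' x Nx; have Ngx : N1 (bact V g' x) by exact: submA.
    by rewrite !fE -fg; congr f; exact: val_inj.
  + move=> s; exists (val (f' s)); first exact: sub_memP.
    rewrite (fE _ (sub_memP (f' s))) -[RHS]fK'; congr f; exact: val_inj.
  + move=> x Nx; rewrite (fE x Nx); split=> [E|/= x0].
      have : sub_of (submodule_lin sN1) Nx = 0 by apply: (can_inj fK); rewrite E f00.
      by move/(congr1 val).
    by rewrite -[RHS]f00; congr f; exact: val_inj.
- exists (fun=> N1), (fun=> setT); split=> // i _.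
  rewrite E2 in HS; have [f [bf [f' fK fK']]] := is_L_iso qnr H2 HS; have [fl fg] := bf.
  have bfg : bhom (f \o g) by split=> [a x y|g' x] /=; rewrite ?gl ?fl ?gg ?fg.
  have := sq_full bfg; have -> : [set x | (f \o g) x = 0] = N1.
    apply/seteqP; split=> x /=; last by move=> /gk ->; exact: bhom0.
    by move=> E; apply/gk; apply: (can_inj fK); rewrite E (bhom0 bf).
  apply=> s; have [x gx] := gs (f' s); exists x; by rewrite /= gx fK'.
- by exists (fun=> set0), (fun=> set0).
Qed.
End Subquotients.

(** * Uniqueness and associativity of tensor products *)

Section TensorIso.
Variables (R : realType) (h : R[i]).
Local Notation C := R[i].
Implicit Types (V W S T : bmod h).

Lemma bhom_gen V W (f : V -> W) : linear f -> (forall i x, f (bact V (BE i) x) = bact W (BE i) (f x)) ->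
  (forall i x, f (bact V (BK i) x) = bact W (BK i) (f x)) -> bhom f.
Proof.
move=> fl fE fK; split=> // -[] i x //.
by case: (ord2 i) => ->; rewrite ?opki0 ?opkE -?opkiE ?fK //;
  apply: (@kk_inj _ h W); rewrite opkiK opkE -fK -opkE opkiK.
Qed.

Lemma ten_iso S W T T' (t : S -> W -> T) (t' : S -> W -> T') :
  is_tensor t -> is_tensor t' -> biso T T'.
Proof.
move=> Ht Ht'; have [bt ut _ _] := Ht; have [bt' ut' _ _] := Ht'.
have [f [ft _]] := ut T' t' bt'; have [f' [ft' _]] := ut' T t bt.
exists f; split.
  apply: bhom_gen => [a x y|i x|i x]; first exact: linearP.
    apply: (ten_uniq Ht (f := f \o bact T (BE i)) (g := bact T' (BE i) \o f)) => {}x y /=.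
    by case: (Ht) => _ _ -> _; rewrite linearD !ft; case: (Ht') => _ _ -> _.
  apply: (ten_uniq Ht (f := f \o bact T (BK i)) (g := bact T' (BK i) \o f)) => {}x y /=.
  by case: (Ht) => _ _ _ ->; rewrite !ft; case: (Ht') => _ _ _ ->.
exists f' => x.
  by apply: (ten_uniq Ht (f := f' \o f) (g := idfun)) => {}x y /=; rewrite ft ft'.
by apply: (ten_uniq Ht' (f := f \o f') (g := idfun)) => {}x y /=; rewrite ft' ft.
Qed.

Lemma ten_transport S W S' W' T (t : S -> W -> T) : is_tensor t -> biso S S' -> biso W W' ->
  exists t' : S' -> W' -> T, is_tensor t'.
Proof.
move=> Ht SS WW; have [g [bg [g' gK gK']]] := biso_sym SS; have [k [bk [k' kK kK']]] := biso_sym WW.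
have [gl gg] := bg; have [kl kg] := bk.
have bg' : bhom g'.
  by split=> [a x y|b x]; apply: (can_inj gK); rewrite ?gl ?gg !gK'.
have bk' : bhom k'.
  by split=> [a x y|b x]; apply: (can_inj kK); rewrite ?kl ?kg !kK'.
exists (fun x y => t (g x) (k y)); have [_ ut tE tK] := Ht; split.
- by split=> a x y z; rewrite ?gl ?kl ?(tlP Ht) ?(trP Ht).
- move=> U b [bl br]; have [|f [fb uf]] := ut U (fun x y => b (g' x) (k' y)).
    by have [gl' _] := bg'; have [kl' _] := bk'; split=> a x y z; rewrite ?gl' ?kl' ?bl ?br.
  exists f; split=> [x y|f2 H]; first by rewrite fb gK kK.
  by apply: uf => x y; rewrite -{1}[x]gK' -{1}[y]kK' H.
- by move=> i x y; rewrite tE !gg kg.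
- by move=> i x y; rewrite tK !gg kg.
Qed.

(** The given module [T2] itself serves as tensor product of [S] and [D], so nothing has to be
    constructed. *)
Lemma ten_assoc (A B D S T1 T2 : bmod h) (tS : A -> B -> S) (t1 : B -> D -> T1) (t2 : A -> T1 -> T2) :
  is_tensor tS -> is_tensor t1 -> is_tensor t2 -> exists t : S -> D -> T2, is_tensor t.
Proof.
move=> HS H1 H2; have [bS uS SE SK] := HS; have [b1 u1 E1 K1] := H1; have [b2 u2 E2 K2] := H2.
have ex z : exists f : {linear S -> T2}, forall x y, f (tS x y) = t2 x (t1 y z).
  have [|f [fE _]] := uS T2 (fun x y => t2 x (t1 y z)); last by exists f.
  by split=> a x y y'; rewrite ?(tlP H2) ?(tlP H1) ?(trP H2).
have [F FE] := choice ex; pose t s z := F z s.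
exists t; split.
- split=> [a x y z|a s y z]; rewrite /t; first exact: linearP.
  apply: (ten_uniq HS (f := F (a *: y + z)) (g := (a \*: F y) \+ F z)) => x x' /=.
  by rewrite !FE (trP H1) (trP H2).
- move=> U b [bl br].
  have lin1 z y : linear (fun x => b (tS x y) z) by move=> a x x'; rewrite (tlP HS) bl.
  have ex1 x : exists f : {linear T1 -> U}, forall y z, f (t1 y z) = b (tS x y) z.
    have [|f [fE _]] := u1 U (fun y z => b (tS x y) z); last by exists f.
    by split=> a y y' z; rewrite ?(trP HS) ?bl ?br.
  have [G GE] := choice ex1.
  have [|f [fE uf]] := u2 U (fun x w => G x w).
    split=> a x x' y; last exact: linearP.
    apply: (ten_uniq H1 (f := G (a *: x + x')) (g := (a \*: G x) \+ G x')) => z z' /=.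
    by rewrite !GE (tlP HS) bl.
  have ft s z : f (t s z) = b s z.
    have lb : linear (fun s => b s z) by move=> a x y; exact: bl.
    pose bz : {linear S -> U} := HB.pack (fun s => b s z) (GRing.isLinear.Build _ _ _ _ _ lb).
    by apply: (ten_uniq HS (f := f \o F z) (g := bz)) => x y /=; rewrite FE fE GE.
  exists f; split=> [s z|f2 H]; first exact: ft.
  apply: uf => x w; apply: (ten_uniq H1 (f := f2 \o tenr H2 x) (g := G x)) => y z /=.
  by rewrite GE -[tenr _ _ _]FE -/(t _ _) H.
- move=> i s z; rewrite /t.
  apply: (ten_uniq HS (f := bact T2 (BE i) \o F z) (g := (F z \o bact S (BE i)) \+ (F (bact D (BE i) z) \o bact S (BK i)))) => x y /=.
  rewrite FE SE SK linearD !FE E2 E1.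
  have -> a b c : t2 a (b + c) = t2 a b + t2 a c by exact: (linearD (tenr H2 a)).
  by rewrite addrA.
- move=> i s z; rewrite /t.
  apply: (ten_uniq HS (f := bact T2 (BK i) \o F z) (g := F (bact D (BK i) z) \o bact S (BK i))) => x y /=.
  by rewrite FE SK !FE K2 K1.
Qed.

Lemma sq_transport V V' S S' (N' N : set V) (f : V' -> V) (g : S -> S') : bhom f -> bijective f ->
  bhom g -> bijective g -> subquotient_iso N' N S ->
  subquotient_iso [set x | N' (f x)] [set x | N (f x)] S'.
Proof.
move=> bf [f' fK fK'] bg [g' gK gK'] [sN' sN NN [F [Fl Fg Fs F0]]].
have [fl fg] := bf; have [gl gg] := bg; split; try exact: bhom_sub.
  by move=> x; exact: NN.
exists (g \o F \o f); split=> /=.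
- by move=> a x y Nx Ny; rewrite fl Fl // gl.
- by move=> b x Nx; rewrite fg Fg // gg.
- by move=> s; have [x Nx E] := Fs (g' s); exists (f' x); rewrite /= fK' // E gK'.
- move=> x Nx; rewrite -F0 //; split=> [E|->]; last exact: bhom0.
  by apply: (can_inj gK); rewrite E (bhom0 bg).
Qed.

Lemma occurs_transport V V' S S' n : biso V V' -> biso S S' -> occurs_times V S n -> occurs_times V' S' n.
Proof.
move=> /biso_sym[f [bf bij]] [g [bg bij']] [N' [N [H sub]]].
exists (fun i => [set x | N' i (f x)]), (fun i => [set x | N i (f x)]); split=> i lt.
  exact: (sq_transport bf bij bg bij' (H i lt)).
by move=> x; exact: sub.
Qed.

Lemma mult_transport V V' S S' n : biso V V' -> biso S S' -> has_mult V S n -> has_mult V' S' n.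
Proof.
move=> VV SS [oc noc]; split; first exact: occurs_transport oc.
by move=> oc'; apply: noc; exact: (occurs_transport (biso_sym VV) (biso_sym SS)).
Qed.
End TensorIso.

(** * Evaluation modules *)

Section Evaluation.
Variables (R : realType) (h : R[i]).
Local Notation C := R[i].
Local Notation q := (qpar h).
Hypothesis qnr : forall n : nat, (0 < n)%N -> q ^+ n != 1.
Let q0 : q != 0 := q_neq0 h.
Let qq0 := qqV_neq0 qnr.
Let q21 : q * q - 1 != 0. Proof. by rewrite subr_eq0 -expr2 (q2_neq qnr). Qed.
Variables (V : lmodType C) (E F K Ki : {linear V -> V}) (u : C).
Hypothesis u0 : u != 0.
Hypotheses (KKi : forall v, K (Ki v) = v) (KiK : forall v, Ki (K v) = v)
  (KE : forall v, K (E v) = q ^+ 2 *: E (K v)) (KF : forall v, K (F v) = q ^- 2 *: F (K v))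
  (EF : forall v, E (F v) = F (E v) + (q - q^-1)^-1 *: (K v - Ki v)).

(** The evaluation homomorphism from the loop algebra to the quantum group of
    [sl_2]: [e_0 = u f_1], [f_0 = u^-1 e_1], [k_0 = k_1^-1]. *)
Definition ev_act (g : DJgen) : {linear V -> V} :=
  match g with
  | GE i => if i == ord0 then (u \*: F : {linear V -> V}) else E
  | GF i => if i == ord0 then (u^-1 \*: E : {linear V -> V}) else F
  | GK i => if i == ord0 then Ki else K
  | GKinv i => if i == ord0 then K else Ki
  end.

Lemma presented_act (rho : DJgen -> {linear V -> V}) :
  (forall s t, DJrel h s t -> tact (fun g => rho g) s =1 tact (fun g => rho g) t) ->
  forall s t, Uq_eq h s t -> tact (fun g => rho g) s =1 tact (fun g => rho g) t.
Proof.
move=> H s t; elim=> {s t} /=.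
- by move=> s t /H.
- by [].
- by move=> s t _ IH x; rewrite IH.
- by move=> s t w _ IH _ IH' x; rewrite IH IH'.
- by move=> s s' t t' _ IH _ IH' x /=; rewrite IH IH'.
- by move=> s s' t t' _ IH _ IH' x /=; rewrite IH' IH.
- by move=> s t w x /=; rewrite addrA.
- by move=> s t x /=; rewrite addrC.
- by move=> s x /=; rewrite scale0r add0r.
- by move=> s x /=; rewrite scaleN1r subrr scale0r.
- by [].
- by move=> s x /=; rewrite scale1r.
- by [].
- by move=> s t w x /=; rewrite linearD.
- by move=> a b x /=; rewrite scalerDl.
- by move=> a b x /=; rewrite scalerA.
- by move=> a s x /=; rewrite linearZ.
Qed.

Tactic Notation "lc" uconstr(c) constr(H) := refine (@lin_comb C V c _ _ _ _ H _).
Ltac lin := lin_with (R[i]) V; repeat split; first [ring | solve [field; rewrite ?q0 ?q21 ?u0 //] | idtac].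

Let KiE v : Ki (E v) = q ^- 2 *: E (Ki v).
Proof.
have := KE (Ki v); rewrite KKi => e; lc (- q ^- 2) (congr1 Ki e).
by lc (q ^- 2) (KiK (E (Ki v))); lin.
Qed.
Let KiF v : Ki (F v) = q ^+ 2 *: F (Ki v).
Proof.
have := KF (Ki v); rewrite KKi => e; lc (- q ^+ 2) (congr1 Ki e).
by lc (q ^+ 2) (KiK (F (Ki v))); lin.
Qed.

(** The bracket of [E] and [F] is a combination of [K] and [Ki]; commuting these with [E] makes the
    remaining terms cancel against the coefficient [qint3]. *)
Let serreE v : E (E (E (F v))) = qint3 h *: E (E (F (E v))) - qint3 h *: E (F (E (E v))) + F (E (E (E v))).
Proof.
lc 1 (congr1 (E \o E) (EF v)); lc (1 - qint3 h) (congr1 E (EF (E v))); lc 1 (EF (E (E v))).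
rewrite /qint3 /=; move: (q - q^-1)^-1 => d.
lc d (KE (E v)); lc (d * q ^+ 2) (congr1 E (KE v)); lc (- d * (q ^+ 2 + q ^- 2)) (congr1 E (KE v)).
lc (- d) (KiE (E v)); lc (- d * q ^- 2) (congr1 E (KiE v)); lc (d * (q ^+ 2 + q ^- 2)) (congr1 E (KiE v)).
by lin.
Qed.
Let serreF v : F (F (F (E v))) = qint3 h *: F (F (E (F v))) - qint3 h *: F (E (F (F v))) + E (F (F (F v))).
Proof.
lc (-1) (congr1 (F \o F) (EF v)); lc (- (1 - qint3 h)) (congr1 F (EF (F v))); lc (-1) (EF (F (F v))).
rewrite /qint3 /=; move: (q - q^-1)^-1 => d.
lc (- d) (KF (F v)); lc (- d * q ^- 2) (congr1 F (KF v)); lc (d * (q ^+ 2 + q ^- 2)) (congr1 F (KF v)).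
lc (d) (KiF (F v)); lc (d * q ^+ 2) (congr1 F (KiF v)); lc (- d * (q ^+ 2 + q ^- 2)) (congr1 F (KiF v)).
by lin.
Qed.

Lemma ev_rel s t : DJrel h s t -> tact (fun g => ev_act g) s =1 tact (fun g => ev_act g) t.
Proof.
have o10 : (ord_max == ord0 :> 'I_2) = false by [].
have o01 : (ord0 == ord_max :> 'I_2) = false by [].
case=> {s t} [i|i||i j|i j|i j|i j|i j|i j].
- by move=> v; case: (ord2 i) => -> /=; rewrite ?KKi ?KiK scale1r.
- by move=> v; case: (ord2 i) => -> /=; rewrite ?KKi ?KiK scale1r.
- by move=> v /=; rewrite KiK scale1r.
- by move=> v; case: (ord2 i) => ->; case: (ord2 j) => -> //=; rewrite ?KKi ?KiK.
- have -> : q ^ (cartan i j) = if i == j then q ^+ 2 else q ^- 2.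
    by rewrite /cartan; case: ifP.
  move=> v; case: (ord2 i) => ->; case: (ord2 j) => -> /=.
  + by lc u (KiF (K v)); lc (u * q ^+ 2) (congr1 F (KiK v)); lin.
  + by lc 1 (KiE (K v)); lc (q ^- 2) (congr1 E (KiK v)); lin.
  + by lc u (KF (Ki v)); lc (u * q ^- 2) (congr1 F (KKi v)); lin.
  + by lc 1 (KE (Ki v)); lc (q ^+ 2) (congr1 E (KKi v)); lin.
- have -> : q ^ (- cartan i j) = if i == j then q ^- 2 else q ^+ 2.
    by rewrite /cartan; case: ifP => _; rewrite ?opprK.
  move=> v; case: (ord2 i) => ->; case: (ord2 j) => -> /=.
  + by lc (u^-1) (KiE (K v)); lc (u^-1 * q ^- 2) (congr1 E (KiK v)); lin.
  + by lc 1 (KiF (K v)); lc (q ^+ 2) (congr1 F (KiK v)); lin.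
  + by lc (u^-1) (KE (Ki v)); lc (u^-1 * q ^+ 2) (congr1 E (KKi v)); lin.
  + by lc 1 (KF (Ki v)); lc (q ^- 2) (congr1 F (KKi v)); lin.
- move=> v; case: (ord2 i) => ->; case: (ord2 j) => -> /=.
  + lc (-1) (EF v); move: (q - q^-1)^-1 => d; by lin.
  + by rewrite ?scale0r; lin.
  + by rewrite ?scale0r; lin.
  + lc 1 (EF v); move: (q - q^-1)^-1 => d; by lin.
- case: (ord2 i) => ->; case: (ord2 j) => -> // _ v /=; rewrite scale0r.
  + lc (u ^+ 3) (serreF v); move: (qint3 h) => d; by lin.
  + lc (u) (serreE v); move: (qint3 h) => d; by lin.
- case: (ord2 i) => ->; case: (ord2 j) => -> // _ v /=; rewrite scale0r.
  + lc (u ^- 3) (serreE v); move: (qint3 h) => d; by lin.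
  + lc (u^-1) (serreF v); move: (qint3 h) => d; by lin.
Qed.

Definition ev_bmod : bmod h.
Proof.
refine (@BMod R h V (fun g => ev_act (Bincl g)) _) => s t st v.
have := presented_act ev_rel st v.
have E' r : forall v, tact (fun g => ev_act g) (tmap Bincl r) v = tact (fun g => ev_act (Bincl g)) r v.
  by elim: r => //= [r1 I1 r2 I2 w|r1 I1 r2 I2 w]; rewrite ?I1 ?I2.
by rewrite !E'.
Defined.
End Evaluation.

Section KirillovReshetikhin.
Variables (R : realType) (h : R[i]).
Local Notation C := R[i].
Local Notation q := (qpar h).
Hypothesis qnr : forall n : nat, (0 < n)%N -> q ^+ n != 1.
Let q0 : q != 0 := q_neq0 h.
Let qq0 := qqV_neq0 qnr.
Let q21 : q * q - 1 != 0. Proof. by rewrite subr_eq0 -expr2 (q2_neq qnr). Qed.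
Let qn l : q ^+ l != 0. Proof. exact: expf_neq0. Qed.
Variables (N : nat) (u : C).
Hypothesis u0 : u != 0.
Local Notation VV := (nat -> C^o).

Definition qnum (x : C) := (x - x^-1) / (q - q^-1).

(** Coordinates on vectors [s_l] such that [e_1 s_l = [l] s_{l-1}] and
    [f_1 s_l = [N - l] s_{l+1}]; those with [l <= N] span a submodule. *)
Definition kr_e (v : VV) : VV := fun l => qnum (q ^+ l.+1) * v l.+1.
Definition kr_f (v : VV) : VV :=
  fun l => if l is l'.+1 then qnum (q ^+ N / q ^+ l') * v l' else 0.
Definition kr_k (v : VV) : VV := fun l => q ^+ N / q ^+ (2 * l) * v l.
Definition kr_ki (v : VV) : VV := fun l => q ^- N * q ^+ (2 * l) * v l.

Let AE (f g : VV) l : (f + g) l = f l + g l. Proof. by []. Qed.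
Let NE (f : VV) l : (- f) l = - f l. Proof. by []. Qed.
Let ZE b (f : VV) l : (b *: f) l = b * f l. Proof. by []. Qed.

Lemma kr_e_linear : linear kr_e.
Proof. by move=> a x y; apply/funext => l; rewrite /kr_e AE ZE AE ZE; ring. Qed.
Lemma kr_f_linear : linear kr_f.
Proof.
move=> a x y; apply/funext => -[|l]; rewrite AE ZE /kr_f; first by rewrite mulr0 addr0.
by rewrite AE ZE; ring.
Qed.
Lemma kr_k_linear : linear kr_k.
Proof. by move=> a x y; apply/funext => l; rewrite /kr_k AE ZE AE ZE; ring. Qed.
Lemma kr_ki_linear : linear kr_ki.
Proof. by move=> a x y; apply/funext => l; rewrite /kr_ki AE ZE AE ZE; ring. Qed.
HB.instance Definition _ := GRing.isLinear.Build _ _ _ _ kr_e kr_e_linear.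
HB.instance Definition _ := GRing.isLinear.Build _ _ _ _ kr_f kr_f_linear.
HB.instance Definition _ := GRing.isLinear.Build _ _ _ _ kr_k kr_k_linear.
HB.instance Definition _ := GRing.isLinear.Build _ _ _ _ kr_ki kr_ki_linear.

Ltac fin := field; rewrite ?q0 ?q21 ?qn ?u0 //.

Let kki v : kr_k (kr_ki v) = v.
Proof. by apply/funext => l; rewrite /kr_k /kr_ki; fin. Qed.
Let kik v : kr_ki (kr_k v) = v.
Proof. by apply/funext => l; rewrite /kr_k /kr_ki; fin. Qed.
Let ke v : kr_k (kr_e v) = q ^+ 2 *: kr_e (kr_k v).
Proof. by apply/funext => l; rewrite ZE /kr_k /kr_e mulnS exprD; move: (qnum _) => x; fin. Qed.
Let kf v : kr_k (kr_f v) = q ^- 2 *: kr_f (kr_k v).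
Proof.
apply/funext => -[|l]; rewrite ZE /kr_k /kr_f; first by rewrite !mulr0.
by rewrite mulnS exprD; move: (qnum _) => x; fin.
Qed.
Let ef v : kr_e (kr_f v) = kr_f (kr_e v) + (q - q^-1)^-1 *: (kr_k v - kr_ki v).
Proof.
apply/funext => l; rewrite AE ZE AE NE /kr_k /kr_ki /kr_e /kr_f.
case: l => [|l]; rewrite /qnum ?muln0 ?expr0 ?mulnS ?exprD ?mul2n -?addnn ?exprD ?exprS; fin.
Qed.

Definition kr_big : bmod h := ev_bmod u0 kki kik ke kf ef.
Definition kr_supp : set kr_big := fun v : VV => forall l, (N < l)%N -> v l = 0.
(** The step from [N] to [N + 1] is blocked because the coefficient [[N - l]] vanishes at
    [l = N]. *)
Lemma kr_supp_sub : submodule kr_supp.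
Proof.
have He v : kr_supp v -> kr_supp (kr_e v).
  by move=> H l lt; rewrite /kr_e H ?mulr0 // ltnW.
have Hf v : kr_supp v -> kr_supp (kr_f v).
  move=> H [//|l]; rewrite ltnS leq_eqVlt => /orP[/eqP <-|lt]; rewrite /kr_f; last by rewrite H ?mulr0.
  by rewrite divff // /qnum invr1 subrr !mul0r.
have Hk v : kr_supp v -> kr_supp (kr_k v) by move=> H l lt; rewrite /kr_k H ?mulr0.
have Hki v : kr_supp v -> kr_supp (kr_ki v) by move=> H l lt; rewrite /kr_ki H ?mulr0.
split=> // [a x y Hx Hy l lt|g v Hv].
  by rewrite AE ZE Hx // Hy // mulr0 addr0.
by case: g => i /=; case: ifP => _ /=; auto => l lt; rewrite ZE Hf ?mulr0.
Qed.
Definition kr_mod : bmod h := sub_bmod kr_supp_sub.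

Let kkm v : val (opk kr_mod v) = kr_k (val v). Proof. by rewrite opkE sub_actE. Qed.
Let kX0 v : val (opX kr_mod 0 v) = kr_e (val v). Proof. by rewrite opX0E sub_actE. Qed.
Let kY0 v : val (opY kr_mod 0 v) = u *: kr_f (kr_k (val v)).
Proof. by rewrite opY0 opeE sub_actE kkm. Qed.

Let vZ (a : C) (x : kr_mod) : val (a *: x) = a *: val x :> VV.
Proof. exact: (linearZ_LR (val : {linear sub_car (submodule_lin kr_supp_sub) -> kr_big})). Qed.
Let vB (x y : kr_mod) : val (x - y) = val x - val y :> VV.
Proof. exact: (linearB (val : {linear sub_car (submodule_lin kr_supp_sub) -> kr_big})). Qed.

Definition kr_vec (l : nat) : VV := fun j => (j == l)%:R.
Lemma kr_vec_supp l : (l <= N)%N -> kr_supp (kr_vec l).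
Proof. by move=> le j lt; rewrite /kr_vec gtn_eqF // (leq_ltn_trans le). Qed.
Definition kr_top : kr_mod := sub_of (submodule_lin kr_supp_sub) (kr_vec_supp (leq0n N)).

Lemma qnum_neq0 l : (0 < l)%N -> qnum (q ^+ l) != 0.
Proof.
move=> l0; rewrite mulf_neq0 ?invr_eq0 // subr_eq0; apply/eqP => e.
have := @qnr (l + l)%N; rewrite exprD {2}e mulfV // eqxx => /(_ _)/negP; apply => //.
by rewrite addn_gt0 l0.
Qed.

Lemma kr_top_neq0 : kr_top != 0.
Proof.
by apply/eqP => /(congr1 (fun v : kr_mod => (val v : VV) 0%N)) /eqP; rewrite oner_eq0.
Qed.

Lemma kr_gen : genby kr_top.
Proof.
move=> K sK Kt x; have [K0 Kl Kg] := sK.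
have Kv l (le : (l <= N)%N) : K (sub_of (submodule_lin kr_supp_sub) (kr_vec_supp le)).
  elim: l le => [|l IH] le; first by rewrite (_ : sub_of _ _ = kr_top) //; exact: val_inj.
  pose c := u * qnum (q ^+ N / q ^+ l) * (q ^+ N / q ^+ (2 * l)).
  have c0 : c != 0.
    have E : q ^+ N / q ^+ l = q ^+ (N - l) by rewrite -{1}(subnK (ltnW le)) exprD mulfK.
    apply: mulf_neq0; last by rewrite mulf_neq0 ?invr_eq0.
    by apply: mulf_neq0 => //; rewrite E qnum_neq0 // subn_gt0.
  have -> : sub_of (submodule_lin kr_supp_sub) (kr_vec_supp le) = c^-1 *: opY kr_mod 0 (sub_of (submodule_lin kr_supp_sub) (kr_vec_supp (ltnW le))).
    apply: val_inj; rewrite vZ kY0 /=.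
    apply/funext => j; rewrite !ZE /kr_f /kr_k /kr_vec.
    case: j => [|j]; first by rewrite !mulr0.
    rewrite eqSS; case: eqP => [->|_]; last by rewrite !mulr0.
    rewrite (_ : true%:R = 1) //; apply: (mulfI c0).
    by rewrite mulVKf // /c; ring.
  by apply: (submZ _ sK); rewrite opYE; exact: submod_tact.
have -> : x = \sum_(l < N.+1) (val x : VV) l *: sub_of (submodule_lin kr_supp_sub) (kr_vec_supp (ltn_ord l : (l <= N)%N)).
  apply: val_inj; rewrite (linear_sum (val : kr_mod -> kr_big)) /=; apply/funext => j.
  rewrite fct_sumE.
  have [lt|le] := ltnP N j.
    rewrite (sub_memP x j lt) big1 // => i _; rewrite ZE /kr_vec gtn_eqF ?mulr0 //.
    by rewrite (leq_trans (ltn_ord i)).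
  rewrite (bigD1 (Ordinal (le : (j < N.+1)%N))) //= ZE /kr_vec eqxx mulr1 big1 ?addr0 // => i ne.
  rewrite ZE; case: eqP => [E|_]; last by rewrite mulr0.
  by case/eqP: ne; apply: val_inj.
by apply: (big_ind K) => // [a b|i _]; [exact: (submD sK)|exact: (submZ _ sK)].
Qed.

Let KR := rk_lw (q ^+ N) (u * q ^+ N) (u / q ^+ N).

Let vt : val kr_top = kr_vec 0. Proof. by []. Qed.

Let h0 : oph kr_mod kr_top = (u * qnum (q ^+ N)) *: kr_top.
Proof.
apply: (@kk_inj _ h kr_mod); apply: val_inj.
rewrite ophP vB kkm vZ kX0 !kY0 kX0 vt.
apply/funext => l; rewrite AE NE ZE /kr_e ZE /kr_f /kr_k ZE /kr_vec.
case: l => [|[|l]]; rewrite /= ?(mulr0, mulr1, subr0, expr0, muln0, invr1, divr1) //.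
rewrite expr1; have -> : qnum q = 1 by rewrite /qnum divff.
by ring.
Qed.

(** Computed directly: [rk_Yv] presupposes the simplicity that is to be shown. *)
Lemma kr_Y m : opY kr_mod m kr_top = (u * q ^+ N) ^+ m *: opY kr_mod 0 kr_top.
Proof.
have h1 : oph kr_mod (opY kr_mod 0 kr_top) =
   (u * qnum (q ^+ N) - (q + q^-1) * (u * q ^+ N)) *: opY kr_mod 0 kr_top.
  apply: (@kk_inj _ h kr_mod); apply: val_inj.
  rewrite ophP vB kkm vZ kX0 !kY0 kX0 kY0 vt.
  apply/funext => l; rewrite AE NE ZE /kr_e ZE /kr_f /kr_k !ZE /kr_vec.
  case: l => [|[|l]]; rewrite /= ?ZE /= ?(mulr0, mulr1, mul0r, subr0, expr0, muln0, invr1, divr1, subrr) //.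
  rewrite /qnum ?expr1 ?muln1; move: (q ^+ N) (qn N) => Q Q0.
  by field; rewrite ?q0 ?q21 ?Q0.
elim: m => [|m IH]; first by rewrite scale1r.
have q22 : q * q + 1 != 0.
  by apply: contraNneq (qDqV_neq0 qnr) => e; apply/eqP; apply: (mulfI q0); rewrite mulr0 mulrDr mulfV.
pose W : lmodType R[i] := kr_mod; set d := (q + q^-1)^-1.
rewrite opYS -/d; refine (@lin_comb _ W (- d) _ _ _ _ (congr1 (oph kr_mod) IH) _).
refine (@lin_comb _ W (- d * (u * q ^+ N) ^+ m) _ _ _ _ h1 _).
refine (@lin_comb _ W d _ _ _ _ (congr1 (opY kr_mod m) h0) _).
refine (@lin_comb _ W (d * (u * qnum (q ^+ N))) _ _ _ _ IH _).
rewrite exprS /d; move: (qnum _) => x; lin_with (R[i]) W; repeat split; first [ring | field]; by rewrite ?q0 ?q22.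
Qed.

(** Simplicity: applying [e_1] to a nonzero vector as often as the index of its last nonzero
    coordinate yields a nonzero multiple of [kr_top], which generates. *)
Lemma kr_is_L : is_L KR kr_mod.
Proof.
have ev0 : bact kr_mod (BE ord_max) kr_top = 0.
  apply: val_inj; rewrite -opX0E kX0; apply/funext => l.
  by rewrite /kr_e /= mulr0.
split; last first.
  exists kr_top; split; [exact: kr_top_neq0|exact: ev0|move=> m; rewrite -opPE].
  case: m => [|m].
    rewrite opP0; apply: val_inj; rewrite kkm vZ vt; apply/funext => l.
    by rewrite ZE /kr_k /= /kr_vec; case: l => [|l]; rewrite ?mulr0 // muln0 expr0 divr1.
  rewrite opPS /Pb kr_Y linearZ /= [opX kr_mod 0 kr_top]opX0E ev0 linear0 subr0 scalerA.
  apply: val_inj; rewrite !vZ kX0 kY0 vt.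
  apply/funext => l; rewrite !ZE /kr_e ZE /kr_f /kr_k /=.
  case: l => [|l]; last by rewrite /kr_vec /= !mulr0.
  rewrite /kr_vec eqxx /qnum !expr1 (_ : 2 * 0 = 0)%N // !expr0 !divr1.
  move: ((u * q ^+ N) ^+ m) => x; move: (q ^+ N) (qn N) => Q Q0; field.
  by rewrite ?q0 ?q21 ?Q0.
split; first by exists kr_top; exact: kr_top_neq0.
move=> K sK; have [K0 Kl Kg] := sK.
have [[x Kx x0]|no] := pselect (exists2 x, K x & x != 0); last first.
  left; apply/seteqP; split=> x /=; last by move=> ->.
  by move=> Kx; apply: contrapT => nz; apply: no; exists x => //; apply/eqP.
right; suff Kt : K kr_top by apply/seteqP; split=> // y _; exact: kr_gen.
have Ke n y : K y -> K (iter n (opX kr_mod 0) y).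
  move=> Ky; elim: n => [//|n IH] /=; rewrite opXE; exact: submod_tact.
have [l lx mx] : exists2 l, (val x : VV) l != 0 & forall j, (l < j)%N -> (val x : VV) j = 0.
  have ub i : (val x : VV) i != 0 -> (i <= N)%N.
    by move=> nz; rewrite leqNgt; apply: contra nz => lt; apply/eqP; exact: (sub_memP x).
  have ex : exists i, (val x : VV) i != 0.
    apply: contrapT => H; case/eqP: x0; apply: val_inj; apply/funext => j.
    by apply/eqP; apply: contrapT => /negP nz; apply: H; exists j.
  have [l Pl ml] := ex_maxnP ex ub.
  exists l => // j lt; apply/eqP; apply: contraTT lt => nz; rewrite -leqNgt; exact: ml.
elim: l x {x0} Kx lx mx => [|l IH] x Kx lx mx.
  have -> : kr_top = ((val x : VV) 0%N)^-1 *: x.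
    apply: val_inj; rewrite vZ vt; apply/funext => j; rewrite ZE /= /kr_vec.
    by case: j => [|j]; [rewrite mulVf|rewrite [X in _ * X]mx // mulr0].
  exact: submZ.
apply: (IH (opX kr_mod 0 x)); first exact: (Ke 1%N).
  by rewrite kX0 mulf_neq0 // qnum_neq0.
by move=> j lt; rewrite kX0 /kr_e mx ?mulr0.
Qed.
End KirillovReshetikhin.

Lemma fsum1 (T : choiceType) (x : T) (F : T -> int) : (forall y, y <> x -> F y = 0) ->
  \sum_(y \in setT) F y = F x.
Proof.
move=> H; rewrite -(fsbig_widen [set x] setT) ?fsbig_set1 // => y [_ /= nx].
exact: H.
Qed.

(** * Arithmetic in the Grothendieck ring *)

Section LWeights.
Variable R : realType.
Local Notation C := R[i].
Implicit Types (f g : lweight R).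

Definition trunc N f : {poly C} := \poly_(i < N) f i.

(** Truncation lets the ring laws of power series be inherited from polynomials. *)
Lemma lw_mulE N f g n : (n < N)%N -> lw_mul f g n = (trunc N f * trunc N g)`_n.
Proof.
move=> lt; rewrite coefM; apply: eq_bigr => i _; rewrite !coef_poly.
by rewrite (leq_ltn_trans _ lt) ?(leq_ltn_trans _ lt) ?leq_subr // -ltnS.
Qed.

Lemma lw_mulC : commutative (@lw_mul R).
Proof.
by move=> f g; apply/funext => n; rewrite !(@lw_mulE n.+1) // mulrC.
Qed.

Lemma lw_mulA : associative (@lw_mul R).
Proof.
move=> f g k; apply/funext => n.
have E x y z : lw_mul x (lw_mul y z) n = (trunc n.+1 x * (trunc n.+1 y * trunc n.+1 z))`_n.
  rewrite coefM; apply: eq_bigr => i _; rewrite coef_poly ltn_ord -lw_mulE //.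
  by rewrite ltnS leq_subr.
by rewrite E lw_mulC E mulrA mulrC.
Qed.

Lemma lw_mul1 : left_id (lw_cst 1) (@lw_mul R).
Proof.
move=> f; apply/funext => n; rewrite /lw_mul big_ord_recl /= mul1r subn0 big1 ?addr0 // => i _.
by rewrite mul0r.
Qed.

HB.instance Definition _ := Monoid.isComLaw.Build (lweight R) (lw_cst 1) (@lw_mul R)
  lw_mulA lw_mulC lw_mul1.

Lemma lw_cstM (a b : C) : lw_mul (lw_cst a) (lw_cst b) = lw_cst (a * b).
Proof.
apply/funext => -[|n]; rewrite /lw_mul ?big_ord1 // big1 // => -[[|i] Hi] _ /=.
  by rewrite mulr0.
by rewrite mul0r.
Qed.

Lemma lw_cstE (a : C) f n : lw_mul (lw_cst a) f n = a * f n.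
Proof. by rewrite /lw_mul big_ord_recl /= subn0 big1 ?addr0 // => i _; rewrite mul0r. Qed.

Lemma lw_lin_geom (a : C) : lw_mul (lw_lin a) (lw_geom a) = lw_cst 1.
Proof.
apply/funext => -[|n]; first by rewrite /lw_mul big_ord1 /lw_geom expr0 mulr1.
rewrite /lw_mul big_ord_recl big_ord_recl big1 ?addr0 => [|i _]; last by rewrite /= mul0r.
by rewrite /= /lw_geom subn0 subSS subn0 mul1r exprS mulNr subrr.
Qed.

Lemma lw_linI (a : C) f g : lw_mul (lw_lin a) f = lw_mul (lw_lin a) g -> f = g.
Proof.
move=> E; rewrite -[f]lw_mul1 -[g]lw_mul1 -(lw_lin_geom a) [lw_mul (lw_lin a) _]lw_mulC.
by rewrite -!lw_mulA E.
Qed.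

Lemma lw_cstI (a : C) f g : a != 0 -> lw_mul (lw_cst a) f = lw_mul (lw_cst a) g -> f = g.
Proof.
move=> a0 E; rewrite -[f]lw_mul1 -[g]lw_mul1 -(mulVf a0) -lw_cstM.
by rewrite -!lw_mulA E.
Qed.

Definition lw_prod (s : seq C) : lweight R := \big[@lw_mul R/lw_cst 1]_(a <- s) lw_lin a.
Lemma lw_prod_cons a s : lw_prod (a :: s) = lw_mul (lw_lin a) (lw_prod s).
Proof. by rewrite /lw_prod big_cons. Qed.
Lemma lw_prod_cat s s' : lw_prod (s ++ s') = lw_mul (lw_prod s) (lw_prod s').
Proof. by rewrite /lw_prod big_cat. Qed.
Lemma lw_prod_perm s s' : perm_eq s s' -> lw_prod s = lw_prod s'.
Proof. by move=> p; rewrite /lw_prod (perm_big _ p). Qed.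
Lemma lw_prodI s f g : lw_mul (lw_prod s) f = lw_mul (lw_prod s) g -> f = g.
Proof.
elim: s => [|a s IH]; first by rewrite /lw_prod big_nil !lw_mul1.
by rewrite lw_prod_cons -!lw_mulA => /lw_linI.
Qed.

Definition ppoly (s : seq C) : {poly C} := \prod_(a <- s) (1 - a *: 'X).

Lemma lw_prod_poly s n : lw_prod s n = (ppoly s)`_n.
Proof.
elim: s n => [|a s IH] n; first by rewrite /lw_prod /ppoly !big_nil coef1; case: n.
rewrite lw_prod_cons /ppoly big_cons mulrBl mul1r -scalerAl coefB coefZ coefXM -/(ppoly s) -!IH.
rewrite /lw_mul; case: n => [|n]; first by rewrite big_ord1 /= mulr0 subr0 mul1r.
rewrite big_ord_recl big_ord_recl big1 ?addr0 => [|i _]; last by rewrite /= mul0r.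
by rewrite /= subn0 subSS subn0 mul1r mulNr.
Qed.

Lemma lw_prod0 s : lw_prod s 0%N = 1.
Proof.
elim: s => [|a s IH]; first by rewrite /lw_prod big_nil.
by rewrite lw_prod_cons /lw_mul big_ord1 subn0 IH mulr1.
Qed.

Lemma ppoly_root s (x : C) : (ppoly s).[x] = \prod_(a <- s) (1 - a * x).
Proof. by rewrite /ppoly horner_prod; apply: eq_bigr => a _; rewrite !hornerE. Qed.

(** A factor is recognized by the root [a^-1] of the associated polynomial and then cancelled. *)
Lemma lw_prod_inj s s' : all (fun a => a != 0) s -> all (fun a => a != 0) s' ->
  lw_prod s = lw_prod s' -> perm_eq s s'.
Proof.
elim: s s' => [|a s IH] s'.
  move=> _; case: s' => [//|a s'] /= /andP[a0 _] E.
  have : (ppoly [::]).[a^-1] = (ppoly (a :: s')).[a^-1].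
    congr (_.[_]); apply/polyP => n; rewrite -!lw_prod_poly; congr (_ n); exact: E.
  by rewrite !ppoly_root big_nil big_cons mulfV // subrr mul0r => /eqP; rewrite oner_eq0.
move=> /= /andP[a0 s0] s'0 E.
have as' : a \in s'.
  have : (ppoly (a :: s)).[a^-1] = (ppoly s').[a^-1].
    by congr (_.[_]); apply/polyP => n; rewrite -!lw_prod_poly E.
  rewrite !ppoly_root big_cons mulfV // subrr mul0r => /esym/eqP.
  rewrite prodf_seq_eq0 => /hasP[b bs'] /=; rewrite subr_eq0 => /eqP e.
  suff -> : a = b by [].
  by apply: (mulIf (_ : a^-1 != 0)); rewrite ?invr_eq0 // mulfV.
have p := perm_to_rem as'; rewrite perm_sym in p.
rewrite (lw_prod_perm (s := s') (s' := a :: rem a s')) in E; last by rewrite perm_sym.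
move: E; rewrite !lw_prod_cons => /lw_linI/IH H.
apply: perm_trans p; rewrite perm_cons; apply: H => //.
by apply/allP => b /mem_rem bs; exact: (allP s'0).
Qed.

(** Supplies the degree required by [ten_poly]. *)
Lemma lw_prod_lead s : all (fun a => a != 0) s -> lw_prod s (size s) != 0 /\
  forall m, (size s < m)%N -> lw_prod s m = 0.
Proof.
elim: s => [|a s IH] /=; first by rewrite /lw_prod big_nil /= oner_eq0; split=> // -[].
move=> /andP[a0 /IH[nz z]].
have E n : lw_prod (a :: s) n.+1 = lw_prod s n.+1 - a * lw_prod s n.
  rewrite lw_prod_cons /lw_mul big_ord_recl big_ord_recl big1 ?addr0 => [|i _]; last by rewrite /= mul0r.
  by rewrite /= subn0 subSS subn0 mul1r mulNr.
split; first by rewrite E z // sub0r oppr_eq0 mulf_neq0.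
by move=> [//|m] lt; rewrite E !z ?mulr0 ?subr0 // ltnW.
Qed.
End LWeights.

Section QPowers.
Variables (R : realType) (h : R[i]).
Local Notation C := R[i].
Local Notation q := (qpar h).
Hypothesis qnr : forall n : nat, (0 < n)%N -> q ^+ n != 1.
Let q0 : q != 0 := q_neq0 h.

Lemma cexpD (x y : C) : cexp (x + y) = cexp x * cexp y.
Proof.
case: x => a b; case: y => c d; rewrite /cexp /= expRD cosD sinD.
by apply/eqP; rewrite eq_complex /=; apply/andP; split; apply/eqP; ring.
Qed.

Lemma qpowD s t : qpow h (s + t) = qpow h s * qpow h t.
Proof. by rewrite /qpow rmorphD mulrDl cexpD. Qed.
Lemma qpow0 : qpow h 0 = 1.
Proof.
rewrite /qpow rmorph0 mul0r; apply/eqP.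
by rewrite eq_complex /= expR0 cos0 sin0 mulr1 mulr0 !eqxx.
Qed.
Lemma qpow_neq0 s : qpow h s != 0.
Proof.
apply: contraTneq (oner_neq0 C) => e.
by rewrite -qpow0 -(subrr s) qpowD e mul0r eqxx.
Qed.
Lemma qpowN s : qpow h (- s) = (qpow h s)^-1.
Proof. by apply: (mulIf (qpow_neq0 s)); rewrite -qpowD addNr qpow0 mulVf ?qpow_neq0. Qed.
Lemma qpow1 : qpow h 1 = q. Proof. by rewrite /qpow rmorph1 mul1r. Qed.
Lemma qpow_nat n : qpow h n%:R = q ^+ n.
Proof. by elim: n => [|n IH]; rewrite ?qpow0 // -natr1 qpowD qpow1 IH exprSr. Qed.
Lemma qpow_int (z : int) : qpow h z%:~R = q ^ z.
Proof.
case: z => n; first exact: qpow_nat.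
by rewrite NegzE mulrNz qpowN -[_%:~R]/(n.+1%:R) qpow_nat exprnN.
Qed.
Lemma qpow_mulrn s n : qpow h (s *+ n) = qpow h s ^+ n.
Proof. by elim: n => [|n IH]; rewrite ?mulr0n ?qpow0 // mulrS qpowD IH exprS. Qed.

Lemma qint_inj (a b : int) : q ^ a = q ^ b -> a = b.
Proof.
move=> E; apply/eqP; rewrite -subr_eq0; apply: contrapT => /negP nz.
have : q ^ (a - b) = 1 by rewrite expfzDr // E -expfzDr // subrr.
case: (a - b) nz => n nz; first by move/eqP; apply/negP/qnr; rewrite lt0n.
by rewrite NegzE -exprnN => /eqP; rewrite invr_eq1; apply/negP/qnr.
Qed.

(** Raising to the denominator of the exponent reduces the claim to integral powers of [q]. *)
Lemma qpow_inj : injective (qpow h).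
Proof.
move=> s t E; apply/eqP; rewrite -subr_eq0; apply/eqP.
have e1 : qpow h (s - t) = 1 by rewrite qpowD E -qpowD subrr qpow0.
set r := s - t in e1 *.
have : qpow h ((numq r)%:~R) = 1.
  have -> : (numq r)%:~R = r *+ `|denq r|%N.
    by rewrite -mulr_natr -{2}[r]divq_num_den natr_absz gtr0_norm ?denq_gt0 // divfK // intq_eq0 denq_neq0.
  by rewrite qpow_mulrn e1 expr1n.
rewrite qpow_int -(expr0z q) => /qint_inj /eqP.
by rewrite numq_eq0 => /eqP.
Qed.
End QPowers.

Section Convolution.
Lemma conv_delta (G : zmodType) (x : G) (D : G -> int) : Defs.conv (delta x) D = fun y => D (y - x).
Proof.
apply/funext => y; rewrite /Defs.conv (@fsum1 _ x) /delta.
  by case: asboolP => // _; rewrite mul1r.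
by move=> z zx; case: asboolP => // _; rewrite mul0r.
Qed.
Lemma deltaE (T : Type) (x y : T) : delta x y = (`[< y = x >])%:Z. Proof. by []. Qed.
Lemma delta_xx (T : Type) (x : T) : delta x x = 1. Proof. by rewrite deltaE; case: asboolP. Qed.
Lemma delta_neq (T : Type) (x y : T) : y <> x -> delta x y = 0. Proof. by rewrite deltaE; case: asboolP. Qed.
Lemma conv_dd (G : zmodType) (x y : G) : Defs.conv (delta x) (delta y) = delta (x + y).
Proof.
rewrite conv_delta; apply/funext => z; rewrite !deltaE; congr (nat_of_bool _)%:Z.
by apply/asboolP/asboolP => [<-|->]; [rewrite addrC subrK|rewrite addrC addKr].
Qed.
Lemma tens_delta (e : bool) (m : vtx e -> int) (w : rat) : tens (delta m) (delta w) = delta (m, w).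
Proof.
apply/funext => -[m' w']; rewrite /tens !deltaE /=.
case: asboolP => [->|nm]; case: asboolP => [->|nw]; rewrite ?mulr0 ?mul0r ?mulr1; case: asboolP => // -[]//.
Qed.
End Convolution.

(** * Laurent monomials and the completed cluster algebra *)

Section ClusterElements.
Variable e : bool.
Local Notation V := (vtx e).
Implicit Types (A B : seq V) (m : V -> int).

Definition ex A : V -> int := \sum_(a <- A) expo a.
Lemma ex_nil : ex [::] = 0. Proof. by rewrite /ex big_nil. Qed.
Lemma ex_cons a A : ex (a :: A) = expo a + ex A. Proof. by rewrite /ex big_cons. Qed.
Lemma ex_cat A B : ex (A ++ B) = ex A + ex B. Proof. by rewrite /ex big_cat. Qed.
Lemma exE A r : ex A r = (count_mem r A)%:Z.
Proof.
elim: A => [|a A IH]; first by rewrite ex_nil.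
rewrite ex_cons -[LHS]/(expo a r + ex A r) IH /= PoszD; congr (_ + _).
rewrite /expo deltaE; congr (nat_of_bool _)%:Z.
by apply/asboolP/eqP => [->|->].
Qed.
Lemma ex_perm A B : ex A = ex B <-> perm_eq A B.
Proof.
split=> [E|p]; last by rewrite /ex (perm_big _ p).
by apply/allP => r _; apply/eqP; have := congr1 (fun f => f r) E; rewrite !exE => -[].
Qed.

Definition supp_fin m := finite_set [set r | m r != 0].
Lemma supp_fin0 : supp_fin 0.
Proof. by apply: (sub_finite_set (B := set0)) => // r /=; rewrite eqxx. Qed.
Lemma supp_finD m m' : supp_fin m -> supp_fin m' -> supp_fin (m + m').
Proof.
move=> f f'; have : finite_set ([set r | m r != 0] `|` [set r | m' r != 0]) by rewrite finite_setU.
apply: sub_finite_set => r /=.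
rewrite -[(m + m') r]/(m r + m' r) => nz.
by have [E|] := eqVneq (m r) 0; [right; move: nz; rewrite E add0r|left].
Qed.
Lemma supp_finN m : supp_fin m -> supp_fin (- m).
Proof. by apply: sub_finite_set => r /=; rewrite -[(- m) r]/(- m r) oppr_eq0. Qed.
Lemma supp_expo r : supp_fin (expo r).
Proof.
apply: (sub_finite_set (B := [set r])) => // s /=.
by rewrite /expo deltaE; case: asboolP.
Qed.
Lemma supp_ex A : supp_fin (ex A).
Proof.
elim: A => [|a A IH]; first by rewrite ex_nil; exact: supp_fin0.
by rewrite ex_cons; apply: supp_finD => //; exact: supp_expo.
Qed.

(** Finite supports matter: a sum with infinitely many nonzero terms is 0 by convention. *)
Lemma chi_wtD m m' : supp_fin m -> supp_fin m' -> chi_wt (m + m') = chi_wt m + chi_wt m'.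
Proof.
move=> f f'; pose S := [set r | m r != 0] `|` [set r | m' r != 0].
have fS : finite_set S by rewrite finite_setU.
have W (k : V -> int) : (forall r, k r != 0 -> S r) -> chi_wt k =
    \sum_(r \in S) ((k r)%:~R * (- ((val r)%:~R / 2%:R)) : rat).
  move=> H; rewrite /chi_wt -(fsbig_widen S setT) // => r [_ /= nS].
  have [->|/H//] := eqVneq (k r) 0; by rewrite mul0r.
have W1 : forall r, (m + m') r != 0 -> S r.
  move=> r; rewrite -[(m + m') r]/(m r + m' r) => nz.
  by have [E|nm] := eqVneq (m r) 0; [right; move: nz; rewrite E add0r|left].
rewrite (W _ W1) (W m) ?(W m'); [|by move=> r; right|by move=> r; left].
rewrite -fsbig_split //=; apply: eq_fsbigr => r _.
by rewrite -[(m + m') r]/(m r + m' r) intrD mulrDl.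
Qed.

Lemma chi_expo (r : V) : @chi_wt e (expo r) = - ((val r)%:~R / 2%:R).
Proof.
rewrite /chi_wt -(fsbig_widen [set r] setT) ?fsbig_set1 //.
  by rewrite /expo delta_xx mul1r.
by move=> s [_ /= /eqP ns]; rewrite /expo delta_neq ?mul0r //; exact/eqP.
Qed.

Lemma chi_ex A : chi_wt (ex A) = - \sum_(a <- A) ((val a)%:~R / 2%:R).
Proof.
elim: A => [|a A IH]; last first.
  rewrite ex_cons chi_wtD; [|exact: (@supp_expo a)|exact: (@supp_ex A)].
  by rewrite IH chi_expo big_cons opprD.
rewrite ex_nil big_nil oppr0 /chi_wt fsbig1 // => r _.
by rewrite mul0r.
Qed.

Lemma lone_ex : @lone e = delta (ex [::]). Proof. by rewrite ex_nil. Qed.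
Lemma zvar_ex r : @zvar e r = delta (ex [:: r]). Proof. by rewrite ex_cons ex_nil addr0. Qed.

Lemma laurent_delta m : supp_fin m -> laurent (delta m).
Proof.
move=> fm; split; first by apply: (sub_finite_set (B := [set m])) => // m' /=; rewrite deltaE; case: asboolP.
by move=> m'; rewrite deltaE; case: asboolP => // ->.
Qed.

Lemma laurent_conv (f g : (V -> int) -> int) : laurent f -> laurent g -> laurent (Defs.conv f g).
Proof.
move=> [ff lf] [fg lg].
have nz m : Defs.conv f g m != 0 -> exists2 y, f y != 0 & g (m - y) != 0.
  move=> H; apply: contrapT => no; move/eqP: H; apply; apply: fsbig1 => y _.
  have [->|fy] := eqVneq (f y) 0; first by rewrite mul0r.
  have [->|gy] := eqVneq (g (m - y)) 0; first by rewrite mulr0.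
  by case: no; exists y.
split.
  have := finite_image2 (fun x y => x + y) ff fg; apply: sub_finite_set => m /nz[y fy gy].
  by exists y => //; exists (m - y) => //; rewrite addrC subrK.
move=> m /nz[y fy gy]; rewrite -(subrK y m); apply: supp_finD; [exact: lg|exact: lf].
Qed.

Lemma laurent_sub (f g : (V -> int) -> int) : laurent f -> laurent g -> laurent (f - g).
Proof.
move=> [ff lf] [fg lg].
have nz m : (f - g) m != 0 -> f m != 0 \/ g m != 0.
  rewrite -[(f - g) m]/(f m - g m) => nz.
  by have [E|nf] := eqVneq (f m) 0; [right; move: nz; rewrite E sub0r oppr_eq0|left].
split.
  have : finite_set ([set m | f m != 0] `|` [set m | g m != 0]) by rewrite finite_setU.
  by apply: sub_finite_set => m /nz.
by move=> m /nz[/lf|/lg].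
Qed.

Lemma cluster_laurent f : @cluster_algebra e f -> laurent f.
Proof.
elim=> {f} [f [S HS [r ->]]||f g _ lf _ lg|f g _ lf _ lg].
- elim: HS r => {S} [r|k [x b] [x' b'] _ IH [_ H lk _] r] /=.
    by apply: laurent_delta; exact: supp_expo.
  by have [->//|ne] := eqVneq r k; rewrite H //; exact: IH.
- by rewrite lone_ex; apply: laurent_delta; exact: supp_ex.
- exact: laurent_sub.
- exact: laurent_conv.
Qed.

Lemma cluster_delta A : cluster_algebra (delta (ex A)).
Proof.
elim: A => [|a A IH]; first by rewrite -lone_ex; exact: CAone.
rewrite ex_cons -conv_dd; apply: CAmul => //; apply: CAvar.
by exists (@zvar e, @Gamma e); [exact: reach_init|exists a].
Qed.

Lemma in_E_delta (w : rat) : in_E (delta w).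
Proof.
exists [:: w] => w' /=; rewrite deltaE; case: asboolP => // -> _.
by exists w; rewrite ?inE //; exists 0%N; rewrite subrr mul0r.
Qed.

Lemma abs_chi0 w : @abs_chi e 0 w = 0.
Proof.
by rewrite /abs_chi fsbig1 // => m _; change (`|0 : int| = 0); rewrite normr0.
Qed.

Lemma completed0 : @completed_cluster_algebra e 0.
Proof.
exists (fun=> 0); split=> [i||]; first exact: CTE0.
  split=> [w|].
    by apply: (sub_finite_set (B := set0)) => // i /=; rewrite abs_chi0 eqxx.
  by exists [::] => w /=; rewrite fsbig1 ?eqxx // => i _; rewrite abs_chi0.
by apply/funext => p; rewrite fsbig1.
Qed.

Lemma completed_fin D : @cluster_tensor_E e D -> finite_set [set p | D p != 0] ->
  completed_cluster_algebra D.
Proof.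
move=> HD fD; pose A i : (V -> int) * rat -> int := if i is 0%N then D else 0.
have A0 i w : abs_chi (A i) w != 0 -> i = 0%N.
  by case: i => // i; rewrite abs_chi0 eqxx.
exists A; split.
- by case=> [|i]; [|exact: CTE0].
- split=> [w|]; first by apply: (sub_finite_set (B := [set 0%N])) => // i /A0.
  have [s sE] : exists s : seq ((V -> int) * rat), [set p | D p != 0] = [set` s].
    by move/finite_seqP: fD => [s ->]; exists s.
  exists [seq p.2 + chi_wt p.1 | p <- s] => w /=.
  rewrite (@fsum1 _ 0%N) => [nz|i ni]; last first.
    by apply/eqP; apply: contrapT => /negP/A0.
  have [m nzm] : exists m, D (m, w - chi_wt m) != 0.
    apply: contrapT => no; move/eqP: nz; apply; rewrite /abs_chi fsbig1 // => m _.
    rewrite /A; have [->|nzm] := eqVneq (D (m, w - chi_wt m)) 0; first by rewrite normr0.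
    by case: no; exists m.
  exists w; last by exists 0%N; rewrite subrr mul0r.
  apply/mapP; exists (m, w - chi_wt m); last by rewrite /= subrK.
  by have : [set p | D p != 0] (m, w - chi_wt m) by []; rewrite sE.
- by apply/funext => p; rewrite (@fsum1 _ 0%N) // => -[].
Qed.

Definition shift_by A w : (V -> int) * rat -> int := tens (delta (ex A)) (delta w).
Lemma shift_byE A w : shift_by A w = delta (ex A, w). Proof. exact: tens_delta. Qed.

Lemma tensor_sup D : @cluster_tensor_E e D -> forall p, D p != 0 -> supp_fin p.1.
Proof.
elim=> {D} [p|f c D lf _ _ IH p]; first by rewrite eqxx.
rewrite -[(tens f c + D) p]/(f p.1 * c p.2 + D p).
have [->|nz _] := eqVneq (f p.1) 0; first by rewrite mul0r add0r; exact: IH.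
by have [_ H] := cluster_laurent lf; exact: H.
Qed.

(** Multiplication by a monomial translates [abs_chi] of every term by the same weight. Exponents of
    infinite support, on which [chi_wt] need not be additive, have coefficient 0. *)
Lemma completed_shift A w D : completed_cluster_algebra D ->
  completed_cluster_algebra (Defs.conv (shift_by A w) D).
Proof.
move=> [F [HF [s1 s2] ->]]; rewrite shift_byE.
have Ec (i : nat) w' : abs_chi (Defs.conv (delta (ex A, w)) (F i)) w' = abs_chi (F i) (w' - chi_wt (ex A) - w).
  rewrite /abs_chi (reindex_fsbigT (fun m : V -> int => m + ex A)) /=; last first.
    by exists (fun m => m - ex A) => m; rewrite ?addrK ?subrK.
  apply: eq_fsbigr => m _; rewrite conv_delta /=; rewrite -[(_, _) - _]/(m + ex A - ex A, w' - chi_wt (m + ex A) - w).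
  rewrite addrK.
  have [fm|nf] := pselect (supp_fin m).
    have -> : w' - chi_wt (m + ex A) - w = w' - chi_wt (ex A) - w - chi_wt m by rewrite chi_wtD; [ring|exact: fm|exact: (@supp_ex A)].
    by [].
  have z w2 : F i (m, w2) = 0.
    by apply/eqP; apply: contrapT => /negP/(tensor_sup (HF i)).
  by rewrite !z.
exists (fun i => Defs.conv (delta (ex A, w)) (F i)); split.
- move=> i; elim: (HF i) => [|f c D' lf Ec' _ IH].
    rewrite conv_delta; exact: CTE0.
  have -> : Defs.conv (delta (ex A, w)) (tens f c + D') =
      tens (Defs.conv (delta (ex A)) f) (Defs.conv (delta w) c) + Defs.conv (delta (ex A, w)) D'.
    by rewrite !conv_delta.
  apply: CTEadd => //; first by apply: CAmul => //; exact: cluster_delta.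
  have [mus H] := Ec'; exists [seq mu + w | mu <- mus] => w' /=; rewrite conv_delta => /H[mu mm [n E]].
  by exists (mu + w); [apply/mapP; exists mu|exists n; rewrite -E; ring].
- split=> [w'|]; first by under eq_set do rewrite Ec; exact: s1.
  have [mus H] := s2; exists [seq mu + (chi_wt (ex A) + w) | mu <- mus] => w' /= nz.
  have [|mu mm [n E]] := H (w' - chi_wt (ex A) - w).
    by rewrite /=; under eq_fsbigr do rewrite -Ec.
  by exists (mu + (chi_wt (ex A) + w)); [apply/mapP; exists mu|exists n; rewrite -E; ring].
- by rewrite conv_delta; apply/funext => p; apply: eq_fsbigr => i _; rewrite conv_delta.
Qed.

Lemma completed_delta A w : completed_cluster_algebra (shift_by A w).
Proof.
apply: completed_fin.
  by rewrite -[shift_by _ _]addr0; apply: CTEadd; [exact: cluster_delta|exact: in_E_delta|exact: CTE0].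
rewrite shift_byE; apply: (sub_finite_set (B := [set (ex A, w)])) => // p /=.
by rewrite deltaE; case: asboolP.
Qed.
End ClusterElements.

(** * Classes of simple modules and their products *)

Section Support.
Variables (R : realType) (h : R[i]).
Local Notation C := R[i].
Local Notation q := (qpar h).
Hypothesis qnr : forall n : nat, (0 < n)%N -> q ^+ n != 1.
Let q0 : q != 0 := q_neq0 h.
Variable e : bool.
Implicit Types (S V W T : bmod h) (Psi Th : lweight R).

Lemma simple_constituent V S : simple_mod V -> simple_mod S -> constituent V S -> biso V S.
Proof.
move=> sV [nS _] [N' [N H]].
by have [|_ //] := @simple_occurs _ _ V S 0 sV nS; exists (fun=> N'), (fun=> N).
Qed.

Lemma constituent_self S : simple_mod S -> constituent S S.
Proof.
move=> sS; exists [set 0], setT; have [z tT] := submod_triv S.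
split=> //; exists id; split=> // s; by exists s.
Qed.

Lemma lw_mul0 (f g : lweight R) : lw_mul f g 0%N = f 0%N * g 0%N.
Proof. by rewrite /lw_mul big_ord1. Qed.

Lemma positive_lw0 Psi : positive_lw h Psi -> exists w, Psi 0%N = qpow h w.
Proof.
move=> [ys [ps [w [_ _ ->]]]]; exists (w + (size ys)%:R).
rewrite lw_mul0 qpowD qpow_nat; congr (_ * _); rewrite lw_mul0.
have -> : (\big[@lw_mul R/lw_cst 1]_(a <- ps) lw_Psi a) 0%N = 1 by exact: lw_prod0.
rewrite mulr1; elim: ys => [|y ys IH]; first by rewrite big_nil.
by rewrite big_cons lw_mul0 IH exprS; congr (_ * _); rewrite /lw_Y !lw_mul0 /lw_geom expr0 /= !mulr1.
Qed.

Lemma in_Oplus2Z_lw S Psi : is_L Psi S -> in_Oplus2Z e S ->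
  [/\ positive_lw h Psi,
      roots_poles_in [set x | exists r : vtx e, x = q ^ (val r)] Psi &
      exists w, Psi 0%N = qpow h w].
Proof.
move=> HS [[_ H1] H2]; have [sS _] := HS; have cS := constituent_self sS.
have [Ps1 HS1 p1] := H1 S sS cS; have [Ps2 HS2 p2] := H2 S sS cS.
rewrite -(is_L_uniq qnr HS1 HS) in p1 *; rewrite -(is_L_uniq qnr HS2 HS1).
by rewrite (is_L_uniq qnr HS2 HS1) in p2 *; split=> //; exact: positive_lw0.
Qed.

Lemma has_dim0 V (N : set V) u : has_dim N 0 -> N u -> u = 0.
Proof. by move=> [b [_ H]] /H[c [-> _]]; rewrite big_ord0. Qed.

Lemma dim_LP Psi w : dim_L h Psi w != 0%N ->
  exists (S : bmod h) (u : S), [/\ is_L Psi S, u != 0 & weight_space S w u].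
Proof.
rewrite /dim_L; case: xgetP => [n _ [S HS Hd] n0|_]; last by rewrite eqxx.
case: n n0 Hd => [//|n] _ [b [Hb H]]; exists S, (b ord0); have Hb0 := Hb ord0; split=> //.
apply/eqP => E; have [c [c1 c2]] := H _ (Hb ord0).
pose c' : 'rV[C]_n.+1 := c + delta_mx 0 ord0.
have : c = c'.
  apply: c2; rewrite {1}c1; apply: eq_bigr => i _.
  have [->|ne] := eqVneq i ord0; first by rewrite E !scaler0.
  by rewrite /c' !mxE (negPf ne) andbF addr0.
move/(congr1 (fun m : 'rV[C]_n.+1 => m 0 ord0)); rewrite !mxE !eqxx /=.
by move/eqP; rewrite -subr_eq0 opprD addNKr oppr_eq0 oner_eq0.
Qed.

Lemma dim_L_top S Psi w : is_L Psi S -> in_O S -> Psi 0%N = qpow h w -> dim_L h Psi w != 0%N.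
Proof.
move=> HS [_ H _] P0; have [n Hn] := H w; rewrite /dim_L.
case: xgetP => [m _ [S' HS' Hd]|no]; last by case: (no n); exists S.
apply/eqP => m0; rewrite m0 in Hd; have [v Hv] := is_L_hwm HS'.
have := hwm_neq0 Hv; rewrite (has_dim0 Hd (u := v)) ?eqxx // /weight_space /= -P0 -(hwm_P Hv) opP0.
by rewrite opkE.
Qed.

Lemma class_in_K0 S Psi : is_L Psi S -> in_Oplus2Z e S -> in_K0 h e (K0_class Psi).
Proof.
move=> HS OS; have [[[_ OS2 OS3] _] _] := OS.
have Z Psi' w : Psi' <> Psi -> `|K0_class Psi Psi'| * (dim_L h Psi' w)%:Z = 0.
  by move=> ne; rewrite /K0_class delta_neq // normr0 mul0r.
split=> [Psi'|].
  rewrite /K0_class deltaE; case: asboolP => // -> _; by exists S.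
split=> [w|].
  apply: (sub_finite_set (B := [set Psi])) => // Psi' /= /eqP nz.
  by apply: contrapT => ne; apply: nz; exact: Z.
have [mus Hm] := OS3; exists mus => w /=; rewrite (@fsum1 _ Psi) => [nz|Psi' ne]; last exact: Z.
apply: Hm => /=; have [|S' [u [HS' u0 Hu]]] := @dim_LP Psi w.
  by apply: contra nz => /eqP ->; rewrite mulr0.
have [f [bf [g fK _]]] := is_L_iso qnr HS' HS; exists (f u).
  by apply: contra u0 => /eqP E; rewrite -(fK u) E -(fK 0) (bhom0 bf) eqxx.
have [fl fg] := bf; move: Hu; rewrite /weight_space /= -fg => ->.
by have := fl (qpow h w) u 0; rewrite (bhom0 bf) !addr0.
Qed.

Lemma findim_O S Psi w : in_O S -> Psi 0%N = qpow h w -> findim S Psi.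
Proof.
move=> [_ H _] P0 d; have [n [b [_ Hb]]] := H (w - 2%:R * d%:R); exists n, b => u.
rewrite /dg => du; have [|c [-> _]] := Hb u; last by exists (fun i => c 0 i).
rewrite /weight_space /= qpowD -P0 qpowN -natrM qpow_nat -opkE du; congr (_ *: _).
Qed.

Lemma K0_mulE Psi mu Th : K0_mul h (K0_class Psi) mu Th =
  \sum_(Psi' \in setT) mu Psi' * (tensor_mult h Psi Psi' Th)%:Z.
Proof.
rewrite /K0_mul -(fsbig_widen [set p : lweight R * lweight R | p.1 = Psi] setT) //; last first.
  by move=> [p p'] /= [_ ne]; rewrite /K0_class delta_neq ?mul0r.
rewrite (reindex_fsbig (fun p' : lweight R => (Psi, p')) setT) /=; last first.
  split=> //=; first by move=> x y _ _ [].
  by move=> [p p'] /= ->; exists p'.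
by apply: eq_fsbigr => p _; rewrite /K0_class delta_xx mul1r.
Qed.

Lemma K0_mul_cc Psi Psi' Th :
  K0_mul h (K0_class Psi) (K0_class Psi') Th = (tensor_mult h Psi Psi' Th)%:Z.
Proof.
rewrite K0_mulE (@fsum1 _ Psi') => [|x ne]; first by rewrite /K0_class delta_xx mul1r.
by rewrite /K0_class delta_neq ?mul0r.
Qed.

(** As the default value of [tensor_mult] is 0, a nonzero value witnesses the existence of the
    modules and of their tensor product. *)
Lemma tm_ex Psi Psi' Th : tensor_mult h Psi Psi' Th != 0%N ->
  exists (S S' S'' T : bmod h) (t : S -> S' -> T),
    [/\ is_L Psi S, is_L Psi' S', is_L Th S'', is_tensor t & constituent T S''].
Proof.
rewrite /tensor_mult; case: xgetP => [n _ [S [S' [S'' [T [t [H1 H2 H3 H4 [H5 _]]]]]]] n0|_]; last by rewrite eqxx.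
exists S, S', S'', T, t; split=> //; case: n n0 H5 => [//|n] _ [N' [N [H _]]].
by exists (N' 0%N), (N 0%N); exact: H.
Qed.

Lemma tm_eq S S' S'' T (t : S -> S' -> T) Psi Psi' Th n :
  is_L Psi S -> is_L Psi' S' -> is_L Th S'' -> is_tensor t -> has_mult T S'' n ->
  tensor_mult h Psi Psi' Th = n.
Proof.
move=> HS HS' HS'' Ht Hn; rewrite /tensor_mult.
case: xgetP => [m _ [S1 [S1' [S1'' [T1 [t1 [H1 H2 H3 H4 H5]]]]]]|no]; last first.
  by case: (no n); exists S, S', S'', T, t.
have [t' Ht'] := ten_transport H4 (is_L_iso qnr H1 HS) (is_L_iso qnr H2 HS').
have := mult_transport (ten_iso Ht' Ht) (is_L_iso qnr H3 HS'') H5.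
by move=> H6; exact: (has_mult_uniq H6 Hn).
Qed.

(** The last hypothesis takes care of the series [Th] without a simple module, at which both sides
    are 0. *)
Lemma K0_mul_mult S W T (t : S -> W -> T) Psi Psi' (F : lweight R -> nat) Th :
  is_L Psi S -> is_L Psi' W -> is_tensor t ->
  (forall Th' S'', is_L Th' S'' -> has_mult T S'' (F Th')) ->
  (forall Th', F Th' != 0%N -> exists S'' : bmod h, is_L Th' S'') ->
  K0_mul h (K0_class Psi) (K0_class Psi') Th = (F Th)%:Z.
Proof.
move=> HS HW Ht HF Hex; rewrite K0_mul_cc; congr Posz.
have [[S'' HS'']|no] := pselect (exists S'' : bmod h, is_L Th S'').
  exact: (tm_eq HS HW HS'' Ht (HF _ _ HS'')).
have [->|/Hex//] := eqVneq (F Th) 0%N.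
apply/eqP; apply: contrapT => /negP/tm_ex[S2 [W2 [S'' [T2 [t2 [_ _ H _ _]]]]]].
by apply: no; exists S''.
Qed.

Lemma occurs_pos V S n : constituent V S -> has_mult V S n -> (0 < n)%N.
Proof.
move=> [N' [N H]] [_ nH]; rewrite lt0n; apply/eqP => n0; apply: nH; rewrite n0.
by exists (fun=> N'), (fun=> N).
Qed.

End Support.

Section TensorMultiplicity.
Variables (R : realType) (h : R[i]).
Local Notation C := R[i].
Local Notation q := (qpar h).
Hypothesis qnr : forall n : nat, (0 < n)%N -> q ^+ n != 1.
Let q0 : q != 0 := q_neq0 h.
Variables (kap a be : C) (kap0 : kap != 0).
Variables (S W T : bmod h) (t : S -> W -> T) (Psi : lweight R).
Hypotheses (HS : is_L (rk_lw kap a be) S) (HW : is_L Psi W) (Ht : is_tensor t).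
Local Notation PsT := (lw_mul (rk_lw kap a be) Psi).
Local Notation s := (rk_s HS).
Local Notation cw := (cw qnr kap0 HS Ht).

Lemma ten_graded : graded T PsT.
Proof. by have [w0 HW0] := is_L_hwm HW; exact: (ten_dec qnr kap0 HS HW0 Ht). Qed.

Lemma ten_Psi0 : PsT 0%N != 0.
Proof. by have [w0 HW0] := is_L_hwm HW; exact: (PsT_neq0 a be kap0 HW0). Qed.

(** Degree [d] of [T] is spanned by the tensors of [rk_s l] with degree [d - l] of [W], for
    [l <= d]. *)
Lemma ten_findim : findim W Psi -> findim T PsT.
Proof.
move=> fW d; have [w0 HW0] := is_L_hwm HW.
pose m i := projT1 (cid (fW i)).
have Hm i : exists b : 'I_(m i) -> W, forall u, dg Psi i u -> exists c : 'I_(m i) -> C, u = \sum_j c j *: b j.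
  exact: projT2 (cid (fW i)).
pose b i := projT1 (cid (Hm i)).
have Hb i u : dg Psi i u -> exists c : 'I_(m i) -> C, u = \sum_j c j *: b i j.
  exact: (projT2 (cid (Hm i))).
pose idx := {l : 'I_d.+1 & 'I_(m (d - l)%N)}.
exists #|{: idx}|, (fun i => let x : idx := enum_val i in t (s (tag x)) (b (d - tag x)%N (tagged x))) => u du.
have H l : (l <= d)%N -> exists c : 'I_(m (d - l)%N) -> C, cw l u = \sum_i c i *: b (d - l)%N i.
  by move=> ld; apply: Hb; have [H _] := cw_dg qnr kap0 HS HW0 Ht du l; exact: H.
have H' (l : 'I_d.+1) : exists c : 'I_(m (d - l)%N) -> C, cw l u = \sum_i c i *: b (d - l)%N i.
  by apply: H; rewrite -ltnS.
pose c l := projT1 (cid (H' l)).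
have Hc (l : 'I_d.+1) : cw l u = \sum_i c l i *: b (d - l)%N i by exact: (projT2 (cid (H' l))).
exists (fun i => let x : idx := enum_val i in c (tag x) (tagged x)).
have -> : u = \sum_(l < d.+1) t (s l) (cw l u).
  have [D [D0 E]] := cw_dec qnr kap0 HS Ht u; rewrite {1}E.
  rewrite -(@sum_widen _ D (maxn D d.+1) (fun l => t (s l) (cw l u))) => [|i /D0 ->|]; rewrite ?leq_maxl ?(tr0 Ht) //.
  rewrite -(@sum_widen _ d.+1 (maxn D d.+1) (fun l => t (s l) (cw l u))) ?leq_maxr // => i lt.
  by have [_ ->] := cw_dg qnr kap0 HS HW0 Ht du i; rewrite // (tr0 Ht).
transitivity (\sum_(x : idx) c (tag x) (tagged x) *: t (s (tag x)) (b (d - tag x)%N (tagged x))); last first.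
  by rewrite (reindex (@enum_val idx xpredT)) //; exists enum_rank => i _; [exact: enum_valK|exact: enum_rankK].
rewrite -(sig_big_dep (fun _ => true) (fun _ _ => true) (fun (l : 'I_d.+1) (j : 'I_(m (d - l)%N)) => c l j *: t (s l) (b (d - l)%N j))) /=.
apply: eq_bigr => l _; rewrite Hc (trsum Ht); apply: eq_bigr => i _.
by rewrite (trZ Ht).
Qed.

Lemma ten_mult_ex S'' Th : findim W Psi -> is_L Th S'' -> exists n, has_mult T S'' n.
Proof. by move=> fW; exact: (mult_exists qnr ten_Psi0 ten_graded (ten_findim fW)). Qed.

(** The vector [ten_top] produces the constituent by [simple_subquo]. *)
Lemma tm_top : findim W Psi -> (0 < tensor_mult h (rk_lw kap a be) Psi PsT)%N.
Proof.
move=> fW; have [w0 HW0] := is_L_hwm HW; have [z tT] := submod_triv T.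
have [||||m|M' [M [B [_ _ HB iso]]]] := @simple_subquo _ _ T [set 0] setT (ten_top t HS w0) PsT z tT; try by [].
- by move=> /= /eqP; apply/negP; exact: (ten_top_neq0 qnr kap0 HS HW0 Ht).
- by rewrite /= opX0E; exact: (ten_top_E qnr kap0 HS HW0 Ht).
- by rewrite /= (ten_top_P qnr kap0 HS HW0 Ht) subrr.
have [n Hn] := ten_mult_ex fW HB.
rewrite (tm_eq qnr HS HW HB Ht Hn); apply: (occurs_pos _ Hn).
by exists M', M.
Qed.

Lemma tm_degree S'' Th : is_L Th S'' -> constituent T S'' ->
  exists d, Th 0%N = lam h PsT d.
Proof.
move=> HB [N' [N [sN' sN NN [f Hf]]]]; have [v Hv] := is_L_hwm HB.
by have [d [x [_ _ _ E]]] := sq_lift qnr ten_Psi0 ten_graded Hv sN Hf; exists d.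
Qed.

End TensorMultiplicity.

Section FiniteSums.
Variable T : choiceType.
Implicit Types F G : T -> int.

Lemma fsum_seq F (r : seq T) : uniq r -> (forall y, y \notin r -> F y = 0) ->
  \sum_(y \in setT) F y = \sum_(y <- r) F y.
Proof.
move=> ur H; rewrite (fsbigE r) //; last by move=> i _; exact: H.
by apply: eq_bigl => y; rewrite mem_set.
Qed.

Lemma supp_seq F : finite_set [set y | F y != 0] ->
  exists r : seq T, uniq r /\ forall y, y \notin r -> F y = 0.
Proof.
move=> /finite_seqP[s sE]; exists (undup s); split=> [|y]; first exact: undup_uniq.
rewrite mem_undup => ns; apply/eqP; apply: contrapT => /negP Fy; move/negP: ns; apply.
by have : [set y | F y != 0] y by []; rewrite sE.
Qed.

Lemma fsum_le F G : finite_set [set y | G y != 0] -> (forall y, 0 <= F y <= G y) ->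
  \sum_(y \in setT) F y <= \sum_(y \in setT) G y.
Proof.
move=> /supp_seq[r [ur Hr]] FG.
have Fr y : y \notin r -> F y = 0.
  by move=> /Hr Gy; have /andP[? ?] := FG y; apply/eqP; rewrite eq_le -{1}Gy; apply/andP.
by rewrite (fsum_seq ur Hr) (fsum_seq ur Fr); apply: ler_sum => y _; have /andP[] := FG y.
Qed.

Lemma fsum_term F x : finite_set [set y | F y != 0] -> (forall y, 0 <= F y) ->
  F x <= \sum_(y \in setT) F y.
Proof.
move=> fF F0; pose G y := if y == x then F x else 0.
have -> : F x = \sum_(y \in setT) G y.
  by rewrite (@fsum1 _ x) /G ?eqxx // => y /eqP/negPf ->.
apply: fsum_le => // y; rewrite /G; case: eqP => [->|_]; rewrite ?lexx ?F0 //.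
Qed.
End FiniteSums.

(** * Positivity in the Grothendieck ring and the isomorphism *)

Section Grothendieck.
Variables (R : realType) (h : R[i]).
Local Notation C := R[i].
Local Notation q := (qpar h).
Hypothesis qnr : forall n : nat, (0 < n)%N -> q ^+ n != 1.
Let q0 : q != 0 := q_neq0 h.
Variable e : bool.
Local Notation V := (vtx e).
Local Notation cls := (@K0_class R).
Implicit Types (Psi Th : lweight R) (mu lam : lweight R -> int) (A M : seq V).

Definition qv (r : V) : C := q ^ (val r).
Lemma qv_neq0 r : qv r != 0. Proof. exact: expfz_neq0. Qed.
Lemma all_qv A : all (fun a => a != 0) (map qv A).
Proof. by apply/allP => x /mapP[r _ ->]; exact: qv_neq0. Qed.

Lemma rk_lin (b : C) : rk_lw 1 0 b = lw_lin b.
Proof. by apply/funext => -[|[|m]] //=; rewrite ?expr0 ?exprS ?mul0r ?mulr0 // mulr1 mul1r sub0r. Qed.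
Lemma rk_cst (k : C) : rk_lw k 0 0 = lw_cst k.
Proof. by apply/funext => -[|m] //=; rewrite subrr mulr0 mul0r. Qed.

(** The finitely many cones of [mu] bound [D]. For each [D] finitely many series occur, since each
    contributes a positive dimension at its own top weight and the sums of absolute values admit no
    cancellation. *)
Lemma K0_fin mu (w : rat) : in_K0 h e mu ->
  finite_set [set Psi | mu Psi != 0 /\ exists D : nat, Psi 0%N = qpow h (w + 2%:R * D%:R)].
Proof.
move=> [Hs [s1 [mus s2]]].
pose F Psi w' : int := `|mu Psi| * (dim_L h Psi w')%:Z.
have F0 Psi w' : 0 <= F Psi w' by rewrite mulr_ge0.
have top Psi w' : mu Psi != 0 -> Psi 0%N = qpow h w' -> F Psi w' != 0.
  move=> nz P0; have [S HS [[OS _] _]] := Hs _ nz.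
  by rewrite /F mulf_neq0 // ?normr_eq0 // (dim_L_top HS OS P0).
pose B := Num.bound (\sum_(m <- mus) `|m - w|).
have bd Psi (D : nat) : mu Psi != 0 -> Psi 0%N = qpow h (w + 2%:R * D%:R) -> (D < B)%N.
  move=> nz P0; have [|m mm [n E]] := s2 (w + 2%:R * D%:R).
    apply/eqP => E0; have := top _ _ nz P0.
    have := @fsum_term _ (fun Ps => F Ps (w + 2%:R * D%:R)) Psi (s1 _) (fun y => F0 y _).
    by rewrite E0 => le0; apply/negP; rewrite negbK eq_le le0 F0.
  have : (D%:R <= \sum_(m <- mus) `|m - w|).
    rewrite (big_rem m) //= -[D%:R]addr0; apply: lerD; last by apply: sumr_ge0.
    apply: le_trans (ler_norm _); have -> : m - w = n%:R * 2%:R + 2%:R * D%:R by rewrite -E; ring.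
    rewrite -natrM -natrM -natrD ler_nat; lia.
  move=> /le_lt_trans/(_ (archi_boundP _)); rewrite ltr_nat; apply.
  by apply: sumr_ge0.
have : finite_set (\bigcup_(D in `I_B) [set Psi | F Psi (w + 2%:R * D%:R) != 0]).
  by apply: bigcup_finite => [|D _]; [exact: finite_II|exact: s1].
by apply: sub_finite_set => Psi /= [nz [D P0]]; exists D; [exact: bd P0|exact: top].
Qed.

(** A series contributing to [Th] has its weight above that of [Th] by a multiple of [alpha_1], so
    [K0_fin] applies. *)
Lemma tm_fin r mu Th : in_K0 h e mu ->
  finite_set [set Psi | mu Psi * (tensor_mult h (lw_lin (qv r)) Psi Th)%:Z != 0].
Proof.
move=> Hmu; set A := [set Psi | _].
have key Psi : A Psi -> mu Psi != 0 /\ exists w D, Psi 0%N = qpow h w /\ Th 0%N = qpow h (w - 2%:R * D%:R).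
  rewrite /A /= mulf_eq0 negb_or => /andP[nz nt]; split=> //.
  have [S' HS' OS'] := (let: conj H _ := Hmu in H) Psi nz.
  have [_ _ [w P0]] := in_Oplus2Z_lw qnr HS' OS'.
  have [|S [W [S'' [T [t [HS HW HB Ht cT]]]]]] := @tm_ex _ h (lw_lin (qv r)) Psi Th; first exact: nt.
  rewrite -rk_lin in HS.
  have [d E] := tm_degree qnr (oner_neq0 _) HS HW Ht HB cT.
  exists w, d; split=> //; rewrite E /lam lw_mul0 /= mul1r P0 qpowD qpowN -natrM qpow_nat.
  by rewrite ?exprVn.
have [[Psi APsi]|no] := pselect (exists Psi, A Psi); last first.
  by apply: (sub_finite_set (B := set0)) => // Psi APsi; apply: no; exists Psi.
have [_ [w [D [_ T0]]]] := key _ APsi.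
have := K0_fin (w - 2%:R * D%:R) Hmu; apply: sub_finite_set => Ps /key[nz [w' [D' [P0 T0']]]].
split=> //; exists D'; rewrite P0; congr (qpow h _).
have : qpow h (w' - 2%:R * D'%:R) = qpow h (w - 2%:R * D%:R) by rewrite -T0 -T0'.
by move/(qpow_inj qnr) => <-; ring.
Qed.

(** Structure constants are nonnegative; the finiteness [tm_fin] is essential, as infinite sums are
    0 by convention. *)
Lemma K0_mono r lam mu Th : in_K0 h e mu -> (forall Psi, 0 <= lam Psi <= mu Psi) ->
  0 <= K0_mul h (cls (lw_lin (qv r))) lam Th <= K0_mul h (cls (lw_lin (qv r))) mu Th.
Proof.
move=> Hmu H; rewrite !K0_mulE; apply/andP; split.
  by apply: fsumr_ge0 => Psi _; rewrite mulr_ge0 //; have /andP[] := H Psi.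
apply: fsum_le => [|Psi]; first exact: tm_fin.
have /andP[l0 lm] := H Psi.
by rewrite mulr_ge0 //= ler_wpM2r.
Qed.

Section Iso.
Variable Phi : ((V -> int) * rat -> int) -> (lweight R -> int).
Hypothesis Phi_iso : E_algebra_iso h Phi.
Hypothesis Phi_z : forall r : V,
  Phi (tens (zvar r) (delta ((val r)%:~R / 2%:R))) = K0_class (lw_Psi (q ^ (val r))).
Local Notation completed := (@completed_cluster_algebra e).

Lemma Phi_in D : completed D -> in_K0 h e (Phi D).
Proof. by have [[H _ _] _ _ _] := Phi_iso; exact: H. Qed.
Lemma Phi_surj mu : in_K0 h e mu -> exists2 D, completed D & Phi D = mu.
Proof. by have [[_ _ H] _ _ _] := Phi_iso; exact: H. Qed.
Lemma Phi_inj D D' : completed D -> completed D' -> Phi D = Phi D' -> D = D'.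
Proof. by have [[_ H _] _ _ _] := Phi_iso; move=> c c'; apply: H; rewrite inE. Qed.
Lemma PhiD D D' : completed D -> completed D' -> Phi (D + D') = Phi D + Phi D'.
Proof. by have [_ H _ _] := Phi_iso; exact: H. Qed.
Lemma PhiM D D' : completed D -> completed D' -> Phi (Defs.conv D D') = K0_mul h (Phi D) (Phi D').
Proof. by have [_ _ H _] := Phi_iso; exact: H. Qed.
Lemma Phi0 : Phi 0 = 0.
Proof.
have := PhiD (completed0 e) (completed0 e); rewrite addr0 => /eqP.
by rewrite -subr_eq0 opprD addrA subrr sub0r oppr_eq0 => /eqP.
Qed.
Lemma Phi_neq0 D : completed D -> D <> 0 -> exists Th, Phi D Th != 0.
Proof.
move=> cD nD; apply: contrapT => no; apply: nD; apply: (Phi_inj cD (completed0 e)).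
rewrite Phi0; apply/funext => Th; apply/eqP; apply: contrapT => /negP nz.
by apply: no; exists Th.
Qed.

Lemma Phi_wt w : Phi (shift_by [::] w) = cls (lw_weight h w).
Proof.
have [_ _ _ H] := Phi_iso; rewrite /shift_by -lone_ex H; last exact: in_E_delta.
apply/funext => Psi; rewrite /E_to_K0 (@fsum1 _ w) => [|w' ne]; last by rewrite delta_neq ?mul0r.
by rewrite delta_xx mul1r.
Qed.

Lemma Phi_one r : Phi (shift_by [:: r] ((val r)%:~R / 2%:R)) = cls (lw_lin (qv r)).
Proof. by rewrite /shift_by -zvar_ex Phi_z. Qed.

(** The source of all tensor products used below: [Phi] sends a nonzero element to a nonzero one, so
    some [tensor_mult] is nonzero. *)
Lemma Phi_tensor D D' Psi Psi' : completed D -> completed D' -> Phi D = cls Psi -> Phi D' = cls Psi' ->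
  completed (Defs.conv D D') -> Defs.conv D D' <> 0 ->
  exists (S W T : bmod h) (t : S -> W -> T), [/\ is_L Psi S, is_L Psi' W & is_tensor t].
Proof.
move=> cD cD' E E' cc ne; have [Th] := Phi_neq0 cc ne; rewrite PhiM // E E' K0_mul_cc => nz.
have [|S [W [S'' [T [t [H1 H2 _ H4 _]]]]]] := @tm_ex _ h Psi Psi' Th; first exact: nz.
by exists S, W, T, t.
Qed.

Lemma shift_neq0 A w (D : (V -> int) * rat -> int) : D <> 0 -> Defs.conv (shift_by A w) D <> 0.
Proof.
move=> nD E; apply: nD; apply/funext => p; have := congr1 (fun f => f (p + (ex A, w))) E.
by rewrite /= shift_byE conv_delta addrK.
Qed.

Lemma cls_neq0 D Psi : Phi D = cls Psi -> D <> 0.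
Proof.
move=> E D0; have := congr1 (fun f => f Psi) E; rewrite D0 Phi0 /K0_class delta_xx.
by [].
Qed.

Lemma Phi_supp D Psi : completed D -> Phi D Psi != 0 ->
  exists2 S : bmod h, is_L Psi S & in_Oplus2Z e S.
Proof. by move=> /Phi_in[H _]; exact: H. Qed.

Lemma cls_supp D Psi : completed D -> Phi D = cls Psi ->
  exists2 S : bmod h, is_L Psi S & in_Oplus2Z e S.
Proof. by move=> cD E; apply: (Phi_supp cD); rewrite E /K0_class delta_xx. Qed.

(** The weight with which the monomial [z^A] has to be twisted to become the product of the
    corresponding [[L^+]]. *)
Definition halfw A : rat := \sum_(a <- A) ((val a)%:~R / 2%:R).

Lemma shift_cat A M w w' : Defs.conv (shift_by A w) (shift_by M w') = shift_by (A ++ M) (w + w').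
Proof. by rewrite !shift_byE conv_dd ex_cat. Qed.

(** Induction on [A] with [ten_poly]; the flag property is part of the statement because [ten_poly]
    requires it of the second factor. *)
Lemma Phi_shift A w : Phi (shift_by A (w + halfw A)) = cls (lw_mul (lw_weight h w) (lw_prod (map qv A))) /\
  exists2 S : bmod h, is_L (lw_mul (lw_weight h w) (lw_prod (map qv A))) S &
    flagw S (lw_mul (lw_weight h w) (lw_prod (map qv A))) (multiple (lw_mul (lw_weight h w) (lw_prod (map qv A)))).
Proof.
elim: A => [|a A [IH [S HS FS]]].
  rewrite /halfw big_nil addr0 /lw_prod big_nil [lw_mul _ _]lw_mulC lw_mul1 Phi_wt; split=> //.
  have [S HS _] := cls_supp (completed_delta _ _) (Phi_wt w); exists S => //.
  have HS' : is_L (rk_lw (qpow h w) 0 0) S by rewrite rk_cst.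
  have := flagw_rk qnr (qpow_neq0 h w) HS'; rewrite rk_cst; apply: flagw_sub => Th [l ->].
  by exists (q ^- (2 * l)); apply/funext => m; rewrite rk_th_a0 // rk_cst.
set Psi := lw_mul (lw_weight h w) (lw_prod (map qv A)) in IH HS FS.
have E : lw_mul (lw_weight h w) (lw_prod (map qv (a :: A))) = lw_mul (rk_lw 1 0 (qv a)) Psi.
  by rewrite /= lw_prod_cons rk_lin /Psi !lw_mulA (lw_mulC (lw_weight h w)).
have Es : shift_by (a :: A) (w + halfw (a :: A)) = Defs.conv (shift_by [:: a] ((val a)%:~R / 2%:R)) (shift_by A (w + halfw A)).
  by rewrite shift_cat /halfw big_cons; congr (shift_by _ _); ring.
have [||S1 [W [T [t [HS1 HW Ht]]]]] := Phi_tensor (completed_delta _ _) (completed_delta _ _) (Phi_one a) IH.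
- by rewrite -Es; exact: completed_delta.
- by apply: shift_neq0; exact: (cls_neq0 IH).
rewrite -rk_lin in HS1; have FW := flagw_biso (is_L_iso qnr HS HW) FS.
have [z1 z2] := lw_prod_lead (all_qv A).
have P m : Psi m = qpow h w * lw_prod (map qv A) m by rewrite /Psi /lw_weight lw_cstE.
have [||HT FT] := ten_poly qnr (oner_neq0 _) HS1 HW Ht (qv_neq0 a) FW (d := size (map qv A)).
- by rewrite P mulf_neq0 // qpow_neq0.
- by move=> m /z2 E0; rewrite P E0 mulr0.
rewrite E; split; last by exists T.
rewrite Es PhiM; [|exact: completed_delta..]; rewrite Phi_one IH; apply/funext => Th.
rewrite -rk_lin (K0_mul_mult qnr (F := fun Th => nat_of_bool `[< Th = lw_mul (rk_lw 1 0 (qv a)) Psi >]) Th HS1 HW Ht) //.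
- by move=> Th' S'' HS''; exact: (simple_mult qnr HT HS'').
- by move=> Th'; case: asboolP => // -> _; exists T.
Qed.

(** Multiplication by [[L^+]] loses nothing: each [[L(Psi)]] contributes at least the top
    constituent of its product, and all other contributions are nonnegative. *)
Lemma Phi_top r D Psi : completed D -> (forall Th, 0 <= Phi D Th) ->
  Phi D Psi <= Phi (Defs.conv (shift_by [:: r] ((val r)%:~R / 2%:R)) D) (lw_mul (lw_lin (qv r)) Psi).
Proof.
move=> cD pos; have Hin := Phi_in cD.
have cr := completed_delta [:: r] ((val r)%:~R / 2%:R).
rewrite PhiM // Phi_one K0_mulE; set Th := lw_mul _ _.
have [->|nz] := eqVneq (Phi D Psi) 0.
  by apply: fsumr_ge0 => Psi' _; rewrite mulr_ge0.
(* Surjectivity of [Phi] provides a preimage of the single class [[L(Psi)]], from which [Phi_tensor]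
   gets the tensor product. *)
have [S HS OS] := Phi_supp cD nz; have [D1 cD1 E1] := Phi_surj (class_in_K0 qnr HS OS).
have [||S1 [W [T [t [HS1 HW Ht]]]]] := Phi_tensor cr cD1 (Phi_one r) E1.
- exact: completed_shift.
- by apply: shift_neq0; exact: (cls_neq0 E1).
have [_ _ [w P0]] := in_Oplus2Z_lw qnr HS OS; have [[OS1 _] _] := OS.
rewrite -rk_lin in HS1.
have fW : findim W Psi.
  move=> d; have [m [b Hb]] := findim_O OS1 P0 d.
  have [f [bf [g fK gK]]] := is_L_iso qnr HS HW; exists m, (f \o b) => u du.
  have [_ _ _ gk] := bhom_op bf; have [fl fg] := bf.
  have [|c Ec] := Hb (g u).
    by rewrite /dg; apply: (can_inj fK); rewrite gk gK du -[X in f X]addr0 fl gK (bhom0 bf) addr0.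
  exists c; rewrite -(gK u) Ec /=.
  by elim/big_rec2: _ => [|i y1 y2 _ <-]; rewrite ?(bhom0 bf) // -fl.
have tp := tm_top qnr (oner_neq0 _) HS1 HW Ht fW; rewrite rk_lin in tp.
apply: le_trans (@fsum_term _ _ Psi (tm_fin r Th Hin) _) => [|Psi']; last by rewrite mulr_ge0.
by rewrite -[X in X <= _]mulr1 ler_wpM2l // lez_nat.
Qed.
End Iso.
End Grothendieck.

(** * Arcs and Laurent monomials *)

Section Counting.
Lemma perm_sub (T : eqType) (s t : seq T) : (forall x, (count_mem x s <= count_mem x t)%N) ->
  exists r, perm_eq t (s ++ r).
Proof.
elim: s t => [|x s IH] t H; first by exists t.
have xt : x \in t by rewrite -has_pred1 has_count; apply: leq_trans (H x); rewrite /= eqxx.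
have pt := perm_to_rem xt.
have [|r pr] := IH (rem x t).
  by move=> y; have := H y; rewrite (permP pt) /= leq_add2l.
by exists r; apply: perm_trans pt _; rewrite /= perm_cons.
Qed.

Lemma seq_max (s : seq int) (P : pred int) : has P s ->
  exists c, [/\ c \in s, P c & forall x, x \in s -> P x -> x <= c].
Proof.
elim: s => //= a s IH; have [/IH[c [cs Pc H]] _|/hasPn no] := boolP (has P s).
  have [Pa|nPa] := boolP (P a); last first.
    exists c; rewrite inE cs orbT; split=> // x; rewrite inE => /orP[/eqP ->|/H//].
    by rewrite (negPf nPa).
  have [ac|ca] := lerP a c.
    exists c; rewrite inE cs orbT; split=> // x; rewrite inE => /orP[/eqP -> //|]; exact: H.
  exists a; rewrite inE eqxx; split=> // x; rewrite inE => /orP[/eqP -> //|xs Px].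
  by apply: le_trans (ltW ca); exact: H.
rewrite orbF => Pa; exists a; rewrite inE eqxx; split=> // x.
by rewrite inE => /orP[/eqP -> //|/no/negPf ->].
Qed.

(** The maxima are ordered, by the hypothesis at the maximum of [t]; remove them and repeat. *)
Lemma sum_le_count (s t : seq int) : size s = size t ->
  (forall c, c \in t -> (count (> c)%R s <= count (> c)%R t)%N) ->
  \sum_(x <- s) x <= \sum_(x <- t) x.
Proof.
have [n] := ubnP (size s); elim: n s t => // n IH s t; rewrite ltnS => sn st H.
have [s0|sne] := boolP (s == [::]).
  by move: st; rewrite (eqP s0) /= => /esym/size0nil ->; rewrite !big_nil.
have hs : has xpredT s by rewrite has_predT lt0n size_eq0.
have ht : has xpredT t by rewrite has_predT -st lt0n size_eq0.
have [a [as_ _ amax]] := seq_max hs; have [c [ct _ cmax]] := seq_max ht.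
have ps := perm_to_rem as_; have pt := perm_to_rem ct.
have ac : a <= c.
  rewrite leNgt; apply/negP => ca; have := H c ct.
  have -> : count (> c)%R t = 0%N.
    apply/eqP; rewrite -leqn0 leqNgt -has_count; apply/hasPn => x xt /=.
    by rewrite -leNgt; exact: cmax.
  by rewrite (permP ps) /= ca.
rewrite (perm_big _ ps) (perm_big _ pt) !big_cons /= lerD //; apply: IH.
- by rewrite size_rem // prednK // lt0n size_eq0.
- by rewrite !size_rem // st.
- move=> c' c't'; have c't := mem_rem c't'; have := H c' c't.
  rewrite (permP ps) (permP pt) /=.
  have [cc'|] := ltrP c' c.
    have [ca|ac'] := ltrP c' a; first by rewrite leq_add2l.
    move=> _; have -> // : count (> c')%R (rem a s) = 0%N.
    apply/eqP; rewrite -leqn0 leqNgt -has_count; apply/hasPn => x xs /=.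
    by rewrite -leNgt (le_trans _ ac') //; apply: amax => //; exact: mem_rem xs.
  move=> cc' H'; have [ca|ac'] := ltrP c' a.
    by have := lt_le_trans ca (le_trans ac cc'); rewrite ltxx.
  have -> // : count (> c')%R (rem a s) = 0%N.
  apply/eqP; rewrite -leqn0 leqNgt -has_count; apply/hasPn => x xs /=.
  by rewrite -leNgt (le_trans _ ac') //; apply: amax => //; exact: mem_rem xs.
Qed.
End Counting.

Section Arcs.

(** A Laurent monomial [z^A / z^B] is given by the pair [(A, B)]. *)
Definition mono := (seq int * seq int)%type.
Implicit Types (p : mono).
Definition peq p p' := perm_eq (p.1 ++ p'.2) (p'.1 ++ p.2).
Definition pmul p p' : mono := (p.1 ++ p'.1, p.2 ++ p'.2).
Definition pval (phi : int -> int) p : int := \sum_(a <- p.1) phi a - \sum_(b <- p.2) phi b.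

Lemma pval_peq phi p p' : peq p p' -> pval phi p = pval phi p'.
Proof.
move=> E; have : \sum_(a <- p.1 ++ p'.2) phi a = \sum_(a <- p'.1 ++ p.2) phi a by exact: perm_big.
by rewrite !big_cat /pval => E'; apply/eqP; rewrite subr_eq addrAC eq_sym subr_eq eq_sym; apply/eqP.
Qed.
Lemma pval_mul phi p p' : pval phi (pmul p p') = pval phi p + pval phi p'.
Proof. by rewrite /pval /= !big_cat opprD addrACA. Qed.
Lemma peq_refl p : peq p p. Proof. exact: perm_refl. Qed.
Lemma peqP p p' : peq p p' <-> forall r, (count_mem r p.1 + count_mem r p'.2 = count_mem r p'.1 + count_mem r p.2)%N.
Proof.
split=> [/permP H r|H]; first by have := H (pred1 r); rewrite !count_cat.
by apply/allP => r _; have := H r; rewrite /= !count_cat => ->.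
Qed.
Lemma peq_trans p p' p'' : peq p p' -> peq p' p'' -> peq p p''.
Proof. by rewrite !peqP => H H' r; have := H r; have := H' r; lia. Qed.

(** The arc [(a, Some b)] of the infinite polygon with vertex set [int] and one
    more vertex at infinity joins [a] to [b]; [(a, None)] joins [a] to infinity. *)
Definition chord := (int * option int)%type.
Implicit Types (x y : chord) (f g : seq chord).

Definition arc_ok x : bool := if x.2 is Some b then x.1 + 1 < b else true.
Definition top1 x : mono := ([:: x.1], if x.2 is Some b then [:: b - 1] else [::]).
Definition arc_int x : seq int := if x.2 is Some b then [seq x.1 + i%:Z | i <- iota 0 (absz (b - 1 - x.1)%R)] else [::].
(** The cluster variable attached to the arc from [a] to [b] has the Laurent
    expansion [\sum_(a <= k < b) z_a z_b / (z_k z_(k+1))]; the term [k = b - 1],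
    which is the highest l-weight, is [top1]. *)
Definition mons1 x : seq mono :=
  top1 x :: if x.2 is Some b then [seq ([:: x.1; b], [:: k; k + 1]) | k <- arc_int x] else [::].
Fixpoint mons f : seq mono :=
  if f is x :: f' then [seq pmul m m' | m <- mons1 x, m' <- mons f'] else [:: ([::], [::])].
Fixpoint topm f : mono := if f is x :: f' then pmul (top1 x) (topm f') else ([::], [::]).

(** Oriented: [y] starts strictly inside [x] and ends beyond it. The other crossings are obtained by
    exchanging [x] and [y]. *)
Definition crosses x y : bool :=
  if x.2 is Some b then
    [&& x.1 < y.1, y.1 < b & if y.2 is Some d then b < d else true]
  else false.
Definition noncrossing f := forall x y, x \in f -> y \in f -> ~~ crosses x y.

Lemma arc_intP a b k : a + 1 < b -> (k \in arc_int (a, Some b)) = (a <= k < b - 1).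
Proof.
move=> ab; apply/mapP/idP => [[i /=]|/andP[k1 k2]].
  rewrite mem_iota => /andP[_ lt] ->; apply/andP; split; first by lia.
  by rewrite add0n in lt; move: lt; lia.
by exists (absz (k - a)%R); rewrite ?mem_iota /=; lia.
Qed.

Lemma mons_consP x f p : p \in mons (x :: f) ->
  exists m m', [/\ m \in mons1 x, m' \in mons f & p = pmul m m'].
Proof. by move=> /allpairsP[[m m'] [mx mf ->]]; exists m, m'. Qed.

Lemma topm_mons f : topm f \in mons f.
Proof.
elim: f => [|x f IH] /=; first by rewrite inE.
by rewrite mem_cat map_f.
Qed.

Lemma mons_ub phi (M : chord -> int) f : (forall x m, x \in f -> m \in mons1 x -> pval phi m <= M x) ->
  forall p, p \in mons f -> pval phi p <= \sum_(x <- f) M x.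
Proof.
elim: f => [|x f IH] H p; first by rewrite /= inE => /eqP ->; rewrite /pval !big_nil.
move=> /mons_consP[m [m' [mx mf ->]]]; rewrite pval_mul big_cons; apply: lerD.
  by apply: H => //; rewrite inE eqxx.
by apply: IH => // y k yf; apply: H; rewrite inE yf orbT.
Qed.

Lemma mons_lb phi (M : chord -> int) f : (forall x, x \in f -> exists2 m, m \in mons1 x & M x <= pval phi m) ->
  exists2 p, p \in mons f & \sum_(x <- f) M x <= pval phi p.
Proof.
elim: f => [|x f IH] H; first by exists ([::], [::]); rewrite ?inE // /pval !big_nil.
have [m mx Hm] := H x (mem_head _ _).
have [p pf Hp] := IH (fun y yf => H y (mem_behead (s := x :: f) yf)).
exists (pmul m p); first by apply/allpairsP; exists (m, p).
by rewrite pval_mul big_cons lerD.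
Qed.

Lemma pval1 phi a : pval phi ([:: a], [::]) = phi a. Proof. by rewrite /pval big_seq1 big_nil subr0. Qed.
Lemma pval2 phi a b : pval phi ([:: a], [:: b]) = phi a - phi b. Proof. by rewrite /pval !big_seq1. Qed.
Lemma pval4 phi a b k l : pval phi ([:: a; b], [:: k; l]) = phi a + phi b - (phi k + phi l).
Proof. by rewrite /pval !big_cons !big_nil !addr0. Qed.

Lemma mons1P x m : arc_ok x -> m \in mons1 x ->
  m = top1 x \/ exists b k, [/\ x = (x.1, Some b), x.1 <= k < b - 1 & m = ([:: x.1; b], [:: k; k + 1])].
Proof.
case: x => a [b|] ok; rewrite /mons1 in_cons => /predU1P[->|//]; try by left.
by move=> /mapP[k]; rewrite arc_intP // => kk ->; right; exists b, k.
Qed.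

Lemma mons1_in a b k : a + 1 < b -> a <= k < b - 1 -> ([:: a; b], [:: k; k + 1]) \in mons1 (a, Some b).
Proof. by move=> ab kk; rewrite inE; apply/orP; right; apply/mapP; exists k; rewrite // arc_intP. Qed.

(** * Comparison of families through linear functions of exponents *)

Section Comparison.
Variables (f g : seq chord).
Hypotheses (okf : all arc_ok f) (okg : all arc_ok g) (ncf : noncrossing f).
Hypothesis sub : forall p, p \in mons g -> exists2 p', p' \in mons f & peq p p'.

(** The values of a linear function of exponents on the monomials of [g] are among those on the
    monomials of [f]. Such a function is therefore bounded arc by arc: from above for all monomials
    of [f], from below for one well chosen monomial of each arc of [g]. *)
Lemma bound_le phi (M M' : chord -> int) :
  (forall x m, x \in f -> m \in mons1 x -> pval phi m <= M x) ->
  (forall x, x \in g -> exists2 m, m \in mons1 x & M' x <= pval phi m) ->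
  \sum_(x <- g) M' x <= \sum_(x <- f) M x.
Proof.
move=> Hf Hg; have [p pg Hp] := mons_lb Hg; have [p' p'f E] := sub pg.
by apply: le_trans Hp _; rewrite (pval_peq phi E); exact: mons_ub p'f.
Qed.

Lemma sum_count (x : chord) s : \sum_(y <- s) (- (y == x)%:Z) = - (count_mem x s)%:Z.
Proof. by elim: s => [|y s IH]; rewrite ?big_nil // big_cons IH /=; lia. Qed.

(** The function counts exponents strictly between [i] and [j]. On an arc not crossing [(i, j)] it
    is at most 0, and at most -1 on [(i, j)] itself; conversely every arc has a monomial with value
    at least 0, or -1 for [(i, j)]. *)
Lemma count_fin i j : (i, Some j) \in f -> (count_mem (i, Some j) f <= count_mem (i, Some j) g)%N.
Proof.
move=> ijf; have ij : i + 1 < j by have := allP okf _ ijf.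
pose phi r : int := ((i < r) && (r < j))%:Z.
suff : \sum_(y <- g) (- (y == (i, Some j))%:Z) <= \sum_(y <- f) (- (y == (i, Some j))%:Z).
  by rewrite !sum_count; lia.
apply: (@bound_le phi) => [x m xf /(mons1P (allP okf _ xf))|x xg].
  have okx := allP okf _ xf; have nc1 := ncf ijf xf; have nc2 := ncf xf ijf.
  case: x xf okx nc1 nc2 => a [b|] xf okx; rewrite /crosses /arc_ok /= in okx * => nc1 nc2.
    case=> [->|[b' [k [[Eb] kk ->]]]]; rewrite ?pval4 ?pval2 /phi.
      rewrite -[_ == _]/((a == i) && (b == j)); move: nc1 nc2 okx ij; clear; rewrite /=; lia.
    subst b'; rewrite -[_ == _]/((a == i) && (b == j)); move: nc1 nc2 okx ij kk; clear; rewrite /=; lia.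
  case=> [->|[b [k [//]]]]; rewrite pval1 /phi -[_ == _]/((a == i) && false); move: nc1 nc2; clear; rewrite /=; lia.
have okx := allP okg _ xg.
case: x xg okx => a [b|] xg okx; rewrite /arc_ok /= in okx; last first.
  by exists ([:: a], [::]); rewrite ?inE // pval1 /phi /=; lia.
rewrite -[_ == _]/((a == i) && (b == j)).
have [ai|ia] := ltrP a i; [|have [ai|nai] := eqVneq a i].
- exists ([:: a; b], [:: a; a + 1]); first by apply: mons1_in; lia.
  by rewrite pval4 /phi; move: okx ai; clear; rewrite /=; lia.
- subst a; have [bj|jb] := lerP b j.
    exists ([:: i; b], [:: i; i + 1]); first by apply: mons1_in; lia.
    by rewrite pval4 /phi; move: okx bj ij; clear; rewrite /=; lia.
  exists ([:: i], [:: b - 1]); first exact: mem_head.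
  by rewrite pval2 /phi; move: okx jb ij; clear; rewrite /=; lia.
- exists ([:: a], [:: b - 1]); first exact: mem_head.
  by rewrite pval2 /phi; move: okx ia nai; clear; rewrite /=; lia.
Qed.

Definition inf_pos s : seq int := [seq x.1 | x <- [seq y <- s | y.2 == None :> option int]].

Lemma sum_inf (F : int -> int) s : \sum_(x <- s) (if x.2 is Some _ then 0 else F x.1) = \sum_(a <- inf_pos s) F a.
Proof.
rewrite /inf_pos big_map big_filter [RHS]big_mkcond /=; apply: eq_bigr => -[a [b|]] _ //.
Qed.

(** The total degree of a monomial is the number of arcs to infinity. *)
Lemma size_inf : size (inf_pos g) = size (inf_pos f).
Proof.
have key s : all arc_ok s -> forall p, p \in mons s -> pval (fun=> 1) p = (size (inf_pos s))%:Z.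
  move=> oks p ps; have E (F : int -> int) : \sum_(a <- inf_pos s) 1 = (size (inf_pos s))%:Z.
    by rewrite big_const_seq count_predT; elim: (size _) => //= n ->; lia.
  have H x m : x \in s -> m \in mons1 x -> pval (fun=> 1) m = if x.2 is Some _ then 0 else 1.
    move=> xs /(mons1P (allP oks _ xs))[->|[b [k [-> _ ->]]]]; last by rewrite pval4.
    by case: x xs => a [b|] _; rewrite ?pval2 ?pval1.
  rewrite -(E (fun=> 1)) -(sum_inf (fun=> 1)); elim: s p ps H {oks E} => [|x s IH] p.
    by rewrite inE => /eqP -> _; rewrite /pval !big_nil.
  move=> /mons_consP[m [m' [mx ms ->]]] H; rewrite pval_mul big_cons; congr (_ + _).
    by rewrite (H x) ?inE ?eqxx.
  by apply: IH => // y n ys; apply: H; rewrite inE ys orbT.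
have [p' p'f E] := sub (topm_mons g).
have := key f okf _ p'f; rewrite -(pval_peq _ E) (key g okg _ (topm_mons g)).
by case.
Qed.

(** The function counts exponents above [c], where the arc from [c] to infinity is in [f]. Finite
    arcs not crossing that one have no monomial of positive value, while every finite arc has one of
    value at least 0. *)
Lemma inf_le : \sum_(a <- inf_pos g) a <= \sum_(a <- inf_pos f) a.
Proof.
apply: sum_le_count => [|c cf]; first exact: size_inf.
pose phi r : int := (c < r)%R%:Z.
have cnt s : \sum_(a <- s) phi a = (count (> c)%R s)%:Z.
  by elim: s => [|a s IH]; rewrite ?big_nil // big_cons IH /= /phi PoszD.
suff : \sum_(a <- inf_pos g) phi a <= \sum_(a <- inf_pos f) phi a by rewrite !cnt.
rewrite -!sum_inf.
have cf' : (c, None) \in f.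
  by move: cf => /mapP[[a [b|]]]; rewrite mem_filter //= => xf ->.
apply: (@bound_le phi) => [x m xf /(mons1P (allP okf _ xf))|x xg].
  have okx := allP okf _ xf; have nc1 := ncf xf cf'.
  case: x xf okx nc1 => a [b|] xf okx; rewrite /crosses /arc_ok /= in okx * => nc1.
    case=> [->|[b' [k [[Eb] kk ->]]]]; rewrite ?pval4 ?pval2 /phi.
      by move: nc1 okx; clear; rewrite /=; lia.
    by subst b'; move: nc1 okx kk; clear; rewrite /=; lia.
  by case=> [->|[b [k [//]]]]; rewrite pval1.
have okx := allP okg _ xg.
case: x xg okx => a [b|] xg okx; rewrite /arc_ok /= in okx; last first.
  by exists ([:: a], [::]); rewrite ?inE // pval1.
have [ac|ca] := lerP a c.
  exists ([:: a; b], [:: a; a + 1]); first by apply: mons1_in; lia.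
  by rewrite pval4 /phi; move: okx ac; clear; rewrite /=; lia.
exists ([:: a], [:: b - 1]); first exact: mem_head.
by rewrite pval2 /phi; move: okx ca; clear; rewrite /=; lia.
Qed.

Variable H : int.

Lemma pval_top (phi : int -> int) s : pval phi (topm s) = \sum_(x <- s) pval phi (top1 x).
Proof. by elim: s => [|x s IH]; rewrite ?big_nil ?big_cons ?pval_mul ?IH // /pval !big_nil. Qed.

(** The height of the leading monomial adds the spans of the finite arcs and the distances to [H] of
    the ends of the infinite ones. *)
Definition height a := H - a.

Lemma height_split s : pval height (topm s) =
  \sum_(x <- s) (if x.2 is Some b then b - 1 - x.1 else 0) + ((size (inf_pos s))%:Z * H - \sum_(a <- inf_pos s) a).
Proof.
have -> : (size (inf_pos s))%:Z * H - \sum_(a <- inf_pos s) a = \sum_(a <- inf_pos s) height a.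
  rewrite /height sumrB big_const_seq count_predT; congr (_ - _).
  by elim: (size _) => [|n IH]; rewrite ?mul0r //= -IH; lia.
rewrite -(sum_inf height) -big_split pval_top /=; apply: eq_bigr => -[a [b|]] _; rewrite ?pval2 ?pval1 /height /=; lia.
Qed.

(** Finite arcs of [f] occur at least as often in [g] and have positive height; there are equally
    many infinite arcs, and their ends have the larger sum in [f]. *)
Lemma comparison : pval height (topm f) <= pval height (topm g).
Proof.
rewrite !height_split size_inf; apply: lerD; last by have := inf_le; lia.
pose isf := (fun x : chord => if x.2 is Some _ then true else false).
pose wt := (fun x : chord => if x.2 is Some b then b - 1 - x.1 else 0).
have E (s : seq chord) : \sum_(x <- s) wt x = \sum_(x <- seq.filter isf s) wt x.
  by rewrite big_filter [RHS]big_mkcond; apply: eq_bigr => -[a [b|]].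
change (\sum_(x <- f) wt x <= \sum_(x <- g) wt x).
rewrite (E f) (E g); have [|r pr] := @perm_sub _ (seq.filter isf f) (seq.filter isf g).
  move=> x; rewrite !count_filter; case: x => i [j|]; last first.
    rewrite (@eq_count _ _ pred0) ?count_pred0 // => y /=.
    by apply/negbTE/negP => /andP[/eqP ->].
  have H' s : count (predI (pred1 (i, Some j)) isf) s = count_mem (i, Some j) s.
    apply: eq_count => y /=; case: eqP => //= -> //.
  rewrite !H'; have [xf|nxf] := boolP ((i, Some j) \in f); first exact: count_fin.
  by rewrite (count_memPn nxf).
rewrite (perm_big _ pr) big_cat /= lerDl big_seq; apply: sumr_ge0 => x xr.
have : x \in seq.filter isf g by rewrite (perm_mem pr) mem_cat xr orbT.
by rewrite mem_filter => /andP[_ /(allP okg)]; case: x {xr} => a [b|] //; rewrite /arc_ok /wt /=; lia.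
Qed.
End Comparison.

(** In an arc from [a] to [b] the term [k] has height [2 k + 1 - a - b], which for [k < b - 1] is
    below the height [b - 1 - a] of the leading term. *)
Lemma height_lt H f p : all arc_ok f -> p \in mons f -> ~~ peq p (topm f) ->
  pval (height H) p < pval (height H) (topm f).
Proof.
elim: f p => [|x f IH] p; first by rewrite inE => _ /eqP ->; rewrite peq_refl.
move=> /= /andP[okx okf] /mons_consP[m [m' [mx mf ->]]] ne; rewrite !pval_mul.
have le1 : pval (height H) m' <= pval (height H) (topm f).
  by have [E|ne'] := boolP (peq m' (topm f)); [rewrite (pval_peq _ E)|apply: ltW; exact: IH].
have [Em|[b [k [Ex kk ->]]]] := mons1P okx mx.
  rewrite Em ltrD2l; apply: IH => //; apply: contra ne; rewrite Em !peqP => E r.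
  by rewrite /pmul !count_cat addnACA (E r) addnACA.
apply: ltr_leD => //; rewrite Ex /top1 pval4 pval2 /height; rewrite Ex in okx; move: okx kk; rewrite /arc_ok /=; lia.
Qed.

(** Ensures that a family matched to a monomial of [f] stays below the same bound [H]. *)
Lemma mons_bd H f p : all arc_ok f -> (forall x, x \in f -> x.1 < H /\ (forall b, x.2 = Some b -> b < H)) ->
  p \in mons f -> (forall a, a \in p.1 -> a < H) /\ (forall b, b \in p.2 -> b + 1 < H).
Proof.
elim: f p => [|x f IH] p; first by rewrite inE => _ _ /eqP ->.
move=> /andP[okx okf] Hf /mons_consP[m [m' [mx mf ->]]].
have [|I1 I2] := IH m' okf _ mf; first by move=> y yf; apply: Hf; rewrite inE yf orbT.
have [H1 H2] := Hf x (mem_head _ _).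
have [J1 J2] : (forall a, a \in m.1 -> a < H) /\ (forall b, b \in m.2 -> b + 1 < H).
  case: x okx mx H1 H2 {Hf} => a ob okx mx /= H1 H2.
  have [->|[b [k [[Ex] kk ->]]]] := mons1P okx mx; rewrite /=.
    case: ob H2 {okx mx} => [b|] H2; split=> c; rewrite ?inE // => /eqP -> //.
    by have := H2 b erefl; lia.
  have := H2 b Ex => bH; move: kk => /= kk.
  by split=> c; rewrite !inE => /orP[] /eqP ->; lia.
by split=> c; rewrite mem_cat => /orP[]; [exact: J1|exact: I1|exact: J2|exact: I2].
Qed.

(** Parenthesis matching: the smallest [be \in B] is joined to the largest
    [al \in A] with [al <= be]. *)
Lemma matching (A B : seq int) :
  (forall c, (count (<= c)%R B <= count (<= c)%R A)%N) ->
  exists f, [/\ all arc_ok f, noncrossing f, peq (A, B) (topm f) &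
    forall x, x \in f -> x.1 \in A /\ forall b, x.2 = Some b -> b - 1 \in B].
Proof.
have [n] := ubnP (size B); elim: n A B => // n IH A B; rewrite ltnS => sB HAB.
have [B0|Bne] := boolP (B == [::]).
  exists [seq (a, None) | a <- A]; rewrite (eqP B0); split.
  - by apply/allP => x /mapP[a _ ->].
  - by move=> x y /mapP[a _ ->].
  - have -> : topm [seq (a, None) | a <- A] = (A, [::]) by elim: A {HAB} => //= a A ->.
    exact: peq_refl.
  - by move=> x /mapP[a aA ->].
have [|mbe [mbB _ bmin]] := @seq_max (map -%R B) xpredT; first by rewrite has_predT size_map lt0n size_eq0.
have [be beB Ebe] := mapP mbB; subst mbe.
have {}bmin (x : int) : x \in B -> be <= x by move=> xB; have := bmin _ (map_f _ xB) isT; rewrite lerN2.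
have [|al [alA albe almax]] := @seq_max A (<= be)%R.
  rewrite has_count; apply: leq_trans (HAB be); rewrite -has_count; apply/hasP.
  by exists be => //=.
have pA := perm_to_rem alA; have pB := perm_to_rem beB.
have [||f [okf ncf topf inf]] := IH (rem al A) (rem be B).
- by rewrite size_rem // prednK // lt0n size_eq0.
- move=> c; have := HAB c; rewrite (permP pA) (permP pB) /=.
  have [bc|cb] := lerP be c; first by rewrite (le_trans albe bc) leq_add2l.
  move=> _; have -> // : count (<= c)%R (rem be B) = 0%N.
  apply/eqP; rewrite -leqn0 leqNgt -has_count; apply/hasPn => x xB /=.
  by rewrite -ltNge (lt_le_trans cb) // bmin // (mem_rem xB).
have topf' : peq (A, B) (pmul ([:: al], [:: be]) (topm f)).
  by move: topf; rewrite !peqP => E r; have := E r; rewrite /= (permP pA) (permP pB) /=; lia.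
have inf' x : x \in f -> x.1 \in A /\ forall b, x.2 = Some b -> b - 1 \in B.
  by move=> /inf[H1 H2]; split=> [|b /H2 H3]; [exact: mem_rem H1|exact: mem_rem H3].
have [E|nab] := eqVneq al be.
  exists f; split=> //; apply: peq_trans topf' _; rewrite E; apply/peqP => r /=; lia.
exists ((al, Some (be + 1)) :: f).
have albe' : al < be by rewrite lt_neqAle nab.
have okx : arc_ok (al, Some (be + 1)) by rewrite /arc_ok /= ltrD2r.
split=> [/=||/=|x].
- by rewrite okx okf.
- have c1 y : y \in f -> ~~ crosses (al, Some (be + 1)) y.
    move=> /inf[yA _]; rewrite /crosses /=; apply/negP => /and3P[ay yb _].
    have yb' : y.1 <= be by rewrite -ltzD1.
    by have := almax y.1 (mem_rem yA) yb'; rewrite leNgt ay.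
  have c2 y : y \in f -> ~~ crosses y (al, Some (be + 1)).
    move=> /inf[_ yB]; rewrite /crosses; case Ey : y.2 => [b|] //=; apply/negP => /and3P[ya ab bb].
    have := bmin _ (mem_rem (yB b Ey)); rewrite lerBrDr => /le_lt_trans/(_ bb).
    by rewrite ltxx.
  move=> x y; rewrite !inE => /orP[/eqP ->|xf] /orP[/eqP ->|yf]; [|exact: c1|exact: c2|exact: ncf].
  by rewrite /crosses /= ltxx.
- by apply: peq_trans topf' _; apply/peqP => r; rewrite /= addrK.
- rewrite inE => /orP[/eqP ->|/inf'//]; split=> // b [<-]; by rewrite addrK.
Qed.
Lemma count_top f : all arc_ok f -> count (peq ^~ (topm f)) (mons f) = 1%N.
Proof.
elim: f => [|x f IH]; first by [].
move=> /= /andP[okx okf]; rewrite count_cat.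
have -> : count (peq^~ (pmul (top1 x) (topm f))) [seq pmul (top1 x) m' | m' <- mons f] = 1%N.
  rewrite count_map -[RHS](IH okf); apply: eq_count => m /=.
  by apply/idP/idP => /peqP H; apply/peqP => r; have := H r; rewrite /pmul /= !count_cat; lia.
apply/eqP; rewrite -[X in _ == X]addn0 eqn_add2l; apply/eqP/eqP; rewrite -leqn0 leqNgt -has_count.
apply/hasPn => p /allpairsP[[m m'] [/= mx mf ->]]; apply/negP => /(pval_peq (height 0)).
rewrite !pval_mul.
have le1 : pval (height 0) m' <= pval (height 0) (topm f).
  have [E|ne'] := boolP (peq m' (topm f)); [by rewrite (pval_peq _ E)|apply: ltW; exact: height_lt].
case: x okx mx => a [b|//] okx /mapP[k kk ->]; rewrite arc_intP // in kk.
rewrite /top1 pval4 pval2 /height /=; move: kk le1; rewrite /height /arc_ok /=; lia.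
Qed.

Definition bounded H f := forall x, x \in f -> x.1 < H /\ (forall b, x.2 = Some b -> b < H).

Lemma height_ge0 H f : all arc_ok f -> bounded H f -> 0 <= pval (height H) (topm f).
Proof.
move=> okf Hf; rewrite pval_top big_seq; apply: sumr_ge0 => x xf.
have [H1 H2] := Hf x xf; have := allP okf x xf.
case: x xf H1 H2 => a [b|] xf /= H1 H2; rewrite /arc_ok /top1 ?pval2 ?pval1 /height /=; lia.
Qed.

End Arcs.

(** Equality of two products up to associativity and commutativity, by rotating
    the right-hand side until the first factors agree. *)
Ltac lw_ac := rewrite -?lw_mulA; do 40? [ first [ reflexivity
  | match goal with |- lw_mul ?a _ = lw_mul ?a _ => congr (lw_mul _ _) end
  | rewrite [RHS]lw_mulC -?lw_mulA ] ].

(** * The l-weight of a Laurent monomial *)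

Section Vertices.
Variable e : bool.
Local Notation V := (vtx e).
Lemma vx_proof (n : int) : odd (absz (n * 2 + e%:Z)) == e.
Proof. by case: e; lia. Qed.
(** Parametrizes the vertices by all integers, so that the arrow from [r] to [r + 2] goes from [n]
    to [n + 1]. *)
Definition vx (n : int) : V := exist _ (n * 2 + e%:Z) (vx_proof n).
Lemma vx_val n : val (vx n) = n * 2 + e%:Z. Proof. by []. Qed.
Lemma vx_inj : injective vx.
Proof. by move=> m n /(congr1 val); rewrite !vx_val; lia. Qed.
Lemma vx_surj r : exists n, r = vx n.
Proof.
have H := valP r; exists ((val r - e%:Z) %/ 2)%Z; apply: val_inj; rewrite vx_val.
by move: H; case: e r => r; lia.
Qed.

Definition vxs (A : seq int) : seq V := map vx A.
End Vertices.

Section Monomials.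
Variables (R : realType) (h : R[i]).
Local Notation C := R[i].
Local Notation q := (qpar h).
Hypothesis qnr : forall n : nat, (0 < n)%N -> q ^+ n != 1.
Let q0 : q != 0 := q_neq0 h.
Variable e : bool.
Local Notation V := (vtx e).
Implicit Types (A B : seq int) (p : mono) (w : rat) (Psi Th : lweight R).

Local Notation vx := (@vx e).
Local Notation vxs := (@vxs e).
Definition qs A : seq C := map (qv h (e := e)) (vxs A).
Lemma qs_cat A B : qs (A ++ B) = qs A ++ qs B. Proof. by rewrite /qs /vxs !map_cat. Qed.
Lemma qv_inj : injective (fun n => qv h (vx n)).
Proof. by move=> m n /(qint_inj qnr); rewrite !vx_val; lia. Qed.
Lemma qs_perm A B : perm_eq (qs A) (qs B) -> perm_eq A B.
Proof. by rewrite /qs /vxs -!map_comp => H; apply: (perm_map_inj qv_inj). Qed.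
Lemma qs_neq0 A : all (fun a => a != 0) (qs A). Proof. exact: all_qv. Qed.

(** The weight that the normalization of [Phi] on [z_r] attaches to the monomial [p]. In [isLw] the
    l-weight of [p], twisted by [w], is characterized by a cross-multiplied identity, without
    division of power series. *)
Definition chi p : rat := halfw (vxs p.2) - halfw (vxs p.1).
Definition isLw w p Psi :=
  lw_mul (lw_prod (qs p.2)) Psi = lw_mul (lw_weight h (w + chi p)) (lw_prod (qs p.1)).

Lemma halfw_cat (A B : seq V) : halfw (A ++ B) = halfw A + halfw B.
Proof. by rewrite /halfw big_cat. Qed.
Lemma halfw_perm (A B : seq V) : perm_eq A B -> halfw A = halfw B.
Proof. exact: perm_big. Qed.
Lemma vxs_cat A B : vxs (A ++ B) = vxs A ++ vxs B. Proof. exact: map_cat. Qed.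

Lemma chi_peq p p' : peq p p' -> chi p = chi p'.
Proof.
move=> /(perm_map vx)/halfw_perm; rewrite -/(vxs _) -[map vx _]/(vxs _) !vxs_cat !halfw_cat /chi => E.
have -> : halfw (vxs p.2) = halfw (vxs p.1) + halfw (vxs p'.2) - halfw (vxs p'.1) by rewrite E; ring.
by ring.
Qed.

Lemma chi_mul p p' : chi (pmul p p') = chi p + chi p'.
Proof. by rewrite /chi /= !vxs_cat !halfw_cat; ring. Qed.

Lemma weightD w w' : lw_weight h (w + w') = lw_mul (lw_weight h w) (lw_weight h w').
Proof. by rewrite /lw_weight lw_cstM qpowD. Qed.

Lemma isLw_mul w w' p p' Psi Psi' : isLw w p Psi -> isLw w' p' Psi' ->
  isLw (w + w') (pmul p p') (lw_mul Psi Psi').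
Proof.
rewrite /isLw /= !qs_cat !lw_prod_cat => E E'.
have -> : w + w' + chi (pmul p p') = (w + chi p) + (w' + chi p') by rewrite chi_mul; ring.
rewrite weightD -lw_mulA (lw_mulA (lw_prod (qs p'.2))) (lw_mulC (lw_prod (qs p'.2))) -lw_mulA E' lw_mulA E.
rewrite -!lw_mulA; congr (lw_mul _ _); rewrite !lw_mulA; congr (lw_mul _ _); exact: lw_mulC.
Qed.

Lemma weightI w f g : lw_mul (lw_weight h w) f = lw_mul (lw_weight h w) g -> f = g.
Proof. exact: (lw_cstI (qpow_neq0 h w)). Qed.

Lemma weight_prod w w' (s s' : seq C) :
  lw_mul (lw_weight h w) (lw_prod s) = lw_mul (lw_weight h w') (lw_prod s') ->
  lw_weight h w = lw_weight h w' /\ lw_prod s = lw_prod s'.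
Proof.
move=> E; have := congr1 (fun f => f 0%N) E; rewrite !lw_mul0 !lw_prod0 !mulr1 => E0.
have Ew : lw_weight h w = lw_weight h w' by rewrite /lw_weight; congr (lw_cst _); exact: E0.
by split=> //; rewrite -Ew in E; exact: weightI E.
Qed.

Lemma isLw_peq w p p' Psi : peq p p' -> isLw w p Psi -> isLw w p' Psi.
Proof.
move=> E; rewrite /isLw (chi_peq E) => H; apply: (@lw_prodI _ (qs p.2)).
rewrite lw_mulA (lw_mulC (lw_prod (qs p.2))) -lw_mulA H lw_mulA (lw_mulC (lw_prod _)) -lw_mulA -lw_prod_cat.
rewrite [RHS]lw_mulA (lw_mulC (lw_prod (qs p.2))) -[RHS]lw_mulA; congr (lw_mul _ _).
rewrite -lw_prod_cat -!qs_cat; apply: lw_prod_perm; apply/perm_map/perm_map.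
by rewrite perm_catC (perm_trans E) // perm_catC.
Qed.

Lemma isLw_uniq w p Psi Psi' : isLw w p Psi -> isLw w p Psi' -> Psi = Psi'.
Proof. by rewrite /isLw => E E'; apply: (@lw_prodI _ (qs p.2)); rewrite E E'. Qed.

Lemma isLw_inj w w' p p' Psi : isLw w p Psi -> isLw w' p' Psi -> peq p p'.
Proof.
rewrite /isLw => E E'.
have : lw_mul (lw_weight h (w + chi p)) (lw_prod (qs (p.1 ++ p'.2))) =
       lw_mul (lw_weight h (w' + chi p')) (lw_prod (qs (p'.1 ++ p.2))).
  rewrite !qs_cat !lw_prod_cat !lw_mulA -E -E'.
  by lw_ac.
by move=> /weight_prod[_ /lw_prod_inj]; rewrite !qs_neq0 => /(_ isT isT); exact: qs_perm.
Qed.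

Lemma isLw0 w : isLw w ([::], [::]) (lw_weight h w).
Proof.
by rewrite /isLw /chi /halfw /= !big_nil subrr addr0 /lw_prod big_nil lw_mulC.
Qed.

Lemma isLw_rk w a Psi : isLw w ([:: a], [::]) Psi <->
  Psi = rk_lw (qpow h (w - halfw [:: vx a])) 0 (qv h (vx a)).
Proof.
have E k b : rk_lw k 0 b = lw_mul (lw_cst k) (lw_lin b).
  by apply/funext => -[|[|m]]; rewrite lw_cstE /= ?expr0 ?exprS ?mul0r ?mulr0 // ?mulr1 // sub0r.
rewrite E /isLw /chi /= {1}/halfw big_nil sub0r /lw_prod big_nil lw_mul1.
by rewrite /qs /= big_seq1.
Qed.

Lemma prod_Y (ys : seq C) :
  lw_mul (lw_prod [seq y * q | y <- ys]) (\big[@lw_mul R/lw_cst 1]_(a <- ys) lw_Y h a) =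
  lw_mul (lw_cst (q ^+ size ys)) (lw_prod [seq y * q^-1 | y <- ys]).
Proof.
elim: ys => [|y ys IH]; first by rewrite /lw_prod !big_nil.
rewrite /= !lw_prod_cons big_cons exprS -lw_cstM /lw_Y.
set P := \big[_/_]_(_ <- _) _ in IH *.
transitivity (lw_mul (lw_mul (lw_lin (y * q)) (lw_geom (y * q)))
  (lw_mul (lw_mul (lw_cst q) (lw_lin (y * q^-1))) (lw_mul (lw_prod [seq y0 * q | y0 <- ys]) P))).
  rewrite !lw_mulA; congr (lw_mul _ _).
  rewrite -!lw_mulA; congr (lw_mul _ _).
  rewrite lw_mulC -!lw_mulA; rewrite [RHS]lw_mulC -!lw_mulA; congr (lw_mul _ _); congr (lw_mul _ _).
  exact: lw_mulC.
rewrite lw_lin_geom lw_mul1 IH -!lw_mulA; congr (lw_mul _ _).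
by rewrite !lw_mulA (lw_mulC (lw_lin _)).
Qed.

(** A factor [Y_y] has the numerator parameter [y q^-1] one vertex below the denominator parameter
    [y q], so among the parameters up to [c] those of the numerator prevail. Counting in the
    cross-multiplied identity makes cancellations harmless. *)
Lemma positive_count w p Th : positive_lw h Th -> isLw w p Th ->
  forall c, (count (<= c)%R p.2 <= count (<= c)%R p.1)%N.
Proof.
move=> [ys [ps [w' [ys0 ps0 ->]]]]; rewrite /isLw; set P := \big[_/_]_(_ <- _) _.
rewrite -[X in lw_mul P X]/(lw_prod ps) => E c.
have {}E : lw_mul (lw_weight h (w + chi p)) (lw_prod ([seq y * q | y <- ys] ++ qs p.1)) =
   lw_mul (lw_weight h (w' + (size ys)%:R)) (lw_prod (qs p.2 ++ [seq y * q^-1 | y <- ys] ++ ps)).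
  rewrite !lw_prod_cat lw_mulA (lw_mulC (lw_weight _ _)) -lw_mulA -E weightD.
  have -> : lw_weight h (size ys)%:R = lw_cst (q ^+ size ys) by rewrite /lw_weight qpow_nat.
  transitivity (lw_mul (lw_weight h w') (lw_mul (lw_prod (qs p.2))
     (lw_mul (lw_mul (lw_prod [seq y * q | y <- ys]) P) (lw_prod ps)))); first by lw_ac.
  by rewrite prod_Y; lw_ac.
have [_ /lw_prod_inj H] := weight_prod E; have {H} := H _ _.
have nz (u : C) : u != 0 -> all (fun a => a != 0) [seq y * u | y <- ys].
  move=> u0; rewrite all_map; apply/allP => y /(allP ys0) /= y0; exact: mulf_neq0.
rewrite !all_cat !qs_neq0 ps0 !nz ?invr_neq0 // => /(_ isT isT)/permP.
pose Pc : pred C := fun x => `[< exists2 n, n <= c & x = qv h (vx n) >].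
have cq A : count Pc (qs A) = count (<= c)%R A.
  rewrite /qs /vxs !count_map; apply: eq_count => n /=.
  by apply/asboolP/idP => [[m mc /qv_inj ->]//|nc]; exists n.
move=> /(_ Pc); rewrite !count_cat !cq.
have : (count Pc [seq (y * q)%R | y <- ys] <= count Pc [seq (y * q^-1)%R | y <- ys])%N.
  rewrite !count_map; apply: sub_count => y /= /asboolP[n nc E1].
  apply/asboolP; exists (n - 1); first by lia.
  have -> : y = y * q * q^-1 by rewrite mulfK.
  rewrite E1 /qv !vx_val; have -> : n * 2 + e%:Z = ((n - 1) * 2 + e%:Z) + 1 + 1 by ring.
  by rewrite !expfzDr // expr1z !mulfK.
move=> le E1; rewrite -(leq_add2l (count Pc [seq (y * q)%R | y <- ys])) E1.
by rewrite addnC leq_add2l (leq_trans le) ?leq_addr.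
Qed.
End Monomials.

(** * Classes of noncrossing families of arcs *)

Section NoncrossingClasses.
Variables (R : realType) (h : R[i]).
Local Notation C := R[i].
Local Notation q := (qpar h).
Hypothesis qnr : forall n : nat, (0 < n)%N -> q ^+ n != 1.
Let q0 : q != 0 := q_neq0 h.
Variable e : bool.
Local Notation V := (vtx e).
Local Notation cls := (@K0_class R).
Local Notation vxs := (@vxs e).
Local Notation vx := (@vx e).
Variable Phi : ((V -> int) * rat -> int) -> (lweight R -> int).
Hypothesis Phi_iso : E_algebra_iso h Phi.
Hypothesis Phi_z : forall r : V,
  Phi (tens (zvar r) (delta ((val r)%:~R / 2%:R))) = K0_class (lw_Psi (q ^ (val r))).
Local Notation completed := (@completed_cluster_algebra e).
Local Notation isLw := (@isLw R h e).
Implicit Types (Psi Th : lweight R) (M : seq V) (f g : seq chord) (p : mono) (w : rat).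

Definition evex p : V -> int := ex (vxs p.1) - ex (vxs p.2).
(** The product of the Laurent expansions of the arcs of [f]; for noncrossing [f] it will turn out
    to be a cluster monomial. *)
Definition X f : (V -> int) -> int := \sum_(p <- mons f) delta (evex p).

Lemma evex_mul p p' : evex (pmul p p') = evex p + evex p'.
Proof. by rewrite /evex /= !vxs_cat !ex_cat opprD addrACA. Qed.
Lemma evex_peq p p' : evex p = evex p' <-> peq p p'.
Proof.
rewrite /evex; split=> [E|/(perm_map vx)].
  have : ex (vxs (p.1 ++ p'.2)) = ex (vxs (p'.1 ++ p.2)).
    by rewrite !vxs_cat !ex_cat; apply/eqP; rewrite -subr_eq addrAC E subrK.
  by move/ex_perm/(perm_map_inj (@vx_inj e)).
rewrite -/(vxs _) -[map _ (p'.1 ++ _)]/(vxs _) -ex_perm !vxs_cat !ex_cat => E.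
by apply/eqP; rewrite subr_eq addrAC eq_sym subr_eq E.
Qed.

Lemma sumE (I : Type) (T : Type) (s : seq I) (F : I -> T -> int) (y : T) :
  (\sum_(i <- s) F i) y = \sum_(i <- s) F i y.
Proof. by elim: s => [|i s IH]; rewrite ?big_nil // !big_cons -IH. Qed.

Lemma tens_X f w : tens (X f) (delta w) = \sum_(p <- mons f) delta (evex p, w).
Proof.
apply/funext => y; rewrite sumE /tens /X sumE mulr_suml; apply: eq_bigr => p _.
by rewrite -tens_delta.
Qed.

Lemma conv_sum (G : zmodType) (s : seq G) (D : G -> int) :
  Defs.conv (\sum_(x <- s) delta x) D = \sum_(x <- s) Defs.conv (delta x) D.
Proof.
apply/funext => y; rewrite sumE /Defs.conv.
have F0 x : x \notin undup s -> (\sum_(x <- s) delta x) x * D (y - x) = 0.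
  rewrite mem_undup sumE => xs; rewrite big_seq big1 ?mul0r // => z zs.
  by rewrite delta_neq // => E; rewrite E zs in xs.
rewrite (fsum_seq (undup_uniq s)) //.
rewrite (eq_bigr (fun x => \sum_(z <- s) delta z x * D (y - x))) => [|x _]; last by rewrite sumE mulr_suml.
rewrite exchange_big /= big_seq [RHS]big_seq; apply: eq_bigr => z zs; symmetry; apply: fsum_seq => [|x xs].
  exact: undup_uniq.
rewrite delta_neq ?mul0r // => E; move: xs; rewrite mem_undup E zs //.
Qed.

Lemma conv_sum2 (G : zmodType) (x : G) (s : seq G) :
  Defs.conv (delta x) (\sum_(z <- s) delta z) = \sum_(z <- s) delta (x + z).
Proof.
rewrite conv_delta; apply/funext => y; rewrite !sumE; apply: eq_bigr => z _.
by rewrite -conv_dd conv_delta.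
Qed.

Lemma mons_single x : mons [:: x] = mons1 x.
Proof.
rewrite -[mons _]/[seq pmul m m' | m <- mons1 x, m' <- [:: ([::], [::])]].
by elim: (mons1 x) => //= -[m1 m2] s ->; rewrite /pmul /= !cats0.
Qed.

Lemma X_cons x f : X (x :: f) = Defs.conv (X [:: x]) (X f).
Proof.
have E s : \sum_(p <- s) delta (evex p) = \sum_(z <- map evex s) delta z by rewrite big_map.
have -> : X [:: x] = \sum_(z <- map evex (mons1 x)) delta z.
  by rewrite -E /X mons_single.
rewrite conv_sum big_map /X; rewrite -[mons (x :: f)]/[seq pmul m m' | m <- mons1 x, m' <- mons f].
rewrite big_allpairs_dep; apply: eq_bigr => m _; rewrite E conv_sum2 big_map; apply: eq_bigr => m' _.
by rewrite evex_mul.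
Qed.

Lemma X_nil : X [::] = @lone e.
Proof. by rewrite /X /= big_seq1 /evex /= subrr. Qed.

Lemma X_cat f g : X (f ++ g) = Defs.conv (X f) (X g).
Proof.
elim: f => [|x f IH] /=.
  by rewrite X_nil /lone conv_delta; apply/funext => y; rewrite subr0.
rewrite X_cons IH [X (x :: f)]X_cons.
have E f' : X f' = \sum_(z <- map evex (mons f')) delta z by rewrite big_map.
rewrite (E [:: x]) (E f) (E g).
rewrite !conv_sum; apply/funext => y.
set s1 := map evex _; set s2 := map evex _; set s3 := map _ _.
rewrite sumE.
have -> : \sum_(z <- s1) Defs.conv (delta z) (\sum_(x0 <- s2) delta x0) =
   \sum_(u <- [seq z1 + z2 | z1 <- s1, z2 <- s2]) delta u.
  rewrite big_allpairs_dep; apply: eq_bigr => z _; exact: conv_sum2.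
rewrite conv_sum sumE big_allpairs_dep; apply: eq_bigr => z1 _.
rewrite conv_delta sumE; apply: eq_bigr => z2 _.
by rewrite !conv_delta opprD addrA.
Qed.

Hypothesis X_cluster : forall x, arc_ok x -> cluster_algebra (X [:: x]).

Lemma X_cluster_list f : all arc_ok f -> cluster_algebra (X f).
Proof.
elim: f => [|x f IH] /=; first by rewrite X_nil => _; exact: CAone.
by move=> /andP[okx okf]; rewrite X_cons; apply: CAmul; [exact: X_cluster|exact: IH].
Qed.

Lemma supp_deltas (T : choiceType) (s : seq T) : finite_set [set p | (\sum_(x <- s) delta x) p != 0].
Proof.
apply: (sub_finite_set (B := [set` s])) => [p|]; last exact: finite_seq.
rewrite /= sumE => nz; apply: contrapT => ns; move/eqP: nz; apply.
by rewrite big_seq big1 // => x xs; rewrite delta_neq // => E; apply: ns; rewrite /= E.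
Qed.

Lemma completed_X f w : all arc_ok f -> completed (tens (X f) (delta w)).
Proof.
move=> okf; apply: completed_fin.
  rewrite -[tens _ _]addr0; apply: CTEadd; [exact: X_cluster_list|exact: in_E_delta|exact: CTE0].
by rewrite tens_X -(big_map (fun p => (evex p, w)) xpredT (@delta _)); exact: supp_deltas.
Qed.

(** Multiplication by the product of the [[L^+]] with labels in [M]. It clears denominators, after
    which [Phi_shift] evaluates [Phi] term by term. *)
Definition Z M (D : (V -> int) * rat -> int) := Defs.conv (shift_by M (halfw M)) D.

Lemma Z_nil D : Z [::] D = D.
Proof. by rewrite /Z shift_byE conv_delta ex_nil /halfw big_nil; apply/funext => y; rewrite subr0. Qed.
Lemma Z_cons r M D : Z (r :: M) D = Defs.conv (shift_by [:: r] ((val r)%:~R / 2%:R)) (Z M D).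
Proof.
rewrite /Z !shift_byE !conv_delta; apply/funext => y; congr D.
rewrite -addrA -opprD; congr (_ - _).
by rewrite -[RHS]/(ex [:: r] + ex M, (val r)%:~R / 2%:R + halfw M) !ex_cons ex_nil addr0 /halfw big_cons.
Qed.
Lemma completed_Z M D : completed D -> completed (Z M D).
Proof. by move=> cD; exact: completed_shift. Qed.

Lemma Z_pos M D : completed D -> (forall Th, 0 <= Phi D Th) -> forall Th, 0 <= Phi (Z M D) Th.
Proof.
move=> cD pos; elim: M => [|r M IH] Th; first by rewrite Z_nil.
have cZ := completed_Z M cD; rewrite Z_cons (PhiM Phi_iso) //; last exact: completed_delta.
rewrite (Phi_one Phi_z); have Hin := Phi_in Phi_iso cZ.
by have /andP[] := K0_mono qnr r Th Hin (fun Psi => introT andP (conj (IH Psi) (lexx _))).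
Qed.

Lemma Z_mono M D D' : completed D -> completed D' -> (forall Th, 0 <= Phi D Th <= Phi D' Th) ->
  forall Th, Phi (Z M D) Th <= Phi (Z M D') Th.
Proof.
move=> cD cD' le; elim: M => [|r M IH] Th; first by rewrite !Z_nil; have /andP[] := le Th.
have cZ := completed_Z M cD; have cZ' := completed_Z M cD'.
have pos := Z_pos M cD (fun Th => let: conj H _ := andP (le Th) in H).
rewrite !Z_cons (PhiM Phi_iso (completed_delta _ _) cZ) (PhiM Phi_iso (completed_delta _ _) cZ').
rewrite (Phi_one Phi_z); have Hin := Phi_in Phi_iso cZ'.
by have /andP[] := K0_mono qnr r Th Hin (fun Psi => introT andP (conj (pos Psi) (IH Psi))).
Qed.

Lemma Z_top M D Psi : completed D -> (forall Th, 0 <= Phi D Th) ->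
  Phi D Psi <= Phi (Z M D) (lw_mul (lw_prod (map (qv h (e := e)) M)) Psi).
Proof.
move=> cD pos; elim: M => [|r M IH]; first by rewrite Z_nil /lw_prod big_nil lw_mul1.
apply: le_trans IH _; rewrite Z_cons /= lw_prod_cons -lw_mulA.
apply: (Phi_top qnr Phi_iso Phi_z); [exact: completed_Z|exact: Z_pos].
Qed.

Lemma Phi_deltas (s : seq (seq V * rat)) :
  completed (\sum_(x <- s) shift_by x.1 (x.2 + halfw x.1)) /\
  Phi (\sum_(x <- s) shift_by x.1 (x.2 + halfw x.1)) =
    \sum_(x <- s) cls (lw_mul (lw_weight h x.2) (lw_prod (map (qv h (e := e)) x.1))).
Proof.
elim: s => [|[A w] s [IH1 IH2]]; first by rewrite !big_nil; split; [exact: completed0|exact: (Phi0 Phi_iso)].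
rewrite !big_cons /=; split; last first.
  by rewrite (PhiD Phi_iso (completed_delta _ _) IH1) IH2 (Phi_shift qnr Phi_iso Phi_z A w).1.
apply: completed_fin.
  apply: CTEadd; [exact: cluster_delta|exact: in_E_delta|].
  elim: s {IH1 IH2} => [|y s IH]; first by rewrite big_nil; exact: CTE0.
  by rewrite big_cons; apply: CTEadd; [exact: cluster_delta|exact: in_E_delta|].
have := supp_deltas ((ex A, w + halfw A) :: [seq (ex x.1, x.2 + halfw x.1) | x <- s]).
rewrite big_cons big_map shift_byE.
by under [X in _ + X]eq_bigr do rewrite -shift_byE.
Qed.

Definition clears M (s : seq mono) := forall p, p \in s -> forall r, (count_mem r (vxs p.2) <= count_mem r M)%N.

Lemma clears_ex (s : seq mono) : exists M, clears M s.
Proof.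
elim: s => [|p s [M HM]]; first by exists [::].
exists (vxs p.2 ++ M) => p'; rewrite inE => /orP[/eqP ->|/HM H] r; rewrite count_cat; first exact: leq_addr.
by apply: leq_trans (H r) _; exact: leq_addl.
Qed.

(** The numerator of [z^M] times the monomial [p] once the denominator is cancelled, chosen up to
    order. *)
Definition cleared M p : seq V := xget [::] [set c | perm_eq (M ++ vxs p.1) (vxs p.2 ++ c)].
Lemma clearedP M s p : clears M s -> p \in s -> perm_eq (M ++ vxs p.1) (vxs p.2 ++ cleared M p).
Proof.
move=> HM ps; rewrite /cleared; case: xgetP => [c -> //|no].
have [|c Hc] := @perm_sub _ (vxs p.2) (M ++ vxs p.1); last by case: (no c).
by move=> r; rewrite count_cat; apply: leq_trans (HM p ps r) _; exact: leq_addr.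
Qed.

Definition cleared_lw M w p : lweight R :=
  lw_mul (lw_weight h (w + chi e p)) (lw_prod (map (qv h (e := e)) (cleared M p))).

(** After clearing, every monomial is a product of initial variables, hence the class of one simple
    module. *)
Lemma Phi_Z M f w : clears M (mons f) ->
  Phi (Z M (tens (X f) (delta w))) = \sum_(p <- mons f) cls (cleared_lw M w p).
Proof.
move=> HM; have [_ ] := Phi_deltas [seq (cleared M p, w + chi e p) | p <- mons f].
rewrite !big_map /= => <-; congr Phi.
rewrite /Z shift_byE tens_X -(big_map (fun p => (evex p, w)) xpredT (@delta _)) conv_sum2 big_map.
rewrite big_seq [RHS]big_seq; apply: eq_bigr => p pf; rewrite shift_byE; congr delta.
have P := clearedP HM pf; have P1 := (ex_perm _ _).2 P; have P2 := halfw_perm P.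
rewrite !ex_cat in P1; rewrite !halfw_cat in P2.
rewrite -[LHS]/(ex M + evex p, halfw M + w); congr (_, _).
  by rewrite /evex addrA P1 addrAC subrr add0r.
have -> : halfw M = halfw (vxs p.2) + halfw (cleared M p) - halfw (vxs p.1) by rewrite -P2; ring.
by rewrite /chi; ring.
Qed.

Lemma cleared_isLw M s p w Psi : clears M s -> p \in s ->
  (isLw w p Psi <-> lw_mul (lw_prod (map (qv h (e := e)) M)) Psi = cleared_lw M w p).
Proof.
move=> HM ps; have P := lw_prod_perm (perm_map (qv h (e := e)) (clearedP HM ps)).
rewrite !map_cat !lw_prod_cat in P; rewrite /isLw /cleared_lw /qs.
set m := lw_prod _ in P *; set a := lw_prod _ in P *; set b := lw_prod _ in P *; set c := lw_prod _ in P *.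
split=> E; [apply: (@lw_prodI _ (map (qv h (e := e)) (vxs p.2)))|apply: (@lw_prodI _ (map (qv h (e := e)) M))].
  rewrite -/b; transitivity (lw_mul m (lw_mul b Psi)); first by lw_ac.
  by rewrite E; transitivity (lw_mul (lw_weight h (w + chi e p)) (lw_mul m a)); [lw_ac|rewrite P; lw_ac].
rewrite -/m; transitivity (lw_mul b (lw_mul m Psi)); first by lw_ac.
by rewrite E; transitivity (lw_mul (lw_weight h (w + chi e p)) (lw_mul m a)); [rewrite P; lw_ac|lw_ac].
Qed.

Lemma cleared_inj M s s' p p' w : clears M s -> clears M s' -> p \in s -> p' \in s' ->
  cleared_lw M w p = cleared_lw M w p' -> peq p p'.
Proof.
move=> HM HM' ps ps' /weight_prod[_ /lw_prod_inj]; rewrite !all_qv => /(_ isT isT) H.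
have {}H : perm_eq (cleared M p) (cleared M p').
  have [n1 E1] : exists n, cleared M p = vxs n.
    elim: (cleared M p) => [|r c [n ->]]; first by exists [::].
    by have [m ->] := vx_surj r; exists (m :: n).
  have [n2 E2] : exists n, cleared M p' = vxs n.
    elim: (cleared M p') => [|r c [n ->]]; first by exists [::].
    by have [m ->] := vx_surj r; exists (m :: n).
  by rewrite E1 E2 in H *; apply: perm_map; apply: (qs_perm qnr H).
have P := (ex_perm _ _).2 (clearedP HM ps); have P' := (ex_perm _ _).2 (clearedP HM' ps').
apply/evex_peq; rewrite /evex; rewrite !ex_cat ((ex_perm _ _).2 H) in P P'.
have {P} -> : ex (vxs p.1) = ex (vxs p.2) + ex (cleared M p') - ex M by rewrite -P addrAC subrr add0r.
have {P'} -> : ex (vxs p'.1) = ex (vxs p'.2) + ex (cleared M p') - ex M by rewrite -P' addrAC subrr add0r.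
by rewrite ![_ - ex M - _]addrAC !(addrC (ex (vxs _))) !addrK.
Qed.

Lemma K0_mul_pos Psi Psi' Th : 0 <= K0_mul h (cls Psi) (cls Psi') Th.
Proof. by rewrite K0_mul_cc. Qed.

(** The coefficients are nonnegative, and that of the leading monomial is positive. *)
Lemma X_neq0 f w : tens (X f) (delta w) <> 0.
Proof.
move=> E; have := congr1 (fun D => D (evex (topm f), w)) E; rewrite tens_X sumE => E0.
have := topm_mons f => /perm_to_rem P; move: E0; rewrite (perm_big _ P) big_cons delta_xx.
have : 0 <= \sum_(p <- rem (topm f) (mons f)) delta (evex p, w) (evex (topm f), w) by apply: sumr_ge0.
set S := \big[_/_]_(_ <- _) _ => S0 E1; have p1 : 0 < (1 : int) + S by exact: ltr_wpDr.
by have := lt0r_neq0 p1; rewrite (E1 : 1 + S = 0) eqxx.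
Qed.
End NoncrossingClasses.

(** * The class of a noncrossing family is simple *)

Section MainInduction.
Variables (R : realType) (h : R[i]).
Local Notation C := R[i].
Local Notation q := (qpar h).
Hypothesis qnr : forall n : nat, (0 < n)%N -> q ^+ n != 1.
Let q0 : q != 0 := q_neq0 h.
Variable e : bool.
Local Notation V := (vtx e).
Local Notation cls := (@K0_class R).
Local Notation vxs := (@vxs e).
Local Notation vx := (@vx e).
Local Notation X := (@X e).
Variable Phi : ((V -> int) * rat -> int) -> (lweight R -> int).
Hypothesis Phi_iso : E_algebra_iso h Phi.
Hypothesis Phi_z : forall r : V,
  Phi (tens (zvar r) (delta ((val r)%:~R / 2%:R))) = K0_class (lw_Psi (q ^ (val r))).
Local Notation completed := (@completed_cluster_algebra e).
Local Notation isLw := (@isLw R h e).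
Implicit Types (Psi Th : lweight R) (M : seq V) (f g : seq chord) (p : mono) (w : rat).
Hypothesis X_cluster : forall x, arc_ok x -> cluster_algebra (X [:: x]).
Hypothesis arc_rank1 : forall x, arc_ok x -> exists kap a be, [/\ kap != 0,
  Phi (tens (X [:: x]) (delta 0)) = cls (rk_lw kap a be) & isLw 0 (top1 x) (rk_lw kap a be)].

Lemma sum_cls_ge (I : eqType) (s : seq I) (F : I -> lweight R) Th :
  0 < (\sum_(i <- s) cls (F i)) Th -> exists2 i, i \in s & F i = Th.
Proof.
rewrite sumE => H; apply: contrapT => no; move: H; rewrite big_seq big1 ?ltxx // => i js.
by rewrite /K0_class delta_neq // => E; apply: no; exists i.
Qed.

Lemma sum_cls_mem (I : eqType) (s : seq I) (F : I -> lweight R) i : i \in s ->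
  0 < (\sum_(j <- s) cls (F j)) (F i).
Proof.
move=> js; rewrite sumE (perm_big _ (perm_to_rem js)) big_cons /K0_class delta_xx.
have : 0 <= \sum_(j <- rem i s) delta (F j) (F i) :> int by apply: sumr_ge0.
set S := \big[_/_]_(_ <- _) _ => S0; change (0 < 1 + S); lia.
Qed.

Lemma conv_X f g w w' :
  Defs.conv (tens (X f) (delta w)) (tens (X g) (delta w')) = tens (X (f ++ g)) (delta (w + w')).
Proof.
have E f' v : tens (X f') (delta v) = \sum_(z <- [seq (@evex e p, v) | p <- mons f']) delta z.
  by rewrite tens_X big_map.
rewrite X_cat; apply/funext => -[m v].
rewrite (E f) (E g) conv_sum sumE big_map /tens /=.
have Ex f' : X f' = \sum_(z <- [seq @evex e p | p <- mons f']) delta z by rewrite big_map.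
have -> : Defs.conv (X f) (X g) m = \sum_(p <- mons f) X g (m - @evex e p).
  by rewrite {1}(Ex f) conv_sum sumE big_map; apply: eq_bigr => p _; rewrite conv_delta.
rewrite mulr_suml; apply: eq_bigr => p _.
rewrite !conv_delta -(E g) /tens /=; congr (_ * _); rewrite !deltaE; congr (nat_of_bool _)%:Z.
by apply/asboolP/asboolP => [<-|->]; [rewrite addrC subrK|rewrite addrC addKr].
Qed.

(** Strong induction on the height, so that the classes of all noncrossing families with a lower
    leading monomial and the same bound [H] are available. *)
Theorem noncrossing_class H f w : all arc_ok f -> noncrossing f -> bounded H f ->
  exists2 Psi, isLw w (topm f) Psi & Phi (tens (X f) (delta w)) = cls Psi.
Proof.
have [n] := ubnP (absz (pval (height H) (topm f))).
elim: n f w => // n IH [|x f] w; rewrite ltnS => le okf ncf Hf.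
  exists (lw_weight h w); first exact: isLw0.
  have -> : X [::] = delta (ex [::]) by rewrite X_nil lone_ex.
  exact: (Phi_wt Phi_iso).
set F := x :: f in le okf ncf Hf *; have /andP[okx okf'] := okf.
have ncf' : noncrossing f by move=> y z yf zf; apply: ncf; rewrite inE ?yf ?zf orbT.
have Hf' : bounded H f by move=> y yf; apply: Hf; rewrite inE yf orbT.
have [Psi' L' E'] : exists2 Psi, isLw w (topm f) Psi & Phi (tens (X f) (delta w)) = cls Psi.
  apply: IH => //; apply: leq_trans le.
  have := height_ge0 okf' Hf'; have : 0 < pval (height H) (top1 x).
    have [H1 H2] := Hf x (mem_head _ _).
    case: (x) okx H1 H2 => a [b|] /=; rewrite /arc_ok /top1 ?pval2 ?pval1 /height /=; lia.
  by rewrite /F /= pval_mul; lia.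
have [kap [a [be [kap0 Ex Lx]]]] := arc_rank1 okx.
set Psi := lw_mul (rk_lw kap a be) Psi'.
have L : isLw w (topm F) Psi by rewrite -[w]add0r; exact: isLw_mul.
have cD1 : completed (tens (X [:: x]) (delta 0)) by apply: completed_X => //=; rewrite okx.
have cD2 : completed (tens (X f) (delta w)) by exact: completed_X.
have cD v : completed (tens (X F) (delta v)) by exact: completed_X.
have ED : Defs.conv (tens (X [:: x]) (delta 0)) (tens (X f) (delta w)) = tens (X F) (delta w).
  by rewrite conv_X add0r.
have Emu : Phi (tens (X F) (delta w)) = K0_mul h (cls (rk_lw kap a be)) (cls Psi').
  by rewrite -ED (PhiM Phi_iso) // Ex E'.
set D := tens (X F) (delta w) in ED Emu *.
have pos Th : 0 <= Phi D Th by rewrite Emu; exact: K0_mul_pos.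
have top1' : 1 <= Phi D Psi.
  have [||S [W [T [t [HS HW Ht]]]]] := Phi_tensor Phi_iso cD1 cD2 Ex E'.
  - by rewrite ED; exact: cD.
  - by rewrite ED; exact: X_neq0.
  have [S' HS' OS'] := cls_supp Phi_iso cD2 E'.
  have [_ _ [w0 P0]] := in_Oplus2Z_lw qnr HS' OS'; have [[OS1 _] _] := OS'.
  have [S2 HS2 fS2] : exists2 S2 : bmod h, is_L Psi' S2 & findim S2 Psi' by exists S' => //; exact: findim_O OS1 P0.
  have [t' Ht'] := ten_transport Ht (is_L_iso qnr HS HS) (is_L_iso qnr HW HS2).
  have := tm_top qnr kap0 HS HS2 Ht' fS2.
  by rewrite Emu K0_mul_cc lez_nat.
(* By [Z_top] a constituent, multiplied by the clearing product, is one of the simple classes listed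
   by [Phi_Z], hence comes from a monomial of [F]. *)
have mon Th : Phi D Th != 0 -> exists2 p, p \in mons F & isLw w p Th.
  move=> nz; have [M HM] := clears_ex e (mons F).
  have := Z_top qnr Phi_iso Phi_z M Th (cD w) pos; rewrite (Phi_Z qnr Phi_iso Phi_z w HM) => le1.
  have [|p pF Ep] := @sum_cls_ge _ (mons F) (cleared_lw h M w) (lw_mul (lw_prod (map (qv h (e := e)) M)) Th).
    by apply: lt_le_trans le1; rewrite lt_def nz pos.
  by exists p => //; apply: (proj2 (cleared_isLw h w Th HM pF)); rewrite Ep.
(* A constituent other than the leading one belongs to a positive l-weight, hence is the leading
   monomial of a noncrossing [g] of smaller height. By induction the class of [g] is simple and
   dominated by the product, so after clearing its monomials are among those of [F], against
   [comparison]. *)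
have uniq Th : Phi D Th != 0 -> Th = Psi.
  move=> nz; have [p pF Lp] := mon Th nz.
  have [E|ne] := boolP (peq p (topm F)); first exact: isLw_uniq (isLw_peq E Lp) L.
  exfalso; have [S HS OS] := Phi_supp Phi_iso (cD w) nz.
  have [posTh _ _] := in_Oplus2Z_lw qnr HS OS.
  have [g [okg ncg Eg Hg]] := matching (positive_count qnr posTh Lp).
  have [b1 b2] := mons_bd okf Hf pF.
  have bg : bounded H g.
    move=> y yg; have [y1 y2] := Hg y yg; split=> [|b Eb]; first exact: b1.
    by have := b2 _ (y2 b Eb); rewrite subrK.
  have Ep : peq p (topm g) by case: (p) Eg.
  have lt := height_lt H okf pF ne; rewrite (pval_peq _ Ep) in lt.
  have [Psi2 L2 E2] : exists2 Psi, isLw w (topm g) Psi & Phi (tens (X g) (delta w)) = cls Psi.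
    apply: IH => //; apply: leq_trans le.
    by rewrite -ltz_nat !gez0_abs ?(height_ge0 okg bg) ?(height_ge0 okf Hf).
  have ETh : Psi2 = Th := isLw_uniq L2 (isLw_peq Ep Lp); rewrite {}ETh in L2 E2.
  have cG : completed (tens (X g) (delta w)) by exact: completed_X.
  have [M HM] := clears_ex e (mons F ++ mons g).
  have HM1 : clears M (mons F) by move=> p' p'F; apply: HM; rewrite mem_cat p'F.
  have HM2 : clears M (mons g) by move=> p' p'g; apply: HM; rewrite mem_cat p'g orbT.
  have mono Ps : 0 <= Phi (tens (X g) (delta w)) Ps <= Phi D Ps.
    rewrite E2 /K0_class deltaE; case: asboolP => [->|_]; rewrite ?pos //=.
    by rewrite -gtz0_ge1 lt_def nz pos.
  suff /(comparison okf okg ncf)/(_ H) : forall p1, p1 \in mons g -> exists2 p', p' \in mons F & peq p1 p'.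
    by rewrite leNgt lt.
  move=> p1 p1g; have := Z_mono qnr Phi_iso Phi_z M cG (cD w) mono (cleared_lw h M w p1).
  rewrite !(Phi_Z qnr Phi_iso Phi_z w) // => le1.
  have [p' p'F E1] := sum_cls_ge (lt_le_trans (sum_cls_mem (cleared_lw h M w) p1g) le1).
  exists p' => //; exact: (cleared_inj qnr HM2 HM1 p1g p'F (esym E1)).
(* After clearing, the multiplicity of [Psi] is at most the number of occurrences of the leading
   monomial in [F], which is 1 by [count_top]. *)
have le1 : Phi D Psi <= 1.
  have [M HM] := clears_ex e (mons F).
  apply: le_trans (Z_top qnr Phi_iso Phi_z M Psi (cD w) pos) _.
  rewrite (Phi_Z qnr Phi_iso Phi_z w HM) sumE -[X in _ <= X]/(1%N%:Z) -(count_top okf).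
  have -> s : (count (peq^~ (topm F)) s)%:Z = \sum_(p <- s) (peq p (topm F))%:Z.
    by elim: s => [|p s IHs]; rewrite ?big_nil // big_cons /= PoszD IHs.
  rewrite big_seq [X in _ <= X]big_seq; apply: ler_sum => p pF.
  rewrite /K0_class deltaE; case: asboolP => [/(proj2 (cleared_isLw h w Psi HM pF)) Lp|//].
  by rewrite (isLw_inj qnr Lp L).
exists Psi => //; apply/funext => Th; rewrite /K0_class deltaE; case: asboolP => [->|ne].
  by apply/eqP; rewrite eq_le le1 top1'.
by apply/eqP; apply: contrapT => /negP/uniq.
Qed.
End MainInduction.

(** * Rank-one modules in the category, Kirillov-Reshetikhin l-weights *)

Section RankOneWeights.
Variables (R : realType) (h : R[i]).
Local Notation C := R[i].
Local Notation q := (qpar h).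
Hypothesis qnr : forall n : nat, (0 < n)%N -> q ^+ n != 1.
Let q0 : q != 0 := q_neq0 h.
Let qq0 := qqV_neq0 qnr.

Lemma lin_mulE (a : C) (f : lweight R) :
  lw_mul (lw_lin a) f = fun n => if n is n'.+1 then f n - a * f n' else f 0%N.
Proof.
apply/funext => -[|n]; first by rewrite lw_mul0 mul1r.
rewrite /lw_mul big_ord_recl big_ord_recl big1 /= ?addr0 => [|i _]; last by rewrite mul0r.
by rewrite mul1r subn0 subSS subn0 mulNr.
Qed.

Lemma rk_lwE (k a b : C) : lw_mul (lw_lin a) (rk_lw k a b) = lw_mul (lw_cst k) (lw_lin b).
Proof.
rewrite lin_mulE; apply/funext => -[|[|n]]; rewrite lw_cstE /= ?expr0 ?exprS; ring.
Qed.

Lemma rk_lw0E (k b : C) : rk_lw k 0 b = lw_mul (lw_cst k) (lw_lin b).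
Proof.
apply/funext => -[|[|m]]; rewrite lw_cstE /= ?expr0 ?exprS; ring.
Qed.

(** The l-weight of [rk_s 1] is the highest one times [q^-2 (1 - a q^2 z) / (1 - a q^-2 z)], the
    inverse of a variable of type [A]. *)
Lemma rk_th1E (k a b : C) :
  lw_mul (lw_lin (a * q ^- 2)) (lw_mul (lw_lin a) (rk_th h k a b 1)) =
  lw_mul (lw_cst (k * q ^- 2)) (lw_mul (lw_lin (a * q ^+ 2)) (lw_lin b)).
Proof.
have q21 : 1 - q ^- 2 != 0.
  apply: contra (qnr (isT : (0 < 2)%N)) => /eqP E.
  by rewrite -(mulr1 (q ^+ 2)) -[1 in X in X == _](subrK (q ^- 2)) E add0r mulfV // expf_neq0.
have q22 : q ^+ 2 != 0 by rewrite expf_neq0.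
have qm : q * q - 1 != 0 by rewrite subr_eq0 -expr2 qnr.
have q0' := q0.
rewrite !lin_mulE; apply/funext => -[|[|[|n]]]; rewrite lw_cstE /rk_th /rk_b /rk_c /rk_kap /= ?expr0 ?expr1 ?exprS.
- by rewrite mulr1.
- by rewrite !expr0; field; rewrite ?q0 ?q0' ?qm.
- by rewrite !expr0; field; rewrite ?q0 ?q0' ?qm.
- have -> : a * (q * (q * 1))^-1 * (q * (q * 1)) = a by rewrite mulfVK // mulr1 mulf_neq0.
  by rewrite ?expr0 ?exprS; ring.
Qed.

(** The l-weight of the singular vector of [ten_KR_sing] is the highest l-weight of another tensor
    product, the one on the other side of the exchange relation. *)
Lemma rk_th1_split (k k1 k2 a b : C) : k1 * k2 = k * q ^- 2 ->
  lw_mul (rk_lw 1 0 a) (rk_th h k a b 1) =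
  lw_mul (rk_lw k1 0 (a * q ^+ 2)) (rk_lw k2 (a * q ^- 2) b).
Proof.
move=> E; apply: (@lw_linI _ (a * q ^- 2)).
have -> : rk_lw 1 0 a = lw_lin a by rewrite rk_lw0E lw_mul1.
rewrite rk_th1E -E -lw_cstM rk_lw0E.
transitivity (lw_mul (lw_mul (lw_cst k1) (lw_lin (a * q ^+ 2))) (lw_mul (lw_cst k2) (lw_lin b))); first by lw_ac.
by rewrite -(rk_lwE k2 (a * q ^- 2) b); lw_ac.
Qed.

Variables (kap a be : C) (kap0 : kap != 0).
Variables (S : bmod h) (HS : is_L (rk_lw kap a be) S).
Local Notation s := (rk_s HS).
Variable (w : rat).
Hypothesis kapE : kap = qpow h w.

Lemma rk_kapE l : rk_kap h kap l = qpow h (w - 2%:R * l%:R).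
Proof. by rewrite /rk_kap kapE qpowD qpowN -natrM qpow_nat. Qed.

Lemma rk_weight l : weight_space S (w - 2%:R * l%:R) (s l).
Proof. by rewrite /weight_space /= -rk_kapE -(rk_ks qnr) opkE. Qed.

Lemma rk_weight_inv w' u : weight_space S w' u -> u != 0 -> exists l, w' = w - 2%:R * l%:R.
Proof.
move=> Hu; have [D [c E]] := rk_span qnr kap0 HS u; rewrite E => nz.
have [l lD nzl] : exists2 l, (l < D)%N & c l *: s l != 0.
  apply: contrapT => no; move/eqP: nz; apply; rewrite big1 // => i _.
  by apply/eqP; apply: contrapT => /negP nz; apply: no; exists i.
exists l; apply: (qpow_inj qnr); rewrite -rk_kapE; symmetry.
apply: (@eig_sum0 _ _ S (rk_kap h kap) (qpow h w') D (fun l => c l *: s l)) => //.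
- by move=> m n /eqP; rewrite !rk_kapE => /eqP/(qpow_inj qnr)/addrI/oppr_inj/mulfI => H; apply/eqP; rewrite -(eqr_nat rat); apply/eqP/H.
- by move=> i _; rewrite linearZ_LR (rk_ks qnr) !scalerA mulrC.
- by rewrite -E -Hu opkE.
Qed.

Lemma rk_in_O : in_O S.
Proof.
split.
- move=> v; have [D [c ->]] := rk_span qnr kap0 HS v.
  exists [seq c i *: s i | i <- index_iota 0 D]; split; first by rewrite big_map big_mkord.
  move=> x /mapP[i _ ->]; exists (w - 2%:R * i%:R); have := rk_weight i.
  by rewrite /weight_space /= linearZ_LR => ->; rewrite !scalerA mulrC.
- move=> w'; have [[l E]|no] := pselect (exists l : nat, w' = w - 2%:R * l%:R); last first.
    exists 0%N, (fun=> 0); split=> [[]//|v Hv]; exists 0; split=> [|c _].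
      rewrite big_ord0; apply/eqP; apply: contrapT => /negP nz; apply: no.
      exact: rk_weight_inv Hv nz.
    by apply/rowP => -[].
  have line v : weight_space S w' v -> exists c, v = c *: s l.
    move=> Hv; apply: (rk_line qnr kap0 HS); rewrite /dg opkE; move: Hv; rewrite /weight_space /= => ->.
    by rewrite E -rk_kapE.
  have [sl0|nz] := eqVneq (s l) 0.
    exists 0%N, (fun=> 0); split=> [[]//|v /line[c ->]]; exists 0; split=> [|c' _].
      by rewrite big_ord0 sl0 scaler0.
    by apply/rowP => -[].
  exists 1%N, (fun=> s l); split=> [_|v /line[c ->]]; first by rewrite E; exact: rk_weight.
  exists (const_mx c); split=> [|c' Ec]; first by rewrite big_ord1 mxE.
  apply/rowP => i; rewrite mxE ord1; move: Ec; rewrite big_ord1 => /eqP.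
  by rewrite -subr_eq0 -scalerBl scaler_eq0 (negPf nz) orbF subr_eq0 => /eqP.
- exists [:: w] => w' [v v0 Hv]; exists w; first by rewrite inE.
  have [l ->] := rk_weight_inv Hv v0; exists l; ring.
Qed.
End RankOneWeights.

Section OplusCriterion.
Variables (R : realType) (h : R[i]).
Hypothesis qnr : forall n : nat, (0 < n)%N -> qpar h ^+ n != 1.

Lemma simple_in_Oplus2Z e (S : bmod h) Psi : is_L Psi S -> in_O S -> positive_lw h Psi ->
  roots_poles_in [set x | exists r : vtx e, x = qpar h ^ (val r)] Psi -> in_Oplus2Z e S.
Proof.
move=> HS OS pP rP; have [sS _] := HS.
have key S' : simple_mod S' -> constituent S S' -> is_L Psi S'.
  by move=> sS' cS; apply: (is_L_transport (simple_constituent sS sS' cS)).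
by split; [split=> //|] => S' sS' cS; exists Psi => //; exact: key.
Qed.
End OplusCriterion.

Section KRWeights.
Variables (R : realType) (h : R[i]).
Local Notation C := R[i].
Local Notation q := (qpar h).
Hypothesis qnr : forall n : nat, (0 < n)%N -> q ^+ n != 1.
Let q0 : q != 0 := q_neq0 h.
Variable e : bool.
Local Notation Q := (fun n => qv h (vx e n)).
Implicit Types (a : int) (N : nat).

Lemma QD a N : Q (a + N%:Z) = Q a * q ^+ (2 * N).
Proof.
rewrite /qv !vx_val -[q ^+ _]/(q ^ (2 * N)%N%:Z) -expfzDr //; congr (q ^ _); rewrite PoszM; ring.
Qed.
Lemma Q_neq0 a : Q a != 0. Proof. exact: qv_neq0. Qed.

(** The l-weight attached to the arc from [a] to [a + N + 1]; [N = 0] is a side of the polygon. *)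
Definition kr_lw a N : lweight R := rk_lw (q ^+ N) (Q (a + N%:Z)) (Q a).

Lemma kr_lw0 a : kr_lw a 0 = lw_weight h 0.
Proof.
rewrite /kr_lw /lw_weight qpow0 addr0 expr0; apply/funext => -[|m] //=.
by rewrite subrr mulr0 mul0r.
Qed.

Lemma kr_lw_isLw a N : isLw h e 0 (top1 (a, Some (a + N.+1%:Z))) (kr_lw a N).
Proof.
rewrite /isLw /top1 /=; have -> : a + N.+1%:Z - 1 = a + N%:Z by lia.
rewrite /qs /= !/lw_prod !big_seq1 /kr_lw rk_lwE /lw_weight; congr (lw_mul (lw_cst _) _).
rewrite /chi /halfw /= !big_seq1 !vx_val add0r -mulrBl -rmorphB /=.
have -> : (a + N%:Z) * 2 + e%:Z - (a * 2 + e%:Z) = N%:Z * 2 by ring.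
by rewrite rmorphM /= mulfK // -qpow_nat.
Qed.

(** The product of the [Y] at the points [Q (a + i) q] for [i <= N] telescopes. *)
Lemma kr_positive a N : positive_lw h (kr_lw a N.+1).
Proof.
exists [seq Q (a + i%:Z) * q | i <- iota 0 N.+1], [::], 0; split=> //.
  by apply/allP => x /mapP[i _ ->]; rewrite mulf_neq0 ?Q_neq0.
rewrite /lw_weight qpow0 lw_mul1 big_nil lw_mulC lw_mul1.
apply: (@lw_prodI _ [seq y * q | y <- [seq Q (a + i%:Z) * q | i <- iota 0 N.+1]]).
rewrite prod_Y size_map size_iota.
have -> : [seq y * q^-1 | y <- [seq Q (a + i%:Z) * q | i <- iota 0 N.+1]] = [seq Q (a + i%:Z) | i <- iota 0 N.+1].
  by rewrite -map_comp; apply: eq_map => i /=; rewrite mulfK.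
have -> : [seq y * q | y <- [seq Q (a + i%:Z) * q | i <- iota 0 N.+1]] = [seq Q (a + i%:Z) | i <- iota 1 N.+1].
  rewrite -[1%N]addn0 iotaDl -!map_comp; apply: eq_map => i /=.
  by rewrite add1n -addn1 PoszD addrA !QD muln1 expr2 -!mulrA.
have -> : iota 1 N.+1 = iota 1 N ++ [:: (1 + N)%N] by rewrite -(iotaD 1 N 1) addn1.
rewrite map_cat lw_prod_cat /= /kr_lw -lw_mulA.
have -> : lw_prod [:: Q (a + (1 + N)%N%:Z)] = lw_lin (Q (a + N.+1%:Z)) by rewrite /lw_prod big_seq1.
rewrite rk_lwE lw_prod_cons addr0; lw_ac.
Qed.

Lemma Q_inv_vtx a x : 1 - Q a * x = 0 -> exists r : vtx e, x = q ^ (val r).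
Proof.
move/eqP; rewrite subr_eq0 eq_sym => /eqP E; exists (vx e (- a - e%:Z)).
have -> : val (vx e (- a - e%:Z)) = - val (vx e a) by rewrite !vx_val; ring.
by apply: (mulfI (Q_neq0 a)); rewrite E /qv -expfzDr // subrr expr0z.
Qed.

Lemma kr_roots a N : roots_poles_in [set x | exists r : vtx e, x = q ^ (val r)] (kr_lw a N.+1).
Proof.
exists (q ^+ N.+1 *: ppoly [:: Q a]), (ppoly [:: Q (a + N.+1%:Z)]).
have rt (c : C) x : root (ppoly [:: c]) x -> 1 - c * x = 0.
  by move/eqP; rewrite ppoly_root big_seq1.
split.
- rewrite coprimepZl ?expf_neq0 //; apply/coprimepP => d d1 d2; apply: contrapT => nd.
  have dn : d != 0.
    apply: contra_notN nd => /eqP d0; move: d1; rewrite d0 dvd0p => /eqP E.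
    have := ppoly_root [:: Q a] 0; rewrite E horner0 big_seq1 mulr0 subr0 => /eqP.
    by rewrite eq_sym oner_eq0.
  have sd : size d != 1%N by apply: contra_notN nd => s1; rewrite -size_poly_eq1.
  have [x rx] := closed_rootP d sd.
  rewrite -dvdp_XsubCl in rx; have r1 : 1 - Q a * x = 0 by apply: rt; rewrite -dvdp_XsubCl (dvdp_trans rx).
  have r2 : 1 - Q (a + N.+1%:Z) * x = 0 by apply: rt; rewrite -dvdp_XsubCl (dvdp_trans rx).
  have x0 : x != 0 by apply: contra_eqN r1 => /eqP ->; rewrite mulr0 subr0 oner_eq0.
  have : Q a = Q (a + N.+1%:Z).
    by apply: (mulIf x0); apply/eqP; rewrite -subr_eq0 -(subr0 0) -{1}r2 -r1; apply/eqP; ring.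
  by move/(qv_inj qnr); lia.
- by rewrite -lw_prod_poly lw_prod0 oner_eq0.
- have -> : (fun n => (ppoly [:: Q (a + N.+1%:Z)])`_n) = lw_lin (Q (a + N.+1%:Z)).
    by apply/funext => n; rewrite -lw_prod_poly /lw_prod big_seq1.
  rewrite rk_lwE; apply/funext => n; rewrite lw_cstE coefZ -lw_prod_poly /lw_prod big_seq1 //.
- move=> x [|/rt]; last exact: Q_inv_vtx.
  by rewrite rootZ ?expf_neq0 // => /rt; exact: Q_inv_vtx.
Qed.

Lemma kr_ex a N : exists2 W : bmod h, is_L (kr_lw a N.+1) W & in_Oplus2Z e W.
Proof.
(* [u] is the geometric mean of the parameters [Q a] and [Q (a + N.+1)] of root and pole. *)
pose u := Q a * q ^+ N.+1; have u0 : u != 0 by rewrite mulf_neq0 ?Q_neq0 ?expf_neq0.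
have := kr_is_L qnr N.+1 u0.
have -> : u * q ^+ N.+1 = Q (a + N.+1%:Z) by rewrite QD /u -mulrA -exprD addnn -mul2n.
have -> : u / q ^+ N.+1 = Q a by rewrite mulfK ?expf_neq0.
move=> HW; exists (kr_mod qnr N.+1 u0) => //.
apply: (simple_in_Oplus2Z HW); [|exact: kr_positive|exact: kr_roots].
by apply: (rk_in_O qnr _ HW (w := N.+1%:R)); rewrite ?expf_neq0 // qpow_nat.
Qed.
End KRWeights.

(** * A tensor product of length two *)

Section KRTensor.
Variables (R : realType) (h : R[i]).
Local Notation C := R[i].
Local Notation q := (qpar h).
Hypothesis qnr : forall n : nat, (0 < n)%N -> q ^+ n != 1.
Let q0 : q != 0 := q_neq0 h.

Lemma rk_s_ne (kap a be : C) (kap0 : kap != 0) (S : bmod h) (HS : is_L (rk_lw kap a be) S) l :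
  (forall i, (0 < i <= l)%N -> a * q ^+ 2 * q ^- (2 * i) != be) -> rk_s HS l != 0.
Proof.
move=> H; apply: (rk_s_neq0 qnr kap0) => i il; have /andP[i0 _] := il.
have q2 n : (0 < n)%N -> 1 - q ^- n != 0.
  move=> n0; rewrite subr_eq0 eq_sym invr_eq1; exact: qnr.
rewrite /rk_c mulf_neq0 ?invr_neq0 ?mulf_neq0 ?q2 ?muln_gt0 //.
- by rewrite subr_eq0 H.
- exact: qqV_neq0.
Qed.

Lemma val_bhom (V : bmod h) (N : set V) (sN : submodule N) : bhom (V := sub_bmod sN) (W := V) (fun x => val x).
Proof. by []. Qed.

Variables (N : nat) (p be : C).
Hypotheses (be0 : be != 0) (pE : p = be * q ^+ (2 * N.+1)).
Local Notation kap := (q ^+ N.+1).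
Let kap0 : kap != 0. Proof. exact: expf_neq0. Qed.
Let one0 : 1 != 0 :> C := oner_neq0 _.
Let kinv0 : q^-1 != 0. Proof. exact: invr_neq0. Qed.
Let qN0 : q ^+ N != 0. Proof. exact: expf_neq0. Qed.
Let p0 : p != 0. Proof. by rewrite pE mulf_neq0 // expf_neq0. Qed.
Variables (S W T : bmod h) (t : S -> W -> T).
Variables (HS : is_L (rk_lw 1 0 p) S) (HW : is_L (rk_lw kap p be) W) (Ht : is_tensor t).
Variables (S1 W1 T1 : bmod h) (t1 : S1 -> W1 -> T1).
Variables (HS1 : is_L (rk_lw q^-1 0 (p * q ^+ 2)) S1) (HW1 : is_L (rk_lw (q ^+ N) (p * q ^- 2) be) W1).
Hypothesis Ht1 : is_tensor t1.
Variables (L0 : bmod h) (HL0 : is_L (rk_lw kap 0 be) L0).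
Local Notation PsT := (lw_mul (rk_lw 1 0 p) (rk_lw kap p be)).
Local Notation Th := (lw_mul (rk_lw q^-1 0 (p * q ^+ 2)) (rk_lw (q ^+ N) (p * q ^- 2) be)).

Let PsTE : PsT = rk_lw kap 0 be.
Proof. by rewrite (rk_lw0E 1) lw_mul1 rk_lwE (rk_lw0E kap). Qed.
Let ThE : lw_mul (rk_lw 1 0 p) (rk_th h kap p be 1) = Th.
Proof. by apply: rk_th1_split => //; rewrite exprS; field; rewrite q0. Qed.
Let PsT0 : PsT 0%N = kap. Proof. by rewrite PsTE. Qed.
Let Th0 : Th 0%N = lam h PsT 1.
Proof. by rewrite lw_mul0 /lam PsT0 /= muln1 exprS; field; rewrite q0. Qed.
Let lamT d : lam h Th d = lam h PsT d.+1.
Proof. by rewrite /lam Th0 /lam -mulrA -invfM -exprD muln1 mulnS. Qed.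
Let PsTn0 : PsT 0%N != 0. Proof. by rewrite PsT0. Qed.

Let sS l : rk_s HS l != 0.
Proof. by apply: rk_s_ne => // i _; rewrite !mul0r eq_sym. Qed.
Let sS1 l : rk_s HS1 l != 0.
Proof. by apply: rk_s_ne => // i _; rewrite !mul0r eq_sym mulf_neq0 // expf_neq0. Qed.
Let sL l : rk_s HL0 l != 0.
Proof. by apply: rk_s_ne => // i _; rewrite !mul0r eq_sym. Qed.

Let qdiff m n : (n < m)%N -> be * q ^+ m * q ^- n != be.
Proof.
move=> lt; rewrite -{2}(mulr1 be) -mulrA; apply/eqP => /(mulfI be0)/eqP.
rewrite -(subnK (ltnW lt)) exprD mulfK ?expf_neq0 //; apply/negP/qnr.
by rewrite subn_gt0.
Qed.

Let sW j : (j <= N.+1)%N -> rk_s HW j != 0.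
Proof.
move=> jN; apply: rk_s_ne => // i /andP[i0 ij].
by rewrite pE -(mulrA be) -exprD qdiff //; lia.
Qed.
Let sW1 j : (j <= N)%N -> rk_s HW1 j != 0.
Proof.
move=> jN; apply: rk_s_ne => // i /andP[i0 ij].
by rewrite mulfVK ?expf_neq0 // pE qdiff //; lia.
Qed.
Let sW0 j : (N.+1 < j)%N -> rk_s HW j = 0.
Proof.
move=> jN; apply/eqP; apply: contrapT => /negP nz.
have := rk_c_neq0 qnr kap0 (rk_s_le jN nz).
rewrite /rk_c pE -(mulrA be) -exprD.
have -> : (2 * N.+1 + 2 = 2 * N.+2)%N by lia.
by rewrite mulfK ?expf_neq0 // subrr mulr0 mul0r eqxx.
Qed.

(** [ten_KR] applies because the ratios [p q^-2 q^(-2 d)] never equal [p q^2]. *)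
Lemma KR_sub_simple : is_L Th T1.
Proof.
apply: (ten_KR qnr kinv0 HS1 qN0 be0 (HW := HW1) Ht1) => d _; rewrite /rk_b -mulrA.
apply/eqP => /(mulfI p0)/eqP; rewrite -invfM -exprD => /eqP E.
have := qnr (isT : (0 < (2 + 2 * d) + 2)%N); rewrite exprD -E mulfV ?expf_neq0 // eqxx //.
Qed.

(** The singular vector of degree 1 generates a simple module [N1] with series [Th], and [T] maps
    onto [L0], with [N1] in the kernel. That [N1] is the whole kernel is a count of dimensions: in
    degree [d.+1] the module [T] is spanned by [m.+1] vectors, while [N1] contributes [m]
    independent ones and [L0] one more, so a further vector of the kernel would be one too many. *)
Lemma KR_mult S'' Th'' : is_L Th'' S'' -> has_mult T S'' (`[< Th'' = Th >] + `[< Th'' = PsT >]).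
Proof.
have hT := ten_KR_hwm qnr one0 HS kap0 be0 HW Ht.
have [w [w0 dw sw Pw]] : exists w : T, [/\ w != 0, dg PsT 1 w, sing w & forall m, opP T m w = Th m *: w].
  have [||w [w0 dw sw Pw]] := @ten_KR_sing _ _ qnr _ _ one0 _ _ _ _ HS _ _ _ kap0 be0 HW Ht erefl.
  - exact: sS.
  - exact: sW.
  - by exists w; split=> // m; rewrite Pw ThE.
pose N1 : set T := fun u => forall K, submodule K -> K w -> K u.
have sN1 : submodule N1.
  split=> [K sK _|c x y Nx Ny K sK Kw|g x Nx K sK Kw]; first exact: subm0 sK.
    by apply: (submL c sK); [exact: Nx|exact: Ny].
  exact: (submA g sK (Nx K sK Kw)).
have N1w : N1 w by [].
pose w1 : sub_bmod sN1 := sub_of (submodule_lin sN1) N1w.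
have [vP vX vY vk] := bhom_op (val_bhom sN1).
have h1 : hwm Th w1.
  split.
  - by apply: contra w0 => /eqP/(congr1 val) /= ->.
  - by apply: val_inj => /=; have := sw 0%N; rewrite opX0E.
  - by move=> m; apply: val_inj; rewrite vP Pw.
  - move=> K sK Kw1 u.
    have sK' : submodule [set x | exists2 y : sub_bmod sN1, K y & val y = x].
      split=> [|c _ _ [x Kx <-] [y Ky <-]|g _ [x Kx <-]].
      + by exists 0 => //; exact: subm0 sK.
      + by exists (c *: x + y) => //; exact: submL.
      + by exists (bact _ g x) => //; exact: submA.
    have [|y Ky E] := sub_memP u _ sK'; first by exists w1.
    by rewrite -(val_inj E).
have HN1 : is_L Th (sub_bmod sN1).
  split; last by exists w1; case: h1.
  apply: (sing_simple qnr h1) => d u du su; apply: val_inj.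
  apply: (ten_KR_nosing qnr one0 HS kap0 (HW := HW) Ht (d := d.+1)) => [||_].
  - by rewrite /dg -lamT -vk du.
  - by move=> m; rewrite -vX su.
  - rewrite /rk_b -[X in _ != X]mulr1; apply/eqP => /(mulfI p0)/eqP.
    by rewrite invr_eq1; apply/negP/qnr.
have HL : is_L PsT L0 by rewrite PsTE.
have [g [bg gs gt]] := hw_onto qnr hT HL.
have [gl gg] := bg; have [gP gX gY gk] := bhom_op bg; have g0 := bhom0 bg.
have gZ c x : g (c *: x) = c *: g x by have := gl c x 0; rewrite !addr0 g0 addr0.
have sker := bhom_ker bg.
have hL := rk_hwm HL0; have hL' : hwm PsT (rk_v HL0) by rewrite PsTE.
have dgg d u : dg PsT d u -> dg PsT d (g u) by rewrite /dg -gk => ->; rewrite gZ.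
have kw : g w = 0.
  have [sL0 _] := HL; apply: (simple_sing qnr hL' sL0 (d := 0)); first exact: dgg.
  by move=> m; rewrite -gX sw.
have kN1 u : N1 u -> g u = 0 by move=> Nu; exact: (Nu _ sker).
have lamI := lam_injective qnr PsTn0.
apply: (length2_mult qnr (sN1 := sN1) HN1 HL bg gs) => [x|]; last first.
  move/(congr1 (fun f => f 0%N)); rewrite Th0 => E.
  by have /lamI : lam h PsT 1 = lam h PsT 0 by rewrite E /lam muln0 expr0 invr1 mulr1.
split; last exact: kN1.
have [D [f [fd _ ->]]] := ten_graded qnr one0 HS HW Ht x => kx.
have kf := deg_sub qnr PsTn0 (N := fun u => g u = 0) (submodule_lin sker) (fun u gu0 => etrans (gk u) (etrans (congr1 _ gu0) (linear0 _))) (fun e _ => fd e) kx.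
suff hom d u : dg PsT d u -> g u = 0 -> N1 u.
  move=> K sK Kw; elim/big_rec: _ => [|i y _ Ky]; first exact: subm0 sK.
  by apply: (submD sK) => //; apply: (hom i) => //; apply: kf.
move=> {x D f fd kx kf} du gu; case: d du => [|d] du.
  have [c E] := hwm_deg0 qnr hT du; move: gu; rewrite E gZ => /eqP; rewrite scaler_eq0 (negPf gt) orbF => /eqP ->.
  by rewrite scale0r; exact: subm0 sN1.
apply: contrapT => nNu.
have [psi [bpsi [psi' psiK psiK']]] := is_L_iso qnr KR_sub_simple HN1.
have [pl pg] := bpsi; have [_ _ _ pk] := bhom_op bpsi; have psi0 := bhom0 bpsi.
have psiZ c x : psi (c *: x) = c *: psi x by have := pl c x 0; rewrite !addr0 psi0 addr0.
(* [m] counts the pairs of basis vectors of degree [d] in [T1], which is isomorphic to [N1], and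
   [m.+1] those of degree [d.+1] in [T]. *)
pose m := minn d.+1 N.+1; have md : (m <= d.+1)%N := geq_minl _ _; have mN : (m <= N.+1)%N := geq_minr _ _.
pose y i := t1 (rk_s HS1 (d - i)) (rk_s HW1 i).
have dy i : (i <= d)%N -> dg PsT d.+1 (val (psi (y i))).
  move=> id; rewrite /dg -vk -pk /y ten_k // (rk_ks qnr) (rk_ks qnr) (tlZ Ht1) (trZ Ht1) scalerA psiZ.
  rewrite -lamT; congr (_ *: _); rewrite /rk_kap /lam lw_mul0 /=.
  rewrite -[in RHS](subnK id) mulnDr.
  by rewrite exprD; field; rewrite !expf_neq0.
pose x0 := iter d.+1 (opY T 0) (ten_top t HS (rk_v HW)).
have dx0 : dg PsT d.+1 x0.
  rewrite /x0; elim: d.+1 => [|l IH]; first by apply: dg_v.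
  by rewrite iterS; apply: (dgY qnr).
have gx0 : g x0 != 0.
  have [c Ec] := hwm_deg0 qnr hL' (dgg _ _ (dg_v hT)).
  have c0 : c != 0 by apply: contra gt => /eqP c0; rewrite Ec c0 scale0r.
  have -> : g x0 = c *: rk_s HL0 d.+1.
    rewrite /x0; elim: d.+1 => [|l IH]; first by rewrite Ec.
    by rewrite iterS gY IH linearZ_LR.
  by rewrite scaler_eq0 negb_or c0 sL.
pose fam (i : 'I_m.+2) : T := if (i < m)%N then val (psi (y i)) else if i == m :> nat then u else x0.
pose b (j : 'I_m.+1) : T := t (rk_s HS (d.+1 - j)) (rk_s HW j).
have : (m.+2 <= m.+1)%N; last by rewrite ltnn.
apply: (@indep_bound _ _ T _ _ fam b) => [c Hc|i].
  have F (i : 'I_m) : fam (widen_ord (leqW (leqnSn m)) i) = val (psi (y i)) by rewrite /fam /= ltn_ord.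
  have Fm : fam (inord m) = u by rewrite /fam inordK ?ltnn ?eqxx // ltnS leqnSn.
  have Fm1 : fam ord_max = x0 by rewrite /fam /= ltnNge leqnSn /= gtn_eqF.
  have E2 (G : 'I_m.+2 -> T) : \sum_i G i = \sum_(i < m) G (widen_ord (leqW (leqnSn m)) i) + G (inord m) + G ord_max.
    rewrite big_ord_recr /= big_ord_recr /=; congr (_ + _ + _); last first.
      by congr G; apply: val_inj => /=; rewrite inordK // ltnS leqnSn.
    by apply: eq_bigr => i _; congr G; apply: val_inj.
  move: Hc; rewrite E2 Fm Fm1 (eq_bigr (fun i : 'I_m => val (c (widen_ord (leqW (leqnSn m)) i) *: psi (y i)))) => [Hc|i _]; last by rewrite F.
  set A := \sum_(i < m) _ in Hc.
  have NA : N1 A.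
    rewrite /A; elim/big_rec: _ => [|i z _ Nz]; first exact: subm0 sN1.
    by apply: (submD sN1) => //; exact: sub_memP.
  have cm1 : c ord_max = 0.
    have gD x z : g (x + z) = g x + g z by have := gl 1 x z; rewrite !scale1r.
    have := congr1 g Hc; rewrite !gD !gZ (kN1 _ NA) gu scaler0 !add0r g0 => /eqP; rewrite scaler_eq0 (negPf gx0) orbF.
    by move/eqP.
  move: Hc; rewrite cm1 scale0r addr0 => Hc.
  have cm : c (inord m) = 0.
    apply/eqP; apply: contrapT => /negP cn; apply: nNu.
    have -> : u = - (c (inord m))^-1 *: A.
      apply: (scalerI cn); rewrite scalerA mulrN mulfV // scaleN1r; apply/eqP.
      by rewrite -addr_eq0 addrC Hc.
    exact: (submZ _ sN1 NA).
  move: Hc; rewrite cm scale0r addr0 => HA.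
  have HA2 : \sum_(i < m) c (widen_ord (leqW (leqnSn m)) i) *: y i = 0.
    have : psi (\sum_(i < m) c (widen_ord (leqW (leqnSn m)) i) *: y i) = 0.
      apply: val_inj; apply: etrans HA; rewrite /A.
      elim/big_rec2: _ => [|i z1 z2 _ IH]; first by rewrite psi0.
      by rewrite pl -IH.
    by move/(congr1 psi'); rewrite psiK -psi0 psiK.
  have ci (i : 'I_m) : c (widen_ord (leqW (leqnSn m)) i) = 0.
    have id : (i <= d)%N by rewrite -ltnS; exact: leq_trans (ltn_ord i) md.
    have := congr1 (cw qnr kinv0 HS1 Ht1 (d - i)) HA2; rewrite (linear_sum (cw qnr kinv0 HS1 Ht1 (d - i))) linear0.
    rewrite (bigD1 i) //= big1 => [|j ji]; last first.
      have jd : (j <= d)%N by rewrite -ltnS; exact: leq_trans (ltn_ord j) md.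
      rewrite linearZ_LR /y (cw_s qnr kinv0 Ht1 _ _ (sS1 _)); case: eqP => [E|_]; last by rewrite scale0r scaler0.
      by case/eqP: ji; apply: val_inj; rewrite /= -(subKn jd) E subKn.
    rewrite addr0 linearZ_LR /y (cw_s qnr kinv0 Ht1 _ _ (sS1 _)) eqxx scale1r => /eqP.
    rewrite scaler_eq0 (negPf (sW1 _)) ?orbF => [/eqP//|].
    by rewrite -ltnS; exact: leq_trans (ltn_ord i) mN.
  move=> i; have [lt|] := ltnP i m; first by rewrite -(ci (Ordinal lt)); congr c; exact: val_inj.
  rewrite leq_eqVlt => /orP[/eqP E|lt].
    rewrite -cm; congr (c _); apply: val_inj; apply: etrans (esym E) _; apply: esym.
    by apply: (@inordK m.+1 m); rewrite ltnS leqnSn.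
  rewrite -cm1; congr (c _); apply: val_inj; by apply/eqP; rewrite eqn_leq -ltnS ltn_ord.
have dfam : dg PsT d.+1 (fam i).
  rewrite /fam; case: ifP => [lt|_]; first by apply: dy; rewrite -ltnS; exact: leq_trans lt md.
  by case: ifP.
have [D [D0 E]] := cw_dec qnr one0 HS Ht (fam i).
have Hl l : exists c, cw qnr one0 HS Ht l (fam i) = (if (l <= d.+1)%N then c else 0) *: rk_s HW (d.+1 - l).
  have [H1 H2] := cw_dg qnr one0 HS (rk_hwm HW) Ht dfam l.
  have [ld|dl] := leqP l d.+1; last by exists 0; rewrite H2 ?scale0r.
  exact: (rk_line qnr kap0 HW (H1 ld)).
have [c Hc] := choice Hl.
exists (fun j => c (d.+1 - j)%N); rewrite E.
rewrite -(@sum_widen _ D (maxn D d.+2) (fun l => t (rk_s HS l) (cw qnr one0 HS Ht l (fam i)))) => [|l /D0 ->|]; rewrite ?leq_maxl ?(tr0 Ht) //.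
rewrite (@sum_widen _ d.+2 (maxn D d.+2) (fun l => t (rk_s HS l) (cw qnr one0 HS Ht l (fam i)))) ?leq_maxr // => [|l lt]; last first.
  by rewrite Hc leqNgt lt /= scale0r (tr0 Ht).
rewrite (reindex_inj rev_ord_inj) /=.
transitivity (\sum_(j < d.+2) c (d.+1 - j)%N *: t (rk_s HS (d.+1 - j)) (rk_s HW j)).
  by apply: eq_bigr => j _; rewrite subSS Hc leq_subr (trZ Ht) subKn // -ltnS.
have [dN|Nd] := leqP d N.
  have Em : m.+1 = d.+2 by rewrite /m (minn_idPl _).
  rewrite -(big_mkord xpredT (fun j => c (d.+1 - j)%N *: t (rk_s HS (d.+1 - j)) (rk_s HW j))).
  by rewrite -(big_mkord xpredT (fun j => c (d.+1 - j)%N *: t (rk_s HS (d.+1 - j)) (rk_s HW j))) Em.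
have Em : m = N.+1 by rewrite /m (minn_idPr _) // ltnS ltnW.
apply: (@sum_widen _ m.+1 d.+2 (fun j => c (d.+1 - j)%N *: t (rk_s HS (d.+1 - j)) (rk_s HW j))) => [j jm|].
  by rewrite sW0 ?(tr0 Ht) ?scaler0 // -Em.
by rewrite Em !ltnS ltnW.
Qed.
End KRTensor.

(** * The class of a single arc *)

Section ChordClasses.
Variables (R : realType) (h : R[i]).
Local Notation C := R[i].
Local Notation q := (qpar h).
Hypothesis qnr : forall n : nat, (0 < n)%N -> q ^+ n != 1.
Let q0 : q != 0 := q_neq0 h.
Variable e : bool.
Local Notation V := (vtx e).
Local Notation cls := (@K0_class R).
Local Notation vx := (@vx e).
Local Notation X := (@X e).
Local Notation evex := (@evex e).
Local Notation Q := (fun n => qv h (vx n)).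
Variable Phi : ((V -> int) * rat -> int) -> (lweight R -> int).
Hypothesis Phi_iso : E_algebra_iso h Phi.
Hypothesis Phi_z : forall r : V,
  Phi (tens (zvar r) (delta ((val r)%:~R / 2%:R))) = K0_class (lw_Psi (q ^ (val r))).
Local Notation completed := (@completed_cluster_algebra e).
Implicit Types (a : int) (N : nat).
Hypothesis X_cluster : forall x, arc_ok x -> cluster_algebra (X [:: x]).

Definition fan a N : seq chord := [:: (a, Some (a + N.+1%:Z))].

Lemma tens_fan a N (w : rat) : tens (X (fan a N)) (delta w) =
  delta (evex ([:: a], [:: a + N%:Z]), w) +
  \sum_(i <- iota 0 N) delta (evex ([:: a; a + N.+1%:Z], [:: a + i%:Z; a + i%:Z + 1]), w).
Proof.
rewrite tens_X mons_single big_cons /top1 /=.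
have -> : a + N.+1%:Z - 1 = a + N%:Z by lia.
congr (_ + _); rewrite big_map /arc_int /=.
have -> : a + N.+1%:Z - 1 - a = N%:Z by lia.
by rewrite big_map.
Qed.

Lemma evex_unit a : evex ([:: a], [::]) = ex [:: vx a].
Proof. by rewrite /evex /= ex_nil subr0. Qed.

Lemma halfw1 a : halfw [:: vx a] = (a * 2 + e%:Z)%:~R / 2%:R.
Proof. by rewrite /halfw big_seq1. Qed.

Lemma halfwD a N : halfw [:: vx (a + N%:Z)] = halfw [:: vx a] + N%:R.
Proof.
rewrite !halfw1; have -> : (a + N%:Z) * 2 + e%:Z = (a * 2 + e%:Z) + N%:Z * 2 by ring.
by rewrite intrD mulrDl intrM mulfK.
Qed.

(** The Ptolemy relation in the quadrilateral with vertices [a], [a + N + 1], [a + N + 2] and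
    infinity, one side of which has value 1. The shifts [-1] and [N.+1] are the powers of [q] in the
    two constituents of [KR_mult]. *)
Lemma fan_rec a N :
  Defs.conv (shift_by [:: vx (a + N.+1%:Z)] (halfw [:: vx (a + N.+1%:Z)])) (tens (X (fan a N.+1)) (delta 0)) =
  Defs.conv (shift_by [:: vx (a + N.+2%:Z)] (-1 + halfw [:: vx (a + N.+2%:Z)])) (tens (X (fan a N)) (delta 0)) +
  shift_by [:: vx a] (N.+1%:R + halfw [:: vx a]).
Proof.
have cD (x : (V -> int) * rat) (f g : (V -> int) * rat -> int) : Defs.conv (delta x) (f + g) = Defs.conv (delta x) f + Defs.conv (delta x) g.
  by rewrite !conv_delta.
have cS (x : (V -> int) * rat) s (G : nat -> mono) (w : rat) :
   Defs.conv (delta x) (\sum_(i <- s) delta (evex (G i), w)) = \sum_(i <- s) delta (x + (evex (G i), w)).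
  by rewrite -(big_map (fun i => (evex (G i), w)) xpredT (@delta _)) conv_sum2 big_map.
have pE b p w w' : (ex [:: vx b], w) + (evex p, w') = (evex (pmul ([:: b], [::]) p), w + w').
  by rewrite evex_mul evex_unit.
rewrite !tens_fan !shift_byE !cD !cS !conv_dd.
have -> : iota 0 N.+1 = iota 0 N ++ [:: N] by rewrite -(iotaD 0 N 1) addn1.
rewrite big_cat big_seq1 !pE !addr0.
have -> : -1 + halfw [:: vx (a + N.+2%:Z)] = halfw [:: vx (a + N.+1%:Z)].
  by rewrite !halfwD -[N.+2%:R]natr1; ring.
have -> : N.+1%:R + halfw [:: vx a] = halfw [:: vx (a + N.+1%:Z)] by rewrite halfwD addrC.
rewrite -(evex_unit a) [RHS]addrC; congr (_ + _).
  congr (delta (_, _)); apply/evex_peq/peqP => r /=; lia.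
rewrite [LHS]addrC; congr (_ + _).
  congr (delta (_, _)); apply/evex_peq/peqP => r /=.
  have -> : a + N%:Z + 1 = a + N.+1%:Z by lia.
  lia.
apply: eq_bigr => i _; rewrite !pE; congr (delta (_, _)); apply/evex_peq/peqP => r /=; lia.
Qed.

Lemma conv_delta_inj (G : zmodType) (x : G) (f g : G -> int) :
  Defs.conv (delta x) f = Defs.conv (delta x) g -> f = g.
Proof.
rewrite !conv_delta => E; apply/funext => y; have := congr1 (fun f => f (y + x)) E.
by rewrite /= addrK.
Qed.

(** The class of the Kirillov-Reshetikhin module has a preimage [D], since [Phi] is onto. By
    [KR_mult], [D] satisfies the relation [fan_rec] of the expected Laurent polynomial, and
    multiplication by a monomial can be cancelled. *)
Lemma fan_class a N : completed (tens (X (fan a N)) (delta 0)) /\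
  Phi (tens (X (fan a N)) (delta 0)) = cls (kr_lw h e a N).
Proof.
elim: N => [|N [cI EI]].
  have -> : tens (X (fan a 0)) (delta 0) = shift_by [::] 0.
    rewrite tens_fan big_nil addr0 shift_byE ex_nil addr0.
    by have -> : evex ([:: a], [:: a]) = 0 by rewrite /evex subrr.
  by rewrite (Phi_wt Phi_iso) kr_lw0; split=> //; exact: completed_delta.
have [W0 HW0 OW0] := kr_ex qnr e a N.
have [D cD ED] := Phi_surj Phi_iso (class_in_K0 qnr HW0 OW0).
set p := Q (a + N.+1%:Z).
have Ep : Q (a + N.+2%:Z) = p * q ^+ 2.
  by rewrite -[N.+2]addn1 PoszD addrA QD.
have Em : Q (a + N%:Z) = p * q ^- 2.
  have E := QD h e (a + N%:Z) 1; rewrite -addrA -PoszD addn1 muln1 in E.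
  by rewrite /p E mulfK // expf_neq0.
have pE : p = Q a * q ^+ (2 * N.+1) by rewrite /p QD.
have one b w : lw_mul (lw_weight h w) (lw_prod (map (qv h (e := e)) [:: vx b])) = rk_lw (qpow h w) 0 (Q b).
  by rewrite rk_lw0E /lw_prod big_seq1.
have [E1 _] := Phi_shift qnr Phi_iso Phi_z [:: vx (a + N.+2%:Z)] (-1); rewrite one Ep qpowN qpow1 in E1.
have [E2 [L0 HL0 _]] := Phi_shift qnr Phi_iso Phi_z [:: vx a] N.+1%:R; rewrite one qpow_nat in E2 HL0.
have E0 : Phi (shift_by [:: vx (a + N.+1%:Z)] (halfw [:: vx (a + N.+1%:Z)])) = cls (rk_lw 1 0 p).
  by rewrite rk_lin /halfw big_seq1 (Phi_one Phi_z).
set D0 := shift_by _ _ in E0; set D1 := shift_by _ _ in E1; set D2 := shift_by _ _ in E2.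
have cD0 : completed D0 by exact: completed_delta.
have cD1 : completed D1 by exact: completed_delta.
have cD2 : completed D2 by exact: completed_delta.
have cc0 : completed (Defs.conv D0 D) by exact: completed_shift.
have cc1 : completed (Defs.conv D1 (tens (X (fan a N)) (delta 0))) by exact: completed_shift.
have [|S [W [T [t [HS HW Ht]]]]] := Phi_tensor Phi_iso cD0 cD E0 ED cc0.
  by apply: shift_neq0; exact: (cls_neq0 Phi_iso ED).
have [|S1 [W1 [T1 [t1 [HS1 HW1 Ht1]]]]] := Phi_tensor Phi_iso cD1 cI E1 EI cc1.
  by apply: shift_neq0; exact: (cls_neq0 Phi_iso EI).
rewrite /kr_lw -/p in HW; rewrite /kr_lw Em in HW1 EI.
have be0 : Q a != 0 by exact: Q_neq0.
have HT1 := KR_sub_simple qnr be0 pE HS1 HW1 Ht1.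
have HTm := KR_mult qnr be0 pE HS HW Ht HS1 HW1 Ht1 HL0.
pose Th1 := lw_mul (rk_lw q^-1 0 (p * q ^+ 2)) (rk_lw (q ^+ N) (p * q ^- 2) (Q a)).
pose Th2 := lw_mul (rk_lw 1 0 p) (rk_lw (q ^+ N.+1) p (Q a)).
have PE : lw_mul (rk_lw 1 0 p) (rk_lw (q ^+ N.+1) p (Q a)) = rk_lw (q ^+ N.+1) 0 (Q a).
  by rewrite (rk_lw0E 1) lw_mul1 rk_lwE (rk_lw0E (q ^+ _)).
have key : Defs.conv D0 D = Defs.conv D1 (tens (X (fan a N)) (delta 0)) + D2.
  have ccs : completed (Defs.conv D1 (tens (X (fan a N)) (delta 0)) + D2).
    rewrite -fan_rec; apply: completed_shift; apply: completed_X => //.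
    by rewrite /fan /= /arc_ok /= andbT; lia.
  apply: (Phi_inj Phi_iso cc0 ccs); rewrite (PhiD Phi_iso cc1 cD2) !(PhiM Phi_iso) // E0 E1 E2 ED EI.
  apply/funext => Th; rewrite -[RHS]/(K0_mul h _ _ Th + cls _ Th).
  rewrite (K0_mul_mult qnr (F := fun Th'' => (`[< Th'' = Th1 >] + `[< Th'' = Th2 >])%N) Th HS HW Ht (fun Th' S'' => @HTm S'' Th')); last first.
    by move=> Th'; case: asboolP => [-> _|_]; [exists T1|case: asboolP => // -> _; exists L0; rewrite /Th2 PE].
  rewrite (K0_mul_mult qnr (F := fun Th'' => nat_of_bool `[< Th'' = Th1 >]) Th HS1 HW1 Ht1 (fun Th' S'' => @simple_mult _ _ qnr _ _ _ _ HT1)); last first.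
    by move=> Th'; case: asboolP => // -> _; exists T1.
  by rewrite PoszD /K0_class deltaE /Th2 PE.
have <- : D = tens (X (fan a N.+1)) (delta 0); last by split.
by move: key; rewrite -fan_rec /D0 shift_byE; exact: conv_delta_inj.
Qed.

Lemma chord_rank1 (x : chord) : arc_ok x -> exists kap a be : C, [/\ kap != 0,
  Phi (tens (X [:: x]) (delta 0)) = cls (rk_lw kap a be) & isLw h e 0 (top1 x) (rk_lw kap a be)].
Proof.
case: x => a [b|] ok.
  rewrite /arc_ok /= in ok; have Eb : b = a + (absz (b - a - 1)%R).+1%:Z by lia.
  exists (q ^+ absz (b - a - 1)%R), (Q (a + (absz (b - a - 1)%R)%:Z)), (Q a); split.
  - exact: expf_neq0.
  - by have [_] := fan_class a (absz (b - a - 1)%R); rewrite /fan -Eb.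
  - by have := kr_lw_isLw h e a (absz (b - a - 1)%R); rewrite -Eb.
exists (qpow h (- halfw [:: vx a])), 0, (Q a); split; first exact: qpow_neq0.
  have [E _] := Phi_shift qnr Phi_iso Phi_z [:: vx a] (- halfw [:: vx a]).
  rewrite addNr /lw_prod big_seq1 in E; rewrite rk_lw0E -[RHS]E; congr Phi.
  by rewrite tens_X mons_single big_seq1 shift_byE evex_unit.
by apply/isLw_rk; rewrite sub0r.
Qed.
End ChordClasses.

(** * From simple classes to simple tensor products *)

Section SimpleTensor.
Variables (R : realType) (h : R[i]).
Local Notation C := R[i].
Local Notation q := (qpar h).
Hypothesis qnr : forall n : nat, (0 < n)%N -> q ^+ n != 1.
Let q0 : q != 0 := q_neq0 h.
Variables (kap a be : C) (kap0 : kap != 0).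
Variables (S W T : bmod h) (t : S -> W -> T) (Psi : lweight R).
Hypotheses (HS : is_L (rk_lw kap a be) S) (HW : is_L Psi W) (Ht : is_tensor t).
Local Notation PsT := (lw_mul (rk_lw kap a be) Psi).

Let gT : graded T PsT := ten_graded qnr kap0 HS HW Ht.
Let PsTn0 : PsT 0%N != 0 := ten_Psi0 a be kap0 HW.

Let X0_low u : dg PsT 0 u -> opX T 0 u = 0.
Proof.
move=> du; have [D [f [fd _ E]]] := gT (opX T 0 u).
have kX : opk T (opX T 0 u) = (PsT 0%N * q ^+ 2) *: opX T 0 u.
  by rewrite (kXm qnr) du linearZ_LR scalerA /lam muln0 expr0 invr1 mulr1 mulrC.
have H e : (e < D)%N -> f e = 0.
  move=> eD; apply/eqP; apply: contrapT => /negP nz.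
  have := @eig_sum0 _ _ T (lam h PsT) (PsT 0%N * q ^+ 2) D f (lam_injective qnr PsTn0) (fun e _ => fd e).
  rewrite -E kX => /(_ erefl e eD nz); rewrite /lam => /(mulfI PsTn0) Eq.
  have := qnr (isT : (0 < 2 + 2 * e)%N); rewrite exprD -Eq mulVf ?expf_neq0 // eqxx //.
by rewrite E big1 // => i _; exact: H.
Qed.

Let X0_low' d u : dg PsT d.+1 u -> dg PsT d (opX T 0 u).
Proof. exact: (dgX qnr). Qed.

Lemma least (P : nat -> Prop) : (exists n, P n) -> exists n, P n /\ forall m, P m -> (n <= m)%N.
Proof.
move=> [n Pn]; have ex : exists n, `[< P n >] by exists n; apply/asboolP.
case: (ex_minnP ex) => m /asboolP Pm H; exists m; split=> // k Pk; apply: H; exact/asboolP.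
Qed.

(** A proper nonzero submodule [N] would yield two occurrences of the top series, one inside [N] and
    one above it: in [N], and in [T] modulo [N], a common eigenvector in the least possible degree
    is singular and gives a simple subquotient. The multiplicity is only 1. *)
Lemma ten_simple Sg : findim W Psi -> flagw W Psi Sg ->
  (forall Th, tensor_mult h (rk_lw kap a be) Psi Th = `[< Th = PsT >]) -> is_L PsT T.
Proof.
move=> fW FW Hm; have [w0 HW0] := is_L_hwm HW.
have FT := flagw_ten qnr kap0 HS HW0 Ht FW.
have tn0 := ten_top_neq0 qnr kap0 HS HW0 Ht.
split; last first.
  exists (ten_top t HS w0); split=> //; first exact: (ten_top_E qnr kap0 HS HW0 Ht).
  exact: (ten_top_P qnr kap0 HS HW0 Ht).
split; first by exists (ten_top t HS w0).
move=> N sN; apply: contrapT => /not_orP[nN0 nNT]; have lN := submodule_lin sN.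
have dgl d : lin_closed (dg PsT d : T -> Prop).
  by split=> [|c u w du dw]; [exact: dg0|exact: dg_lin].
have mult1 (M' M : set T) (B : bmod h) Th : is_L Th B -> subquotient_iso M' M B -> Th = PsT.
  move=> HB iso; have [n Hn] := ten_mult_ex qnr kap0 HS HW Ht fW HB.
  have := occurs_pos (ex_intro _ M' (ex_intro _ M iso)) Hn.
  by rewrite -(tm_eq qnr HS HW HB Ht Hn) Hm; case: asboolP.
have [z triv] := submod_triv T.
have [M' [M [B [_ MN HB iso]]]] : exists M' M (B : bmod h), [/\ [set 0] `<=` M', M `<=` N, is_L PsT B & subquotient_iso M' M B].
  have [|d [[u [Nu u0 du]] dmin]] := @least (fun d => exists u, [/\ N u, u != 0 & dg PsT d u]).
    apply: contrapT => no; apply: nN0; apply/seteqP; split=> u /=; last by move=> ->; exact: subm0.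
    move=> Nu; have [D [f [fd _ E]]] := gT u; rewrite E in Nu *.
    have Nk v : N v -> N (opk T v) by rewrite opkE; exact: submA.
    have Nf := deg_sub qnr PsTn0 lN Nk (fun e _ => fd e) Nu.
    rewrite big1 // => i _; apply/eqP; apply: contrapT => /negP nz; apply: no; exists i, (f i); split=> //.
    exact: Nf.
  have [|||||| zz [Th [[Nz dz] nz _ HP]]] := FT d (fun u => N u /\ dg PsT d u) (fun u => u = 0).
  - by split=> [|c x y [? ?] [? ?]]; split; [exact: subm0|exact: dg0|exact: submL|exact: dg_lin].
  - by split=> // c x y -> ->; rewrite scaler0 addr0.
  - by move=> m x [Nx dx]; split; [rewrite opPE; exact: submod_tact|exact: dgP'].
  - by move=> m x ->; rewrite linear0.
  - by move=> x [].
  - by exists u => //; apply/eqP.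
  have [||||m|M' [M [B [? ? HB iso]]]] := @simple_subquo _ _ T [set 0] N zz Th z sN; try by [].
  - by move=> x ->; exact: subm0.
  - case: d dz dmin {du} => [|d] dz dmin; first exact: X0_low.
    apply: contrapT => nX; suff: (d < d)%N by [rewrite ltnn]; apply: dmin.
    exists (opX T 0 zz); split; [rewrite opXE; exact: submod_tact|exact/eqP|exact: X0_low'].
  by exists M', M, B; rewrite -(mult1 _ _ _ _ HB iso).
have [M1' [M1 [B1 [NM _ HB1 iso1]]]] : exists M' M (B : bmod h), [/\ N `<=` M', M `<=` setT, is_L PsT B & subquotient_iso M' M B].
  have [|d [[u [nNu du]] dmin]] := @least (fun d => exists u, ~ N u /\ dg PsT d u).
    apply: contrapT => no; apply: nNT; apply/seteqP; split=> u //= _.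
    have [D [f [fd _ ->]]] := gT u.
    elim/big_rec: _ => [|i x _ Nx]; first exact: subm0.
    apply: (submD sN) => //; apply: contrapT => nf; apply: no; by exists i, (f i).
  have [|||||| zz [Th [dz nz _ HP]]] := FT d (fun u => dg PsT d u) (fun u => N u /\ dg PsT d u).
  - exact: dgl.
  - by split=> [|c x y [? ?] [? ?]]; split; [exact: subm0|exact: dg0|exact: submL|exact: dg_lin].
  - by move=> m x dx; exact: dgP'.
  - by move=> m x [Nx dx]; split; [rewrite opPE; exact: submod_tact|exact: dgP'].
  - by [].
  - by exists u => // -[].
  have nNz : ~ N zz by move=> Nz; apply: nz.
  have [||||m|M2' [M2 [B2 [? ? HB2 iso2]]]] := @simple_subquo _ _ T N setT zz Th sN triv; try by [].
  - case: d dz dmin {du nz HP} => [|d] dz dmin; first by rewrite X0_low //; exact: subm0.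
    apply: contrapT => nX; suff: (d < d)%N by [rewrite ltnn]; apply: dmin.
    by exists (opX T 0 zz); split; [|exact: X0_low'].
  - by have [] := HP m.
  by exists M2', M2, B2; rewrite -(mult1 _ _ _ _ HB2 iso2).
have [n Hn] := ten_mult_ex qnr kap0 HS HW Ht fW HB.
have n1 : n = 1%N by rewrite -(tm_eq qnr HS HW HB Ht Hn) Hm; case: asboolP.
have [_] := Hn; apply; rewrite n1.
have [g [bg gb]] := is_L_iso qnr HB1 HB.
have iso2 : subquotient_iso M1' M1 B.
  apply: (@sq_transport _ _ T T B1 B M1' M1 id g) => //.
  by exists id.
exists (fun i => if i is 0%N then M' else M1'), (fun i => if i is 0%N then M else M1); split.
  by case=> [|[|i]].
by case=> [|i] // _ x /MN/NM.
Qed.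
End SimpleTensor.

(** * Tensor products of noncrossing families *)

Section RealSimples.
Variables (R : realType) (h : R[i]).
Local Notation C := R[i].
Local Notation q := (qpar h).
Hypothesis qnr : forall n : nat, (0 < n)%N -> q ^+ n != 1.
Variable e : bool.
Local Notation V := (vtx e).
Local Notation cls := (@K0_class R).
Local Notation X := (@X e).
Variable Phi : ((V -> int) * rat -> int) -> (lweight R -> int).
Hypothesis Phi_iso : E_algebra_iso h Phi.
Hypothesis Phi_z : forall r : V,
  Phi (tens (zvar r) (delta ((val r)%:~R / 2%:R))) = K0_class (lw_Psi (q ^ (val r))).
Local Notation completed := (@completed_cluster_algebra e).
Local Notation isLw := (@isLw R h e).
Implicit Types (Psi Th : lweight R) (f g : seq chord).
Hypothesis X_cluster : forall x, arc_ok x -> cluster_algebra (X [:: x]).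
Let rank1 := chord_rank1 qnr Phi_iso Phi_z X_cluster.

Lemma bounded_ex f : exists H, bounded H f.
Proof.
elim: f => [|[a b] f [H IH]]; first by exists 0.
exists (Num.max H (Num.max (a + 1) (if b is Some b' then b' + 1 else 0))) => x.
rewrite inE => /orP[/eqP ->|/IH[H1 H2]] /=; split=> [|b' Eb].
- by rewrite !lt_max ltrDl orbT.
- by rewrite Eb !lt_max ltrDl !orbT.
- by rewrite lt_max H1.
- by rewrite lt_max (H2 _ Eb).
Qed.

Lemma noncrossing_cls f w : all arc_ok f -> noncrossing f ->
  exists2 Psi, isLw w (topm f) Psi & Phi (tens (X f) (delta w)) = cls Psi.
Proof.
move=> okf ncf; have [H Hf] := bounded_ex f.
exact: (noncrossing_class qnr Phi_iso Phi_z X_cluster rank1 w okf ncf Hf).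
Qed.

Let Tr : lweight R -> Prop := fun _ => True.

Lemma cls_inj Psi Psi' : cls Psi = cls Psi' -> Psi = Psi'.
Proof.
by move/(congr1 (fun F => F Psi)); rewrite /K0_class delta_xx deltaE; case: asboolP.
Qed.

(** The passage from classes to modules: the class of the product being that of a simple module,
    [ten_simple] applies. The flag property, here without condition on the l-weights, is carried
    along for the next factor. *)
Lemma rank1_tensor D1 D2 kap a be Psi2 Psi3 : kap != 0 -> completed D1 -> completed D2 ->
  completed (Defs.conv D1 D2) -> Defs.conv D1 D2 <> 0 ->
  Phi D1 = cls (rk_lw kap a be) -> Phi D2 = cls Psi2 -> Phi (Defs.conv D1 D2) = cls Psi3 ->
  (exists2 W : bmod h, is_L Psi2 W & flagw W Psi2 Tr) ->
  exists (S W T : bmod h) (t : S -> W -> T),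
    [/\ is_L (rk_lw kap a be) S, is_L Psi2 W, is_tensor t, is_L Psi3 T & flagw T Psi3 Tr].
Proof.
move=> kap0 c1 c2 cc nz E1 E2 E3 [W0 HW0 FW0].
have [S [W [T [t [HS HW Ht]]]]] := Phi_tensor Phi_iso c1 c2 E1 E2 cc nz.
have [S' HS' OS'] := cls_supp Phi_iso c2 E2.
have [_ _ [w P0]] := in_Oplus2Z_lw qnr HS' OS'; have [[OS1 _] _] := OS'.
have fS' := findim_O OS1 P0; have FS' := flagw_biso (is_L_iso qnr HW0 HS') FW0.
have [t' Ht'] := ten_transport Ht (is_L_iso qnr HS HS) (is_L_iso qnr HW HS').
have tm Th : tensor_mult h (rk_lw kap a be) Psi2 Th = `[< Th = Psi3 >].
  by apply/eqP; rewrite -eqz_nat -K0_mul_cc -E1 -E2 -(PhiM Phi_iso) // E3.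
have EP : lw_mul (rk_lw kap a be) Psi2 = Psi3.
  by have := tm_top qnr kap0 HS HS' Ht' fS'; rewrite tm; case: asboolP.
exists S, S', T, t'; split=> //.
  by rewrite -EP; apply: (ten_simple qnr kap0 HS HS' Ht' fS' FS') => Th; rewrite tm EP.
have [w0 Hw0] := is_L_hwm HS'; rewrite -EP.
by apply: flagw_sub (flagw_ten qnr kap0 HS Hw0 Ht' FS') => Th _.
Qed.

Lemma noncrossing_flag f Psi : all arc_ok f -> noncrossing f -> Phi (tens (X f) (delta 0)) = cls Psi ->
  exists2 W : bmod h, is_L Psi W & flagw W Psi Tr.
Proof.
elim: f Psi => [|x f IH] Psi okf ncf E.
  have [E1 [W HW FW]] := Phi_shift qnr Phi_iso Phi_z [::] 0.
  have EP : Psi = lw_mul (lw_weight h 0) (lw_prod (map (qv h (e := e)) [::])).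
    rewrite /lw_prod big_nil lw_mulC lw_mul1; apply: cls_inj.
    by rewrite -E X_nil lone_ex -/(shift_by _ _) (Phi_wt Phi_iso).
  by rewrite EP; exists W => //; apply: flagw_sub FW.
have /andP[okx okf'] := okf.
have ncf' : noncrossing f by move=> y z yf zf; apply: ncf; rewrite inE ?yf ?zf orbT.
have [Psi' _ E'] := noncrossing_cls 0 okf' ncf'.
have [kap [a [be [kap0 Ex _]]]] := rank1 okx.
have Ec : Defs.conv (tens (X [:: x]) (delta 0)) (tens (X f) (delta 0)) = tens (X (x :: f)) (delta 0).
  by rewrite conv_X addr0.
have [|||||S [W [T [t [_ _ _ HT FT]]]]] := @rank1_tensor _ _ kap a be Psi' Psi kap0 _ _ _ _ Ex E' _ (IH _ okf' ncf' E').
- by apply: completed_X => //=; rewrite okx.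
- exact: completed_X.
- by rewrite Ec; apply: completed_X.
- by rewrite Ec; exact: X_neq0.
- by rewrite Ec.
by exists T.
Qed.

(** Induction on [f], one arc at a time with [ten_assoc], because a tensor product is under control
    only when its first factor has rank one. *)
Lemma noncrossing_tensor f g Psi Psi' Psi'' : all arc_ok (f ++ g) -> noncrossing (f ++ g) ->
  Phi (tens (X f) (delta 0)) = cls Psi -> Phi (tens (X g) (delta 0)) = cls Psi' ->
  Phi (tens (X (f ++ g)) (delta 0)) = cls Psi'' ->
  exists (S W T : bmod h) (t : S -> W -> T), [/\ is_L Psi S, is_L Psi' W, is_tensor t & is_L Psi'' T].
Proof.
elim: f Psi Psi'' => [|x f IH] Psi Psi'' ok nc E E' E''.
  have Ec : Defs.conv (shift_by [::] 0) (tens (X g) (delta 0)) = tens (X g) (delta 0).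
    by rewrite shift_byE conv_delta ex_nil; apply/funext => y; rewrite subr0.
  have E0 : Phi (shift_by [::] 0) = cls (rk_lw 1 0 0).
    by rewrite (Phi_wt Phi_iso) rk_cst /lw_weight qpow0.
  have EP : Psi = rk_lw 1 0 0.
    by apply: cls_inj; rewrite -E X_nil lone_ex -/(shift_by _ _).
  have [|||||S [W [T [t [HS HW Ht HT _]]]]] := @rank1_tensor _ _ 1 0 0 Psi' Psi'' (oner_neq0 _) (completed_delta _ _) _ _ _ E0 E' _ _.
  - exact: completed_X.
  - by rewrite Ec; exact: completed_X.
  - by rewrite Ec; exact: X_neq0.
  - by rewrite Ec.
  - exact: noncrossing_flag E'.
  by exists S, W, T, t; rewrite EP.
move: (ok); rewrite /= => /andP[okx ok']; have okf : all arc_ok f by move: ok'; rewrite all_cat => /andP[].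
have nc' : noncrossing (f ++ g) by move=> y z yf zf; apply: nc; rewrite /= inE ?yf ?zf orbT.
have ncf : noncrossing f by move=> y z yf zf; apply: nc'; rewrite mem_cat ?yf ?zf.
have ncx : noncrossing (x :: f).
  by move=> y z; rewrite !inE => yf zf; apply: nc; rewrite /= !inE mem_cat orbA ?yf ?zf.
have okxf : all arc_ok (x :: f) by rewrite /= okx.
have [Psi1 _ E1] := noncrossing_cls 0 okf ncf; have [Psi2 _ E2] := noncrossing_cls 0 ok' nc'.
have [S' [W [T1 [t1 [HS' HW Ht1 HT1]]]]] := IH _ _ ok' nc' E1 E' E2.
have [kap [a [be [kap0 Ex _]]]] := rank1 okx.
have Ec f' : Defs.conv (tens (X [:: x]) (delta 0)) (tens (X f') (delta 0)) = tens (X (x :: f')) (delta 0).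
  by rewrite conv_X addr0.
have cx : completed (tens (X [:: x]) (delta 0)) by apply: completed_X => //=; rewrite okx.
have [||||A [B [S [tS [HA HB HtS HS _]]]]] := @rank1_tensor _ _ kap a be Psi1 Psi kap0 cx _ _ _ Ex E1 _ (noncrossing_flag okf ncf E1).
- exact: completed_X.
- by rewrite Ec; exact: completed_X.
- by rewrite Ec; exact: X_neq0.
- by rewrite Ec.
have [||||A2 [B2 [T [t2 [HA2 HB2 Ht2 HT _]]]]] := @rank1_tensor _ _ kap a be Psi2 Psi'' kap0 cx _ _ _ Ex E2 _ (noncrossing_flag ok' nc' E2).
- exact: completed_X.
- by rewrite Ec; exact: completed_X.
- by rewrite Ec; exact: X_neq0.
- by rewrite Ec.
have [tS' HtS'] := ten_transport HtS (is_L_iso qnr HA HA) (is_L_iso qnr HB HS').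
have [t2' Ht2'] := ten_transport Ht2 (is_L_iso qnr HA2 HA) (is_L_iso qnr HB2 HT1).
have [t3 Ht3] := ten_assoc HtS' Ht1 Ht2'.
by exists S, W, T, t3.
Qed.

Lemma noncrossing_real f Psi : all arc_ok f -> noncrossing f -> Phi (tens (X f) (delta 0)) = cls Psi ->
  exists S : bmod h, [/\ in_Oplus2Z e S, real_simple S & is_L Psi S].
Proof.
move=> okf ncf E.
have okff : all arc_ok (f ++ f) by rewrite all_cat okf.
have ncff : noncrossing (f ++ f) by move=> y z; rewrite !mem_cat !orbb; exact: ncf.
have [Psi2 _ E2] := noncrossing_cls 0 okff ncff.
have [S [W [T [t [HS HW Ht HT]]]]] := noncrossing_tensor okff ncff E E E2.
have [S' HS' OS'] := cls_supp Phi_iso (completed_X X_cluster 0 okf) E.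
have [t' Ht'] := ten_transport Ht (is_L_iso qnr HS HS') (is_L_iso qnr HW HS').
exists S'; split=> //; split; first by case: HS'.
by exists T, t'; split=> //; case: HT.
Qed.
End RealSimples.

(** * Triangulations and seeds *)

Section Triangulations.
Implicit Types (x y z k : chord) (p a P Q R : int) (r s S : option int).

Definition lto p r : bool := if r is Some b then p < b else true.
Variable T : chord -> Prop.

Definition tb x := T x \/ exists a, x = (a, Some (a + 1)).

(** Maximality is expressed locally. [tri_in] gives the triangle of a chord on the side of the
    vertices between its ends, [tri_out] the one on the other side, whose third vertex lies beyond
    the right end or before the left one. [tb] admits the sides of the polygon as well. *)
Record triangulation : Prop := Triangulation {
  tri_ok : forall x, T x -> arc_ok x;
  tri_nc : forall x y, T x -> T y -> ~~ crosses x y;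
  tri_in : forall p r, T (p, r) -> exists q : int, [/\ p < q, lto q r, tb (p, Some q) & tb (q, r)];
  tri_out : forall p r, tb (p, r) ->
    (exists (b : int) (s : option int), [/\ r = Some b, lto b s, tb (b, s) & tb (p, s)]) \/
    (exists s : int, [/\ s < p, tb (s, Some p) & tb (s, r)])
}.

Hypothesis HT : triangulation.

Lemma tb_lto p r : tb (p, r) -> lto p r.
Proof.
case=> [/(tri_ok HT)|[a [-> ->]]]; rewrite /lto /arc_ok /=; last by lia.
by case: r => // b; lia.
Qed.

Lemma tb_nc x y : tb x -> tb y -> ~~ crosses x y.
Proof.
case=> [Tx|[a ->]] [Ty|[b ->]]; first exact: (tri_nc HT).
- have := tri_ok HT Tx; case: x Tx => u [v|] _; rewrite /crosses /arc_ok /=; lia.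
- case: y Ty => u [v|] _; rewrite /crosses /=; lia.
- rewrite /crosses /=; lia.
Qed.

Ltac nc H1 H2 := have := tb_nc H1 H2; have := tb_nc H2 H1; rewrite /crosses /=.

(** Otherwise a side of one triangle would cross a side of the other. *)
Lemma apex_in p r a b : tb (p, Some a) -> tb (a, r) -> tb (p, Some b) -> tb (b, r) -> a = b.
Proof.
move=> A1 A2 B1 B2; have a1 := tb_lto A1; have a2 := tb_lto A2; have b1 := tb_lto B1; have b2 := tb_lto B2.
nc A2 B1; nc A1 B2; move: a1 a2 b1 b2; rewrite /lto /=; case: r {A1 A2 B1 B2} => [r|]; lia.
Qed.

Lemma apex_right p b r s : tb (b, r) -> tb (p, r) -> tb (b, s) -> tb (p, s) -> p < b -> r = s.
Proof.
move=> A1 A2 B1 B2 pb; have a1 := tb_lto A1; have b1 := tb_lto B1.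
nc A1 B2; nc A2 B1; move: a1 b1 pb; rewrite /lto /=.
case: r {A1 A2} => [r|]; case: s {B1 B2} => [s|] //=; try lia.
move=> ? ? ? ? ? ? ?; congr Some; lia.
Qed.

Lemma apex_left p r a b : tb (a, Some p) -> tb (a, r) -> tb (b, Some p) -> tb (b, r) -> lto p r -> a = b.
Proof.
move=> A1 A2 B1 B2 pr; have a1 := tb_lto A1; have b1 := tb_lto B1.
nc A1 B2; nc A2 B1; move: a1 b1 pr; rewrite /lto /=; case: r {A1 A2 B1 B2} => [r|]; lia.
Qed.

(** [pat x y z]: the chords [x], [y], [z] are the sides of a triangle, with
    [y] following [x] in the cyclic order used to orient the quiver. *)
Definition pat x y z := exists (p q : int) (r : option int), [/\ p < q, lto q r &
  [\/ [/\ x = (p, r), y = (q, r) & z = (p, Some q)],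
      [/\ x = (q, r), y = (p, Some q) & z = (p, r)] |
      [/\ x = (p, Some q), y = (p, r) & z = (q, r)]]].

Lemma pat_cyc x y z : pat x y z -> pat y z x.
Proof.
move=> [p [q [r [pq qr H]]]]; exists p, q, r; split=> //.
by case: H => -[-> -> ->]; [constructor 2|constructor 3|constructor 1].
Qed.

Ltac inj := repeat match goal with
  | H : (_, _) = (_, _) |- _ => injection H; clear H; intros; subst
  | H : Some _ = Some _ |- _ => injection H; clear H; intros; subst
  end.

Lemma pat_fun x y z z' : pat x y z -> pat x y z' -> z = z'.
Proof.
move=> [p [q [r [pq qr H]]]] [p' [q' [r' [pq' qr' H']]]].
case: H => -[? ? ?]; case: H' => -[? ? ?]; subst; inj; rewrite /lto /= in qr qr'; first [by [] | lia].
Qed.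

Lemma pat_anti x y z z' : pat x y z -> pat y x z' -> False.
Proof.
move=> [p [q [r [pq qr H]]]] [p' [q' [r' [pq' qr' H']]]].
case: H => -[? ? ?]; case: H' => -[? ? ?]; subst; inj; rewrite /lto /= in qr qr'; first [by [] | lia].
Qed.

Section Quadrilateral.
Variables (P Q R : int) (S : option int).
Hypotheses (PQ : P < Q) (QR : Q < R) (RS : lto R S).
Hypotheses (bPQ : tb (P, Some Q)) (bQR : tb (Q, Some R)) (bRS : tb (R, S)) (bPS : tb (P, S)).

Lemma tri_PR x y : tb x -> tb y -> pat x y (P, Some R) ->
  (x = (Q, Some R) /\ y = (P, Some Q)) \/ (x = (P, S) /\ y = (R, S)).
Proof.
move=> bx bY [p [q [r [pq qr H]]]]; case: H => -[Ex Ey Ez]; rewrite {}Ex in bx *; rewrite {}Ey in bY *; case: Ez => Ep Er.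
- right; rewrite -Ep -Er in bx bY pq *; have -> : r = S by exact: (apex_right bY bx bRS bPS).
  by [].
- left; rewrite -Ep -Er in bx bY pq *.
  by have -> : q = Q by exact: (apex_in bY bx bPQ bQR).
- exfalso; rewrite -Ep -Er in bx bY pq qr *; nc bY bPS.
  by move: pq RS qr; rewrite /lto; case: (S) => [s|]; lia.
Qed.

Lemma tri_QS x y : tb x -> tb y -> pat x y (Q, S) ->
  (x = (P, Some Q) /\ y = (P, S)) \/ (x = (R, S) /\ y = (Q, Some R)).
Proof.
move=> bx bY [p [q [r [pq qr H]]]]; case: H => -[Ex Ey Ez]; rewrite {}Ex in bx *; rewrite {}Ey in bY *; case: Ez => Ep Er.
- exfalso; rewrite -Ep in bx bY pq; nc bx bPS; rewrite Er; move: pq PQ qr; rewrite /lto.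
  by case: (r) => [s|]; lia.
- right; rewrite -Ep -Er in bx bY pq qr *.
  by have -> : q = R by exact: (apex_in bY bx bQR bRS).
- left; rewrite -Ep -Er in bx bY pq qr *.
  by have -> : p = P by exact: (apex_left bx bY bPQ bPS qr).
Qed.
End Quadrilateral.

Definition swap k k' x := (T x /\ x <> k) \/ x = k'.
End Triangulations.

Local Notation tb0 := tb.
Section Flips.
Implicit Types (x y z k : chord) (p a P Q R : int) (r s S : option int).
Variable T : chord -> Prop.
Hypothesis HT : triangulation T.
Variables (P Q R : int) (S : option int).
Hypotheses (PQ : P < Q) (QR : Q < R) (RS : lto R S).
Local Notation tb := (tb T).
Hypotheses (bPQ : tb (P, Some Q)) (bQR : tb (Q, Some R)) (bRS : tb (R, S)) (bPS : tb (P, S)).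

Ltac nc H1 H2 := have := tb_nc HT H1 H2; have := tb_nc HT H2 H1; rewrite /crosses /=.

Definition tbs k k' := tb0 (swap T k k').
Section OneFlip.
Variables (k k' : chord).
Local Notation tb' := (tbs k k').
Lemma tb_keep x : tb x -> x <> k -> tb' x.
Proof. by move=> [Tx|B] ne; [left; left|right]. Qed.
Lemma tb_new : tb' k'. Proof. by left; right. Qed.
Lemma tb_old x : tb' x -> (tb x /\ x <> k) \/ x = k' \/ (exists a, x = (a, Some (a + 1))).
Proof. by move=> [[[Tx ne]|->]|B]; [left; split=> //; left|right; left|right; right]. Qed.
End OneFlip.

(** A triangle of the old triangulation is kept unless it uses the removed chord; in that case
    uniqueness of the apex places it in the quadrilateral, which supplies the new triangle. *)
Lemma flip_PR : T (P, Some R) -> triangulation (swap T (P, Some R) (Q, S)).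
Proof.
move=> TPR; have bPR : tb (P, Some R) by left.
have okPR := tri_ok HT TPR; rewrite /arc_ok /= in okPR.
have k0 a : (a, Some (a + 1)) <> (P, Some R) by move=> [? ?]; lia.
have kPQ : tbs (P, Some R) (Q, S) (P, Some Q) by apply: tb_keep bPQ _ => -[?]; lia.
have kQR : tbs (P, Some R) (Q, S) (Q, Some R) by apply: tb_keep bQR _ => -[?]; lia.
have kRS : tbs (P, Some R) (Q, S) (R, S) by apply: tb_keep bRS _ => -[? _]; lia.
have kPS : tbs (P, Some R) (Q, S) (P, S).
  by apply: tb_keep bPS _ => -[E]; move: RS; rewrite E /lto; lia.
have kQS := tb_new (P, Some R) (Q, S).
split.
- move=> x [[Tx _]|->]; first exact: (tri_ok HT).
  by rewrite /arc_ok /=; move: RS; rewrite /lto; case: (S) => [s|] //; lia.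
- have nc1 y : T y -> y <> (P, Some R) -> ~~ crosses (Q, S) y /\ ~~ crosses y (Q, S).
    move=> Ty ne; have bY : tb y by left.
    have okY := tri_ok HT Ty; case: y ne bY okY {Ty} => u [v|] ne bY; rewrite /arc_ok /= => okY;
      nc bY bPQ; nc bY bQR; nc bY bRS; nc bY bPS; nc bY bPR; move: RS; rewrite /lto;
      case: (S) => [s|] //; move=> *; split; apply/negP; try (move=> /and3P[? ? ?]); try lia.
    + have [u1|u1] := eqVneq u P; last by lia.
      have [v1|v1] := eqVneq v R; last by lia.
      by apply: ne; rewrite u1 v1.
    + have [u1|u1] := eqVneq u P; last by lia.
      have [v1|v1] := eqVneq v R; last by lia.
      by apply: ne; rewrite u1 v1.
  move=> x y [[Tx nx]|->] [[Ty ny]|->]; first exact: (tri_nc HT).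
  + by have [] := nc1 x Tx nx.
  + by have [] := nc1 y Ty ny.
  + by rewrite /crosses /=; case: (S) => [s|] //; lia.
- move=> p r [[Tx ne]|[-> ->]]; last by exists R.
  have [q [pq qr b1 b2]] := tri_in HT Tx.
  have [E1|n1] := pselect ((p, Some q) = (P, Some R)).
    case: E1 => Ep Eq; rewrite Ep Eq in b1 b2 Tx pq qr *.
    have Er : r = S by apply: (apex_right HT b2 _ bRS bPS) => //; left.
    by rewrite Er; exists Q; split=> //; move: RS; rewrite /lto; case: (S) => //; lia.
  have [E2|n2] := pselect ((q, r) = (P, Some R)); last by exists q; split=> //; exact: tb_keep.
  case: E2 => Eq Er; rewrite Eq Er in b1 b2 Tx pq qr *; have bx : tb (p, Some R) by left.
  by exfalso; nc bx bPS; move: RS; rewrite /lto; case: (S) => [s|]; lia.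
- have main p r : tb (p, r) -> (p, r) <> (P, Some R) ->
    (exists (b : int) (s : option int), [/\ r = Some b, lto b s, tbs (P, Some R) (Q, S) (b, s) & tbs (P, Some R) (Q, S) (p, s)]) \/
    (exists s : int, [/\ s < p, tbs (P, Some R) (Q, S) (s, Some p) & tbs (P, Some R) (Q, S) (s, r)]).
    move=> bx ne; have pr := tb_lto HT bx.
    case: (tri_out HT bx) => [[b [s [Er bs b1 b2]]]|[s [sp b1 b2]]].
      rewrite Er in bx ne pr *; rewrite /lto in pr.
      have [E1|n1] := pselect ((b, s) = (P, Some R)).
        case: E1 => Eb Es; rewrite Eb Es in bx b1 b2 pr bs.
        by exfalso; nc b2 bPS; move: RS; rewrite /lto; case: (S) => [s'|]; lia.
      have [E2|n2] := pselect ((p, s) = (P, Some R)); last by left; exists b, s; split=> //; exact: tb_keep.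
      case: E2 => Ep Es; rewrite Ep Es in bx b1 b2 pr bs *.
      have -> : b = Q by exact: (apex_in HT bx b1 bPQ bQR).
      by left; exists Q, S; split=> //; move: RS; rewrite /lto; case: (S) => //; lia.
    have [E1|n1] := pselect ((s, Some p) = (P, Some R)).
      case: E1 => Es Ep; rewrite Es Ep in bx b1 b2 pr sp *.
      have -> : r = S by exact: (apex_right HT bx b2 bRS bPS).
      by right; exists Q.
    have [E2|n2] := pselect ((s, r) = (P, Some R)); last by right; exists s; split=> //; exact: tb_keep.
    case: E2 => Es Er; rewrite Es Er in bx b1 b2 pr sp *; rewrite /lto in pr.
    have -> : p = Q by exact: (apex_in HT b1 bx bPQ bQR).
    by left; exists R, S.
  move=> p r /tb_old[[bx ne]|[[-> ->]|[a [-> ->]]]]; first exact: main.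
    by right; exists P.
  apply: main; last exact: k0.
  by right; exists a.
Qed.

Lemma flip_QS : T (Q, S) -> triangulation (swap T (Q, S) (P, Some R)).
Proof.
move=> TQS; have bQS : tb (Q, S) by left.
have okQS := tri_ok HT TQS; rewrite /arc_ok /= in okQS.
have k0 a : (a, Some (a + 1)) <> (Q, S).
  by move=> [E E']; move: okQS RS; rewrite -E' /lto; lia.
have kPQ : tbs (Q, S) (P, Some R) (P, Some Q) by apply: tb_keep bPQ _ => -[? _]; lia.
have kQR : tbs (Q, S) (P, Some R) (Q, Some R).
  by apply: tb_keep bQR _ => -[E]; move: RS; rewrite -E /lto; lia.
have kRS : tbs (Q, S) (P, Some R) (R, S) by apply: tb_keep bRS _ => -[? ]; lia.
have kPS : tbs (Q, S) (P, Some R) (P, S) by apply: tb_keep bPS _ => -[E]; lia.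
have kPR := tb_new (Q, S) (P, Some R).
split.
- move=> x [[Tx _]|->]; first exact: (tri_ok HT).
  by rewrite /arc_ok /=; lia.
- have nc1 y : T y -> y <> (Q, S) -> ~~ crosses (P, Some R) y /\ ~~ crosses y (P, Some R).
    move=> Ty ne; have bY : tb y by left.
    have okY := tri_ok HT Ty; case: y ne bY okY {Ty} => u v ne bY; rewrite /arc_ok /= => okY.
    nc bY bPQ; nc bY bQR; nc bY bRS; nc bY bPS; nc bY bQS; move: RS ne okY; rewrite /lto.
    case: (S) v {bY} => [s|] [v|] //= rs ne okY *; split; apply/negP; try (move=> /and3P[? ? ?]); try lia.
    + have [u1|u1] := eqVneq u Q; last by lia.
      have [v1|v1] := eqVneq v s; last by lia.
      by apply: ne; rewrite u1 v1.
    + have [u1|u1] := eqVneq u Q; last by lia.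
      by apply: ne; rewrite u1.
  move=> x y [[Tx nx]|->] [[Ty ny]|->]; first exact: (tri_nc HT).
  + by have [] := nc1 x Tx nx.
  + by have [] := nc1 y Ty ny.
  + by rewrite /crosses /=; lia.
- move=> p r [[Tx ne]|[-> ->]]; last by exists Q.
  have bx : tb (p, r) by left.
  have [q [pq qr b1 b2]] := tri_in HT Tx.
  have [E1|n1] := pselect ((p, Some q) = (Q, S)).
    case: E1 => Ep Eq; rewrite Ep in b1 b2 bx pq; exfalso; nc bx bPS; rewrite -Eq.
    by move: qr pq RS; rewrite -Eq /lto; case: (r) => [s|]; lia.
  have [E2|n2] := pselect ((q, r) = (Q, S)); last by exists q; split=> //; exact: tb_keep.
  case: E2 => Eq Er; rewrite Eq Er in b1 b2 bx pq qr *.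
  have -> : p = P by exact: (apex_left HT b1 bx bPQ bPS).
  by exists R; split=> //; lia.
- have main p r : tb (p, r) -> (p, r) <> (Q, S) ->
    (exists (b : int) (s : option int), [/\ r = Some b, lto b s, tbs (Q, S) (P, Some R) (b, s) & tbs (Q, S) (P, Some R) (p, s)]) \/
    (exists s : int, [/\ s < p, tbs (Q, S) (P, Some R) (s, Some p) & tbs (Q, S) (P, Some R) (s, r)]).
    move=> bx ne; have pr := tb_lto HT bx.
    case: (tri_out HT bx) => [[b [s [Er bs b1 b2]]]|[s [sp b1 b2]]].
      rewrite Er in bx ne pr *; rewrite /lto in pr.
      have [E1|n1] := pselect ((b, s) = (Q, S)).
        case: E1 => Eb Es; rewrite Eb Es in bx b1 b2 pr bs *.
        have -> : p = P by exact: (apex_left HT bx b2 bPQ bPS).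
        by left; exists Q, (Some R).
      have [E2|n2] := pselect ((p, s) = (Q, S)); last by left; exists b, s; split=> //; exact: tb_keep.
      case: E2 => Ep Es; rewrite Ep Es in bx b1 b2 pr bs *.
      have -> : b = R by exact: (apex_in HT bx b1 bQR bRS).
      by right; exists P.
    have [E1|n1] := pselect ((s, Some p) = (Q, S)).
      case: E1 => Es Ep; exfalso; rewrite Es in b2 b1; nc b2 bPS; rewrite -Ep.
      by move: pr RS PQ QR; rewrite -Ep /lto; case: (r) => [r'|]; lia.
    have [E2|n2] := pselect ((s, r) = (Q, S)); last by right; exists s; split=> //; exact: tb_keep.
    case: E2 => Es Er; rewrite Es Er in bx b1 b2 pr sp *.
    have -> : p = R by exact: (apex_in HT b1 bx bQR bRS).
    by right; exists P; split=> //; lia.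
  move=> p r /tb_old[[bx ne]|[[-> ->]|[a [-> ->]]]]; first exact: main.
    by left; exists R, S.
  apply: main; last exact: k0.
  by right; exists a.
Qed.
End Flips.

(** * Laurent expansions of arcs and the Ptolemy relation *)

Section LaurentAlgebra.
Variable e : bool.
Local Notation V := (vtx e).
Local Notation vx := (@vx e).
Local Notation E n := (expo (vx n)).
Local Notation X := (@X e).
Implicit Types (x y : chord) (f g : seq chord).

Lemma conv_deltas (G : zmodType) (I J : Type) (s : seq I) (t : seq J) (F : I -> G) (F' : J -> G) :
  Defs.conv (\sum_(i <- s) delta (F i)) (\sum_(j <- t) delta (F' j)) =
  \sum_(i <- s) \sum_(j <- t) delta (F i + F' j).
Proof.
rewrite -(big_map F xpredT (@delta G)) conv_sum big_map; apply: eq_bigr => i _.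
by rewrite -(big_map F' xpredT (@delta G)) conv_sum2 big_map.
Qed.

Lemma X_catC f g : X (f ++ g) = X (g ++ f).
Proof.
rewrite !X_cat /X !conv_deltas exchange_big /=; apply: eq_bigr => i _; apply: eq_bigr => j _.
by rewrite addrC.
Qed.

Lemma X_mid f1 x f2 : X (f1 ++ x :: f2) = X (x :: f1 ++ f2).
Proof. by rewrite -cat1s catA X_cat X_catC -X_cat. Qed.

Lemma X_perm f g : perm_eq f g -> X f = X g.
Proof.
elim: f g => [|x f IH] g; first by rewrite perm_sym => /perm_nilP ->.
move=> pe; have : x \in g by rewrite -(perm_mem pe) mem_head.
move=> xg; have [g1 [g2 Eg]] : exists g1 g2, g = g1 ++ x :: g2 by case/splitPr: xg => g1 g2; exists g1, g2.
rewrite {}Eg in pe *; rewrite X_mid X_cons [RHS]X_cons; congr Defs.conv; apply: IH.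
by move: pe; rewrite perm_sym -cat1s perm_catCA /= perm_cons perm_sym.
Qed.

Lemma X_nseq n x : lpow (X [:: x]) n = X (nseq n x).
Proof. elim: n => [|n IH]; first by rewrite X_nil.
by rewrite [RHS]X_cons -IH. Qed.

Lemma X_big (I : Type) (s : seq I) (F : I -> seq chord) :
  \big[@Defs.conv _/@lone e]_(i <- s) X (F i) = X (flatten (map F s)).
Proof. by elim: s => [|i s IH]; rewrite ?big_nil ?X_nil // big_cons IH -X_cat. Qed.

Lemma X_filter (I : Type) (P : pred I) (s : seq I) (F : I -> seq chord) :
  (forall i, ~~ P i -> X (F i) = @lone e) ->
  X (flatten (map F (seq.filter P s))) = X (flatten (map F s)).
Proof.
move=> H; elim: s => [//|i s IH]; rewrite [seq.filter _ _]/=.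
have [Pi|nPi] := boolP (P i); first by rewrite ![flatten _]/= X_cat IH -X_cat.
rewrite IH [RHS]X_cat H // /lone conv_delta; apply/funext => y; by rewrite subr0.
Qed.

(** The product over all vertices runs only over factors different from 1, whereas a nonempty [F r]
    may also have value 1; [X_filter] makes up for the difference. *)
Lemma X_fsbig (s : seq V) (F : V -> seq chord) : uniq s -> (forall r, r \notin s -> F r = [::]) ->
  \big[@Defs.conv _/@lone e]_(r \in setT) X (F r) = X (flatten (map F s)).
Proof.
move=> us H; rewrite X_big.
set fs := finite_support _ _ _.
have fin : finite_set ([set: V] `&` (fun r => X (F r)) @^-1` [set~ @lone e]).
  apply: (sub_finite_set (B := [set` s])); last exact: finite_seq.
  move=> r [_ /=] ne; apply: contrapT => /negP rs; apply: ne.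
  by rewrite H // X_nil.
have pe : perm_eq fs [seq r <- s | `[< X (F r) <> @lone e >]].
  apply: uniq_perm; [exact: finite_support_uniq|exact: filter_uniq|].
  move=> r; rewrite in_finite_support // mem_filter; apply/idP/idP.
    rewrite inE /= => -[_ ne]; apply/andP; split; first exact/asboolP.
    by apply: contrapT => /negP rs; apply: ne; rewrite H // X_nil.
  by move=> /andP[/asboolP ne _]; rewrite inE.
rewrite (X_perm (perm_flatten (perm_map F pe))).
by apply: X_filter => r /asboolP/contrapT.
Qed.

Definition rng (a b : int) : seq int := [seq a + i%:Z | i <- iota 0 (absz (b - a)%R)].
Definition gap (k : int) : V -> int := - E k - E (k + 1).

Lemma rng_cat (a b c : int) : a <= b -> b <= c -> rng a c = rng a b ++ rng b c.
Proof.
move=> ab bc; rewrite /rng; have -> : absz (c - a)%R = (absz (b - a)%R + absz (c - b)%R)%N by lia.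
rewrite iotaD map_cat add0n; congr (_ ++ _).
rewrite -[X in iota X]addn0 iotaDl -map_comp; apply: eq_map => i /=; lia.
Qed.

Lemma X_infty (a : int) : X [:: (a, None)] = delta (E a).
Proof.
by rewrite /X mons_single /mons1 big_seq1 /evex /top1 /= !ex_cons !ex_nil subr0 addr0.
Qed.

(** The leading term is [k = b - 1], where [z_b] cancels. *)
Lemma X_finite (a b : int) : a < b -> X [:: (a, Some b)] = \sum_(k <- rng a b) delta (E a + E b + gap k).
Proof.
move=> ab; rewrite /X mons_single /mons1 /= big_cons big_map (@rng_cat a (b - 1) b); try lia.
rewrite big_cat /= [LHS]addrC; congr (_ + _).
  by apply: eq_bigr => k _; rewrite /evex /gap /= !ex_cons !ex_nil !addr0 -opprD.
have -> : rng (b - 1) b = [:: b - 1] by rewrite /rng (_ : absz (b - (b - 1))%R = 1%N) /= ?addr0 //; lia.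
rewrite big_seq1; congr delta; rewrite /evex /gap /top1 /= !ex_cons !ex_nil !addr0.
by rewrite subrK addrACA subrr addr0.
Qed.

Lemma X_side (a : int) : X [:: (a, Some (a + 1))] = @lone e.
Proof.
rewrite X_finite; last by lia.
have -> : rng a (a + 1) = [:: a] by rewrite /rng (_ : absz (a + 1 - a)%R = 1%N) /= ?addr0 //; lia.
by rewrite big_seq1 /lone; congr delta; rewrite /gap -opprD subrr.
Qed.

(** With the monomial of the four ends taken out, each product is a sum of [F k l] over a rectangle.
    Splitting the intervals at [Q] and [R] and using the symmetry of [F] matches the rectangles;
    with [S] at infinity only one interval is split. *)
Lemma ptolemy (P Q R : int) (S : option int) : P < Q -> Q < R -> (if S is Some s then R < s else true) ->
  Defs.conv (X [:: (P, Some R)]) (X [:: (Q, S)]) =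
  Defs.conv (X [:: (P, Some Q)]) (X [:: (R, S)]) + Defs.conv (X [:: (Q, Some R)]) (X [:: (P, S)]).
Proof.
move=> PQ QR; have PR := lt_trans PQ QR.
case: S => [s RS|_].
  have QS := lt_trans QR RS; have PS := lt_trans PQ QS.
  rewrite !X_finite // !conv_deltas.
  pose F k l := delta (E P + E Q + E R + E s + gap k + gap l).
  have FC k l : F k l = F l k by rewrite /F addrAC.
  have -> : \sum_(i <- rng P R) \sum_(j <- rng Q s) delta (E P + E R + gap i + (E Q + E s + gap j)) =
     \sum_(i <- rng P R) \sum_(j <- rng Q s) F i j.
    by apply: eq_bigr => i _; apply: eq_bigr => j _; congr delta; ring.
  have -> : \sum_(i <- rng P Q) \sum_(j <- rng R s) delta (E P + E Q + gap i + (E R + E s + gap j)) =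
     \sum_(i <- rng P Q) \sum_(j <- rng R s) F i j.
    by apply: eq_bigr => i _; apply: eq_bigr => j _; congr delta; ring.
  have -> : \sum_(i <- rng Q R) \sum_(j <- rng P s) delta (E Q + E R + gap i + (E P + E s + gap j)) =
     \sum_(i <- rng Q R) \sum_(j <- rng P s) F i j.
    by apply: eq_bigr => i _; apply: eq_bigr => j _; congr delta; ring.
  rewrite (@rng_cat P Q R) ?(@rng_cat Q R s) ?(@rng_cat P Q s) ?(@rng_cat Q R s) ?ltW // !big_cat /=.
  under eq_bigr do rewrite big_cat /=.
  under [X in _ + X = _]eq_bigr do rewrite big_cat /=.
  under [X in _ = _ + X]eq_bigr do rewrite !big_cat /=.
  rewrite !big_split /= [X in X + _ + _ = _]exchange_big /=.
  have -> : \sum_(j <- rng Q R) \sum_(i <- rng P Q) F i j = \sum_(j <- rng Q R) \sum_(i <- rng P Q) F j i.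
    by apply: eq_bigr => i _; apply: eq_bigr => j _; exact: FC.
  by rewrite addrAC addrC.
rewrite !X_infty !X_finite //.
have cs (s : seq int) (F : int -> V -> int) (y : V -> int) :
    Defs.conv (\sum_(i <- s) delta (F i)) (delta y) = \sum_(i <- s) delta (F i + y).
  by have := conv_deltas s [:: tt] F (fun=> y); rewrite big_seq1 => ->; apply: eq_bigr => i _; rewrite big_seq1.
rewrite !cs (@rng_cat P Q R) ?ltW // big_cat /=; congr (_ + _); apply: eq_bigr => i _; congr delta; ring.
Qed.

Lemma seq_argmax (T : eqType) (s : seq T) (F : T -> rat) : s != [::] ->
  exists2 x, x \in s & forall z : T, z \in s -> F z <= F x.
Proof.
elim: s => // x [|y s] IH _; first by exists x => [|y]; rewrite inE // => /eqP ->.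
have [//|z zs H] := IH; have [xz|zx] := leP (F x) (F z).
  by exists z => [|t]; rewrite inE ?zs ?orbT // => /predU1P[->|/H].
by exists x; rewrite ?mem_head // => t; rewrite inE => /predU1P[->//|/H]; move/le_trans; apply; exact: ltW.
Qed.

Lemma supp_evex (p : mono) : supp_fin (@evex e p).
Proof. by apply: supp_finD; [|apply: supp_finN]; exact: supp_ex. Qed.

Lemma laurent_X f : laurent (X f).
Proof.
split; first by rewrite /X -(big_map (@evex e) xpredT (@delta _)); exact: supp_deltas.
move=> m; rewrite /X sumE => nz; have [p] : exists p, m = @evex e p.
  apply: contrapT => no; move/eqP: nz; apply; rewrite big1 // => p _; rewrite delta_neq // => Em.
  by apply: no; exists p.
by move=> ->; exact: supp_evex.
Qed.

Lemma chi_wt_evex (p : mono) : chi_wt (@evex e p) =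
  (pval (fun n => - n) p)%:~R - ((size p.1)%:R - (size p.2)%:R) * (e%:R / 2%:R).
Proof.
rewrite /evex chi_wtD; [|exact: supp_ex|exact/supp_finN/supp_ex].
have -> : chi_wt (- ex (vxs e p.2)) = - chi_wt (ex (vxs e p.2)).
  apply/eqP; rewrite -addr_eq0 -chi_wtD; [|exact/supp_finN/supp_ex|exact: supp_ex].
  rewrite addNr /chi_wt fsbig1 // => r _; by rewrite mul0r.
have F A : chi_wt (ex (vxs e A)) = (\sum_(a <- A) (- a))%:~R - (size A)%:R * (e%:R / 2%:R) :> rat.
  rewrite chi_ex /vxs big_map; elim: A => [|a A IH]; first by rewrite !big_nil mul0r subr0.
  rewrite !big_cons opprD IH vx_val /= -natr1 !intrD intrM !rmorphN /=.
  have -> : ((e : nat)%:Z)%:~R = e%:R :> rat by [].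
  by field.
rewrite !F /pval intrB; ring.
Qed.

(** Multiplication by [X [:: x]] is injective because one monomial of [X [:: x]]
    has a strictly larger weight than the others. *)
Lemma X_cancel x (y y' : (V -> int) -> int) : arc_ok x -> laurent y -> laurent y' ->
  Defs.conv (X [:: x]) y = Defs.conv (X [:: x]) y' -> y = y'.
Proof.
move=> okx ly ly' H; apply: contrapT => ne; pose z := y - y'.
have lz : laurent z by exact: laurent_sub.
have Xm (D : (V -> int) -> int) m : Defs.conv (X [:: x]) D m = \sum_(p <- mons1 x) D (m - @evex e p).
  rewrite /X mons_single -(big_map (@evex e) xpredT (@delta _)) conv_sum big_map sumE.
  by apply: eq_bigr => p _; rewrite conv_delta.
have cz m : \sum_(p <- mons1 x) z (m - @evex e p) = 0.
  by rewrite /z sumrB -!Xm H subrr.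
have /finite_seqP[s us] := lz.1.
have sne : s != [::].
  apply/negP => /eqP s0; apply: ne; apply/funext => m; apply: contrapT => nm.
  suff : [set` s] m by rewrite s0.
  by rewrite -us; apply/eqP => /eqP; rewrite subr_eq0 => /eqP.
have [m ms mmax] := seq_argmax (@chi_wt e) sne.
have zm : z m != 0 by have : [set` s] m by []; rewrite -us.
have := cz (m + @evex e (top1 x)); rewrite /mons1 big_cons addrK big_seq big1 ?addr0; first by apply/eqP.
move=> p ps; apply: contrapT => /eqP np.
have : m + @evex e (top1 x) - @evex e p \in s.
  suff : [set` s] (m + @evex e (top1 x) - @evex e p) by [].
  by rewrite -us.
move/mmax; rewrite -addrA chi_wtD; [|exact: lz.2|by apply: supp_finD; [|apply: supp_finN]; exact: supp_evex].
rewrite gerDl chi_wtD; [|exact: supp_evex|exact/supp_finN/supp_evex].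
have -> : chi_wt (- @evex e p) = - chi_wt (@evex e p).
  apply/eqP; rewrite -addr_eq0 -chi_wtD; [|exact/supp_finN/supp_evex|exact: supp_evex].
  rewrite addNr /chi_wt fsbig1 // => r _; by rewrite mul0r.
case: x okx ps {H Xm cz np} => a [b|] //= okx /mapP[k]; rewrite arc_intP // => kk ->.
rewrite !chi_wt_evex /top1 /pval /= !big_cons !big_nil !addr0.
apply/negP; rewrite -ltNge subr_gt0 subrr !mul0r !subr0 ltr_int.
by move: kk; lia.
Qed.

End LaurentAlgebra.

Lemma seq_argmin (T : eqType) (s : seq T) (P : T -> Prop) (F : T -> int) :
  (exists x, P x) -> (forall x, P x -> x \in s) -> exists2 x, P x & forall y, P y -> F x <= F y.
Proof.
move=> [x0 Px0] Ps; have : x0 \in [seq y <- s | `[< P y >]] by rewrite mem_filter Ps // andbT; exact/asboolP.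
have : forall y, P y -> y \in [seq y <- s | `[< P y >]] by move=> y Py; rewrite mem_filter Ps // andbT; exact/asboolP.
have : forall y, y \in [seq y <- s | `[< P y >]] -> P y by move=> y; rewrite mem_filter => /andP[/asboolP].
move: [seq y <- s | _] => t tP Pt xt; have [c [/mapP[x xt' ->] _ H]] : exists c, [/\ c \in [seq - F y | y <- t], true &
    forall x, x \in [seq - F y | y <- t] -> true -> x <= c].
  by apply: (@seq_max [seq - F y | y <- t] xpredT); apply/hasP; exists (- F x0) => //; exact: (map_f (fun y => - F y)).
exists x; first exact: tP.
by move=> y /Pt yt; rewrite -lerN2; apply: H => //; exact: (map_f (fun y => - F y)).
Qed.

(** * Flips *)

Section FlipData.
Implicit Types (x y z k : chord) (p P Q R : int) (r s S : option int) (T : chord -> Prop).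

Record quad T P Q R S : Prop := Quad {
  quad_PQ : P < Q; quad_QR : Q < R; quad_RS : lto R S;
  quad_1 : tb T (P, Some Q); quad_2 : tb T (Q, Some R); quad_3 : tb T (R, S); quad_4 : tb T (P, S) }.

Definition diagonals P Q R S k k' :=
  (k = (P, Some R) /\ k' = (Q, S)) \/ (k = (Q, S) /\ k' = (P, Some R)).

(** [a1], [a2], [a3], [a4] stand for the sides of the quadrilateral around [k] in cyclic order: the
    two triangles at [k] have the further sides [a1], [a2] and [a3], [a4]. *)
Definition pat_spec T k (a1 a2 a3 a4 : chord) := forall x y, tb T x -> tb T y ->
  (pat x y k <-> (x = a2 /\ y = a1) \/ (x = a4 /\ y = a3)).

Record flip_data T k k' (a1 a2 a3 a4 : chord) : Prop := FlipData {
  fd_tri : triangulation T;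
  fd_tri' : triangulation (swap T k k');
  fd_k : T k;
  fd_k' : ~ tb T k';
  fd_a : forall a, a \in [:: a1; a2; a3; a4] -> tb T a /\ tb (swap T k k') a;
  fd_uniq : uniq [:: a1; a2; a3; a4];
  fd_pat : pat_spec T k a1 a2 a3 a4;
  fd_pat' : pat_spec T k' a4 a1 a2 a3;
  fd_pat2' : pat_spec (swap T k k') k' a4 a1 a2 a3 }.

Lemma pat_rot T k (a1 a2 a3 a4 : chord) : pat_spec T k a1 a2 a3 a4 -> pat_spec T k a3 a4 a1 a2.
Proof. by move=> H x y bx bY; have := H x y bx bY; tauto. Qed.

Lemma pat_PR T P Q R S : triangulation T -> quad T P Q R S ->
  pat_spec T (P, Some R) (P, Some Q) (Q, Some R) (R, S) (P, S).
Proof.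
move=> HT [PQ QR RS b1 b2 b3 b4] x y bx bY; split=> [H|[[-> ->]|[-> ->]]].
- suff : (x = (Q, Some R) /\ y = (P, Some Q)) \/ (x = (P, S) /\ y = (R, S)) by tauto.
  by eapply tri_PR; eassumption.
- by exists P, Q, (Some R); split=> //; constructor 2.
- by exists P, R, S; split=> //; [lia|constructor 1].
Qed.

Lemma pat_QS T P Q R S : triangulation T -> quad T P Q R S ->
  pat_spec T (Q, S) (P, S) (P, Some Q) (Q, Some R) (R, S).
Proof.
move=> HT [PQ QR RS b1 b2 b3 b4] x y bx bY; split=> [H|[[-> ->]|[-> ->]]].
- suff : (x = (P, Some Q) /\ y = (P, S)) \/ (x = (R, S) /\ y = (Q, Some R)) by tauto.
  by eapply tri_QS; eassumption.
- exists P, Q, S; split=> //; last by constructor 3.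
  by move: RS; rewrite /lto; case: (S) => // s; lia.
- by exists Q, R, S; split=> //; constructor 2.
Qed.

Lemma quad_uniq T P Q R S : quad T P Q R S ->
  uniq [:: (P, Some Q); (Q, Some R); (R, S); (P, S)].
Proof.
move=> [PQ QR RS _ _ _ _]; rewrite /= !inE !negb_or !xpair_eqE !andbT.
have PR := lt_trans PQ QR.
rewrite (lt_eqF PQ) (lt_eqF PR) (lt_eqF QR) (gt_eqF PQ) (gt_eqF PR) eqxx /= andbT.
by apply/eqP => E; move: RS; rewrite -E /lto; lia.
Qed.

Lemma diagonals_cross P Q R S k k' : P < Q -> Q < R -> lto R S -> diagonals P Q R S k k' ->
  crosses k k' || crosses k' k.
Proof.
move=> PQ QR RS [[-> ->]|[-> ->]]; rewrite /crosses /=; move: RS; rewrite /lto; case: S => [s|]; lia.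
Qed.

Lemma quad_swap T P Q R S k k' : triangulation T -> quad T P Q R S -> diagonals P Q R S k k' ->
  quad (swap T k k') P Q R S.
Proof.
move=> HT [PQ QR RS b1 b2 b3 b4] D; split=> //; apply: tb_keep => // E.
all: move: D; rewrite /diagonals -E => -[[]|[]] [*]; subst; move: RS; rewrite /lto; try case: (S) => [s|]; lia.
Qed.

Lemma flip_ex T P Q R S k k' : triangulation T -> quad T P Q R S -> diagonals P Q R S k k' -> T k ->
  exists a1 a2 a3 a4, flip_data T k k' a1 a2 a3 a4 /\
    ((k = (P, Some R) /\ [:: a1; a2; a3; a4] = [:: (P, Some Q); (Q, Some R); (R, S); (P, S)]) \/
     (k = (Q, S) /\ [:: a1; a2; a3; a4] = [:: (P, S); (P, Some Q); (Q, Some R); (R, S)])).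
Proof.
move=> HT q D Tk; have q' := quad_swap HT q D; have u := quad_uniq q.
have [PQ QR RS b1 b2 b3 b4] := q; have [_ _ _ c1 c2 c3 c4] := q'.
have nb : ~ tb T k'.
  move=> bk'; have bk : tb T k by left.
  have := diagonals_cross PQ QR RS D.
  by rewrite (negbTE (tb_nc HT bk bk')) (negbTE (tb_nc HT bk' bk)).
have tri' : triangulation (swap T k k').
  by case: D => -[Ek Ek']; rewrite Ek Ek' in Tk *; [exact: flip_PR|exact: flip_QS].
case: D => -[Ek Ek'].
  exists (P, Some Q), (Q, Some R), (R, S), (P, S); split; last by left.
  split=> //.
  - by move=> a; rewrite !inE => /or4P[]/eqP ->.
  - by rewrite Ek; exact: pat_PR.
  - by rewrite Ek'; exact: pat_QS.
  - by rewrite {2}Ek'; exact: pat_QS.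
exists (P, S), (P, Some Q), (Q, Some R), (R, S); split; last by right.
split=> //.
- by move=> a; rewrite !inE => /or4P[]/eqP ->.
- by rewrite -[uniq _]/(uniq ([:: (P, S)] ++ _)) uniq_catC.
- by rewrite Ek; exact: pat_QS.
- by rewrite Ek'; apply: pat_rot; exact: pat_PR.
- by rewrite {2}Ek'; apply: pat_rot; exact: pat_PR.
Qed.

Lemma quad_ex T k : triangulation T -> T k ->
  exists P Q R S k', quad T P Q R S /\ diagonals P Q R S k k'.
Proof.
case: k => p r HT Tk; have [q [pq qr b1 b2]] := tri_in HT Tk.
have bk : tb T (p, r) by left.
case: (tri_out HT bk) => [[b [s [Er bs b3 b4]]]|[s [sp b3 b4]]].
  by rewrite Er in qr b2 *; exists p, q, b, s, (q, s); split; [split|left].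
by exists s, p, q, r, (s, Some q); split; [split|right].
Qed.

Definition chords_meet x y := crosses x y || crosses y x.

Lemma chords_meetE i j u v : chords_meet (i, j) (u, v) =
  (if j is Some d then [&& i < u, u < d & if v is Some w then d < w else true] else false) ||
  (if v is Some w then [&& u < i, i < w & lto w j] else false).
Proof. by rewrite /chords_meet /crosses /lto /=; case: j => [d|]; case: v. Qed.

Definition leo p r : bool := if r is Some d then p <= d else true.

(** Take the last chord or side [(i, v)] with [v] not beyond [j]. If [v] is not [j], the triangle on
    its outer side yields [x] itself, a longer chord of this kind, or a chord that crosses [x]. *)
Lemma tri_complete T x (L : seq chord) : triangulation T -> arc_ok x ->
  (forall a b, T (a, Some b) -> (a, Some b) \in L) -> (forall y, T y -> ~~ chords_meet x y) -> T x.
Proof.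
case: x => i j HT ok HL H.
have tbT y : tb T y -> ~ (exists a, y = (a, Some (a + 1))) -> T y by case.
pose Pv v := tb T (i, Some v) /\ leo v j.
have [|v|v [bv vj] vmax] := @seq_argmin _ ((i + 1) :: [seq odflt 0 y.2 | y <- L]) Pv (fun v => - v).
- exists (i + 1); split; first by right; exists i.
  by move: ok; rewrite /arc_ok /leo /=; case: (j) => // d; lia.
- case=> -[/HL vL|[a [-> ->]]] _; last exact: mem_head.
  by rewrite inE; apply/orP; right; apply/mapP; exists (i, Some v).
have iv : i < v := tb_lto HT bv.
have [Ej|nj] := pselect (j = Some v).
  rewrite Ej in ok *; apply: (tbT) => // -[a [Ea Eb]]; move: ok; rewrite /arc_ok /=; lia.
have vj' : lto v j.
  by move: vj nj; rewrite /lto /leo; case: (j) => // d vd ne; rewrite lt_neqAle vd andbT; apply/eqP => E; apply: ne; rewrite E.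
case: (tri_out HT bv) => [[b [s [[Eb] bs b1 b2]]]|[s [sp b1 b2]]].
  rewrite -{}Eb in bs b1.
  case: s bs b1 b2 => [s|] bs b1 b2; last first.
    case: j {Pv vmax vj nj} ok H vj' => [d|] ok H vd; last by apply: (tbT) => // -[a []].
    have : T (v, None) by apply: (tbT) => // -[a []].
    by have vd' : v < d := vd; move/H; rewrite chords_meetE iv vd'.
  rewrite /lto in bs.
  have [sj|js] := boolP (leo s j).
    by have := vmax s (conj b2 sj); lia.
  case: j {Pv vmax vj nj} ok H vj' js => [d|] ok H vd; rewrite /leo // -ltNge => js.
  have vd' : v < d := vd.
  have : T (v, Some s) by apply: (tbT) => // -[a []]; lia.
  by move/H; rewrite chords_meetE iv vd' js.
have : T (s, Some v) by apply: (tbT) => // -[a []]; lia.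
by move/H; rewrite chords_meetE sp iv vj' orbT.
Qed.

(** Among the chords meeting [x], one flips the one that cuts [x] closest to its
    first end [i]; the triangle on its side of [i] has [i] as third vertex. *)
Lemma flip_towards T x (L : seq chord) : triangulation T ->
  (forall y, T y -> chords_meet x y -> y \in L) -> (exists2 y, T y & chords_meet x y) ->
  exists P Q R S k k', [/\ quad T P Q R S, diagonals P Q R S k k', T k, chords_meet x k & ~~ chords_meet x k'].
Proof.
case: x => i j HT HL [y0 Ty0 my0].
have tbT y : tb T y -> ~ (exists a, y = (a, Some (a + 1))) -> T y by case.
pose inner (y : chord) := if y.1 < i then odflt 0 y.2 else y.1.
have [|y [Ty my]|y [Ty my] ymin] := @seq_argmin _ L (fun y => T y /\ chords_meet (i, j) y) inner.
- by exists y0.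
- exact: HL.
pose m := inner y.
have im : i < m /\ lto m j.
  move: my; rewrite /m /inner; case: (y) => u v; rewrite chords_meetE /=.
  by case: (j) => [d|]; case: v => [v|]; case: (ltP u i) => /=; rewrite /lto; lia.
have {im} [im mj] := im.
have [[u [ui Tu]]|noleft] := pselect (exists u, u < i /\ T (u, Some m)).
  have [|[u' [w|]] [Tk' ui' E]|[k1 k2] [Tk ki Ek] kmin] :=
    @seq_argmin _ L (fun y => [/\ T y, y.1 < i & y.2 = Some m]) (fun y => - y.1).
  - by exists (u, Some m).
  - by apply: HL => //; move: E ui' => /= -[->] ui'; rewrite chords_meetE ui' im mj orbT.
  - by [].
  move: ki Ek kmin => /= ki Ek kmin; rewrite Ek in Tk.
  have mk : chords_meet (i, j) (k1, Some m) by rewrite chords_meetE ki im mj orbT.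
  have [q [kq qm b1 b2]] := tri_in HT Tk; rewrite /lto in qm.
  have Eq : q = i.
    have [//|qi] := eqVneq q i; have {qi} [qi|iq] : q < i \/ i < q by move: qi; lia.
      have Tq : T (q, Some m) by apply: (tbT) => // -[a []]; lia.
      by have := kmin (q, Some m) (And3 Tq qi erefl); rewrite /=; lia.
    have Tq : T (k1, Some q) by apply: (tbT) => // -[a []]; lia.
    have mq : chords_meet (i, j) (k1, Some q).
      by rewrite chords_meetE ki iq /=; apply/orP; right; move: mj; rewrite /lto; case: (j) => // d; lia.
    by have := ymin _ (conj Tq mq); rewrite -/m /inner /= ki /=; lia.
  rewrite Eq in kq qm b1 b2.
  have bk : tb T (k1, Some m) by left.
  case: (tri_out HT bk) => [[b [s [[Eb] bs b3 b4]]]|[s [sp b3 b4]]].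
    rewrite -{}Eb in bs b3.
    exists k1, i, m, s, (k1, Some m), (i, s); split=> //; first by left.
    by rewrite chords_meetE ltxx; case: (j) => [d|]; case: (s) => [s'|]; rewrite ?ltxx.
  exists s, k1, i, (Some m), (k1, Some m), (s, Some i); split=> //; first by right.
  by rewrite chords_meetE; case: (j) => [d|]; rewrite ?ltxx ?andbF //= orbF; lia.
have [d Ej] : exists d, j = Some d.
  case: j my {HL my0 ymin mj} => [d|]; first by exists d.
  case: y @m Ty im noleft => u [v|] m Ty im noleft; rewrite chords_meetE // => /and3P[ui iv _].
  by exfalso; apply: noleft; exists u; split=> //; move: Ty; rewrite /m /inner /= ui.
rewrite {}Ej in HL my0 my ymin mj *; rewrite /lto in mj.
have [v [Tv dv vmax]] : exists v, [/\ T (m, v), lto d v & forall w, T (m, w) -> lto d w -> (if v is Some v' then lto v' w else false) = false].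
  have [Tn|nTn] := pselect (T (m, None)); first by exists None.
  have [|y' [Ty' my' E]|[k1 k2] [Tk mk Ek] kmin] :=
    @seq_argmin _ L (fun y => [/\ T y, chords_meet (i, Some d) y & y.1 = m]) (fun y => - odflt 0 y.2).
  - exists y; split=> //; rewrite /m /inner; case: ifP => // yi; exfalso; apply: noleft.
    exists y.1; split=> //; move: Ty my; rewrite /m /inner yi; case: (y) yi => u [w|] //= ui _.
    by rewrite chords_meetE /=; lia.
  - exact: HL.
  move: Ek => /= Ek; rewrite Ek in Tk mk kmin.
  case: k2 => [w|] in Tk mk kmin *; last by [].
  have mR w' : d < w' -> chords_meet (i, Some d) (m, Some w') by move=> dw; rewrite chords_meetE im mj dw.
  exists (Some w); split=> //; first by move: mk; rewrite chords_meetE /lto; lia.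
  by move=> [w'|] Tw' dw' //; have := kmin (m, Some w') (And3 Tw' (mR _ dw') erefl); rewrite /lto /=; lia.
have mv : chords_meet (i, Some d) (m, v) by rewrite chords_meetE im mj /=; move: dv; rewrite /lto => ->.
have bk : tb T (m, v) by left.
have mv' : lto m v by exact: (tb_lto HT bk).
have [q [mq qv b3 b4]] := tri_in HT Tv.
case: (tri_out HT bk) => [[b [s [Eb bs b1 b2]]]|[s [sm b1 b2]]].
  exfalso; rewrite Eb in dv vmax mv'; rewrite /lto in mv'.
  have Ts : T (m, s) by apply: (tbT) => // -[a [Ea Es]]; move: bs; rewrite Es /lto; lia.
  have ds : lto d s by move: bs dv; rewrite /lto; case: (s) => // w; lia.
  by have := vmax _ Ts ds; rewrite bs.
have Es : s = i.
  have [//|si] := eqVneq s i; have {si} [si|is_] : s < i \/ i < s by move: si; lia.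
    by exfalso; apply: noleft; exists s; split=> //; apply: (tbT) => // -[a []]; lia.
  have Ts : T (s, v) by apply: (tbT) => // -[a [Ea Ev]]; move: dv; rewrite /lto Ev; lia.
  have ms : chords_meet (i, Some d) (s, v).
    by rewrite chords_meetE is_ /=; move: dv; rewrite /lto => ->; apply/orP; left; rewrite andbT; lia.
  have := ymin _ (conj Ts ms); rewrite -/m /inner /= ltNge (ltW is_) /=; lia.
rewrite Es in sm b1 b2.
exists i, m, q, v, (m, v), (i, Some q); split=> //; first by right.
by rewrite chords_meetE !ltxx.
Qed.
End FlipData.

(** * Seeds as labelled triangulations *)

Section Seeds.
Variable e : bool.
Local Notation V := (vtx e).
Local Notation vx := (@vx e).
Local Notation X := (@X e).
Implicit Types (x y z k : chord) (f g : seq chord) (S : @seed e) (c : V -> chord) (T : chord -> Prop).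

Definition labels c : chord -> Prop := fun x => exists r, c r = x.
(** Two sides of a triangle determine the third, so there is at most one arrow between two chords
    and a truth value suffices. *)
Definition arr T x y : bool := `[< exists2 z, tb T z & pat x y z >].

(** [c] tells which chord each quiver vertex stands for. [si_fin] reflects that only finitely many
    flips lead from the fan at infinity to the seed. *)
Record seed_inv S c : Prop := SeedInv {
  si_tri : triangulation (labels c);
  si_inj : injective c;
  si_X : forall r, S.1 r = X [:: c r];
  si_b : forall r s, S.2 r s = (arr (labels c) (c r) (c s))%:Z - (arr (labels c) (c s) (c r))%:Z;
  si_fin : exists L : seq chord, forall a b, labels c (a, Some b) -> (a, Some b) \in L }.

Lemma arr_anti T x y : arr T x y -> arr T y x = false.
Proof. by move=> /asboolP[z _ pz]; apply/asboolP => -[z' _]; exact: pat_anti pz. Qed.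

Lemma posp_b (b1 b2 : bool) : ~~ (b1 && b2) -> posp (b1%:Z - b2%:Z) = b1.
Proof. by case: b1; case: b2. Qed.

Lemma posp_si S c r s : seed_inv S c -> posp (S.2 r s) = arr (labels c) (c r) (c s).
Proof.
move=> H; rewrite (si_b H); apply: posp_b; apply/negP => /andP[a1].
by rewrite (arr_anti a1).
Qed.

Lemma arr_in T k (a1 a2 a3 a4 : chord) y : pat_spec T k a1 a2 a3 a4 ->
  tb T a1 -> tb T a2 -> tb T a3 -> tb T a4 -> tb T y -> arr T y k = (y == a1) || (y == a3).
Proof.
move=> H b1 b2 b3 b4 bY; apply/asboolP/orP => [[z bz /pat_cyc/pat_cyc/(H _ _ bz bY)]|].
  by move=> [[_ ->]|[_ ->]]; [left|right].
by move=> [/eqP ->|/eqP ->]; [exists a2|exists a4] => //; apply: pat_cyc; apply/H => //; tauto.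
Qed.

Lemma arr_out T k (a1 a2 a3 a4 : chord) y : pat_spec T k a1 a2 a3 a4 ->
  tb T a1 -> tb T a2 -> tb T a3 -> tb T a4 -> tb T y -> arr T k y = (y == a2) || (y == a4).
Proof.
move=> H b1 b2 b3 b4 bY; apply/asboolP/orP => [[z bz /pat_cyc/(H _ _ bY bz)]|].
  by move=> [[-> _]|[-> _]]; [left|right].
by move=> [/eqP ->|/eqP ->]; [exists a1|exists a3] => //; do 2 apply: pat_cyc; apply/H => //; tauto.
Qed.

Lemma eq_big_conv (F F' : V -> (V -> int) -> int) : (forall r, F r = F' r) ->
  \big[@Defs.conv _/@lone e]_(r \in setT) F r = \big[@Defs.conv _/@lone e]_(r \in setT) F' r.
Proof. by move=> /funext ->. Qed.

(** Sides of the polygon have value 1 and carry no quiver vertex, so they may be counted in the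
    product freely. *)
Lemma prod_two c (u v : chord) : injective c -> u != v -> tb (labels c) u -> tb (labels c) v ->
  \big[@Defs.conv _/@lone e]_(r \in setT) lpow (X [:: c r]) ((c r == u) || (c r == v)) = X [:: u; v].
Proof.
move=> ci uv bu bv.
have side w : tb (labels c) w -> exists s : seq V,
    [/\ uniq s, forall r, (r \in s) = (c r == w) & X (map c s) = X [:: w]].
  have [[r0 <-] _|no] := pselect (labels c w).
    by exists [:: r0]; split=> // r; rewrite inE; apply/eqP/eqP => [->|/ci].
  move=> [//|[a Ew]]; exists [::]; split=> //.
    by move=> r; apply/esym/eqP => E; apply: no; exists r.
  by rewrite Ew X_side X_nil.
have [su [uu Hu Eu]] := side u bu; have [sv [uw Hv Ev]] := side v bv.
pose F r := nseq ((c r == u) || (c r == v)) (c r).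
rewrite (@eq_big_conv _ (fun r => X (F r))); last by move=> r; exact: X_nseq.
rewrite (@X_fsbig e (su ++ sv)).
- have -> : flatten (map F (su ++ sv)) = map c (su ++ sv).
    have : {subset su ++ sv <= su ++ sv} by [].
    elim: {1 3 4}(su ++ sv) => //= r s IH sub; rewrite IH; last by move=> t ts; apply: sub; rewrite inE ts orbT.
    have := sub r (mem_head _ _); by rewrite mem_cat Hu Hv /F => ->.
  by rewrite map_cat X_cat Eu Ev -X_cat.
- rewrite cat_uniq uu uw andbT /=; apply/hasPn => r; rewrite Hv Hu => /eqP ->.
  by rewrite eq_sym.
- by move=> r; rewrite mem_cat Hu Hv /F => /negbTE ->.
Qed.

Lemma X_exchange (P Q R0 : int) (S0 : option int) k k' (a1 a2 a3 a4 : chord) : P < Q -> Q < R0 -> lto R0 S0 ->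
  diagonals P Q R0 S0 k k' ->
  ((k = (P, Some R0) /\ [:: a1; a2; a3; a4] = [:: (P, Some Q); (Q, Some R0); (R0, S0); (P, S0)]) \/
   (k = (Q, S0) /\ [:: a1; a2; a3; a4] = [:: (P, S0); (P, Some Q); (Q, Some R0); (R0, S0)])) ->
  X [:: k; k'] = X [:: a1; a3] + X [:: a2; a4].
Proof.
move=> PQ QR RS D H; have := @ptolemy e P Q R0 S0 PQ QR RS; rewrite -!X_cat ![_ ++ _]/= => pt.
have PQne : (P, Some R0) <> (Q, S0) by move=> [E _]; move: PQ; rewrite E ltxx.
case: D => -[Ek Ek']; case: H => -[Ek2 [-> -> -> ->]].
- by rewrite Ek Ek' pt.
- by exfalso; apply: PQne; rewrite -Ek -Ek2.
- by exfalso; apply: PQne; rewrite -Ek -Ek2.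
rewrite Ek Ek' (@X_catC e [:: _] [:: _]) [_ ++ _]/= pt [RHS]addrC; congr (_ + _).
by rewrite (@X_catC e [:: _] [:: _]).
Qed.

(** The mutation rule at the quadrilateral: the booleans tell which of its four sides the two chords
    are, and each chord is at most one of them. *)
Lemma mutation_bools (x1 x2 x3 x4 y1 y2 y3 y4 A B : bool) :
  (x1 + x2 + x3 + x4 <= 1)%N -> (y1 + y2 + y3 + y4 <= 1)%N ->
  forall u v : int,
  u = A%:Z - (x2 && y1 || x4 && y3)%:Z + (x1 && y4 || x3 && y2)%:Z ->
  v = B%:Z - (y2 && x1 || y4 && x3)%:Z + (y1 && x4 || y3 && x2)%:Z ->
  u - v = A%:Z - B%:Z + ((x1 || x3) * (y2 || y4))%N%:Z - ((y1 || y3) * (x2 || x4))%N%:Z.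
Proof.
move=> hx hy u v -> ->; case: A; case: B;
move: hx hy; case: x1; case: x2; case: x3; case: x4 => //= _;
case: y1; case: y2; case: y3; case: y4 => //=.
Qed.

Lemma uniq_le1 (a1 a2 a3 a4 x : chord) : uniq [:: a1; a2; a3; a4] ->
  ((x == a1) + (x == a2) + (x == a3) + (x == a4) <= 1)%N.
Proof.
move=> u; have := count_uniq_mem x u => /= E; rewrite -!addnA.
by rewrite -[X in (_ + (_ + (_ + X)))%N]addn0 ![x == _]eq_sym E leq_b1.
Qed.

(** The flip destroys the two triangles at [k] and creates the two at [k']; arrows inside other
    triangles persist. *)
Lemma arr_swap T k k' (a1 a2 a3 a4 : chord) x y : flip_data T k k' a1 a2 a3 a4 ->
  T x -> T y -> x <> k -> y <> k ->
  (arr (swap T k k') x y)%:Z = (arr T x y)%:Z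
    - ((x == a2) && (y == a1) || (x == a4) && (y == a3))%:Z
    + ((x == a1) && (y == a4) || (x == a3) && (y == a2))%:Z :> int.
Proof.
move=> FD Tx Ty nx ny; have bx : tb T x by left. have bY : tb T y by left.
have bk : tb T k by left; exact: (fd_k FD).
have bk' : tb (swap T k k') k' by exact: tb_new.
have neq : k <> k' by move=> E; apply: (fd_k' FD); rewrite -E.
have nbk : ~ tb (swap T k k') k.
  move=> [[[_ //]|//]|[a Ea]]; have := tri_ok (fd_tri FD) (fd_k FD).
  by rewrite Ea /arc_ok /=; lia.
have P1 : reflect (pat x y k) ((x == a2) && (y == a1) || (x == a4) && (y == a3)).
  apply: (iffP orP) => [H|/(fd_pat FD bx bY)[[-> ->]|[-> ->]]]; rewrite ?eqxx; [|by left|by right].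
  by apply/(fd_pat FD bx bY); case: H => /andP[/eqP -> /eqP ->]; tauto.
have P2 : reflect (pat x y k') ((x == a1) && (y == a4) || (x == a3) && (y == a2)).
  apply: (iffP orP) => [H|/(fd_pat' FD bx bY)[[-> ->]|[-> ->]]]; rewrite ?eqxx; [|by left|by right].
  by apply/(fd_pat' FD bx bY); case: H => /andP[/eqP -> /eqP ->]; tauto.
case: P1 => p1; case: P2 => p2.
- by have := pat_fun p1 p2.
- have -> : arr T x y by apply/asboolP; exists k.
  have -> // : arr (swap T k k') x y = false.
  by apply/asboolP => -[z bz pz]; apply: nbk; rewrite [X in tb _ X](pat_fun p1 pz).
- have -> : arr (swap T k k') x y by apply/asboolP; exists k'.
  have -> // : arr T x y = false.
  by apply/asboolP => -[z bz pz]; apply: (fd_k' FD); rewrite (pat_fun p2 pz).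
- suff -> : arr (swap T k k') x y = arr T x y by rewrite subr0 addr0.
  apply/asboolP/asboolP => -[z bz pz]; exists z => //.
    have [[//]|[Ez|bd]] := tb_old bz; last by right.
    by rewrite Ez in pz.
  by apply: tb_keep => // Ez; apply: p1; rewrite -Ez.
Qed.

Definition relabel c (k : V) k' : V -> chord := fun r => if r == k then k' else c r.

Lemma labels_relabel c (k : V) k' : injective c -> labels (relabel c k k') = swap (labels c) (c k) k'.
Proof.
move=> ci; apply/funext => x; apply/propext; split=> [[r <-]|].
  rewrite /relabel; case: eqP => [_|ne]; first by right.
  by left; split; [exists r|move=> /ci].
move=> [[[r <-] ne]|->].
  by exists r; rewrite /relabel; case: eqP ne => // ->.
by exists k; rewrite /relabel eqxx.
Qed.

Section Mutation.
Variables (S : @seed e) (c : V -> chord) (k : V) (k' a1 a2 a3 a4 : chord).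
Hypotheses (si : seed_inv S c) (FD : flip_data (labels c) (c k) k' a1 a2 a3 a4).
Hypothesis EX : X [:: c k; k'] = X [:: a1; a3] + X [:: a2; a4].
Local Notation T := (labels c).
Let b1 : tb T a1. Proof. by have [] := fd_a FD (_ : a1 \in _); rewrite // !inE eqxx. Qed.
Let b2 : tb T a2. Proof. by have [] := fd_a FD (_ : a2 \in _); rewrite // !inE eqxx !orbT. Qed.
Let b3 : tb T a3. Proof. by have [] := fd_a FD (_ : a3 \in _); rewrite // !inE eqxx !orbT. Qed.
Let b4 : tb T a4. Proof. by have [] := fd_a FD (_ : a4 \in _); rewrite // !inE eqxx !orbT. Qed.
Let c1 : tb (swap T (c k) k') a1. Proof. by have [] := fd_a FD (_ : a1 \in _); rewrite // !inE eqxx. Qed.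
Let c2 : tb (swap T (c k) k') a2. Proof. by have [] := fd_a FD (_ : a2 \in _); rewrite // !inE eqxx !orbT. Qed.
Let c3 : tb (swap T (c k) k') a3. Proof. by have [] := fd_a FD (_ : a3 \in _); rewrite // !inE eqxx !orbT. Qed.
Let c4 : tb (swap T (c k) k') a4. Proof. by have [] := fd_a FD (_ : a4 \in _); rewrite // !inE eqxx !orbT. Qed.
Let bc r : tb T (c r). Proof. by left; exists r. Qed.
Let arr_k r : arr T (c r) (c k) = (c r == a1) || (c r == a3).
Proof. exact: (arr_in (fd_pat FD)). Qed.
Let arr_k' r : arr T (c k) (c r) = (c r == a2) || (c r == a4).
Proof. exact: (arr_out (fd_pat FD)). Qed.

Lemma exchange_rhs :
  (\big[@Defs.conv _/@lone e]_(r \in setT) lpow (S.1 r) (posp (S.2 r k))) +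
  (\big[@Defs.conv _/@lone e]_(r \in setT) lpow (S.1 r) (posp (S.2 k r))) =
  X [:: c k; k'].
Proof.
have u := fd_uniq FD; rewrite EX.
rewrite -(@prod_two c a1 a3) ?(si_inj si) //; last first.
- by move: u; rewrite /= !inE !negb_or => /andP[/and3P[]].
- exact: (si_inj si).
rewrite -(@prod_two c a2 a4) ?(si_inj si) //; last first.
- by move: u; rewrite /= !inE !negb_or => /and3P[_ /andP[]].
- exact: (si_inj si).
congr (_ + _); apply: eq_big_conv => r; rewrite (si_X si) (posp_si _ _ si).
  by rewrite arr_k.
by rewrite arr_k'.
Qed.

(** The exchange relation determines the new variable, by [X_cancel]. *)
Lemma mutation_inv S' : seed_mutation k S S' -> seed_inv S' (relabel c k k').
Proof.
have ci := si_inj si; have tri' := fd_tri' FD; have u := fd_uniq FD.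
have rhs := exchange_rhs; have si0 := si; move: rhs si0.
case: S => x b rhs si0; case: S' => x' b' [Eb Ex' lx' ex].
have El := labels_relabel k k' ci.
have nTk' : ~ T k' by move=> H; apply: (fd_k' FD); left.
split.
- by rewrite El.
- move=> r s; rewrite /relabel; case: eqP => [->|nr]; case: eqP => [->|ns] //.
  + by move=> E; exfalso; apply: nTk'; exists s.
  + by move=> E; exfalso; apply: nTk'; exists r.
  + by move/ci.
- move=> r /=; rewrite /relabel; case: eqP => [->|/eqP ne]; last by rewrite Ex' //; exact: (si_X si0 r).
  apply: (@X_cancel e (c k)) => //; [exact: (tri_ok (fd_tri FD) (fd_k FD))|exact: laurent_X|].
  by have sk : x k = _ := si_X si0 k; rewrite -X_cat -[_ ++ _]/[:: c k; k'] -rhs -ex sk.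
- move=> r s; rewrite El /= Eb /mutate_quiver /relabel.
  have si_b' r1 r2 : b r1 r2 = _ := si_b si0 r1 r2.
  have posp' r1 r2 : posp (b r1 r2) = arr T (c r1) (c r2) := posp_si r1 r2 si0.
  have tbs r1 : r1 <> k -> tb (swap T (c k) k') (c r1).
    by move=> ne; apply: tb_keep => // /ci.
  case: eqP => [->|nr]; case: eqP => [->|ns] //=.
  + by rewrite si_b' !subrr oppr0.
  + rewrite si_b' arr_k arr_k' opprB.
    rewrite (arr_in (fd_pat2' FD)) ?(arr_out (fd_pat2' FD)) //; [|exact: tbs|exact: tbs].
    by rewrite [(c s == a2) || _]orbC.
  + rewrite si_b' arr_k arr_k' opprB.
    rewrite (arr_in (fd_pat2' FD)) ?(arr_out (fd_pat2' FD)) //; [|exact: tbs|exact: tbs].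
    by rewrite [(c r == a4) || _]orbC.
  + rewrite si_b' !posp' !arr_k !arr_k'; symmetry.
    have Tr r1 : T (c r1) by exists r1.
    have nk r1 : r1 <> k -> c r1 <> c k by move=> ne /ci.
    apply: (mutation_bools (uniq_le1 (c r) u) (uniq_le1 (c s) u)).
      by apply: arr_swap => //; exact: nk.
    by apply: arr_swap => //; exact: nk.
- have [L HL] := si_fin si0; exists (k' :: L) => a b0; rewrite El => -[[Tab _]|->].
    by rewrite inE HL ?orbT.
  exact: mem_head.
Qed.

Lemma mutation_ex : exists S', seed_mutation k S S'.
Proof.
exists (fun r => if r == k then X [:: k'] else S.1 r, mutate_quiver k S.2).
have rhs := exchange_rhs; have sX := si_X si k; case: S rhs sX => x b /= rhs sX; split=> //.
- by move=> r /negbTE ->.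
- by rewrite eqxx; exact: laurent_X.
- by rewrite eqxx sX -X_cat -rhs.
Qed.
End Mutation.

Definition init_label : V -> chord := fun r => (((val r - e%:Z) %/ 2)%Z, None).
Lemma init_vx n : init_label (vx n) = (n, None).
Proof. by rewrite /init_label vx_val addrK mulzK. Qed.
Lemma init_labelsP x : labels init_label x <-> x.2 = None.
Proof.
split=> [[r <-] //|]; case: x => a b /= ->; exists (vx a); exact: init_vx.
Qed.

Lemma init_inv : seed_inv (@zvar e, @Gamma e) init_label.
Proof.
have tbE p r : tb (labels init_label) (p, r) <-> r = None \/ r = Some (p + 1).
  split=> [[/init_labelsP|[a [-> ->]]]|[->|->]]; [by left|by right|by left; apply/init_labelsP|].
  by right; exists p.
split.
- split.
  + by case=> a b /init_labelsP /= ->.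
  + by case=> a b y /init_labelsP /= ->.
  + move=> p r /init_labelsP /= ->; exists (p + 1); split=> //; [lia|apply/tbE; right|apply/tbE; left] => //.
  + move=> p r /tbE[->|->]; [right; exists (p - 1)|left; exists (p + 1), None].
      by split; [lia|apply/tbE; right; rewrite subrK|apply/tbE; left].
    by split=> //; apply/tbE; left.
- move=> r s; have [n ->] := vx_surj r; have [m ->] := vx_surj s.
  by rewrite !init_vx => -[->].
- by move=> r; have [n ->] := vx_surj r; rewrite init_vx X_infty.
- move=> r s; have [n ->] := vx_surj r; have [m ->] := vx_surj s; rewrite !init_vx.
  have A n1 n2 : arr (labels init_label) (n1, None) (n2, None) = (n2 == n1 + 1).
    apply/asboolP/eqP => [[z bz [p [q [t [pq qt H]]]]]|->].
      case: H => -[] // [-> ->] [->] Ez; rewrite Ez in bz.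
      by move/tbE: bz => [//|[]].
    exists (n1, Some (n1 + 1)); first by apply/tbE; right.
    by exists n1, (n1 + 1), None; split=> //; [lia|constructor 1].
  rewrite !A /= /Gamma !vx_val.
  have B n1 n2 : (n2 * 2 + e%:Z == n1 * 2 + e%:Z + 2) = (n2 == n1 + 1) by apply/eqP/eqP; lia.
  by rewrite !B.
- by exists [::] => a b /init_labelsP.
Qed.

Lemma reachable_inv S : reachable S -> exists c, seed_inv S c.
Proof.
elim=> [|k S0 S' _ [c si] mut]; first by exists init_label; exact: init_inv.
have Tk : labels c (c k) by exists k.
have [P [Q [R0 [S1 [k' [q D]]]]]] := quad_ex (si_tri si) Tk.
have [a1 [a2 [a3 [a4 [FD Ea]]]]] := flip_ex (si_tri si) q D Tk.
exists (relabel c k k'); apply: mutation_inv mut; [exact: si|exact: FD|].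
by apply: X_exchange D Ea; case: q.
Qed.

(** Each flip of [flip_towards] removes one of the chords meeting [x]; those of [f] do not meet [x]
    and stay. When none is left, [tri_complete] applies. *)
Lemma reach_chord n S c x L f : reachable S -> seed_inv S c -> arc_ok x ->
  (forall y, labels c y -> chords_meet x y -> y \in L) -> (size L <= n)%N ->
  (forall y, y \in f -> labels c y /\ ~~ chords_meet x y) ->
  exists S' c', [/\ reachable S', seed_inv S' c', labels c' x & forall y, y \in f -> labels c' y].
Proof.
elim: n S c L => [|n IH] S c L rS si okx HL sL Hf;
  (have [mt|no] := pselect (exists2 y, labels c y & chords_meet x y); last first).
1,3: exists S, c; split=> //; [|by move=> y /Hf[]]; have [L' HL'] := si_fin si;
  apply: (tri_complete (si_tri si) okx HL') => y Ty; apply/negP => my; apply: no; exists y => //.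
  by case: mt => y Ty my; move: sL (HL y Ty my); rewrite leqn0 => /nilP ->.
have [P [Q [R0 [S1 [k [k' [q D Tk mk mk']]]]]]] := flip_towards (si_tri si) HL mt.
have [a1 [a2 [a3 [a4 [FD Ea]]]]] := flip_ex (si_tri si) q D Tk.
have EX : X [:: k; k'] = X [:: a1; a3] + X [:: a2; a4] by apply: X_exchange D Ea; case: q.
have kL := HL k Tk mk.
case: (Tk) => r Er; rewrite -Er in FD EX.
have [S' mut] := mutation_ex si FD EX.
have si' := mutation_inv si FD EX mut; have El := labels_relabel r k' (si_inj si).
apply: (IH S' (relabel c r k') [seq y <- L | y != k]) => //.
- exact: reach_mut mut.
- move=> y; rewrite El => -[[Ty ny]|->] my; last by rewrite my in mk'.
  by rewrite mem_filter HL // andbT; apply/eqP; rewrite -Er.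
- rewrite -ltnS; apply: leq_trans sL; rewrite size_filter -(count_predC (pred1 k) L).
  by rewrite -[X in (X < _)%N]add0n ltn_add2r -has_count has_pred1.
- move=> y /Hf[Ty ny]; split=> //; rewrite El; left; split=> // Ey.
  by rewrite Ey Er mk in ny.
Qed.

(** Infinitely many arcs may go to infinity, but those meeting [x] start between its ends. *)
Lemma meets_fin S c x : seed_inv S c -> arc_ok x ->
  exists L : seq chord, forall y, labels c y -> chords_meet x y -> y \in L.
Proof.
move=> si okx; have [L HL] := si_fin si; case: x okx => i [d|] ok; last first.
  by exists L => -[a [b|]] H; [move=> _; exact: HL|rewrite chords_meetE].
exists (L ++ [seq (i + j%:Z, None) | j <- iota 0 (absz (d - i)%R)]) => -[a [b|]] H.
  by rewrite mem_cat HL.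
rewrite chords_meetE orbF andbT mem_cat => /andP[ia ad]; apply/orP; right; apply/mapP; exists (absz (a - i)%R).
  by rewrite mem_iota; lia.
by congr (_, _); lia.
Qed.

Lemma reach_noncrossing f : all arc_ok f -> noncrossing f ->
  exists S c, [/\ reachable S, seed_inv S c & forall y, y \in f -> labels c y].
Proof.
elim: f => [|x f IH] /=; first by move=> _ _; exists (@zvar e, @Gamma e), init_label; split; [constructor|exact: init_inv|].
move=> /andP[okx okf] nc; have [|S [c [rS si Hf]]] := IH okf.
  by move=> y z yf zf; apply: nc; rewrite inE ?yf ?zf orbT.
have [L HL] := meets_fin si okx.
have [|S' [c' [rS' si' Tx Hf']]] := reach_chord rS si okx HL (leqnn _) (f := f).
  move=> y yf; split; first exact: Hf.
  by rewrite negb_or; apply/andP; split; apply: nc; rewrite inE ?yf ?eqxx ?orbT.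
by exists S', c'; split=> // y; rewrite inE => /predU1P[->|/Hf'].
Qed.

Lemma X_cluster x : arc_ok x -> cluster_algebra (X [:: x]).
Proof.
move=> okx; have [||S [c [rS si H]]] := @reach_noncrossing [:: x]; first by rewrite /= okx.
  move=> y z; rewrite !inE => /eqP -> /eqP ->; case: (x) => a [b|] //.
  by rewrite /crosses /= ltxx.
have [r Er] := H x (mem_head _ _); apply: CAvar; exists S => //; exists r.
by rewrite (si_X si) Er.
Qed.

Lemma cluster_monomial_noncrossing (f : (V -> int) -> int) : cluster_monomial f ->
  exists g, [/\ all arc_ok g, noncrossing g & f = X g].
Proof.
move=> [S rS [rs ->]]; have [c si] := reachable_inv rS; exists (map c rs).
have Tl y : y \in map c rs -> labels c y by move=> /mapP[r _ ->]; exists r.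
split.
- by apply/allP => y /Tl; exact: (tri_ok (si_tri si)).
- by move=> y z /Tl Ty /Tl Tz; exact: (tri_nc (si_tri si)).
- elim: rs {Tl} => [|r rs IH]; first by rewrite big_nil X_nil.
  by rewrite big_cons IH (si_X si) -X_cat.
Qed.

Lemma noncrossing_cluster_monomial g : all arc_ok g -> noncrossing g -> cluster_monomial (X g).
Proof.
move=> okg ncg; have [S [c [rS si H]]] := reach_noncrossing okg ncg; exists S => //.
elim: g H {okg ncg} => [|x g IH] H; first by exists [::]; rewrite big_nil X_nil.
have [|rs Ers] := IH; first by move=> y yg; apply: H; rewrite inE yg orbT.
have [r Er] := H x (mem_head _ _); exists (r :: rs).
by rewrite big_cons -Ers (si_X si) Er -X_cat.
Qed.
End Seeds.

(** * Rational l-weights as Laurent monomials, and the conclusion *)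

Section Rational.
Variables (R : realType) (h : R[i]).
Local Notation C := R[i].
Local Notation q := (qpar h).
Variable e : bool.

Lemma lw_mul_poly (P Q : {poly C}) : (fun n => (P * Q)`_n) = lw_mul (fun n => P`_n) (fun n => Q`_n).
Proof. by apply/funext => n; rewrite coefM. Qed.

Lemma poly_factor (P : {poly C}) : P`_0 != 0 ->
  (forall x, root P x -> exists r : vtx e, x = q ^ (val r)) ->
  exists A : seq int, (fun n => P`_n) = lw_mul (lw_cst P`_0) (lw_prod (qs h e A)).
Proof.
have [n] := ubnP (size P); elim: n P => // n IH P; rewrite ltnS => sP P0 HP.
have [s1|/closed_rootP[x rx]] := eqVneq (size P) 1%N.
  exists [::]; rewrite /lw_prod /= big_nil lw_mulC lw_mul1.
  by rewrite {1}(size1_polyC (eq_leq s1)); apply/funext => -[|m]; rewrite coefC.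
have [r Er] := HP x rx; have [k Ek] := vx_surj r.
have x0 : x != 0 by rewrite Er expfz_neq0 // q_neq0.
have [P' EP] := factor_theorem _ _ rx.
have EP0 : P`_0 = P'`_0 * - x by rewrite EP coefM big_ord1 subnn coefB coefX coefC /= sub0r.
have P'0 : P'`_0 != 0 by move: P0; rewrite EP0 mulf_eq0 negb_or => /andP[].
have [||A EA] := IH P' _ P'0.
- apply: leq_trans sP; rewrite EP size_Mmonic ?monicXsubC ?size_XsubC ?addn2 //.
  by apply: contraNneq P'0 => ->; rewrite coef0.
- by move=> y ry; apply: HP; rewrite EP rootM ry.
(* The root [x = q ^ (2 k + e)] gives the factor [1 - x^-1 z], and [x^-1] is again attached to a
   vertex, of index [- k - e]. *)
have Ex : exists k', x^-1 = qv h (vx e k').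
  exists (- k - e%:Z); rewrite Er Ek /qv invr_expz; congr (_ ^ _); rewrite !vx_val; ring.
have [k' Ek'] := Ex; exists (k' :: A).
rewrite {1}EP lw_mul_poly EA -[qs h e (k' :: A)]/(qv h (vx e k') :: qs h e A) lw_prod_cons -Ek'.
have -> : (fun n0 => ('X - x%:P)`_n0) = lw_mul (lw_cst (- x)) (lw_lin x^-1).
  apply/funext => -[|[|m]]; rewrite lw_cstE coefB coefX coefC /= ?sub0r ?subr0 ?mulr1 ?mulr0 ?oppr0 //.
  by rewrite mulrNN mulfV.
have -> : lw_cst P`_0 = lw_mul (lw_cst P'`_0) (lw_cst (- x)) by rewrite lw_cstM EP0.
by rewrite -!lw_mulA [in LHS](lw_mulC (lw_prod _)) -!lw_mulA.
Qed.

Lemma rational_isLw Psi (w0 : rat) : Psi 0%N = qpow h w0 ->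
  roots_poles_in [set x | exists r : vtx e, x = q ^ (val r)] Psi ->
  exists w p, isLw h e w p Psi.
Proof.
move=> E0 [P [Q [_ Q0 EP HPQ]]].
have P0E : P`_0 = Q`_0 * Psi 0%N by have := congr1 (fun f => f 0%N) EP; rewrite lw_mul0.
have P0 : P`_0 != 0 by rewrite P0E mulf_neq0 // E0 qpow_neq0.
have [A EA] := poly_factor P0 (fun x rx => HPQ x (or_introl rx)).
have [B EB] := poly_factor Q0 (fun x rx => HPQ x (or_intror rx)).
exists (w0 - chi e (A, B)), (A, B); rewrite /isLw /= subrK.
apply: (lw_cstI Q0); rewrite lw_mulA -EB EP EA P0E E0 -lw_cstM -lw_mulA //.
Qed.
End Rational.
Theorem theorem7p11 (R : realType) (h : R[i])
    (q_not_root_of_unity : forall n : nat, (0 < n)%N -> qpar h ^+ n != 1)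
    (e : bool)
    (Phi : ((vtx e -> int) * rat -> int) -> (lweight R -> int))
    (Phi_iso : E_algebra_iso h Phi)
    (Phi_sums : countable_sum_compatible h Phi)
    (Phi_z : forall r : vtx e,
       Phi (tens (zvar r) (delta ((val r)%:~R / 2%:R))) =
         K0_class (lw_Psi (qpar h ^ (val r)))) :
  monoidal_categorification h Phi.
Proof.
have qnr := q_not_root_of_unity.
have Xc x : arc_ok x -> cluster_algebra (@X e [:: x]) by exact: X_cluster.
(* Multiplication by an invertible class only shifts the weight component. *)
have twist g (w w' : rat) : all arc_ok g ->
    K0_mul h (E_to_K0 h (delta w)) (Phi (tens (@X e g) (delta w'))) = Phi (tens (@X e g) (delta (w + w'))).
  move=> okg; have [_ _ PhiM PhiE] := Phi_iso.
  rewrite -PhiE; last exact: in_E_delta.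
  rewrite -X_nil -PhiM; [|exact: (completed_X Xc)|exact: (completed_X Xc)].
  by rewrite conv_X.
split=> [f /cluster_monomial_noncrossing[g [okg ncg ->]]|S OS [sS _]].
  have [Psi _ E] := noncrossing_cls qnr Phi_iso Phi_z Xc 0 okg ncg.
  have [S [OS rS HS]] := noncrossing_real qnr Phi_iso Phi_z Xc okg ncg E.
  by exists S, Psi, 0; split=> //; rewrite -E twist // addr0.
have [Psi HS _] := OS.2 S sS (constituent_self sS).
have [pos rat_Psi [w0 E0]] := in_Oplus2Z_lw qnr HS OS.
have [w [p lwP]] := rational_isLw E0 rat_Psi.
have [g [okg ncg Eg _]] := matching (positive_count qnr pos lwP).
have [Psi' lw' E] := noncrossing_cls qnr Phi_iso Phi_z Xc w okg ncg.
have EPsi : Psi' = Psi.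
  apply: isLw_uniq lw' _; apply: isLw_peq lwP; move: Eg; by case: (p).
(* [w] is the part of the weight of [S] that the monomial does not account for; twisting by [- w]
   leads back to [X g] with weight 0. *)
exists (@X e g), Psi, (- w); split=> //; first exact: noncrossing_cluster_monomial.
by rewrite -EPsi -E twist // addNr.
Qed.
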